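(* Let $(M,\omega,\mathcal P)$ be a polarized symplectic manifold. Any polarized deformation quantization (PDQ) on $(M,\omega,\mathcal P)$ is equivalent to a polarized star-product (PSP) on $(M,\omega,\mathcal P)$.
   Context: $M$ is a smooth manifold, $C_M^\infty$ the sheaf of complex-valued smooth functions, $\mathcal T$ the complexified tangent bundle. A polarized symplectic manifold $(M,\omega,\mathcal P)$: $\omega$ is a closed nondegenerate complex 2-form and $\mathcal P\subset\mathcal T$ a complex subbundle such that locally there exist complex-valued functions $x_i,y_i$, $i=1,\dots,\frac12\dim M$ (with linearly independent differentials), with $\omega=\sum_i dy_i\wedge dx_i$ and $\mathcal P$ equal to the common kernel of the $dx_i$. $\mathcal O_{\mathcal P}$ is the sheaf of functions $f$ with $Xf=0$ for all $X\in\mathcal P$. The Poisson bracket $\{\cdot,\cdot\}$ inverse to $\omega$ satisfies $\{y_i,x_j\}=\delta_{ij}$, $\{x_i,x_j\}=\{y_i,y_j\}=0$. $t$ is a formal parameter; the symbol map $\sigma:C_M^\infty[[t]]\to C_M^\infty$ is $f_0+tf_1+\cdots\mapsto f_0$. A deformation quantization (DQ) on $(M,\omega)$ is a sheaf of associative $\mathbb C[[t]]$-algebras $\mathbb A_t$ with an epimorphism of $\mathbb C[[t]]$-algebras $\sigma:\mathbb A_t\to C_M^\infty$ (symbol map) such that there is an isomorphism of $\mathbb C[[t]]$-modules $\mathbb A_t\cong C_M^\infty[[t]]$ commuting with symbol maps, and $\sigma(\frac1t[\tilde a,\tilde b])=\{a,b\}$ for any lifts $\tilde a,\tilde b$ of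 functions $a,b$. Two DQ's are equivalent if there is a map of sheaves of $\mathbb C[[t]]$-algebras between them commuting with symbol maps. A PDQ on $(M,\omega,\mathcal P)$ is a pair $(\mathbb A_t,\mathbb O_t)$ with $\mathbb A_t$ a DQ on $(M,\omega)$ and $\mathbb O_t$ a $t$-adically complete commutative subalgebra of $\mathbb A_t$ with $\sigma(\mathbb O_t)=\mathcal O_{\mathcal P}$. Two PDQ's are equivalent if there is an equivalence of DQ's taking one subalgebra to the other. A star-product (SP) on $(M,\omega)$ is an associative multiplication $\mu_t=\sum t^i\mu_i$ on $C_M^\infty[[t]]$ with $\mu_0(f,g)=fg$, $\mu_i$ ($i>0$) bidifferential operators vanishing on constants ($\mu_i(f,g)=0$ if $f$ or $g$ is constant), and $\mu_1(f,g)-\mu_1(g,f)=\{f,g\}$. A PSP on $(M,\omega,\mathcal P)$ is a triple $(C_M^\infty[[t]],\mu_t,\mathcal O_t)$ with $\mu_t$ an SP on $(M,\omega)$ and $\mathcal O_t\subset C_M^\infty[[t]]$ a $t$-adically complete $\mathbb C[[t]]$-submodule, closed under the usual multiplication, such that $\sigma(\mathcal O_t)=\mathcal O_{\mathcal P}$ and $\mu_t(a,b)=ab$ (usual product) for all $a\in\mathcal O_t$, $b\in C_M^\infty[[t]]$. A PSP is regarded as a PDQ. *)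

(* Defs.v *)
From HB Require Import structures.
From mathcomp Require Import all_boot all_order all_algebra.
From mathcomp Require Import all_classical all_reals all_analysis.
From mathcomp.real_closed Require Import complex.

Set Implicit Arguments.
Unset Strict Implicit.
Unset Printing Implicit Defensive.

Import Order.TTheory GRing.Theory Num.Theory.
Import numFieldNormedType.Exports.

Local Open Scope classical_set_scope.
Local Open Scope ring_scope.

Section Euclidean.
Variables (R : realType) (n : nat).
Implicit Types (U V : set 'rV[R]_n) (f g : 'rV[R]_n -> R).

Fixpoint Ck (k : nat) U f : Prop :=
  (forall x, U x -> {for x, continuous f}) /\
  if k is k'.+1 then
    forall i : 'I_n, (forall x, U x -> derivable f x (delta_mx 0 i)) /\
                     Ck k' U ('D_(delta_mx 0 i) f)
  else True.

Definition smooth_on U f := forall k, Ck k U f.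

Lemma Ck_continuous k U f x : Ck k U f -> U x -> {for x, continuous f}.
Proof. by case: k => [|k] [h _]; exact: h. Qed.

Lemma Ck_sub k U V f : V `<=` U -> Ck k U f -> Ck k V f.
Proof.
move=> VU; elim: k f => [|k IH] f /= [h1 h2].
  by split=> // x /VU; exact: h1.
split=> [x /VU|i]; first exact: h1.
by have [h3 h4] := h2 i; split; [move=> x /VU; exact: h3 | exact: IH].
Qed.

Lemma Ck_local k U f :
  (forall x, U x -> exists2 V, V x & Ck k V f) -> Ck k U f.
Proof.
elim: k f => [|k IH] f h /=.
  by split=> // x /h[V Vx /Ck_continuous]; apply.
split=> [x /h[V Vx /Ck_continuous]|i]; first exact.
split=> [x /h[V Vx /= [_ /(_ i)[hd _]]]|]; first exact: hd.
by apply: IH => x /h[V Vx /= [_ /(_ i)[_ hc]]]; exists V.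
Qed.

Lemma near_open_eq U f g x : open U -> U x ->
  (forall y, U y -> f y = g y) -> \forall y \near x, f y = g y.
Proof.
by move=> oU Ux fg; near=> y; apply: fg; near: y; exact: open_nbhs_nbhs.
Unshelve. all: by end_near. Qed.

Lemma derive_open_eq U f g x v : open U -> U x ->
  (forall y, U y -> f y = g y) -> 'D_v f x = 'D_v g x.
Proof.
by move=> oU Ux fg; apply: near_eq_derive; exact: (near_open_eq oU Ux fg).
Qed.

Lemma continuous_open_eq U f g x : open U -> U x ->
  (forall y, U y -> f y = g y) -> {for x, continuous f} -> {for x, continuous g}.
Proof.
move=> oU Ux fg; rewrite /prop_for /continuous_at -fg// => h.
have gf : \forall y \near x, g y = f y.
  by apply: (near_open_eq oU Ux) => y Uy; rewrite fg.
by move=> P /h; apply: filterS2 gf => y /= ->.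
Qed.

Lemma Ck_ext k U f g : open U -> (forall x, U x -> f x = g x) ->
  Ck k U f -> Ck k U g.
Proof.
move=> oU; elim: k f g => [|k IH] f g fg /= [h1 h2].
  by split=> // x Ux; apply: (continuous_open_eq oU Ux fg); exact: h1.
split=> [x Ux|i]; first exact: (continuous_open_eq oU Ux fg (h1 x Ux)).
have [h3 h4] := h2 i; split=> [x Ux|].
  by apply: near_eq_derivable (h3 x Ux); exact: (near_open_eq oU Ux fg).
by apply: IH h4 => x Ux; exact: (derive_open_eq _ oU Ux fg).
Qed.

Lemma Ck_cst k U (c : R) : Ck k U (cst c).
Proof.
elim: k c => [|k IH] c /=; first by split=> // x _; apply: cst_continuous.
split=> [x _|i]; first apply: cst_continuous.
split=> [x _|]; first exact: derivable_cst.
by have -> : 'D_(delta_mx 0 i) (cst c) = cst 0 :> ('rV[R]_n -> R);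
  [apply/funext => x; rewrite derive_cst | exact: IH].
Qed.

Lemma CkW k U f : Ck k.+1 U f -> Ck k U f.
Proof.
elim: k f => [|k IH] f; first by case.
by move=> [h1 h2]; split=> // i; have [h3 h4] := h2 i; split=> //; exact: IH.
Qed.

Lemma CkD k U f g : open U -> Ck k U f -> Ck k U g -> Ck k U (f \+ g).
Proof.
move=> oU; elim: k f g => [|k IH] f g [f1 f2] [g1 g2].
  by split=> // x Ux; apply: continuousD; [exact: f1 | exact: g1].
split=> [x Ux|i]; first by apply: continuousD; [exact: f1 | exact: g1].
have [f3 f4] := f2 i; have [g3 g4] := g2 i; split=> [x Ux|].
  by apply: derivableD; [exact: f3 | exact: g3].
by apply: Ck_ext (IH _ _ f4 g4) => // x Ux; rewrite deriveD//;
  [exact: f3 | exact: g3].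
Qed.

Lemma CkM k U f g : open U -> Ck k U f -> Ck k U g -> Ck k U (f \* g).
Proof.
move=> oU; elim: k f g => [|k IH] f g hf hg.
  by case: hf hg => [f1 f2] [g1 g2]; split=> // x Ux; apply: continuousM;
    [exact: f1 | exact: g1].
have fW := CkW hf; have gW := CkW hg; move: hf hg => [f1 f2] [g1 g2].
split=> [x Ux|i]; first by apply: continuousM; [exact: f1 | exact: g1].
have [f3 f4] := f2 i; have [g3 g4] := g2 i; split=> [x Ux|].
  by apply: derivableM; [exact: f3 | exact: g3].
apply: Ck_ext (CkD oU (IH _ _ fW g4) (IH _ _ gW f4)) => // x Ux.
by rewrite deriveM//; [exact: f3 | exact: g3].
Qed.

End Euclidean.

Record chart (R : realType) (n : nat) (M : topologicalType) := Chart {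
  cdom : set M;
  cfun : M -> 'rV[R]_n;
  cinv : 'rV[R]_n -> M;
  cdom_open : open cdom;
  cimg_open : open (cfun @` cdom);
  cfunK : forall p, cdom p -> cinv (cfun p) = p;
  cfun_continuous : forall p, cdom p -> {for p, continuous cfun};
  cinv_continuous : forall p, cdom p -> {for cfun p, continuous cinv} }.

Record manifold (R : realType) (n : nat) := Manifold {
  msort :> topologicalType;
  atlas : set (chart R n msort);
  m_hausdorff : hausdorff_space msort;
  m_second_countable : @second_countable msort;
  atlas_cover : forall p, exists2 c, atlas c & cdom c p;
  atlas_compat : forall c c', atlas c -> atlas c' -> forall i : 'I_n,
    smooth_on (cfun c @` (cdom c `&` cdom c'))
              (fun x => cfun c' (cinv c x) 0 i) }.

Identity Coercion set_to_fun : set >-> Funclass.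

Record opens (T : topologicalType) := Opens {
  oset :> set T;
  oset_open : open oset }.

Definition covers (T : topologicalType) (U : opens T) (I : Type)
    (W : I -> opens T) :=
  forall p, U p -> exists i, W i p.

Section SmoothFunctions.
Variables (R : realType) (n : nat) (M : manifold R n).
Implicit Types (U V : set M) (f g : M -> R[i]).

Definition msmooth U f := forall c, atlas c ->
  smooth_on (cfun c @` (cdom c `&` U)) (fun x => complex.Re (f (cinv c x))) /\
  smooth_on (cfun c @` (cdom c `&` U)) (fun x => complex.Im (f (cinv c x))).

Lemma cimg_openI (c : chart R n M) U : open U -> open (cfun c @` (cdom c `&` U)).
Proof.
move=> oU; rewrite openE => _ [p [cp Up] <-].
have : \forall x \near cfun c p, U (cinv c x).
  have := cinv_continuous cp; rewrite /prop_for /continuous_at cfunK// => h.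
  exact/h/open_nbhs_nbhs.
have : \forall x \near cfun c p, (cfun c @` cdom c) x.
  by apply: open_nbhs_nbhs; split; [exact: cimg_open | exists p].
apply: filterS2 => x [q cq <-] Uq; exists q => //; split => //.
by rewrite cfunK in Uq.
Qed.

Lemma msmooth_ext U f g : open U -> (forall p, U p -> f p = g p) ->
  msmooth U f -> msmooth U g.
Proof.
move=> oU fg hf c /hf[h1 h2]; split=> k.
  apply: Ck_ext (h1 k) => [|_ [p [cp Up] <-]]; first exact: cimg_openI.
  by rewrite cfunK// fg.
apply: Ck_ext (h2 k) => [|_ [p [cp Up] <-]]; first exact: cimg_openI.
by rewrite cfunK// fg.
Qed.

Lemma msmooth_sub U V f : V `<=` U -> msmooth U f -> msmooth V f.
Proof.
move=> VU hf c /hf[h1 h2].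
by split=> k; [apply: Ck_sub (h1 k) | apply: Ck_sub (h2 k)];
  move=> _ [p [cp Vp] <-]; exists p => //; split=> //; exact: VU.
Qed.

Lemma msmooth_local U f :
  (forall p, U p -> exists2 V, V p & msmooth V f) -> msmooth U f.
Proof.
move=> h c ac; split=> k; apply: Ck_local => _ [p [cp Up] <-];
  have [V Vp /(_ c ac)[h1 h2]] := h p Up;
  by exists (cfun c @` (cdom c `&` V)) => //; exists p.
Qed.

Lemma msmooth_cst U (a : R[i]) : msmooth U (cst a).
Proof. by move=> c ac; split=> k; exact: Ck_cst. Qed.

Lemma msmoothD U f g : open U -> msmooth U f -> msmooth U g ->
  msmooth U (fun p => f p + g p).
Proof.
move=> oU hf hg c ac; have oc := @cimg_openI c U oU.
have [f1 f2] := hf c ac; have [g1 g2] := hg c ac; split=> k.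
  apply: Ck_ext (CkD oc (f1 k) (g1 k)) => // x _ /=.
  by case: (f _) (g _) => [? ?] [].
apply: Ck_ext (CkD oc (f2 k) (g2 k)) => // x _ /=.
by case: (f _) (g _) => [? ?] [].
Qed.

Lemma msmoothM U f g : open U -> msmooth U f -> msmooth U g ->
  msmooth U (fun p => f p * g p).
Proof.
move=> oU hf hg c ac; have oc := @cimg_openI c U oU.
have [f1 f2] := hf c ac; have [g1 g2] := hg c ac; split=> k.
  have hN := CkM oc (Ck_cst k _ (-1)) (CkM oc (f2 k) (g2 k)).
  apply: Ck_ext (CkD oc (CkM oc (f1 k) (g1 k)) hN) => // x _ /=.
  by rewrite mulN1r; case: (f _) (g _) => [? ?] [].
apply: Ck_ext (CkD oc (CkM oc (f1 k) (g2 k)) (CkM oc (f2 k) (g1 k))) => // x _ /=.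
by case: (f _) (g _) => [? ?] [].
Qed.

End SmoothFunctions.

Section Geometry.
Variables (R : realType) (n : nat) (M : manifold R n).

Definition smooth_near (p : M) (f : M -> R[i]) :=
  exists2 U : opens M, U p & msmooth U f.

(* Partial derivative with respect to the i-th coordinate of the chart c;
   meaningful on the domain of c. *)
Definition pderiv (c : chart R n M) (i : 'I_n) (f : M -> R[i]) : M -> R[i] :=
  fun p =>
    Complex ('D_(delta_mx 0 i) (fun x => complex.Re (f (cinv c x))) (cfun c p))
            ('D_(delta_mx 0 i) (fun x => complex.Im (f (cinv c x))) (cfun c p)).

Definition mpderiv (c : chart R n M) (k : nat) (alpha : {ffun 'I_n -> 'I_k.+1})
    (f : M -> R[i]) : M -> R[i] :=
  foldr (fun i => iter (alpha i) (pderiv c i)) f (enum 'I_n).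

Definition tvec := (M -> R[i]) -> R[i].

(* The fibre at p of the complexified tangent bundle: C-linear derivations at p
   of the germs at p of smooth complex functions.  A derivation is extended
   by 0 to the functions that are not smooth near p. *)
Record tangent (p : M) (v : tvec) : Prop := Tangent {
  tangent_linear : forall (a : R[i]) (f g : M -> R[i]),
    smooth_near p f -> smooth_near p g ->
    v (fun q => a * f q + g q) = a * v f + v g;
  tangent_leibniz : forall f g : M -> R[i],
    smooth_near p f -> smooth_near p g ->
    v (fun q => f q * g q) = v f * g p + f p * v g;
  tangent_germ : forall (U : opens M) (f g : M -> R[i]),
    U p -> (forall q, U q -> f q = g q) -> v f = v g;
  tangent_junk : forall f : M -> R[i], ~ smooth_near p f -> v f = 0 }.

Definition coord_tvec (c : chart R n M) (i : 'I_n) (p : M) : tvec :=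
  fun f => if `[< smooth_near p f >] then pderiv c i f p else 0.

(* Only the values of a form on tangent vectors are meaningful. *)
Definition two_form := M -> tvec -> tvec -> R[i].

Definition coord_form (w : two_form) (c : chart R n M) (i j : 'I_n) :
    M -> R[i] :=
  fun p => w p (coord_tvec c i p) (coord_tvec c j p).

Record symplectic (w : two_form) : Prop := Symplectic {
  sympl_linear : forall p (a : R[i]) (u v z : tvec),
    tangent p u -> tangent p v -> tangent p z ->
    w p (fun f => a * u f + v f) z = a * w p u z + w p v z;
  sympl_skew : forall p (u v : tvec), tangent p u -> tangent p v ->
    w p u v = - w p v u;
  sympl_smooth : forall c, atlas c -> forall i j,
    msmooth (cdom c) (coord_form w c i j);
  sympl_closed : forall c, atlas c -> forall i j k p, cdom c p ->
    pderiv c i (coord_form w c j k) p + pderiv c j (coord_form w c k i) p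
      + pderiv c k (coord_form w c i j) p = 0;
  sympl_nondegenerate : forall p (u : tvec), tangent p u ->
    (forall v, tangent p v -> w p u v = 0) -> forall f, u f = 0 }.

Definition free_tvecs (r : nat) (X : 'I_r -> tvec) :=
  forall a : 'I_r -> R[i],
    (forall f, \sum_i a i * X i f = 0) -> forall i, a i = 0.

Definition span_tvecs (r : nat) (X : 'I_r -> tvec) : set tvec :=
  [set v | exists a : 'I_r -> R[i], v = fun f => \sum_i a i * X i f].

Definition smooth_vfield (U : opens M) (X : M -> tvec) :=
  (forall p, U p -> tangent p (X p)) /\
  forall (V : opens M) f, V `<=` U -> msmooth V f ->
    msmooth V (fun p => X p f).

Definition subbundle (P : M -> set tvec) :=
  forall p, exists (U : opens M) (r : nat) (X : 'I_r -> M -> tvec),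
    [/\ U p, forall i, smooth_vfield U (X i) &
        forall q, U q -> free_tvecs (X^~ q) /\ P q = span_tvecs (X^~ q)].

Definition free_differentials (m : nat) (p : M) (f g : 'I_m -> M -> R[i]) :=
  forall a b : 'I_m -> R[i],
    (forall v, tangent p v -> \sum_i (a i * v (f i) + b i * v (g i)) = 0) ->
    forall i, a i = 0 /\ b i = 0.

Definition darboux_chart (w : two_form) (P : M -> set tvec) (U : opens M)
    (x y : 'I_n./2 -> M -> R[i]) :=
  [/\ forall i, msmooth U (x i) /\ msmooth U (y i),
      forall p, U p -> free_differentials p x y,
      forall p, U p -> forall u v, tangent p u -> tangent p v ->
        w p u v = \sum_i (u (y i) * v (x i) - v (y i) * u (x i)) &
      forall p, U p -> P p = [set v | tangent p v /\ forall i, v (x i) = 0]].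

Record polarized_symplectic (w : two_form) (P : M -> set tvec) : Prop :=
  PolarizedSymplectic {
    ps_symplectic : symplectic w;
    ps_subbundle : subbundle P;
    ps_darboux : forall p, exists (U : opens M) (x y : 'I_n./2 -> M -> R[i]),
      U p /\ darboux_chart w P U x y }.

(* The Hamiltonian vector X of f at p, normalized by w (v, X) = v f for all v,
   so that {y_i, x_j} = delta_ij when w is the sum of the dy_i /\ dx_i. *)
Definition hamiltonian (w : two_form) (p : M) (f : M -> R[i]) : tvec :=
  xget (fun=> 0)
    [set X | tangent p X /\ forall v, tangent p v -> w p v X = v f].

Definition poisson (w : two_form) (f g : M -> R[i]) : M -> R[i] :=
  fun p => hamiltonian w p f g.

End Geometry.

(* The sections of C_M^oo over U, represented by their extensions by 0. *)
Record cinf (R : realType) (n : nat) (M : manifold R n) (U : opens M) :=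
  Cinf {
    cinf_val :> M -> R[i];
    cinf_smooth : msmooth U cinf_val;
    cinf_supp : forall p, ~ U p -> cinf_val p = 0 }.

HB.instance Definition _ R n M U := gen_eqMixin (@cinf R n M U).
HB.instance Definition _ R n M U := gen_choiceMixin (@cinf R n M U).

Section CinfAlgebra.
Variables (R : realType) (n : nat) (M : manifold R n).
Implicit Types U V W : opens M.

Lemma cinf_inj U (f g : cinf U) : (forall p, U p -> f p = g p) -> f = g.
Proof.
case: f g => [f hf f0] [g hg g0] /= fg.
have e : f = g.
  by apply/funext => p; case: (pselect (U p)) => [/fg//|Up]; rewrite f0// g0.
by case: _ / e in hg g0 *; congr Cinf; exact: Prop_irrelevance.
Qed.

Definition extend0 U (f : M -> R[i]) : M -> R[i] :=
  fun p => if `[< U p >] then f p else 0.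

Lemma extend0E U f p : U p -> extend0 U f p = f p.
Proof. by move=> Up; rewrite /extend0; case: asboolP. Qed.

Lemma extend0_supp U f p : ~ U p -> extend0 U f p = 0.
Proof. by move=> Up; rewrite /extend0; case: asboolP. Qed.

Lemma extend0_smooth U f : msmooth U f -> msmooth U (extend0 U f).
Proof.
by apply: msmooth_ext; [exact: oset_open | move=> p Up; rewrite extend0E].
Qed.

Definition mk_cinf U (f : M -> R[i]) (hf : msmooth U f) : cinf U :=
  Cinf (extend0_smooth hf) (@extend0_supp U f).

Lemma mk_cinfE U f (hf : msmooth U f) p : U p -> mk_cinf hf p = f p.
Proof. exact: extend0E. Qed.

Definition cinf_cst U (a : R[i]) : cinf U := mk_cinf (msmooth_cst U a).
Definition cinf_add U (f g : cinf U) : cinf U :=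
  mk_cinf (msmoothD (oset_open U) (cinf_smooth f) (cinf_smooth g)).
Definition cinf_mul U (f g : cinf U) : cinf U :=
  mk_cinf (msmoothM (oset_open U) (cinf_smooth f) (cinf_smooth g)).
Definition cinf_scale U (a : R[i]) (f : cinf U) : cinf U :=
  cinf_mul (cinf_cst U a) f.
Definition cinf_res U V (VU : V `<=` U) (f : cinf U) : cinf V :=
  mk_cinf (msmooth_sub VU (cinf_smooth f)).

Lemma cinf_cstE U a p : U p -> cinf_cst U a p = a.
Proof. exact: mk_cinfE. Qed.
Lemma cinf_addE U (f g : cinf U) p : U p -> cinf_add f g p = f p + g p.
Proof. exact: mk_cinfE. Qed.
Lemma cinf_mulE U (f g : cinf U) p : U p -> cinf_mul f g p = f p * g p.
Proof. exact: mk_cinfE. Qed.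
Lemma cinf_scaleE U a (f : cinf U) p : U p -> cinf_scale a f p = a * f p.
Proof. by move=> Up; rewrite cinf_mulE// cinf_cstE. Qed.
Lemma cinf_resE U V (VU : V `<=` U) (f : cinf U) p :
  V p -> cinf_res VU f p = f p.
Proof. exact: mk_cinfE. Qed.

Section Instances.
Variable U : opens M.

Let opp (f : cinf U) := cinf_scale (-1) f.

Let addA : associative (@cinf_add U).
Proof. by move=> f g h; apply: cinf_inj => p Up; rewrite !cinf_addE// addrA. Qed.
Let addC : commutative (@cinf_add U).
Proof. by move=> f g; apply: cinf_inj => p Up; rewrite !cinf_addE// addrC. Qed.
Let add0 : left_id (cinf_cst U 0) (@cinf_add U).
Proof.
by move=> f; apply: cinf_inj => p Up; rewrite cinf_addE// cinf_cstE// add0r.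
Qed.
Let addN : left_inverse (cinf_cst U 0) opp (@cinf_add U).
Proof.
move=> f; apply: cinf_inj => p Up.
by rewrite cinf_addE// cinf_cstE// cinf_scaleE// mulN1r addNr.
Qed.

HB.instance Definition _ :=
  GRing.isZmodule.Build (cinf U) addA addC add0 addN.

Let scaleA (a b : R[i]) (f : cinf U) :
  cinf_scale a (cinf_scale b f) = cinf_scale (a * b) f.
Proof. by apply: cinf_inj => p Up; rewrite !cinf_scaleE// mulrA. Qed.
Let scale1 : left_id 1 (@cinf_scale U).
Proof. by move=> f; apply: cinf_inj => p Up; rewrite !cinf_scaleE// mul1r. Qed.
Let scaleDr : right_distributive (@cinf_scale U) +%R.
Proof.
move=> a f g; apply: cinf_inj => p Up.
by rewrite cinf_scaleE// !cinf_addE// !cinf_scaleE// mulrDr.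
Qed.
Let scaleDl f : {morph (@cinf_scale U)^~ f : a b / a + b}.
Proof.
move=> a b; apply: cinf_inj => p Up.
by rewrite cinf_scaleE// cinf_addE// !cinf_scaleE// mulrDl.
Qed.

HB.instance Definition _ := GRing.Zmodule_isLmodule.Build R[i] (cinf U)
  scaleA scale1 scaleDr scaleDl.

End Instances.

Lemma cinfD U (f g : cinf U) p : U p -> (f + g) p = f p + g p.
Proof. exact: cinf_addE. Qed.
Lemma cinfZ U a (f : cinf U) p : U p -> (a *: f) p = a * f p.
Proof. exact: cinf_scaleE. Qed.

End CinfAlgebra.

Record fps (V : Type) := Fps { coef : nat -> V }.
Coercion coef : fps >-> Funclass.

HB.instance Definition _ (V : Type) := gen_eqMixin (fps V).
HB.instance Definition _ (V : Type) := gen_choiceMixin (fps V).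

Lemma fpsP (V : Type) (a b : fps V) : (forall n, a n = b n) -> a = b.
Proof. by case: a b => [a] [b] /= ab; congr Fps; exact/funext. Qed.

Section Convolution.
Variable V : zmodType.

Lemma triangle_swap (n : nat) (F : nat -> nat -> V) :
  \sum_(i < n.+1) \sum_(j < (n - i).+1) F i j =
  \sum_(j < n.+1) \sum_(i < (n - j).+1) F i j.
Proof.
transitivity (\sum_(i < n.+1) \sum_(j < n.+1 | (j <= n - i)%N) F i j).
  by apply: eq_bigr => i _; rewrite (big_ord_narrow_leq (leq_subr _ _)).
rewrite (exchange_big_dep predT) //=; apply: eq_bigr => j _.
transitivity (\sum_(i < n.+1 | (i <= n - j)%N) F i j).
  by apply: eq_bigl => i; rewrite !leq_subRL ?leq_ord// addnC.
by rewrite (big_ord_narrow_leq (leq_subr _ _)).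
Qed.

Lemma conv_rev (n : nat) (F : nat -> nat -> V) :
  \sum_(i < n.+1) F i (n - i)%N = \sum_(i < n.+1) F (n - i)%N i.
Proof.
rewrite (reindex_inj rev_ord_inj) /=; apply: eq_bigr => i _.
by rewrite subSS subKn// leq_ord.
Qed.

Lemma conv_assoc (n : nat) (F : nat -> nat -> nat -> V) :
  \sum_(i < n.+1) \sum_(j < i.+1) F j (i - j)%N (n - i)%N =
  \sum_(j < n.+1) \sum_(i < (n - j).+1) F j i (n - j - i)%N.
Proof.
rewrite (conv_rev n (fun i k => \sum_(j < i.+1) F j (i - j)%N k)) /=.
rewrite (triangle_swap n (fun k j => F j (n - k - j)%N k)).
apply: eq_bigr => j _.
rewrite (conv_rev (n - j) (fun i k => F j i k)).
by apply: eq_bigr => i _; rewrite -!subnDA (addnC i).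
Qed.

End Convolution.

Section FpsZmodule.
Variable V : zmodType.

Definition fps_add (a b : fps V) : fps V := Fps (fun n => a n + b n).
Definition fps_opp (a : fps V) : fps V := Fps (fun n => - a n).
Definition fps_zero : fps V := Fps (fun=> 0).

Let addA : associative fps_add.
Proof. by move=> a b c; apply: fpsP => n /=; rewrite addrA. Qed.
Let addC : commutative fps_add.
Proof. by move=> a b; apply: fpsP => n /=; rewrite addrC. Qed.
Let add0 : left_id fps_zero fps_add.
Proof. by move=> a; apply: fpsP => n /=; rewrite add0r. Qed.
Let addN : left_inverse fps_zero fps_opp fps_add.
Proof. by move=> a; apply: fpsP => n /=; rewrite addNr. Qed.

HB.instance Definition _ := GRing.isZmodule.Build (fps V) addA addC add0 addN.

Lemma fpsD (a b : fps V) n : (a + b) n = a n + b n. Proof. by []. Qed.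
Lemma fpsN (a : fps V) n : (- a) n = - a n. Proof. by []. Qed.
Lemma fps0 n : (0 : fps V) n = 0. Proof. by []. Qed.

End FpsZmodule.

Section FpsRing.
Variable K : comNzRingType.

Definition fps_mul (a b : fps K) : fps K :=
  Fps (fun n => \sum_(i < n.+1) a i * b (n - i)%N).
Definition fps_one : fps K := Fps (fun n => (n == 0)%:R).

Let mulA : associative fps_mul.
Proof.
move=> a b c; apply: fpsP => n /=.
under eq_bigr do rewrite mulr_sumr.
under [RHS]eq_bigr do rewrite mulr_suml.
rewrite (conv_assoc n (fun i j k => a i * b j * c k)).
by apply: eq_bigr => i _; apply: eq_bigr => j _; rewrite mulrA.
Qed.
Let mulC : commutative fps_mul.
Proof.
move=> a b; apply: fpsP => n /=; rewrite (conv_rev n (fun i j => a i * b j)).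
by apply: eq_bigr => i _; rewrite mulrC.
Qed.
Let mul1 : left_id fps_one fps_mul.
Proof.
move=> a; apply: fpsP => n /=; rewrite big_ord_recl /= mul1r subn0.
by rewrite big1 ?addr0// => i _; rewrite mul0r.
Qed.
Let mulD : left_distributive fps_mul +%R.
Proof.
move=> a b c; apply: fpsP => n; rewrite fpsD /= -big_split /=.
by apply: eq_bigr => i _; rewrite mulrDl.
Qed.
Let one_neq0 : fps_one != 0.
Proof.
by apply/eqP => /(congr1 (fun a : fps K => a 0%N))/eqP; rewrite /= oner_eq0.
Qed.

HB.instance Definition _ :=
  GRing.Zmodule_isComNzRing.Build (fps K) mulA mulC mul1 mulD one_neq0.

(* The formal parameter, denoted t below. *)
Definition fpsX : fps K := Fps (fun n => (n == 1)%:R).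

End FpsRing.

Section FpsModule.
Variables (K : comNzRingType) (V : lmodType K).

Definition fps_scale (c : fps K) (a : fps V) : fps V :=
  Fps (fun n => \sum_(i < n.+1) c i *: a (n - i)%N).

Let scaleA (c d : fps K) (a : fps V) :
  fps_scale c (fps_scale d a) = fps_scale (c * d) a.
Proof.
apply: fpsP => n /=.
under eq_bigr do rewrite scaler_sumr.
under [RHS]eq_bigr do rewrite scaler_suml.
rewrite (conv_assoc n (fun i j k => (c i * d j) *: a k)).
by apply: eq_bigr => i _; apply: eq_bigr => j _; rewrite scalerA.
Qed.
Let scale1 : left_id 1 fps_scale.
Proof.
move=> a; apply: fpsP => n /=; rewrite big_ord_recl /= scale1r subn0.
by rewrite big1 ?addr0// => i _; rewrite scale0r.
Qed.
Let scaleDr : right_distributive fps_scale +%R.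
Proof.
move=> c a b; apply: fpsP => n; rewrite fpsD /= -big_split /=.
by apply: eq_bigr => i _; rewrite scalerDr.
Qed.
Let scaleDl a : {morph fps_scale^~ a : c d / c + d}.
Proof.
move=> c d; apply: fpsP => n; rewrite fpsD /= -big_split /=.
by apply: eq_bigr => i _; rewrite scalerDl.
Qed.

HB.instance Definition _ := GRing.Zmodule_isLmodule.Build (fps K) (fps V)
  scaleA scale1 scaleDr scaleDl.

Lemma fpsZ (c : fps K) (a : fps V) n :
  (c *: a) n = \sum_(i < n.+1) c i *: a (n - i)%N.
Proof. by []. Qed.

Lemma fpsXZ0 (a : fps V) : (fpsX K *: a) 0%N = 0.
Proof. by rewrite fpsZ big_ord1 scale0r. Qed.

Lemma fpsXZS (a : fps V) n : (fpsX K *: a) n.+1 = a n.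
Proof.
rewrite fpsZ big_ord_recl /= scale0r add0r big_ord_recl /= scale1r subn1 /=.
by rewrite big1 ?addr0// => i _; rewrite scale0r.
Qed.

End FpsModule.

Record mod_sheaf (K : comNzRingType) (M : topologicalType) := ModSheaf {
  sec :> opens M -> lmodType K;
  res : forall U V : opens M, V `<=` U -> {linear sec U -> sec V};
  res_id : forall (U : opens M) (UU : U `<=` U) (s : sec U), res UU s = s;
  res_comp : forall (U V W : opens M) (VU : V `<=` U) (WV : W `<=` V) (WU : W `<=` U)
    (s : sec U), res WV (res VU s) = res WU s;
  sheaf_sep : forall (U : opens M) (I : Type) (W : I -> opens M)
    (WU : forall i, W i `<=` U), covers U W ->
    forall s s' : sec U, (forall i, res (WU i) s = res (WU i) s') -> s = s';
  sheaf_glue : forall (U : opens M) (I : Type) (W : I -> opens M)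
    (WU : forall i, W i `<=` U), covers U W ->
    forall s : forall i, sec (W i),
    (forall i j (V : opens M) (Vi : V `<=` W i) (Vj : V `<=` W j),
       res Vi (s i) = res Vj (s j)) ->
    exists s0 : sec U, forall i, res (WU i) s0 = s i }.

(* Algebras are associative and unital; those of sections over the empty set
   are zero, so that lalgType, which excludes the zero ring, is not usable. *)
Record alg_sheaf (K : comNzRingType) (M : topologicalType) := AlgSheaf {
  alg_mod :> mod_sheaf K M;
  amul : forall U, alg_mod U -> alg_mod U -> alg_mod U;
  aone : forall U, alg_mod U;
  amulA : forall U, associative (@amul U);
  amul1l : forall U, left_id (aone U) (@amul U);
  amul1r : forall U, right_id (aone U) (@amul U);
  amul_linl : forall U c (a a' b : alg_mod U),
    amul (c *: a + a') b = c *: amul a b + amul a' b;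
  amul_linr : forall U c (a b b' : alg_mod U),
    amul a (c *: b + b') = c *: amul a b + amul a b';
  res_amul : forall (U V : opens M) (VU : V `<=` U) (a b : alg_mod U),
    res alg_mod VU (amul a b) = amul (res alg_mod VU a) (res alg_mod VU b);
  res_aone : forall (U V : opens M) (VU : V `<=` U), res alg_mod VU (aone U) = aone V }.

Arguments amul {K M A U} : rename.
Arguments aone {K M} A U : rename.

Section SheafNotions.
Variables (K : comNzRingType) (M : topologicalType).

Definition natural_map (F G : mod_sheaf K M)
    (phi : forall U, {linear F U -> G U}) :=
  forall (U V : opens M) (VU : V `<=` U) (s : F U),
    phi V (res F VU s) = res G VU (phi U s).

(* The sheafification of T inside F. *)
Definition locally_in (F : mod_sheaf K M) (T : forall U : opens M, set (F U))
    (U : opens M) : set (F U) :=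
  [set s | forall p, U p ->
     exists (V : opens M) (VU : V `<=` U), V p /\ T V (res F VU s)].

Arguments locally_in {F} T {U}.

Record subsheaf_mod (F : mod_sheaf K M) (O : forall U, set (F U)) : Prop :=
  SubsheafMod {
    sub_zero : forall U, O U 0;
    sub_lin : forall U c a b, O U a -> O U b -> O U (c *: a + b);
    sub_res : forall (U V : opens M) (VU : V `<=` U) a, O U a -> O V (res F VU a);
    sub_local : forall U a, locally_in O a -> O U a }.

End SheafNotions.

Arguments locally_in {K M F} T {U}.

Section CinfSheaf.
Variables (R : realType) (n : nat) (M : manifold R n).

Lemma cinf_res_linear (U V : opens M) (VU : V `<=` U) :
  linear (@cinf_res R n M U V VU : cinf U -> cinf V).
Proof.
move=> a f g; apply: cinf_inj => p Vp; have Up := VU _ Vp.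
by rewrite cinf_resE// !cinfD// !cinfZ// !cinf_resE.
Qed.

HB.instance Definition _ (U V : opens M) (VU : V `<=` U) :=
  GRing.isLinear.Build R[i] (cinf U) (cinf V) *:%R (cinf_res VU)
    (cinf_res_linear VU).

Lemma cinf_sep (U : opens M) (I : Type) (W : I -> opens M)
    (WU : forall i, W i `<=` U) : covers U W ->
  forall f g : cinf U, (forall i, cinf_res (WU i) f = cinf_res (WU i) g) ->
  f = g.
Proof.
move=> cov f g fg; apply: cinf_inj => p /cov[i Wp].
by have := congr1 (fun h : cinf (W i) => h p) (fg i); rewrite !cinf_resE.
Qed.

Lemma opensI_proof (U V : opens M) : open (U `&` V).
Proof. by apply: openI; exact: oset_open. Qed.

Lemma cinf_glue (U : opens M) (I : Type) (W : I -> opens M)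
    (WU : forall i, W i `<=` U) : covers U W ->
  forall f : forall i, cinf (W i),
  (forall i j (V : opens M) (Vi : V `<=` W i) (Vj : V `<=` W j),
     cinf_res Vi (f i) = cinf_res Vj (f j)) ->
  exists f0 : cinf U, forall i, cinf_res (WU i) f0 = f i.
Proof.
move=> cov f compat.
have fE i j p : W i p -> W j p -> f i p = f j p.
  move=> Wi Wj; pose V := Opens (opensI_proof (W i) (W j)).
  have := compat i j V (@subIsetl _ _ _) (@subIsetr _ _ _).
  move/(congr1 (fun h : cinf V => h p)).
  by rewrite !cinf_resE//; split.
pose g (p : M) : R[i] :=
  if pselect (exists i, W i p) is left h then f (projT1 (cid h)) p else 0.
have gE i p : W i p -> g p = f i p.
  move=> Wi; rewrite /g; case: pselect => [h|[]]; last by exists i.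
  by apply: fE => //; case: (cid h).
have gs : msmooth U g.
  apply: msmooth_local => p /cov[i Wi]; exists (W i) => //.
  apply: msmooth_ext (cinf_smooth (f i)); first exact: oset_open.
  by move=> q Wq; rewrite (gE i).
exists (mk_cinf gs) => i; apply: cinf_inj => p Wi.
by rewrite cinf_resE// mk_cinfE ?(gE i)//; exact: (WU i).
Qed.

Lemma cinf_res_id (U : opens M) (UU : U `<=` U) (f : cinf U) :
  cinf_res UU f = f.
Proof. by apply: cinf_inj => p Up; rewrite cinf_resE. Qed.

Lemma cinf_res_comp (U V W : opens M) (VU : V `<=` U) (WV : W `<=` V)
    (WU : W `<=` U) (f : cinf U) :
  cinf_res WV (cinf_res VU f) = cinf_res WU f.
Proof.
by apply: cinf_inj => p Wp; rewrite !cinf_resE//; exact: WV.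
Qed.

Definition cinf_mod : mod_sheaf R[i] M :=
  @ModSheaf R[i] M (fun U => cinf U)
    (fun U V VU => cinf_res VU) cinf_res_id cinf_res_comp cinf_sep cinf_glue.

Lemma cinf_mulA U : associative (@cinf_mul R n M U).
Proof. by move=> f g h; apply: cinf_inj => p Up; rewrite !cinf_mulE// mulrA. Qed.
Lemma cinf_mulC U : commutative (@cinf_mul R n M U).
Proof. by move=> f g; apply: cinf_inj => p Up; rewrite !cinf_mulE// mulrC. Qed.
Lemma cinf_mul1l U : left_id (cinf_cst U 1) (@cinf_mul R n M U).
Proof.
by move=> f; apply: cinf_inj => p Up; rewrite cinf_mulE// cinf_cstE// mul1r.
Qed.
Lemma cinf_mul1r U : right_id (cinf_cst U 1) (@cinf_mul R n M U).
Proof. by move=> f; rewrite cinf_mulC cinf_mul1l. Qed.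
Lemma cinf_mul_linl U c (f f' g : cinf_mod U) :
  cinf_mul (c *: f + f') g = c *: cinf_mul f g + cinf_mul f' g :> cinf U.
Proof.
apply: cinf_inj => p Up.
by rewrite cinf_mulE// !cinfD// !cinfZ// !cinf_mulE// mulrDl mulrA.
Qed.
Lemma cinf_mul_linr U c (f g g' : cinf_mod U) :
  cinf_mul f (c *: g + g') = c *: cinf_mul f g + cinf_mul f g' :> cinf U.
Proof.
by rewrite cinf_mulC cinf_mul_linl (cinf_mulC g) (cinf_mulC g').
Qed.
Lemma cinf_res_mul (U V : opens M) (VU : V `<=` U) (f g : cinf U) :
  cinf_res VU (cinf_mul f g) = cinf_mul (cinf_res VU f) (cinf_res VU g).
Proof.
apply: cinf_inj => p Vp; have Up := VU _ Vp.
by rewrite cinf_resE// !cinf_mulE// !cinf_resE.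
Qed.
Lemma cinf_res_cst (U V : opens M) (VU : V `<=` U) (a : R[i]) :
  cinf_res VU (cinf_cst U a) = cinf_cst V a.
Proof.
apply: cinf_inj => p Vp; have Up := VU _ Vp.
by rewrite cinf_resE// !cinf_cstE.
Qed.

Definition cinf_sheaf : alg_sheaf R[i] M :=
  @AlgSheaf R[i] M cinf_mod (@cinf_mul R n M) (fun U => cinf_cst U 1)
    cinf_mulA cinf_mul1l cinf_mul1r cinf_mul_linl cinf_mul_linr
    cinf_res_mul (fun U V VU => cinf_res_cst VU 1).

End CinfSheaf.

Arguments cinf_sheaf {R n} M.

Section FpsSheaf.
Variables (K : comNzRingType) (M : topologicalType) (F : mod_sheaf K M).

Definition fps_res (U V : opens M) (VU : V `<=` U) (a : fps (F U)) :
  fps (F V) := Fps (fun k => res F VU (a k)).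

Lemma fps_res_linear (U V : opens M) (VU : V `<=` U) : linear (fps_res VU).
Proof.
move=> c a b; apply: fpsP => k; rewrite fpsD fpsZ /=.
rewrite raddfD raddf_sum /=; congr (_ + _).
by apply: eq_bigr => i _; rewrite linearZ.
Qed.

HB.instance Definition _ (U V : opens M) (VU : V `<=` U) :=
  GRing.isLinear.Build (fps K) (fps (F U)) (fps (F V)) *:%R (fps_res VU)
    (fps_res_linear VU).

Lemma fps_res_id (U : opens M) (UU : U `<=` U) (a : fps (F U)) :
  fps_res UU a = a.
Proof. by apply: fpsP => k /=; exact: res_id. Qed.

Lemma fps_res_comp (U V W : opens M) (VU : V `<=` U) (WV : W `<=` V)
    (WU : W `<=` U) (a : fps (F U)) :
  fps_res WV (fps_res VU a) = fps_res WU a.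
Proof. by apply: fpsP => k /=; exact: res_comp. Qed.

Lemma fps_sep (U : opens M) (I : Type) (W : I -> opens M)
    (WU : forall i, W i `<=` U) : covers U W ->
  forall a b : fps (F U), (forall i, fps_res (WU i) a = fps_res (WU i) b) ->
  a = b.
Proof.
move=> cov a b ab; apply: fpsP => k; apply: sheaf_sep cov _ _ _ => i.
exact: (congr1 (fun h : fps (F (W i)) => h k) (ab i)).
Qed.

Lemma fps_glue (U : opens M) (I : Type) (W : I -> opens M)
    (WU : forall i, W i `<=` U) : covers U W ->
  forall a : forall i, fps (F (W i)),
  (forall i j (V : opens M) (Vi : V `<=` W i) (Vj : V `<=` W j),
     fps_res Vi (a i) = fps_res Vj (a j)) ->
  exists a0 : fps (F U), forall i, fps_res (WU i) a0 = a i.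
Proof.
move=> cov a compat.
have /choice[s hs] k : exists s : F U, forall i, res F (WU i) s = a i k.
  apply: sheaf_glue => // i j V Vi Vj.
  exact: (congr1 (fun h : fps (F V) => h k) (compat i j V Vi Vj)).
by exists (Fps s) => i; apply: fpsP => k /=; exact: hs.
Qed.

Definition fps_sheaf : mod_sheaf (fps K) M :=
  @ModSheaf (fps K) M (fun U => fps (F U))
    (fun U V VU => fps_res VU) fps_res_id fps_res_comp fps_sep fps_glue.

End FpsSheaf.

Section TAdic.
Variables (K : comNzRingType) (M : topologicalType) (F : mod_sheaf (fps K) M).
Variable O : forall U : opens M, set (F U).

(* The sections of the subsheaf t^k O, the image of O under t^k. *)
Definition tpow_sub (k : nat) (U : opens M) : set (F U) :=
  locally_in (fun V => [set s | exists2 c : F V, O c & s = fpsX K ^+ k *: c]).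

Arguments tpow_sub k {U}.

(* The map from O to the inverse limit of the quotient sheaves O / t^k O is an
   isomorphism.  A section over U of the limit is a family of sections of O,
   given for each k on the members of an open cover (W k) of U, compatible
   modulo the subsheaves t^k O. *)
Definition t_complete :=
  forall (U : opens M) (I : nat -> Type) (W : forall k, I k -> opens M)
    (WU : forall k i, W k i `<=` U) (s : forall k i, F (W k i)),
  (forall k, covers U (W k)) ->
  (forall k i, O (s k i)) ->
  (forall k l i j, (k <= l)%N ->
     forall (V : opens M) (Vi : V `<=` W k i) (Vj : V `<=` W l j),
     tpow_sub k (res F Vi (s k i) - res F Vj (s l j))) ->
  exists! s0 : F U, O s0 /\
    forall k i, tpow_sub k (res F (WU k i) s0 - s k i).

End TAdic.

Section Quantization.
Variables (R : realType) (n : nat) (M : manifold R n).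
Variables (w : two_form M) (P : M -> set (tvec M)).

Definition polarized_fun (U : opens M) : set (cinf U) :=
  [set f | forall p, U p -> forall X, P p X -> X f = 0].

Definition cinft : mod_sheaf (fps R[i]) M := fps_sheaf (cinf_sheaf M).

Definition usual_prod (U : opens M) (a b : cinft U) : cinft U :=
  Fps (fun k => \sum_(i < k.+1) amul (coef a i) (coef b (k - i)%N)).

Record dq := DQ {
  dq_alg :> alg_sheaf (fps R[i]) M;
  symb : forall U, dq_alg U -> cinf_sheaf M U;
  symb_linear : forall U (c : fps R[i]) (a b : dq_alg U),
    symb (c *: a + b) = c 0%N *: symb a + symb b;
  symb_mul : forall U (a b : dq_alg U),
    symb (amul a b) = amul (symb a) (symb b);
  symb_one : forall U, symb (aone dq_alg U) = aone (cinf_sheaf M) U;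
  symb_res : forall (U V : opens M) (VU : V `<=` U) (a : dq_alg U),
    symb (res dq_alg VU a) = res (cinf_sheaf M) VU (symb a);
  symb_epi : forall U (f : cinf_sheaf M U),
    locally_in (fun V => range (@symb V)) f;
  dq_triv : exists phi : forall U, {linear dq_alg U -> cinft U},
    [/\ natural_map phi, forall U, bijective (phi U) &
        forall U (a : dq_alg U), coef (phi U a) 0%N = symb a];
  dq_bracket : forall (U : opens M) (a b : dq_alg U),
    exists2 c : dq_alg U, amul a b - amul b a = fpsX R[i] *: c &
      forall p, U p ->
        (symb c : cinf U) p = poisson w (symb a : cinf U) (symb b : cinf U) p }.

Definition dq_map (A B : dq) (phi : forall U, {linear A U -> B U}) :=
  [/\ natural_map phi,
      forall U (a b : A U), phi U (amul a b) = amul (phi U a) (phi U b),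
      forall U, phi U (aone A U) = aone B U &
      forall U (a : A U), symb (phi U a) = symb a].

(* The sheaf image of O under the symbol map is O_P. *)
Definition symbol_image (F : mod_sheaf (fps R[i]) M)
    (sigma : forall U, F U -> cinf_sheaf M U) (O : forall U, set (F U)) :=
  forall U (f : cinf_sheaf M U),
    polarized_fun f <-> locally_in (fun V => (@sigma V) @` (O V)) f.

Record is_pdq (A : dq) (O : forall U, set (A U)) : Prop := IsPDQ {
  pdq_sub : subsheaf_mod O;
  pdq_one : forall U, O U (aone A U);
  pdq_mul : forall U a b, O U a -> O U b -> O U (amul a b);
  pdq_comm : forall U a b, O U a -> O U b -> amul a b = amul b a;
  pdq_complete : t_complete O;
  pdq_symbol : symbol_image (@symb A) O }.

(* Stated for pairs of a DQ and a family of sections, so that it applies as it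
   stands to the pair given by a polarized star-product (star_dq below). *)
Definition pdq_equiv (A : dq) (O : forall U, set (A U))
    (B : dq) (O' : forall U, set (B U)) :=
  exists2 phi : forall U, {linear A U -> B U},
    dq_map phi & forall U, phi U @` O U = O' U.

(* Bidifferential operators: in local coordinates, they are finite sums of
   products of partial derivatives of both arguments with smooth coefficients
   (the order is bounded locally on M). *)
Record bidiff := Bidiff {
  bd_op :> forall U, cinf_sheaf M U -> cinf_sheaf M U -> cinf_sheaf M U;
  bd_linl : forall U c (f f' g : cinf_sheaf M U),
    bd_op (c *: f + f') g = c *: bd_op f g + bd_op f' g;
  bd_linr : forall U c (f g g' : cinf_sheaf M U),
    bd_op f (c *: g + g') = c *: bd_op f g + bd_op f g';
  bd_res : forall (U V : opens M) (VU : V `<=` U) (f g : cinf_sheaf M U),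
    res (cinf_sheaf M) VU (bd_op f g) =
    bd_op (res (cinf_sheaf M) VU f) (res (cinf_sheaf M) VU g);
  bd_coord : forall p : M, exists (U : opens M) (c : chart R n M) (k : nat)
    (e : {ffun 'I_n -> 'I_k.+1} -> {ffun 'I_n -> 'I_k.+1} -> M -> R[i]),
    [/\ U p, atlas c /\ U `<=` cdom c, forall alpha beta, msmooth U (e alpha beta) &
        forall (V : opens M) (f g : cinf V), V `<=` U -> forall q, V q ->
          (bd_op (f : cinf_sheaf M V) (g : cinf_sheaf M V) : cinf V) q =
          \sum_alpha \sum_beta
            e alpha beta q * mpderiv c alpha f q * mpderiv c beta g q] }.

Definition star (mu : nat -> bidiff) (U : opens M) (a b : cinft U) : cinft U :=
  Fps (fun k => \sum_(i < k.+1) \sum_(j < (k - i).+1)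
                  mu i U (coef a j) (coef b (k - i - j)%N)).

Record star_product := StarProduct {
  sp_mu :> nat -> bidiff;
  sp_assoc : forall U : opens M, associative (@star sp_mu U);
  sp_mu0 : forall U (f g : cinf_sheaf M U), sp_mu 0%N U f g = amul f g;
  sp_const : forall i U (z : R[i]) (f : cinf_sheaf M U), (0 < i)%N ->
    sp_mu i U (z *: aone (cinf_sheaf M) U) f = 0 /\
    sp_mu i U f (z *: aone (cinf_sheaf M) U) = 0;
  sp_bracket : forall (U : opens M) (f g : cinf_sheaf M U) p, U p ->
    (sp_mu 1%N U f g - sp_mu 1%N U g f : cinf U) p =
    poisson w (f : cinf U) (g : cinf U) p }.

Record is_psp (mu : star_product) (O : forall U, set (cinft U)) : Prop :=
  IsPSP {
    psp_sub : subsheaf_mod O;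
    psp_mul : forall U a b, O U a -> O U b -> O U (usual_prod a b);
    psp_complete : t_complete O;
    psp_symbol : symbol_image (fun U (a : cinft U) => coef a 0%N) O;
    psp_prod : forall U (a b : cinft U), O U a -> star mu a b = usual_prod a b }.

Section StarQuantization.
Variable mu : star_product.

Let bdD_l i U (f f' g : cinf_sheaf M U) :
  mu i U (f + f') g = mu i U f g + mu i U f' g.
Proof. by rewrite -[f]scale1r bd_linl !scale1r. Qed.
Let bd0l i U (g : cinf_sheaf M U) : mu i U 0 g = 0.
Proof. by apply: (addrI (mu i U 0 g)); rewrite -bdD_l !addr0. Qed.
Let bdZl i U c (f g : cinf_sheaf M U) : mu i U (c *: f) g = c *: mu i U f g.
Proof. by rewrite -[c *: f]addr0 bd_linl bd0l addr0. Qed.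
Let bdD_r i U (f g g' : cinf_sheaf M U) :
  mu i U f (g + g') = mu i U f g + mu i U f g'.
Proof. by rewrite -[g]scale1r bd_linr !scale1r. Qed.
Let bd0r i U (f : cinf_sheaf M U) : mu i U f 0 = 0.
Proof. by apply: (addrI (mu i U f 0)); rewrite -bdD_r !addr0. Qed.
Let bdZr i U c (f g : cinf_sheaf M U) : mu i U f (c *: g) = c *: mu i U f g.
Proof. by rewrite -[c *: g]addr0 bd_linr bd0r addr0. Qed.

Lemma star_linl U c (a a' b : cinft U) :
  star mu (c *: a + a') b = c *: star mu a b + star mu a' b.
Proof.
apply: fpsP => k; rewrite fpsD fpsZ /=.
transitivity (\sum_(i < k.+1) (\sum_(j < (k - i).+1) \sum_(l < j.+1)
    coef c l *: mu i U (coef a (j - l)%N) (coef b (k - i - j)%N)) +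
  \sum_(i < k.+1) \sum_(j < (k - i).+1)
    mu i U (coef a' j) (coef b (k - i - j)%N)).
  rewrite -big_split /=; apply: eq_bigr => i _.
  rewrite -big_split /=; apply: eq_bigr => j _.
  rewrite bdD_l; congr (_ + _).
  rewrite (big_morph (fun f => mu i U f _) (fun f f' => bdD_l i f f' _)
    (bd0l i _)).
  by apply: eq_bigr => l _; rewrite bdZl.
congr (_ + _).
transitivity (\sum_(i < k.+1) \sum_(l < (k - i).+1) \sum_(j < (k - i - l).+1)
    coef c l *: mu i U (coef a j) (coef b (k - i - l - j)%N)).
  apply: eq_bigr => i _; exact: (conv_assoc (k - i) (fun l j m =>
    coef c l *: mu i U (coef a j) (coef b m))).
etransitivity; first exact: (triangle_swap k (fun i l =>
  \sum_(j < (k - i - l).+1)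
    coef c l *: mu i U (coef a j) (coef b (k - i - l - j)%N))).
apply: eq_bigr => l _; rewrite scaler_sumr; apply: eq_bigr => i _.
by rewrite scaler_sumr subnAC.
Qed.

Lemma star_linr U c (a b b' : cinft U) :
  star mu a (c *: b + b') = c *: star mu a b + star mu a b'.
Proof.
apply: fpsP => k; rewrite fpsD fpsZ /=.
transitivity (\sum_(i < k.+1) (\sum_(j < (k - i).+1) \sum_(l < (k - i - j).+1)
    coef c l *: mu i U (coef a j) (coef b (k - i - j - l)%N)) +
  \sum_(i < k.+1) \sum_(j < (k - i).+1)
    mu i U (coef a j) (coef b' (k - i - j)%N)).
  rewrite -big_split /=; apply: eq_bigr => i _.
  rewrite -big_split /=; apply: eq_bigr => j _.
  rewrite bdD_r; congr (_ + _).
  rewrite (big_morph (mu i U _) (bdD_r i _) (bd0r i _)).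
  by apply: eq_bigr => l _; rewrite bdZr.
congr (_ + _).
transitivity (\sum_(i < k.+1) \sum_(l < (k - i).+1) \sum_(j < (k - i - l).+1)
    coef c l *: mu i U (coef a j) (coef b (k - i - j - l)%N)).
  apply: eq_bigr => i _; exact: (triangle_swap (k - i) (fun j l =>
    coef c l *: mu i U (coef a j) (coef b (k - i - j - l)%N))).
etransitivity; first exact: (triangle_swap k (fun i l =>
  \sum_(j < (k - i - l).+1)
    coef c l *: mu i U (coef a j) (coef b (k - i - j - l)%N))).
apply: eq_bigr => l _; rewrite scaler_sumr; apply: eq_bigr => i _.
rewrite scaler_sumr subnAC; apply: eq_bigr => j _.
by rewrite (subnAC _ j l) (subnAC k i l).
Qed.

Definition star_one (U : opens M) : cinft U :=
  Fps (fun k => (k == 0)%:R *: aone (cinf_sheaf M) U).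

Let mu_cstl i U z (f : cinf_sheaf M U) : (0 < i)%N ->
  mu i U (z *: aone (cinf_sheaf M) U) f = 0.
Proof. by move=> i0; case: (@sp_const mu i U z f i0). Qed.
Let mu_cstr i U z (f : cinf_sheaf M U) : (0 < i)%N ->
  mu i U f (z *: aone (cinf_sheaf M) U) = 0.
Proof. by move=> i0; case: (@sp_const mu i U z f i0). Qed.

Lemma star1l U : left_id (star_one U) (@star mu U).
Proof.
move=> a; apply: fpsP => k /=; rewrite big_ord_recl /=.
rewrite [X in _ + X]big1 ?addr0; last first.
  by move=> i _; rewrite big1// => j _; exact: mu_cstl.
rewrite subn0 big_ord_recl /=.
rewrite [X in _ + X]big1 ?addr0; last first.
  by move=> i _; rewrite scale0r bd0l.
by rewrite scale1r subn0 sp_mu0 amul1l.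
Qed.

Lemma star1r U : right_id (star_one U) (@star mu U).
Proof.
move=> a; apply: fpsP => k /=; rewrite big_ord_recl /=.
rewrite [X in _ + X]big1 ?addr0; last first.
  by move=> i _; rewrite big1// => j _; exact: mu_cstr.
rewrite subn0 big_ord_recr /= subnn scale1r sp_mu0 amul1r big1 ?add0r// => i _.
by rewrite subn_eq0 leqNgt ltn_ord /= scale0r bd0r.
Qed.

Lemma star_res (U V : opens M) (VU : V `<=` U) (a b : cinft U) :
  res cinft VU (star mu a b) = star mu (res cinft VU a) (res cinft VU b).
Proof.
apply: fpsP => k; rewrite /= [LHS]raddf_sum; apply: eq_bigr => i _.
by rewrite raddf_sum; apply: eq_bigr => j _; exact: bd_res.
Qed.

Lemma star_one_res (U V : opens M) (VU : V `<=` U) :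
  res cinft VU (star_one U) = star_one V.
Proof.
by apply: fpsP => k /=; rewrite [LHS]linearZ; congr (_ *: _); exact: cinf_res_cst.
Qed.

Definition star_alg : alg_sheaf (fps R[i]) M :=
  @AlgSheaf (fps R[i]) M cinft (@star mu) star_one (@sp_assoc mu)
    star1l star1r star_linl star_linr star_res star_one_res.

Definition star_symb U (a : star_alg U) : cinf_sheaf M U :=
  coef (a : cinft U) 0%N.
Local Notation sigma := star_symb.

Lemma star0 U (a b : cinft U) :
  coef (star mu a b) 0%N = amul (coef a 0%N) (coef b 0%N).
Proof. by rewrite /= !big_ord1 sp_mu0. Qed.

Let sigma_linear U (c : fps R[i]) (a b : star_alg U) :
  sigma (c *: a + b) = c 0%N *: sigma a + sigma b.
Proof. by rewrite /star_symb fpsD fpsZ big_ord1. Qed.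

Let sigma_mul U (a b : star_alg U) :
  sigma (amul a b) = amul (sigma a) (sigma b).
Proof. exact: star0. Qed.

Let sigma_one U : sigma (aone star_alg U) = aone (cinf_sheaf M) U.
Proof. exact: scale1r. Qed.

Let sigma_res (U V : opens M) (VU : V `<=` U) (a : star_alg U) :
  sigma (res star_alg VU a) = res (cinf_sheaf M) VU (sigma a).
Proof. by []. Qed.

Let sigma_epi U (f : cinf_sheaf M U) :
  locally_in (fun V => range (@star_symb V)) f.
Proof.
move=> p Up; exists U, (@subset_refl _ _); split=> //.
by exists (Fps (fun=> res (cinf_sheaf M) (@subset_refl _ _) f)).
Qed.

Let sigma_triv : exists phi : forall U, {linear star_alg U -> cinft U},
  [/\ natural_map phi, forall U, bijective (phi U) &
      forall U (a : star_alg U), coef (phi U a) 0%N = sigma a].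
Proof.
by exists (fun U => [the {linear cinft U -> cinft U} of idfun]); split=> // U; exists id.
Qed.

Let sigma_bracket (U : opens M) (a b : star_alg U) :
  exists2 c : star_alg U, amul a b - amul b a = fpsX R[i] *: c &
    forall p, U p ->
      (sigma c : cinf U) p = poisson w (sigma a : cinf U) (sigma b : cinf U) p.
Proof.
pose d : cinft U := star mu a b - star mu b a.
exists (Fps (fun k => coef d k.+1) : cinft U).
  apply: fpsP => -[|k]; last by rewrite fpsXZS.
  rewrite fpsXZ0 fpsD fpsN !star0 /=.
  by rewrite (cinf_mulC (coef (a : cinft U) 0%N)) subrr.
move=> p Up; rewrite -(sp_bracket mu)//; congr (cinf_val _ p).
rewrite /star_symb /d /= !big_ord_recl !big_ord0 /= !addr0 !sp_mu0 /=.
have mulC := @cinf_mulC R n M U.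
set a0 := coef a 0%N; set b0 := coef b 0%N.
set a1 := coef a (bump 0 0); set b1 := coef b (bump 0 0).
change (cinf_mul a0 b1 + cinf_mul a1 b0 + mu 1%N U a0 b0 -
  (cinf_mul b0 a1 + cinf_mul b1 a0 + mu 1%N U b0 a0) =
  mu 1%N U a0 b0 - mu 1%N U b0 a0).
rewrite (mulC b0) (mulC b1) (addrC (cinf_mul a1 b0)).
by rewrite opprD addrACA subrr add0r.
Qed.

Definition star_dq : dq :=
  @DQ star_alg star_symb sigma_linear sigma_mul sigma_one sigma_res sigma_epi
    sigma_triv sigma_bracket.

End StarQuantization.

End Quantization.

(* Main.v *)
Require Import Defs.
From HB Require Import structures.
From mathcomp Require Import all_boot all_order all_algebra.
From mathcomp Require Import all_classical all_reals all_analysis.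
From mathcomp.real_closed Require Import complex.
From mathcomp Require Import ring lra zify.
Set Implicit Arguments.
Unset Strict Implicit.
Unset Printing Implicit Defensive.
Import Order.TTheory GRing.Theory Num.Theory.
Import numFieldNormedType.Exports.
Local Open Scope classical_set_scope.
Local Open Scope ring_scope.

(* Fix a trivialization of [A] by formal power series. Left and right
   multiplications in [A] then become formal series of local operators on smooth
   functions. Near a point choose Darboux coordinates [x i], [y i] and lifts of
   the [x i] in the commutative algebra [O]. A unital series [S] of operators
   with [S L(x i) = (x i) S], where [L] is left multiplication by the lift, is
   found order by order: in each order the equations [ad (x i) N = R i] have
   compatible right-hand sides, and are solved by a Taylor-type series that is
   locally finite by Peetre's theorem. An operator commuting with all [x i]
   commutes with every polarized function, so [S (a * b) = S a S b] as soon as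
   [a] lies in [O].

   Such local solutions are glued by modifying a global trivialization one order
   in [t] at a time. Two trivializations that straighten [O] modulo [t ^ K]
   differ by the exponential of a derivation and by an operator commuting with
   polarized functions; hence a solution modulo [t ^ K] corrects to the next
   order near each point, and the set of corrections is affine over smooth
   functions, so a partition of unity applies.

   The product transported by the global solution is usual multiplication by
   elements of [O]. Its coefficients are bilocal, hence bidifferential by
   Peetre's theorem and a Taylor expansion in the Weyl algebra. *)

(** * Differential calculus on [R^n] *)

(** The trivialization in the definition of a DQ is an arbitrary isomorphism of sheaves of modules,
    so nothing says at the start that the product it transports is differential. Operators are known
    only through their compatibility with restrictions, and finiteness is extracted where it is
    needed. Peetre's bound is obtained off one point of each neighbourhood, since its proof consumes
    infinitely many points accumulating there; continuity restores the missing point.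

    The functions [x i] are complex and need not come from a chart. A polarized function is expanded
    in them only modulo a remainder vanishing to a prescribed order at a point, which is all that
    Peetre's bound requires.

    Only the lifts of the [x i] are straightened by construction. The rest of [O] follows from right
    multiplications: they commute with left ones, so after conjugation they commute with every
    polarized function, and [a * b] is also right multiplication by [b] applied to [a].

    The straightening condition is quadratic in the series, so whole local solutions cannot be
    averaged; this is why truncated solutions must be shown to extend near each point. *)

Section Calculus.
Variable R : realType.

Lemma is_derive_cvg (V W : normedModType R) (f : V -> W) x v l :
  (h^-1 *: (f (h *: v + x) - f x)) @[h --> (0:R)^'] --> l -> is_derive x v f l.
Proof. by move=> fl; split; [apply/cvg_ex; exists l|exact: cvg_lim]. Qed.

Lemma normrV_le n (x : 'rV[R]_n) (e : R) : 0 <= e ->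
  (`|x| <= e) <-> (forall i, `|x 0 i| <= e).
Proof.
move=> e0; rewrite [in `|x|]/Num.Def.normr/= mx_normrE; split.
  by move=> /bigmax_leP[_ h] i; exact: (h (0, i)).
by move=> h; apply/bigmax_leP; split => // -[i j] _ /=; rewrite (ord1 i).
Qed.

Lemma normrV_coord n (x : 'rV[R]_n) i : `|x 0 i| <= `|x|.
Proof. by have /(normrV_le x (normr_ge0 x)) := lexx `|x|. Qed.

Lemma MVT_dist (f df : R -> R) (t c e : R) :
  (forall s : R, `|s| <= `|t| -> is_derive s (1:R) f (df s) /\ `|df s - c| <= e) ->
  `|f t - f 0 - t * c| <= e * `|t|.
Proof.
move=> H.
have e0 : 0 <= e by have [_] := H 0 (eq_ind_r (fun x => x <= _) (normr_ge0 t) (normr0 _)); exact: le_trans.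
pose a : R := Num.min 0 t; pose b : R := Num.max 0 t.
have ab : a <= b by rewrite /a /b; case: (leP 0 t) => // /ltW.
have Hab (s : R) : s \in `[a, b]%R -> `|s| <= `|t|.
  rewrite in_itv /= /a /b; case: (leP 0 t) => t0 /andP[s1 s2].
    by rewrite !ger0_norm// (le_trans s1).
  by rewrite !ler0_norm// ?lerN2// ltW.
have Hd (s : R) : s \in `[a, b]%R -> is_derive s 1 f (df s).
  by move=> /Hab /H[].
have Hd' (s : R) : s \in `]a, b[%R -> is_derive s (1:R) f (df s).
  move=> xab; apply: Hd; rewrite in_itv/=; move: xab.
  by rewrite in_itv/= => /andP[/ltW-> /ltW->].
have Hc : {within `[a, b], continuous f}.
  by apply: derivable_within_continuous => x xab; have [? _] := Hd _ xab.
have [s sab E] := MVT_segment ab Hd' Hc.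
have [_ hs] := H s (Hab _ sab).
have -> : f t - f 0 - t * c = t * (df s - c).
  rewrite mulrBr; congr (_ - _); move: E; rewrite /a /b.
  case: (leP 0 t) => t0 E; first by rewrite E subr0 mulrC.
  by rewrite -opprB E; ring.
by rewrite normrM mulrC ler_wpM2r.
Qed.

(** The segment is replaced by a path that changes one coordinate at a time. In the max norm this
    path stays within [|h|] of [x], so the one-dimensional mean value inequality applies to each of
    the [n] steps. *)
Lemma telescope_dist n (f : 'rV[R]_n -> R) (x h : 'rV[R]_n) (c : 'I_n -> R) e :
  (forall y k, `|y - x| <= `|h| -> derivable f y (delta_mx 0 k) /\
     `|'D_(delta_mx 0 k) f y - c k| <= e) ->
  `|f (x + h) - f x - \sum_k h 0 k * c k| <= n%:R * e * `|h|.
Proof.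
move=> H.
pose hk (k : nat) : 'rV[R]_n := \row_j (if (j < k)%N then h 0 j else 0).
have Hk : forall k, (k <= n)%N ->
   `|f (x + hk k) - f x - \sum_(j < n | (j < k)%N) h 0 j * c j| <= k%:R * e * `|h|.
  elim=> [_|k IH kn].
    have -> : hk 0%N = 0 by apply/rowP => j; rewrite !mxE.
    by rewrite addr0 subrr big_pred0_eq subr0 normr0 !mul0r.
  pose K := Ordinal kn.
  have hS : hk k.+1 = hk k + h 0 K *: delta_mx 0 K.
    apply/rowP => j; rewrite !mxE /= ltnS leq_eqVlt -(inj_eq val_inj) /=.
    case: (ltngtP j k) => //= jk; rewrite ?mulr0 ?addr0 // mulr1 add0r.
    by congr (h 0 _); apply: val_inj.
  rewrite (bigD1 K) //= (eq_bigl (fun j : 'I_n => (j < k)%N)); last first.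
    move=> j; rewrite ltnS leq_eqVlt -(inj_eq val_inj) /=.
    by case: (ltngtP j k).
  rewrite hS addrA -natr1 !mulrDl mul1r.
  set A := f (x + hk k + _); set S := \sum_(_ < _ | _) _.
  have -> : A - f x - (h 0 K * c K + S) = (f (x + hk k) - f x - S) + (A - f (x + hk k) - h 0 K * c K) by ring.
  apply: le_trans (ler_normD _ _) _; apply: lerD; first exact/IH/ltnW.
  pose phi s := f (x + hk k + s *: delta_mx 0 K).
  have e0 : 0 <= e.
    by have [_] := H x K (eq_ind_r (fun x => x <= _) (normr_ge0 h) (eq_ind_r (fun z => `|z| = 0) (normr0 _) (subrr x))); exact: le_trans.
  have : `|phi (h 0 K) - phi 0 - h 0 K * c K| <= e * `|h 0 K|.
    apply: (@MVT_dist phi (fun s => 'D_(delta_mx 0 K) f (x + hk k + s *: delta_mx 0 K))) => s hs.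
    have /(H _ K)[d1 d2] : `|x + hk k + s *: delta_mx 0 K - x| <= `|h|.
      rewrite addrAC [x + _]addrC addrK.
      apply/normrV_le => // j; rewrite !mxE /= -(inj_eq val_inj) /=.
      case: (ltngtP j k) => /= jk; rewrite ?mulr0 ?addr0 ?normr0 ?normrV_coord //.
      by rewrite mulr1 add0r (le_trans hs) ?normrV_coord.
    split; last exact: d2.
    have phiE : (fun h0 : R => h0^-1 *: (phi (h0 *: (1:R) + s) - phi s)) =
       (fun h0 : R => h0^-1 *: ((f \o shift (x + hk k + s *: delta_mx 0 K)) (h0 *: delta_mx 0 K) - f (x + hk k + s *: delta_mx 0 K))).
      by apply/funext => h0; rewrite /phi /= [_%:A]mulr1 scalerDl addrCA.
    apply: (@is_derive_cvg R^o R^o phi s (1:R)); rewrite phiE; exact: d1.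
  rewrite /phi scale0r addr0 => /le_trans; apply.
  by apply: ler_wpM2l => //; exact: normrV_coord.
have := Hk n (leqnn _).
have -> : hk n = h by apply/rowP => j; rewrite !mxE ltn_ord.
by under eq_bigl do rewrite ltn_ord.
Qed.

(** [Ck] speaks of partial derivatives only, so the chain rule is derived from their existence near
    [g x] and their continuity at [g x]: the increment of [g] is fed to [telescope_dist]. *)
Lemma is_derive_chain n (W : normedModType R) (f : 'rV[R]_n -> R) (g : W -> 'rV[R]_n)
    (x v : W) (U : set 'rV[R]_n) :
  open U -> U (g x) ->
  (forall y k, U y -> derivable f y (delta_mx 0 k)) ->
  (forall k, {for g x, continuous ('D_(delta_mx 0 k) f)}) ->
  derivable g x v ->
  is_derive x v (f \o g) (\sum_k ('D_v g x) 0 k * 'D_(delta_mx 0 k) f (g x)).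
Proof.
move=> oU Ux fd fc gd; apply: is_derive_cvg; apply/cvgrPdist_lt => e e0.
set c := fun k => 'D_(delta_mx 0 k) f (g x).
set w := 'D_v g x.
have gw : (h^-1 *: (g (h *: v + x) - g x)) @[h --> (0:R)^'] --> w by exact: gd.
(* [C] collects the coefficients of [d] in the two error terms, the telescoping error and the error
   on the increment of [g]; the extra 1 keeps it positive. *)
pose C : R := n%:R * (`|w| + 1) + 1 + \sum_k `|c k|.
have C0 : 0 < C.
  have h1 : 0 <= n%:R * (`|w| + 1) by rewrite mulr_ge0// addr_ge0.
  have h2 : 0 <= \sum_k `|c k| by apply: sumr_ge0.
  rewrite /C; lra.
pose d : R := Num.min 1 (e / 2 / C).
have d0 : 0 < d by rewrite lt_min ltr01 divr_gt0// divr_gt0.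
have [r r0 Hr] : exists2 r, 0 < r & forall y, `|y - g x| < r -> U y /\ forall k, `|'D_(delta_mx 0 k) f y - c k| <= d.
  have : \forall y \near g x, U y /\ forall k, `|'D_(delta_mx 0 k) f y - c k| <= d.
    apply: filterI; first exact: open_nbhs_nbhs.
    have h k : \forall y \near g x, `|'D_(delta_mx 0 k) f y - c k| <= d.
      by have /cvgrPdistC_le/(_ _ d0) := fc k.
    exact: (@filter_forall _ _ (fun (k : 'I_n) y => `|'D_(delta_mx 0 k) f y - c k| <= d) (nbhs (g x)) _ h).
  move=> /nbhs_ballP[r /= r0 Hr]; exists r => // y yr; apply: Hr.
  by rewrite -ball_normE /= distrC.
have gc : \forall h \near (0:R)^', `|g (h *: v + x) - g x| < r.
  have r1 : 0 < r / (`|w| + 1) by rewrite divr_gt0// ltr_wpDl.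
  have /cvgrPdistC_le/(_ _ ltr01) := gw.
  have := nbhs_dnbhs_neq (0:R); have := @dnbhs0_lt R R^o _ r1.
  apply: filterS3 => h hr hn0 hd.
  rewrite -[g _ - g x]scale1r -(mulfV hn0) -scalerA normrZ.
  move: hr; rewrite ltr_pdivlMr ?ltr_wpDl// => hr; apply: le_lt_trans hr.
  rewrite ler_wpM2l// -[_ *: _](subrK w) addrC.
  by rewrite (le_trans (ler_normD _ _))// lerD2l.
have /cvgrPdistC_le/(_ _ d0) := gw.
have := nbhs_dnbhs_neq (0:R); move: gc.
apply: filterS3 => h grh hn0 hd /=.
set k := g (h *: v + x) - g x in grh hd.
have tel : `|f (g x + k) - f (g x) - \sum_j k 0 j * c j| <= n%:R * d * `|k|.
  apply: telescope_dist => y j yk.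
  by have [Uy yd] := Hr y (le_lt_trans yk grh); split; [exact: fd|].
have kE : k = h *: (h^-1 *: k) by rewrite scalerA mulfV// scale1r.
set u := h^-1 *: k in hd kE.
have Fk : f (g (h *: v + x)) = f (g x + k) by rewrite /k [g x + _]addrC subrK.
rewrite Fk.
set A := \sum_j k 0 j * c j in tel.
have -> : \sum_k0 w 0 k0 * c k0 - h^-1 *: (f (g x + k) - f (g x)) =
   - (h^-1 * (f (g x + k) - f (g x) - A)) - \sum_j (u - w) 0 j * c j.
  have -> : A = h * \sum_j u 0 j * c j.
    rewrite /A mulr_sumr; apply: eq_bigr => j _; rewrite {1}kE !mxE; ring.
  have -> : h^-1 *: (f (g x + k) - f (g x)) = h^-1 * (f (g x + k) - f (g x)) by [].
  rewrite [h^-1 * (_ - _ - _)]mulrBr mulKf//.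
  have -> : \sum_j (u - w) 0 j * c j = \sum_j u 0 j * c j - \sum_j w 0 j * c j.
    by rewrite -sumrB; apply: eq_bigr => j _; rewrite !mxE; ring.
  ring.
apply: le_lt_trans (ler_normD _ _) _; rewrite !normrN normrM normfV.
have uw : `|u| <= `|w| + 1.
  rewrite -[u](subrK w) addrC (le_trans (ler_normD _ _))// lerD2l.
  by rewrite (le_trans hd)// /d ge_min lexx.
have t1 : `|h|^-1 * `|f (g x + k) - f (g x) - A| <= n%:R * (`|w| + 1) * d.
  rewrite ler_pdivrMl ?normr_gt0// (le_trans tel)// kE normrZ.
  have -> : `|h| * (n%:R * (`|w| + 1) * d) = (n%:R * d * `|h|) * (`|w| + 1) by ring.
  rewrite mulrA ler_wpM2l// mulr_ge0// mulr_ge0//; exact: ltW.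
have t2 : `|\sum_j (u - w) 0 j * c j| <= (\sum_j `|c j|) * d.
  rewrite (le_trans (ler_norm_sum _ _ _))// mulr_suml ler_sum// => j _.
  rewrite normrM mulrC ler_wpM2l//; exact: le_trans (normrV_coord _ _) hd.
apply: le_lt_trans (lerD t1 t2) _.
have dC : d * C <= e / 2.
  rewrite -ler_pdivlMr//; by rewrite /d ge_min lexx orbT.
rewrite -mulrDl mulrC.
apply: (@le_lt_trans _ _ (d * C)); last by apply: le_lt_trans dC _; lra.
rewrite ler_pM2l// /C; lra.
Qed.

End Calculus.

(** * Composition of smooth functions and the flat exponential *)

Section SmoothComposition.
Variable R : realType.

Lemma continuous_near (T : topologicalType) (w : T -> R) x :
  (forall e, 0 < e -> \forall y \near x, `|w x - w y| <= e) -> {for x, continuous w}.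
Proof. by move=> h; apply/cvgrPdist_le => e /h. Qed.

Lemma continuous_rV (T : topologicalType) n (g : T -> 'rV[R]_n) x :
  (forall i, {for x, continuous (fun t => g t 0 i)}) -> {for x, continuous g}.
Proof.
move=> h; apply/cvgrPdist_le => e e0.
have h' i : \forall t \near x, `|g x 0 i - g t 0 i| <= e.
  by have /cvgrPdist_le/(_ _ e0) := h i.
have := @filter_forall _ _ (fun (i : 'I_n) t => `|g x 0 i - g t 0 i| <= e) (nbhs x) (nbhs_filter x) h'.
by apply: filterS => t ht; apply/normrV_le; [exact: ltW | move=> i; rewrite !mxE].
Qed.

Lemma Ck_sum m k (U : set 'rV[R]_m) (I : Type) (r : seq I) (f : I -> 'rV[R]_m -> R) :
  open U -> (forall i, Ck k U (f i)) -> Ck k U (fun x => \sum_(i <- r) f i x).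
Proof.
move=> oU hf; elim: r => [|i r IH].
  apply: Ck_ext (Ck_cst k U 0) => // x _; by rewrite big_nil.
apply: Ck_ext (CkD oU (hf i) IH) => // x _; by rewrite big_cons.
Qed.

Lemma Ck_prod m k (U : set 'rV[R]_m) (I : Type) (r : seq I) (f : I -> 'rV[R]_m -> R) :
  open U -> (forall i, Ck k U (f i)) -> Ck k U (fun x => \prod_(i <- r) f i x).
Proof.
move=> oU hf; elim: r => [|i r IH].
  apply: Ck_ext (Ck_cst k U 1) => // x _; by rewrite big_nil.
apply: Ck_ext (CkM oU (hf i) IH) => // x _; by rewrite big_cons.
Qed.

(** By the chain rule a partial derivative of [f \o g] is a sum of products of a derivative of [g]
    with a composition ['D f \o g], to which the induction hypothesis on [k] applies. *)
Lemma Ck_comp m n k (U : set 'rV[R]_m) (V : set 'rV[R]_n) (g : 'rV[R]_m -> 'rV[R]_n)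
    (f : 'rV[R]_n -> R) : open U -> open V -> (forall x, U x -> V (g x)) ->
  (forall i, Ck k U (fun x => g x 0 i)) -> Ck k V f -> Ck k U (f \o g).
Proof.
move=> oU oV; elim: k f => [|k IH] f UV hg hf.
  split=> // x Ux; apply: continuous_comp.
    by apply: continuous_rV => i; exact: Ck_continuous (hg i) Ux.
  exact: Ck_continuous hf (UV _ Ux).
have gc x : U x -> {for x, continuous g}.
  by move=> Ux; apply: continuous_rV => i; exact: Ck_continuous (hg i) Ux.
have [f1 f2] := hf.
have gd x j : U x -> derivable g x (delta_mx 0 j).
  move=> Ux; apply/derivable_mxP => i0 i; rewrite (ord1 i0).
  by have [_ /(_ j)[h _]] := hg i; exact: h.
have fg x j : U x -> is_derive x (delta_mx 0 j) (f \o g)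
    (\sum_l ('D_(delta_mx 0 j) g x) 0 l * 'D_(delta_mx 0 l) f (g x)).
  move=> Ux; apply: (@is_derive_chain _ _ _ _ _ _ _ V) => //; first exact: UV.
  - by move=> y l Vy; have [h _] := f2 l; exact: h.
  - by move=> l; have [_ h] := f2 l; apply: Ck_continuous h _; exact: UV.
  - exact: gd.
split=> [x Ux|j].
  by apply: continuous_comp; [exact: gc|apply: f1; exact: UV].
split=> [x Ux|]; first by have [] := fg x j Ux.
apply: (@Ck_ext _ _ _ _ (fun x => \sum_l 'D_(delta_mx 0 j) (fun y => g y 0 l) x * ('D_(delta_mx 0 l) f \o g) x)) => //.
  move=> x Ux; have [_ ->] := fg x j Ux; apply: eq_bigr => l _; congr (_ * _).
  by rewrite derive_mx ?mxE//; exact: gd.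
apply: Ck_sum => // l; apply: CkM => //.
  by have [_ /(_ j)[_ h]] := hg l.
apply: IH => //; first by move=> i; exact: CkW.
by have [_ h] := f2 l.
Qed.

Lemma derive_line (W : normedModType R) (u : W -> R) (x v : W) :
  'D_v u x = 'D_(1:R) (fun h : R => u (h *: v + x)) 0.
Proof.
rewrite /derive; set g1 := fun h => h^-1 *: _; set g2 := fun h => h^-1 *: _.
suff -> : g1 = g2 by [].
by apply/funext => h; rewrite /g1 /g2 /= addr0 scale0r add0r [h *: (1:R)]mulr1.
Qed.

Lemma is_derive_comp1 (W : normedModType R) (u : W -> R) (phi : R -> R) (x v : W)
    (dphi du : R) : is_derive (u x) (1:R) phi dphi -> is_derive x v u du ->
  is_derive x v (phi \o u) (dphi * du).
Proof.
move=> [pd pE] [ud uE].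
pose l (h : R) := u (h *: v + x).
have l0 : l 0 = u x by rewrite /l scale0r add0r.
have ld : derivable l (0:R) (1:R) by have /derivable1P := ud.
have lE : (l^`())%classic 0 = du by rewrite derive1E -uE [RHS]derive_line.
have pl : derivable (phi \o l) (0:R) (1:R).
  apply/derivable1_diffP/differentiable_comp; apply/derivable1_diffP; first exact: ld.
  by rewrite l0; exact: pd.
split; first exact/derivable1P.
have := derive1_comp ld; rewrite l0 => /(_ phi pd).
by rewrite lE [in X in _ = X -> _]derive1E pE derive1E (derive_line (phi \o u)).
Qed.

(** The flat function exp(-1/x), together with its multiples by powers of 1/x: this family is closed
    under differentiation up to linear combinations, so one induction on the order gives smoothness
    of all its members. *)
Definition flat_exp (k : nat) (x : R) : R :=
  if 0 < x then x^-1 ^+ k * expR (- x^-1) else 0.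

Lemma flat_exp_le0 k x : x <= 0 -> flat_exp k x = 0.
Proof. by rewrite /flat_exp; case: ltP. Qed.

Lemma flat_exp_ge0 k x : 0 <= flat_exp k x.
Proof.
by rewrite /flat_exp; case: ltP => // x0; rewrite mulr_ge0 ?expR_ge0// exprn_ge0// invr_ge0 ltW.
Qed.

Lemma flat_exp_gt0 k x : 0 < x -> 0 < flat_exp k x.
Proof.
by move=> x0; rewrite /flat_exp x0 mulr_gt0 ?expR_gt0// exprn_gt0// invr_gt0.
Qed.

Lemma flat_exp0_mono x y : x <= y -> flat_exp 0 x <= flat_exp 0 y.
Proof.
move=> xy; have [x0|x0] := leP x 0; first by rewrite flat_exp_le0// flat_exp_ge0.
have y0 := lt_le_trans x0 xy.
by rewrite /flat_exp x0 y0 !expr0 !mul1r ler_expR lerN2 lef_pV2// posrE.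
Qed.

(** Put y = 1/x and N = k+1: from exp(y/N) >= 1 + y/N follows exp(y) >= (y/N)^N. The bound for
    [k.+1] shows that the difference quotient of [flat_exp k] at 0, which is [flat_exp k.+1], tends
    to 0. *)
Lemma flat_exp_bound k x : flat_exp k x <= (k.+1%:R ^+ k.+1) * `|x|.
Proof.
rewrite /flat_exp; case: ltP => [x0|_]; last by rewrite mulr_ge0// exprn_ge0.
set N := k.+1; set y := x^-1; have y0 : 0 < y by rewrite invr_gt0.
have N0 : 0 < N%:R :> R by rewrite ltr0n.
have h : (y / N%:R) ^+ N <= expR y.
  have -> : expR y = expR (y / N%:R) ^+ N.
    by rewrite -expRM_natl mulrC divfK// gt_eqF.
  apply: lerXn2r; rewrite ?nnegrE ?expR_ge0 ?divr_ge0 ?ltW//.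
  by rewrite (lt_le_trans _ (expR_ge1Dx _))// ltrDr.
rewrite expRN ler_pdivrMr ?expR_gt0// gtr0_norm//.
have -> : x = y^-1 by rewrite invrK.
rewrite mulrAC -/N ler_pdivlMr// -exprSr mulrC.
by rewrite -ler_pdivrMr ?exprn_gt0// -expr_div_n.
Qed.

Lemma flat_expS k x : flat_exp k.+1 x = x^-1 * flat_exp k x.
Proof.
by rewrite /flat_exp; case: ifP => _; rewrite ?mulr0// exprS mulrA.
Qed.

Lemma is_derive_flat_exp k (x : R) :
  is_derive x (1:R) (flat_exp k) (flat_exp k.+2 x - k%:R * flat_exp k.+1 x).
Proof.
have [x0|x0|->] := ltgtP x 0.
- rewrite !flat_exp_le0 ?(ltW x0)// mulr0 subr0.
  apply: (@near_eq_is_derive _ _ _ (cst 0)).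
    near=> y; rewrite flat_exp_le0//; apply/ltW; near: y; exact: lt_nbhsl.
- have xn0 : x != 0 by rewrite gt_eqF.
  apply: (@near_eq_is_derive _ _ _ (fun y : R => y^-1 ^+ k * expR (- y^-1))).
    by near=> y; rewrite /flat_exp ifT//; near: y; exact: lt_nbhsr.
  have dV : is_derive x (1:R) (fun y : R => y^-1) (- x ^- 2).
    split; first exact: derivableV.
    by rewrite deriveV// derive_id [_ *: _]mulr1.
  have dE : is_derive x (1:R) (fun y : R => expR (- y^-1)) (expR (- x^-1) * (x ^- 2)).
    have h := is_deriveN dV; rewrite opprK in h.
    exact: (@is_derive_comp1 R^o (fun y : R => - y^-1) expR x (1:R) _ _ (is_derive_expR (- x^-1)) h).
  have dP : is_derive x (1:R) (fun y : R => y^-1 ^+ k) (k%:R * x^-1 ^+ k.-1 * (- x ^- 2)).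
    have h := is_deriveX k dV.
    have E : (fun y : R => y^-1 ^+ k) = (fun y : R => y^-1) ^+ k.
      by apply/funext => y; rewrite exprfctE.
    by rewrite E; apply: is_derive_eq h _.
  apply: is_derive_eq (is_deriveM dP dE) _.
  have sR (a b : R) : a *: (b : R^o) = a * b by [].
  rewrite /flat_exp x0 !sR -exprVn.
  case: k {dP} => [|k]; first by rewrite !expr0 expr2; ring.
  by rewrite /= !exprS; ring.
- rewrite !flat_exp_le0// mulr0 subr0.
  apply: is_derive_cvg; apply/cvgrPdist_le => e e0.
  pose C : R := k.+2%:R ^+ k.+2.
  have C0 : 0 < C by rewrite exprn_gt0.
  have eC : 0 < e / C by rewrite divr_gt0.
  have := @dnbhs0_lt R R^o _ eC.
  apply: filterS => h hC; rewrite sub0r normrN addr0 [_%:A]mulr1.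
  rewrite (flat_exp_le0 _ (lexx 0)) subr0.
  have -> : h^-1 *: flat_exp k h = flat_exp k.+1 h by rewrite flat_expS.
  rewrite ger0_norm ?flat_exp_ge0// (le_trans (flat_exp_bound _ _))//.
  by rewrite -ler_pdivlMl// mulrC ltW.
Unshelve. all: by end_near. Qed.

End SmoothComposition.

(** * Bump functions *)

Section Bump.
Variables (R : realType) (n : nat).
Implicit Types (f g : 'rV[R]_n -> R) (q x : 'rV[R]_n).

Lemma normrV_lt (x : 'rV[R]_n) (e : R) : 0 < e ->
  (forall i, `|x 0 i| < e) -> `|x| < e.
Proof.
move=> e0 h; rewrite [in `|x|]/Num.Def.normr/= mx_normrE.
by apply/bigmax_ltP; split => // -[i j] _ /=; rewrite (ord1 i).
Qed.

Lemma Ck_flat_exp k m (U : set 'rV[R]_n) u : open U -> Ck k U u ->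
  Ck k U (flat_exp m \o u).
Proof.
move=> oU; elim: k m u => [|k IH] m u hu.
  split=> // x Ux; apply: continuous_comp; first exact: Ck_continuous hu Ux.
  apply/differentiable_continuous/derivable1_diffP.
  by have [] := is_derive_flat_exp m (u x).
have uW := CkW hu; have [u1 u2] := hu.
have D i x : U x -> is_derive x (delta_mx 0 i) (flat_exp m \o u)
    ((flat_exp m.+2 (u x) - m%:R * flat_exp m.+1 (u x)) * 'D_(delta_mx 0 i) u x).
  move=> Ux; apply: is_derive_comp1; first exact: is_derive_flat_exp.
  by apply: derivableP; have [h _] := u2 i; exact: h.
split=> [x Ux|i].
  apply: continuous_comp; first exact: u1.
  apply/differentiable_continuous/derivable1_diffP.
  by have [] := is_derive_flat_exp m (u x).
split=> [x Ux|]; first by have [] := D i x Ux.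
have [_ hi] := u2 i.
have h := CkM oU (CkD oU (IH m.+2 u uW) (CkM oU (Ck_cst k U (- m%:R)) (IH m.+1 u uW))) hi.
by apply: Ck_ext h => // x Ux; have [_ ->] := D i x Ux; rewrite /= mulNr.
Qed.

(** The function 16 x^2 - 1 is 0 at |x| = 1/4 and 3 at |x| = 1/2. Nesting [flat_exp] makes the
    result constant inside and zero outside, and the only division is by a constant, so smoothness
    is a matter of composition. *)
Definition bump1 (x : R) : R :=
  flat_exp 0 (flat_exp 0 3 - flat_exp 0 (16 * (x * x) - 1)) / flat_exp 0 (flat_exp 0 3).

Lemma bump1_eq1 (x : R) : `|x| <= 4^-1 -> bump1 x = 1.
Proof.
move=> hx; rewrite /bump1 (@flat_exp_le0 _ 0 (16 * _ - 1)); last first.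
  have : `|x| * `|x| <= 4^-1 * 4^-1 by rewrite ler_pM.
  rewrite -normrM ger0_norm; last by rewrite -expr2 sqr_ge0.
  lra.
by rewrite subr0 divff// gt_eqF// flat_exp_gt0// flat_exp_gt0.
Qed.

Lemma bump1_eq0 (x : R) : 2^-1 <= `|x| -> bump1 x = 0.
Proof.
move=> hx; rewrite /bump1 flat_exp_le0 ?mul0r// subr_le0 flat_exp0_mono//.
have : 2^-1 * 2^-1 <= `|x| * `|x| :> R by rewrite ler_pM.
rewrite -normrM ger0_norm; last by rewrite -expr2 sqr_ge0.
lra.
Qed.

Definition box_bump x : R := \prod_i bump1 (x 0 i).

Lemma bump_eq1 x : `|x| <= 4^-1 -> box_bump x = 1.
Proof.
move=> hx; rewrite /box_bump big1// => i _; apply: bump1_eq1.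
exact: le_trans (normrV_coord _ _) hx.
Qed.

Lemma bump_eq0 x : 2^-1 <= `|x| -> box_bump x = 0.
Proof.
move=> hx; have [i hi] : exists i, 2^-1 <= `|x 0 i|.
  apply: contrapT => H; suff : `|x| < 2^-1 by rewrite ltNge hx.
  apply: normrV_lt => // i; rewrite ltNge; apply/negP => hi.
  by apply: H; exists i.
by rewrite /box_bump (bigD1 i)//= bump1_eq0// mul0r.
Qed.

Lemma Ck_coord k (U : set 'rV[R]_n) i : Ck k U (fun x => x 0 i).
Proof.
have D j x : is_derive x (delta_mx 0 j) (fun x => x 0 i) ((j == i)%:R : R).
  apply: is_derive_cvg; apply/cvgrPdist_le => e e0.
  have := nbhs_dnbhs_neq (0:R); apply: filterS => h h0.
  rewrite /= !mxE eqxx /= addrK scalerA mulVf// eq_sym; case: eqP => _; rewrite ?scale1r ?subrr ?normr0 ?ltW//=.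
have c x : {for x, continuous (fun x : 'rV[R]_n => x 0 i)}.
  exact: coord_continuous.
case: k => [|k]; first by split=> // x _; exact: c.
split=> [x _|j]; first exact: c.
split=> [x _|]; first by have [] := D j x.
have -> : 'D_(delta_mx 0 j) (fun x : 'rV[R]_n => x 0 i) = cst (j == i)%:R :> ('rV[R]_n -> R).
  by apply/funext => x; have [_ ->] := D j x.
exact: Ck_cst.
Qed.

Lemma smooth_bump : smooth_on setT box_bump.
Proof.
move=> k; apply: Ck_prod => [|i]; first exact: openT.
have h : Ck k setT (fun x : 'rV[R]_n => flat_exp 0 (flat_exp 0 3 - flat_exp 0 (16 * (x 0 i * x 0 i) - 1))).
  apply: (Ck_flat_exp 0 openT).
  have h1 : Ck k setT (fun x : 'rV[R]_n => 16 * (x 0 i * x 0 i) - 1).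
    apply: CkD; [exact: openT| |exact: Ck_cst].
    apply: CkM; [exact: openT|exact: Ck_cst|].
    apply: CkM; [exact: openT|exact: Ck_coord|exact: Ck_coord].
  have := CkD openT (Ck_cst k setT (flat_exp 0 3)) (CkM openT (Ck_cst k setT (-1)) (Ck_flat_exp 0 openT h1)).
  by apply: Ck_ext; [exact: openT | move=> x _ /=; rewrite mulN1r].
by apply: Ck_ext (CkM openT h (Ck_cst k setT (flat_exp 0 (flat_exp 0 3))^-1)); first exact: openT.
Qed.

(* All partial derivatives of order [j <= m] are bounded on [S] by [K / r ^ j]. *)
Fixpoint sb m (r K : R) (S : set 'rV[R]_n) f : Prop :=
  (forall x, S x -> `|f x| <= K) /\
  if m is m'.+1 then forall i, sb m' r (K / r) S ('D_(delta_mx 0 i) f) else True.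

Lemma sb0 m r K S f : sb m r K S f -> forall x, S x -> `|f x| <= K.
Proof. by case: m => [|m] []. Qed.

Lemma sb_ext m r K S f g : open S -> (forall x, S x -> f x = g x) ->
  sb m r K S f -> sb m r K S g.
Proof.
move=> oS; elim: m K f g => [|m IH] K f g fg [h1 h2].
  by split=> // x Sx; rewrite -fg//; exact: h1.
split=> [x Sx|i]; first by rewrite -fg//; exact: h1.
by apply: IH (h2 i) => x Sx; exact: (derive_open_eq _ oS).
Qed.

Lemma sb_le m r K K' S f : 0 < r -> K <= K' -> sb m r K S f -> sb m r K' S f.
Proof.
move=> r0; elim: m K K' f => [|m IH] K K' f KK [h1 h2].
  by split=> // x /h1 /le_trans; apply.
split=> [x /h1 /le_trans|i]; first exact.
by apply: IH (h2 i); rewrite ler_pM2r// invr_gt0.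
Qed.

Lemma sbW m r K S f : 0 < r -> sb m.+1 r K S f -> sb m r K S f.
Proof.
move=> r0; elim: m K f => [|m IH] K f; first by case.
by move=> [h1 h2]; split=> // i; apply: IH; exact: h2.
Qed.

Lemma sb_mono m m' r K S f : 0 < r -> (m' <= m)%N -> sb m r K S f -> sb m' r K S f.
Proof.
move=> r0 /subnKC <-; elim: (m - m')%N => [|j IH]; first by rewrite addn0.
by rewrite addnS => /(sbW r0).
Qed.

Lemma sb_sub m r K (S S' : set 'rV[R]_n) f : S' `<=` S -> sb m r K S f -> sb m r K S' f.
Proof.
move=> SS; elim: m K f => [|m IH] K f [h1 h2]; first by split=> // x /SS; exact: h1.
by split=> [x /SS|i]; [exact: h1 | exact: (IH _ _ (h2 i))].
Qed.

Lemma sb_setU m r K S S' f : sb m r K S f -> sb m r K S' f -> sb m r K (S `|` S') f.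
Proof.
elim: m K f => [|m IH] K f [h1 h2] [h3 h4].
  by split=> // x [/h1|/h3].
by split=> [x [/h1|/h3]//|i]; exact: (IH _ _ (h2 i) (h4 i)).
Qed.

Lemma sbD m r K K' S f g : open S -> 0 < r -> Ck m S f -> Ck m S g ->
  sb m r K S f -> sb m r K' S g -> sb m r (K + K') S (f \+ g).
Proof.
move=> oS r0; elim: m K K' f g => [|m IH] K K' f g f1 g1 [h1 h2] [h3 h4].
  by split=> // x Sx; rewrite (le_trans (ler_normD _ _))// lerD ?h1 ?h3.
split=> [x Sx|i]; first by rewrite (le_trans (ler_normD _ _))// lerD ?h1 ?h3.
have [_ /(_ i)[f2 f3]] := f1; have [_ /(_ i)[g2 g3]] := g1.
rewrite mulrDl; apply: sb_ext (IH _ _ _ _ f3 g3 (h2 i) (h4 i)) => // x Sx.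
by rewrite deriveD//; [exact: f2|exact: g2].
Qed.

(** The weights [r ^- j] are compatible with products, and each differentiation splits a product in
    two, whence the factor [2 ^+ m]. *)
Lemma sbM m r K K' S f g : open S -> 0 < r -> 0 <= K -> 0 <= K' -> Ck m S f -> Ck m S g ->
  sb m r K S f -> sb m r K' S g -> sb m r (2 ^+ m * (K * K')) S (f \* g).
Proof.
move=> oS r0; elim: m K K' f g => [|m IH] K K' f g K0 K'0 f1 g1 hf hg.
  case: hf hg => [h1 h2] [h3 h4].
  by split=> // x Sx; rewrite mul1r normrM ler_pM ?h1 ?h3.
have fW := CkW f1; have gW := CkW g1.
have hfW := sbW r0 hf; have hgW := sbW r0 hg.
case: hf hg => [h1 h2] [h3 h4]; split=> [x Sx|i].
  rewrite normrM; apply: (@le_trans _ _ (K * K')).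
    by rewrite ler_pM ?h1 ?h3.
  by rewrite ler_peMl ?mulr_ge0// exprn_ege1// ler1n.
have [_ /(_ i)[f2 f3]] := f1; have [_ /(_ i)[g2 g3]] := g1.
have r0' : 0 <= r^-1 by rewrite invr_ge0 ltW.
have E1 := IH _ _ _ _ K0 (mulr_ge0 K'0 r0') fW g3 hfW (h4 i).
have E2 := IH _ _ _ _ K'0 (mulr_ge0 K0 r0') gW f3 hgW (h2 i).
have -> : 2 ^+ m.+1 * (K * K') / r = 2 ^+ m * (K * (K' / r)) + 2 ^+ m * (K' * (K / r)).
  by rewrite exprS; ring.
apply: sb_ext (sbD oS r0 _ _ E1 E2) => //; try exact: CkM.
by move=> x Sx; rewrite deriveM//; [exact: f2|exact: g2].
Qed.

Lemma sb_rescale m r K S f : 0 < r -> r <= 1 -> 0 <= K -> sb m r K S f -> sb m 1 (K / r ^+ m) S f.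
Proof.
move=> r0 r1; elim: m K f => [|m IH] K f K0 [h1 h2].
  by split=> // x Sx; rewrite divr1; exact: h1.
split=> [x Sx|i].
  apply: le_trans (h1 x Sx) _; rewrite ler_peMr// invf_ge1 ?exprn_gt0//.
  by apply: exprn_ile1 => //; exact: ltW.
rewrite divr1 exprS invfM mulrA; apply: IH; last exact: h2.
by rewrite divr_ge0// ltW.
Qed.

Lemma continuous_normB (q : 'rV[R]_n) : continuous (fun x : 'rV[R]_n => `|x - q|).
Proof.
move=> x; apply: (@continuous_comp _ _ _ (fun x => x - q) (fun z => `|z|)).
  apply: continuous_rV => i.
  have h : Ck 0 setT (fun t : 'rV[R]_n => (t - q) 0 i).
    apply: Ck_ext (CkD openT (Ck_coord 0 setT i) (Ck_cst 0 setT (- q 0 i))); first exact: openT.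
    by move=> y _; rewrite !mxE.
  exact: (Ck_continuous h I).
exact: norm_continuous.
Qed.

Lemma open_normgt (q : 'rV[R]_n) (r : R) : open [set x : 'rV[R]_n | r < `|x - q|].
Proof.
apply: (@open_comp _ _ (fun x : 'rV[R]_n => `|x - q|) [set t | r < t]); last exact: open_gt.
by move=> x _; exact: continuous_normB.
Qed.

Lemma open_normlt (q : 'rV[R]_n) (r : R) : open [set x : 'rV[R]_n | `|x - q| < r].
Proof.
apply: (@open_comp _ _ (fun x : 'rV[R]_n => `|x - q|) [set t | t < r]); last exact: open_lt.
by move=> x _; exact: continuous_normB.
Qed.

Lemma sb_compact m q (rho : R) f : Ck m setT f -> (forall x, rho < `|x - q| -> f x = 0) ->
  exists2 K, 0 <= K & sb m 1 K setT f.
Proof.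
elim: m f => [|m IH] f fC f0.
  have [f1 _] := fC.
  have [[x0 hx0]|H] := pselect (exists x : 'rV[R]_n, `|x - q| <= rho); last first.
    exists 0 => //; split=> // x _; rewrite f0 ?normr0// ltNge; apply/negP => h.
    by apply: H; exists x.
  have cA : compact [set x : 'rV[R]_n | `|x - q| <= rho].
    apply: bounded_closed_compact.
      exists (`|q| + rho); split; first exact: num_real.
      move=> M hM x /= hx; rewrite -[x](subrK q) (le_trans (ler_normD _ _))//.
      by rewrite addrC (le_trans _ (ltW hM))// lerD2l.
    rewrite (_ : mkset _ = ~` [set x | rho < `|x - q|]).
      exact/open_closedC/open_normgt.
    by apply/seteqP; split=> x /=; rewrite ltNge; [move=> ->|move=> /negP; rewrite negbK].
  have [||c hc hm] := @EVT_max_rV R n (fun x => `|f x|) _ _ cA.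
  - by exists x0.
  - apply: continuous_in_subspaceT => x _.
    by apply: continuous_comp; [exact: f1 | exact: norm_continuous].
  exists `|f c| => //; split=> // x _.
  have [hx|hx] := leP `|x - q| rho; first by apply: hm; rewrite inE.
  by rewrite f0// normr0.
have fW := CkW fC; have [f1 f2] := fC.
have /choice[K hK] i : exists K, 0 <= K /\ sb m 1 K setT ('D_(delta_mx 0 i) f).
  have [_ h] := f2 i; have [x hx|K K0 h'] := IH _ h; last by exists K.
  have e : forall y, [set x : 'rV[R]_n | rho < `|x - q|] y -> f y = cst 0 y by move=> y /f0.
  by rewrite (derive_open_eq _ (@open_normgt q rho) hx e) derive_cst.
have [K0 K00 hK0] := IH f fW f0.
have Ks : 0 <= \sum_i K i by apply: sumr_ge0 => i _; have [] := hK i.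
exists (K0 + \sum_i K i); first exact: addr_ge0.
split=> [x _|i].
  by rewrite (le_trans (sb0 hK0 _))// lerDl.
rewrite divr1; have [Ki0 Ki] := hK i; apply: sb_le Ki => //.
rewrite (bigD1 i)//= addrCA lerDl addr_ge0//.
by apply: sumr_ge0 => j _; have [] := hK j.
Qed.

End Bump.

(** * Cutting off functions with control of their derivatives *)

Section Cutoff.
Variables (R : realType) (n : nat).
Implicit Types (f g : 'rV[R]_n -> R) (q x : 'rV[R]_n).

Lemma is_derive_affine (q x v : 'rV[R]_n) (r : R) :
  is_derive x v (fun y : 'rV[R]_n => r *: (y - q)) (r *: v).
Proof.
apply: is_derive_cvg; apply/cvgrPdist_le => e e0.
have := nbhs_dnbhs_neq (0:R); apply: filterS => h h0.
rewrite -scalerBr.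
have -> : h *: v + x - q - (x - q) = h *: v by rewrite opprB addrA subrK addrK.
by rewrite !scalerA mulrAC mulVf// mul1r subrr normr0 ltW.
Qed.

Lemma derive_affine k f (q x : 'rV[R]_n) (r : R) i : Ck k.+1 setT f ->
  is_derive x (delta_mx 0 i) (fun y => f (r *: (y - q)))
    (r * 'D_(delta_mx 0 i) f (r *: (x - q))).
Proof.
move=> [f1 f2].
have [da dE] := is_derive_affine q x (delta_mx 0 i) r.
have h := @is_derive_chain _ _ _ f (fun y : 'rV[R]_n => r *: (y - q)) x (delta_mx 0 i) setT openT I.
apply: is_derive_eq (h _ _ da) _.
- by move=> y j _; have [h1 _] := f2 j; exact: h1.
- by move=> j; have [_ h1] := f2 j; exact: Ck_continuous h1 _.
rewrite dE (bigD1 i)//= big1 ?addr0.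
  by rewrite !mxE !eqxx mulr1.
by move=> j ji; rewrite !mxE eqxx (negbTE ji) mulr0 mul0r.
Qed.

Lemma Ck_affine k f q (r : R) : Ck k setT f -> Ck k setT (fun x => f (r *: (x - q))).
Proof.
apply: (@Ck_comp _ _ _ k setT setT (fun x : 'rV[R]_n => r *: (x - q)) f openT openT) => // i.
have := CkM openT (Ck_cst k setT r) (CkD openT (Ck_coord k setT i) (Ck_cst k setT (- q 0 i))).
by apply: Ck_ext => [|x _]; [exact: openT | rewrite /= !mxE].
Qed.

Lemma sb_scale_l m r K c S f : open S -> 0 < r -> 0 <= c -> Ck m S f -> sb m r K S f ->
  sb m r (c * K) S (fun x => c * f x).
Proof.
move=> oS r0 c0; elim: m K f => [|m IH] K f fC [h1 h2].
  by split=> // x Sx; rewrite normrM ger0_norm// ler_wpM2l// h1.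
have [f1 f2] := fC; split=> [x Sx|i].
  by rewrite normrM ger0_norm// ler_wpM2l// h1.
have [f3 f4] := f2 i.
rewrite -mulrA; apply: sb_ext (IH _ _ f4 (h2 i)) => // x Sx.
have := @deriveZ _ _ R^o f c x (delta_mx 0 i) (f3 x Sx) => /= E.
exact: (esym E).
Qed.

Lemma sb_affine m q r K f : 0 < r -> Ck m setT f -> sb m 1 K setT f ->
  sb m r K setT (fun x => f (r^-1 *: (x - q))).
Proof.
move=> r0; elim: m K f => [|m IH] K f fC [h1 h2].
  by split=> // x _; exact: h1.
split=> [x _|i]; first exact: h1.
have [_ /(_ i)[_ f4]] := fC.
have h2i := h2 i; rewrite divr1 in h2i.
have E := sb_scale_l (c := r^-1) openT r0 _ (Ck_affine q r^-1 f4) (IH _ _ f4 h2i).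
rewrite mulrC; apply: sb_ext (E _) => [|x _|]; first exact: openT.
  by have [_ ->] := derive_affine q x r^-1 i fC.
by rewrite invr_ge0 ltW.
Qed.

Fixpoint RJ s f q : Prop :=
  if s is s'.+1 then f q = 0 /\ forall i, RJ s' ('D_(delta_mx 0 i) f) q else True.

(** Taylor's estimate in weighted form: the derivatives of order at most [m] vanish at [q], so on
    the ball of radius [r] those of order [j] are of size r^(m+1-j). Each order is integrated from
    the next one by [telescope_dist]. *)
Lemma flat_est m f q (U : set 'rV[R]_n) : open U -> U q -> Ck m.+1 U f -> RJ m.+1 f q ->
  exists2 C, 0 <= C & \forall r \near (0:R)^'+,
    sb m r (C * r ^+ m.+1) [set x | `|x - q| < r] f.
Proof.
move=> oU Uq; elim: m f => [|m IH] f fC [fq fJ].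
  have [f1 f2] := fC.
  pose c := \sum_i `|'D_(delta_mx 0 i) f q| + 1.
  have c0 : 0 <= c by apply: addr_ge0 => //; apply: sumr_ge0.
  exists (n%:R * c); first exact: mulr_ge0.
  have near1 : \forall x \near q, U x /\ forall i, `|'D_(delta_mx 0 i) f x| <= c.
    apply: filterI; first exact: open_nbhs_nbhs.
    have h i : \forall x \near q, `|'D_(delta_mx 0 i) f x| <= c.
      have [_ h] := f2 i.
      have /cvgrPdist_le/(_ _ ltr01) : {for q, continuous ('D_(delta_mx 0 i) f)} := Ck_continuous (k := 0) h Uq.
      apply: filterS => x hx; rewrite -['D_(delta_mx 0 i) f x](subrK ('D_(delta_mx 0 i) f q)).
      rewrite (le_trans (ler_normD _ _))// addrC /c lerD//; last by rewrite distrC.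
      rewrite (bigD1 i)//= lerDl; exact: sumr_ge0.
    exact: (@filter_forall _ _ (fun (i : 'I_n) x => `|'D_(delta_mx 0 i) f x| <= c) (nbhs q) (nbhs_filter q) h).
  have /nbhs_ballP[d /= d0 Hd] := near1.
  near=> r.
  have r0 : 0 < r by [].
  have rd : r <= d by near: r; exact: nbhs_right_le.
  split=> // x /= xr.
  have := @telescope_dist R n f q (x - q) (fun=> 0) c.
  rewrite [q + _]addrC subrK fq subr0 big1 ?subr0; last by move=> i _; rewrite mulr0.
  move=> h; rewrite expr1; apply: le_trans (h _) _.
    move=> y i yx; have [Uy hy] : U y /\ forall i, `|'D_(delta_mx 0 i) f y| <= c.
      by apply: Hd; rewrite -ball_normE /= distrC (le_lt_trans yx)// (lt_le_trans xr).
    rewrite subr0; split; last exact: hy.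
    by have [h3 _] := f2 i; exact: h3.
  by rewrite ler_wpM2l ?mulr_ge0// ltW.
have [f1 f2] := fC.
have /choice[C HC] i : exists C, 0 <= C /\ \forall r \near (0:R)^'+,
    sb m r (C * r ^+ m.+1) [set x | `|x - q| < r] ('D_(delta_mx 0 i) f).
  have [_ h] := f2 i; have [C C0 HC] := IH _ h (fJ i); by exists C.
pose D := \sum_i C i.
have CD i : C i <= D.
  rewrite /D (bigD1 i)//= lerDl; apply: sumr_ge0 => j _; by have [] := HC j.
have D0 : 0 <= D by apply: sumr_ge0 => i _; have [] := HC i.
exists (n%:R * D + D); first by rewrite addr_ge0// mulr_ge0.
have HU : \forall r \near (0:R)^'+, forall x, `|x - q| < r -> U x.
  have /nbhs_ballP[d /= d0 Hd] : nbhs q U by exact: open_nbhs_nbhs.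
  near=> r => x xr; apply: Hd; rewrite -ball_normE /= distrC (lt_le_trans xr)//.
  near: r; exact: nbhs_right_le.
have HF : \forall r \near (0:R)^'+, forall i, sb m r (C i * r ^+ m.+1) [set x | `|x - q| < r] ('D_(delta_mx 0 i) f).
  have h i : \forall r \near (0:R)^'+, sb m r (C i * r ^+ m.+1) [set x | `|x - q| < r] ('D_(delta_mx 0 i) f).
    by have [] := HC i.
  exact: (@filter_forall _ _ (fun (i : 'I_n) r => sb m r (C i * r ^+ m.+1) [set x | `|x - q| < r] ('D_(delta_mx 0 i) f)) _ _ h).
near=> r.
have r0 : 0 < r by [].
have Ur : forall x, `|x - q| < r -> U x by near: r.
have Fr : forall i, sb m r (C i * r ^+ m.+1) [set x | `|x - q| < r] ('D_(delta_mx 0 i) f) by near: r.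
split=> [x /= xr|i].
  have := @telescope_dist R n f q (x - q) (fun=> 0) (D * r ^+ m.+1).
  rewrite [q + _]addrC subrK fq subr0 big1 ?subr0; last by move=> i _; rewrite mulr0.
  move=> h; apply: le_trans (h _) _.
    move=> y i yx; have yr : `|y - q| < r by exact: le_lt_trans xr.
    rewrite subr0; split; first by have [h3 _] := f2 i; exact/h3/Ur.
    rewrite (le_trans (sb0 (Fr i) _))// ler_wpM2r ?exprn_ge0 ?CD//; exact: ltW.
  have -> : (n%:R * D + D) * r ^+ m.+2 = (n%:R * D + D) * r ^+ m.+1 * r.
    by rewrite [r ^+ m.+2]exprSr mulrA.
  apply: (@le_trans _ _ (n%:R * (D * r ^+ m.+1) * r)).
    by rewrite ler_wpM2l ?mulr_ge0 ?exprn_ge0// ltW.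
  rewrite ler_wpM2r ?(ltW r0)// mulrA ler_wpM2r ?exprn_ge0 ?(ltW r0)//.
  by rewrite lerDl.
apply: sb_le (Fr i) => //.
rewrite [r ^+ m.+2]exprSr mulrA mulfK ?gt_eqF//.
rewrite ler_wpM2r ?exprn_ge0 ?(ltW r0)// (le_trans (CD i))// lerDr mulr_ge0//.
Unshelve. all: by end_near. Qed.

Definition cut q (r : R) f x := f x * box_bump (r^-1 *: (x - q)).

Lemma cut_eq0 q r f x : 0 < r -> r / 2 <= `|x - q| -> cut q r f x = 0.
Proof.
move=> r0 h; rewrite /cut bump_eq0 ?mulr0// normrZ gtr0_norm ?invr_gt0//.
by rewrite ler_pdivlMl.
Qed.

Lemma cut_eq q r f x : 0 < r -> `|x - q| <= r / 4 -> cut q r f x = f x.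
Proof.
move=> r0 h; rewrite /cut bump_eq1 ?mulr1// normrZ gtr0_norm ?invr_gt0//.
by rewrite ler_pdivrMl.
Qed.

Lemma Ck_cut k q r f : 0 < r -> Ck k [set x | `|x - q| < r] f -> Ck k setT (cut q r f).
Proof.
move=> r0 fC; apply: Ck_local => x _.
have [xr|xr] := ltP `|x - q| r.
  exists [set x | `|x - q| < r] => //.
  apply: CkM => //; first exact: open_normlt.
  by apply: Ck_sub (Ck_affine q r^-1 (@smooth_bump R n k)) => y _.
exists [set x | r / 2 < `|x - q|]; first by rewrite /= (lt_le_trans _ xr)//; lra.
apply: Ck_ext (Ck_cst k _ 0); first exact: open_normgt.
by move=> y /= hy; rewrite cut_eq0// ltW.
Qed.

Lemma sb_cut0 m q r K f : 0 < r -> 0 <= K -> sb m 1 K [set x | r / 2 < `|x - q|] (cut q r f).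
Proof.
move=> r0 K0.
have oS := @open_normgt R n q (r / 2).
have : sb m 1 K [set x : 'rV[R]_n | r / 2 < `|x - q|] (cst 0).
  elim: m => [|m IH]; first by split=> // x _; rewrite normr0.
  split=> [x _|i]; first by rewrite normr0.
  rewrite divr1; apply: sb_ext IH => // x _; by rewrite derive_cst.
by apply: sb_ext => // x /= hx; rewrite cut_eq0// ltW.
Qed.

(** The gain r^(m+1) of [flat_est] beats the loss r^(-m) caused by differentiating the rescaled bump
    [m] times. One factor [r] is left, so a small radius brings all bounds below [eps]. *)
Lemma cutoff_flat m f q (U : set 'rV[R]_n) (eps rho : R) : open U -> U q -> smooth_on U f ->
  RJ m.+1 f q -> 0 < eps -> 0 < rho ->
  exists u, [/\ smooth_on setT u, (forall x, rho <= `|x - q| -> u x = 0),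
    \forall x \near q, u x = f x & sb m 1 eps setT u].
Proof.
move=> oU Uq fC fJ e0 rho0.
have [C C0 HC] := flat_est oU Uq (fC m.+1) fJ.
have [K K0 HK] : exists2 K, 0 <= K & sb m 1 K setT (@box_bump R n).
  apply: (@sb_compact _ _ _ 0 1); first exact: smooth_bump.
  by move=> x hx; apply: bump_eq0; rewrite subr0 in hx; lra.
pose B := 2 ^+ m * (C * K).
have B0 : 0 <= B by rewrite !mulr_ge0// exprn_ge0.
have HU : \forall r \near (0:R)^'+, forall x, `|x - q| < r -> U x.
  have /nbhs_ballP[d /= d0 Hd] : nbhs q U by exact: open_nbhs_nbhs.
  near=> r => x xr; apply: Hd; rewrite -ball_normE /= distrC (lt_le_trans xr)//.
  near: r; exact: nbhs_right_le.
have [r [r0 r1 rrho rB [HUr HCr]]] : exists r, [/\ 0 < r, r <= 1, r <= rho, r <= eps / (B + 1) &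
    (forall x, `|x - q| < r -> U x) /\ sb m r (C * r ^+ m.+1) [set x | `|x - q| < r] f].
  near ((0:R)^'+) => r; exists r; split.
  - by [].
  - by near: r; exact: nbhs_right_le.
  - by near: r; exact: nbhs_right_le.
  - by near: r; apply: nbhs_right_le; rewrite divr_gt0// ltr_wpDl.
  - by split; near: r.
have fCr k : Ck k [set x | `|x - q| < r] f by apply: Ck_sub (fC k).
exists (cut q r f); split.
- by move=> k; exact: Ck_cut.
- by move=> x hx; apply: cut_eq0 => //; apply: le_trans hx; lra.
- apply/nbhs_ballP; exists (r / 4) => /=; first by rewrite divr_gt0.
  by move=> x; rewrite -ball_normE /= distrC => /ltW hx; rewrite cut_eq.
have oS := @open_normlt R n q r.
have E : sb m r (B * r ^+ m.+1) [set x | `|x - q| < r] (cut q r f).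
  have h1 : sb m r K [set x : 'rV[R]_n | `|x - q| < r] (fun x => box_bump (r^-1 *: (x - q))).
    have := sb_affine q r0 (@smooth_bump R n m) HK.
    by apply: sb_sub => y _.
  have h2 := sbM oS r0 (mulr_ge0 C0 (exprn_ge0 m.+1 (ltW r0))) K0 (fCr m)
    (Ck_sub (fun _ _ => I) (Ck_affine q r^-1 (@smooth_bump R n m))) HCr h1.
  by have -> : B * r ^+ m.+1 = 2 ^+ m * (C * r ^+ m.+1 * K) by rewrite /B; ring.
have E1 := sb_rescale r0 r1 (mulr_ge0 B0 (exprn_ge0 m.+1 (ltW r0))) E.
have {}E1 : sb m 1 eps [set x | `|x - q| < r] (cut q r f).
  apply: sb_le E1 => //.
  have -> : B * r ^+ m.+1 / r ^+ m = B * r.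
    by rewrite exprS mulrA mulfK// expf_neq0// gt_eqF.
  apply: (@le_trans _ _ (B * (eps / (B + 1)))); first by rewrite ler_wpM2l.
  by rewrite mulrCA ler_piMr ?(ltW e0)// ler_pdivrMr ?ltr_wpDl// mul1r lerDl.
have E2 := sb_cut0 m q f r0 (ltW e0).
have := sb_setU E1 E2.
rewrite (_ : _ `|` _ = setT)//; apply/seteqP; split=> // x _ /=.
by have [?|h] := ltP `|x - q| r; [left | right; apply: lt_le_trans h; lra].
Unshelve. all: by end_near. Qed.

Lemma cutoff g q (U : set 'rV[R]_n) (rho : R) : open U -> U q -> smooth_on U g -> 0 < rho ->
  exists u, [/\ smooth_on setT u, (forall x, rho <= `|x - q| -> u x = 0),
    \forall x \near q, u x = g x & forall m, exists2 K, 0 <= K & sb m 1 K setT u].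
Proof.
move=> oU Uq gC rho0.
have /nbhs_ballP[d /= d0 Hd] : nbhs q U by exact: open_nbhs_nbhs.
pose r := Num.min d rho.
have r0 : 0 < r by rewrite lt_min d0.
have rd : r <= d by rewrite ge_min lexx.
have rrho : r <= rho by rewrite ge_min lexx orbT.
have gCr k : Ck k [set x | `|x - q| < r] g.
  apply: Ck_sub (gC k) => x /= xr; apply: Hd; rewrite -ball_normE /= distrC.
  exact: lt_le_trans xr rd.
have H0 x : rho <= `|x - q| -> cut q r g x = 0.
  by move=> hx; apply: cut_eq0 => //; apply: le_trans hx; lra.
exists (cut q r g); split=> //.
- by move=> k; exact: Ck_cut.
- apply/nbhs_ballP; exists (r / 4) => /=; first by rewrite divr_gt0.
  by move=> x; rewrite -ball_normE /= distrC => /ltW hx; rewrite cut_eq.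
- move=> m; apply: (@sb_compact _ _ m q rho); first exact: Ck_cut.
  by move=> x /ltW; exact: H0.
Qed.

End Cutoff.

(** * Smooth sums of bumps accumulating at a point *)

Section Series.
Variables (R : realType) (n : nat) (x0 : 'rV[R]_n) (q : nat -> 'rV[R]_n).
Let rho j := `|q j - x0|.
Hypothesis rho0 : forall j, 0 < rho j.
Hypothesis rhoS : forall j, rho j.+1 <= rho j / 4.

Let rho_le i j : (i <= j)%N -> rho j <= rho i.
Proof.
move=> /subnKC <-; elim: (j - i)%N => [|k IH]; first by rewrite addn0.
rewrite addnS (le_trans (rhoS _))// (le_trans _ IH)// ler_piMr ?ltW//.
lra.
Qed.

Let rho_lt i j : (i < j)%N -> rho j <= rho i / 4.
Proof. by move=> ij; apply: le_trans (rho_le ij) (rhoS i). Qed.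

Let rho_geo j : rho j <= rho 0 * 2^-1 ^+ j.
Proof.
elim: j => [|j IH]; first by rewrite mulr1.
have hj := rhoS j; have hj0 := rho0 j.
rewrite exprSr mulrA (le_trans hj)// ler_pM//; [exact: ltW|lra].
Qed.

(** On [far N] only the first [N] terms can be nonzero, so the sum is locally finite away from
    [x0]. *)
Let far N := [set x : 'rV[R]_n | 2 * rho N < `|x - x0|].

Let open_far N : open (far N). Proof. exact: open_normgt. Qed.

Let far_ex x : x != x0 -> exists N, far N x.
Proof.
move=> xx0; have d0 : 0 < `|x - x0| by rewrite normr_gt0 subr_eq0.
have [N] : exists N, 2 * (rho 0 * 2^-1 ^+ N) < `|x - x0|.
  have e0 : 0 < `|x - x0| / (2 * rho 0) by rewrite divr_gt0// mulr_gt0.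
  have h : (fun N : nat => 2^-1 ^+ N : R) @ \oo --> (0 : R).
    by apply: cvg_expr; rewrite ger0_norm; lra.
  move/cvgrPdist_lt : h => /(_ _ e0)[N _ /(_ N (leqnn N))] /=.
  rewrite sub0r normrN ger0_norm; last by rewrite exprn_ge0//; lra.
  rewrite ltr_pdivlMr; last by rewrite mulr_gt0.
  by move=> h; exists N; rewrite mulrA mulrC.
by move=> h; exists N; apply: le_lt_trans h; rewrite ler_wpM2l.
Qed.

Let supp (v : nat -> 'rV[R]_n -> R) := forall j x, rho j / 4 < `|x - q j| -> v j x = 0.

Let supp_far v j N x : supp v -> (N <= j)%N -> far N x -> v j x = 0.
Proof.
move=> sv Nj xf; apply: sv; have := rho_le Nj; have := rho0 j.
move: xf; rewrite /far /= /rho => h1 h2 h3.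
have : `|x - x0| <= `|x - q j| + `|q j - x0|.
  by rewrite -(subrKA (q j)) ler_normD.
lra.
Qed.

Let supp_near v j x : supp v -> v j x != 0 -> 3 / 4 * rho j <= `|x - x0| <= 5 / 4 * rho j.
Proof.
move=> sv /eqP vx; have h : `|x - q j| <= rho j / 4.
  by rewrite leNgt; apply/negP => /sv.
have h1 : `|x - x0| <= `|x - q j| + `|q j - x0|.
  by rewrite -(subrKA (q j)) ler_normD.
have h2 : `|q j - x0| <= `|q j - x| + `|x - x0|.
  by rewrite -(subrKA x) ler_normD.
rewrite [`|q j - x|]distrC in h2.
move: h h1 h2; rewrite /rho => h h1 h2; apply/andP; split; lra.
Qed.

Let quad_flat (w : 'rV[R]_n -> R) r : 0 < r -> w x0 = 0 ->
  (forall x, `|x - x0| <= r -> `|w x| <= `|x - x0| ^+ 2) ->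
  {for x0, continuous w} /\ forall v, is_derive x0 v w 0.
Proof.
move=> r0 w0 wq; split.
  apply: continuous_near => e e0; rewrite w0.
  pose d : R := Num.min r (Num.min 1 e).
  have d0 : 0 < d by rewrite !lt_min r0 ltr01.
  apply/nbhs_ballP; exists d => //= x.
  rewrite -ball_normE /= distrC !lt_min => /andP[h1 /andP[h2 h3]].
  rewrite sub0r normrN (le_trans (wq x (ltW h1)))// expr2.
  by apply: le_trans (ltW h3); rewrite ler_piMl// ltW.
move=> v; apply: is_derive_cvg; apply/cvgrPdist_le => e e0.
have v0 : 0 < `|v| + 1 by rewrite ltr_wpDl.
have h1 : 0 < r / (`|v| + 1) by rewrite divr_gt0.
have h2 : 0 < e / (`|v| + 1) ^+ 2 by rewrite divr_gt0// exprn_gt0.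
have := nbhs_dnbhs_neq (0:R); have := @dnbhs0_lt R R^o _ h2; have := @dnbhs0_lt R R^o _ h1.
apply: filterS3 => h hr he hn0.
rewrite w0 subr0 sub0r normrN normrZ normfV ler_pdivrMl ?normr_gt0//.
have hE : h *: v + x0 - x0 = h *: v by rewrite addrK.
have hv : `|h *: v| <= `|h| * (`|v| + 1) by rewrite normrZ ler_wpM2l// lerDl.
rewrite (le_trans (wq _ _))// hE.
  by apply: le_trans hv _; rewrite -ler_pdivlMr// ltW.
apply: (@le_trans _ _ ((`|h| * (`|v| + 1)) ^+ 2)).
  by rewrite lerXn2r// nnegrE// mulr_ge0// ltW.
rewrite exprMn expr2 -mulrA ler_wpM2l//.
by rewrite -ler_pdivlMr ?exprn_gt0// ltW.
Qed.

(** The factors [2^-1 ^+ j.+1] sum to at most 1. On the support of the j-th term |x - x0| is at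
    least 3/4 of [rho j], so [rho j ^+ 2 / 4] is at most |x - x0|^2. The sum is thus bounded by |x -
    x0|^2 near [x0], which gives continuity and zero derivatives there. *)
Definition series_bound j : R := 2^-1 ^+ j.+1 * rho j ^+ 2 / 4.

Lemma series_bound_gt0 j : 0 < series_bound j.
Proof.
rewrite /series_bound divr_gt0// mulr_gt0// exprn_gt0//; lra.
Qed.

Let geo_le N : \sum_(j < N) 2^-1 ^+ j.+1 <= 1 :> R.
Proof.
suff -> : \sum_(j < N) 2^-1 ^+ j.+1 = 1 - 2^-1 ^+ N :> R.
  by rewrite gerBl exprn_ge0//; lra.
elim: N => [|N IH]; first by rewrite big_ord0 subrr.
by rewrite big_ord_recr /= IH exprS; field.
Qed.

Let quad v w k : supp v -> w x0 = 0 ->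
  (forall N x, far N x -> w x = \sum_(j < N) v j x) ->
  (forall j x, (k <= j)%N -> `|v j x| <= series_bound j) ->
  forall x, `|x - x0| <= rho k -> `|w x| <= `|x - x0| ^+ 2.
Proof.
move=> sv w0 wN vb x xk.
have [->|/far_ex[N xN]] := eqVneq x x0; first by rewrite w0 normr0 exprn_ge0.
rewrite (wN N x xN).
apply: (@le_trans _ _ (\sum_(j < N) 2^-1 ^+ j.+1 * `|x - x0| ^+ 2)); last first.
  by rewrite -mulr_suml ler_piMl// exprn_ge0.
apply: le_trans (ler_norm_sum _ _ _) _; apply: ler_sum => j _.
have [->|vj] := eqVneq (v j x) 0.
  by rewrite normr0 mulr_ge0// exprn_ge0//; lra.
have /andP[h1 h2] := supp_near sv vj.
have kj : (k <= j)%N.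
  rewrite leqNgt; apply/negP => /rho_lt h3; have := rho0 k; lra.
apply: le_trans (vb j x kj) _.
rewrite /series_bound -mulrA ler_wpM2l//.
have := rho0 j => hj.
have : (3 / 4 * rho j) ^+ 2 <= `|x - x0| ^+ 2.
  by rewrite lerXn2r// nnegrE// mulr_ge0 ?ltW//; lra.
rewrite exprMn expr2; have : 0 <= rho j ^+ 2 by rewrite exprn_ge0// ltW.
lra.
Qed.

(** Induction on [k] over all families: the termwise derivatives form a family of the same kind.
    Bounds are imposed from the index [k0] on only, because points within [rho k0] of [x0] meet no
    earlier term. [glue_series] takes [k0 = k], its j-th term being controlled up to order [j]. *)
Let series_Ck k (v : nat -> 'rV[R]_n -> R) w : supp v -> w x0 = 0 ->
  (forall N x, far N x -> w x = \sum_(j < N) v j x) ->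
  (forall j, Ck k setT (v j)) ->
  forall k0, (forall j, (k0 <= j)%N -> sb k 1 (series_bound j) setT (v j)) ->
  Ck k setT w.
Proof.
elim: k v w => [|k IH] v w sv w0 wN vC k0 vb.
  have wq := quad sv w0 wN (fun j x kj => sb0 (vb j kj) (x := x) I).
  split=> // x _; have [->|/far_ex[N xN]] := eqVneq x x0.
    by have [] := quad_flat (rho0 k0) w0 wq.
  have h : Ck 0 (far N) (fun x => \sum_(j < N) v j x).
    by apply: Ck_sum => // j; apply: Ck_sub (vC j) => y _.
  by apply: (@Ck_continuous _ _ 0 (far N)) xN; apply: Ck_ext h => // y /wN ->.
have wq := quad sv w0 wN (fun j x kj => sb0 (vb j kj) (x := x) I).
have [wc wd] := quad_flat (rho0 k0) w0 wq.
have vN N : Ck k.+1 (far N) (fun x => \sum_(j < N) v j x).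
  by apply: Ck_sum => // j; apply: Ck_sub (vC j) => y _.
have wCN N : Ck k.+1 (far N) w.
  by apply: Ck_ext (vN N) => // x /wN ->.
split=> [x _|i].
  have [->//|/far_ex[N xN]] := eqVneq x x0; exact: Ck_continuous (wCN N) xN.
split=> [x _|].
  have [->|/far_ex[N xN]] := eqVneq x x0; first by have [] := wd (delta_mx 0 i).
  by have [_ /(_ i)[h _]] := wCN N; exact: h.
apply: (IH (fun j => 'D_(delta_mx 0 i) (v j)) _ _ _ _ _ k0).
- move=> j x h.
  have e : forall y, [set y : 'rV[R]_n | rho j / 4 < `|y - q j|] y -> v j y = cst 0 y.
    by move=> y /sv.
  by rewrite (derive_open_eq _ (@open_normgt R n (q j) (rho j / 4)) h e) derive_cst.
- by have [_ ->] := wd (delta_mx 0 i).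
- move=> N x xN; rewrite (derive_open_eq _ (@open_far N) xN (wN N)).
  rewrite (_ : (fun x => _) = \sum_(j < N) v j); last by apply/funext => y; rewrite fct_sumE.
  rewrite derive_sum// => j; by have [_ /(_ i)[h _]] := vC j; exact: h.
- by move=> j; have [_ /(_ i)[_ h]] := vC j.
- by move=> j /vb[_ /(_ i)]; rewrite divr1.
Qed.

Lemma glue_series u : (forall j, smooth_on setT (u j)) ->
  (forall j x, rho j / 4 < `|x - q j| -> u j x = 0) ->
  (forall j, sb j 1 (series_bound j) setT (u j)) ->
  exists h, smooth_on setT h /\ forall j x, `|x - q j| < rho j / 4 -> h x = u j x.
Proof.
move=> uC us ub.
pose h x := if pselect (exists N, far N x) is left H then \sum_(j < projT1 (cid H)) u j x else 0.
have sumE N N' x : (N <= N')%N -> far N x -> \sum_(j < N') u j x = \sum_(j < N) u j x.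
  move=> /subnKC <- xN; elim: (N' - N)%N => [|k IH]; first by rewrite addn0.
  by rewrite addnS big_ord_recr /= IH (supp_far us _ xN) ?addr0// leq_addr.
have hN N x : far N x -> h x = \sum_(j < N) u j x.
  move=> xN; rewrite /h; case: pselect => [H|[]]; last by exists N.
  case: (cid H) => /= N' xN'.
  by case/orP: (leq_total N N') => NN; rewrite ?(sumE _ _ x NN xN) -?(sumE _ _ x NN xN').
have h0 : h x0 = 0.
  rewrite /h; case: pselect => // -[N]; rewrite /far /= subrr normr0 => hn.
  by exfalso; move: hn; apply/negP; rewrite -leNgt mulr_ge0// ltW.
exists h; split.
  move=> k; apply: (@series_Ck k u h us h0 hN (fun j => uC j k) k) => j kj.
  exact: (sb_mono ltr01 kj (ub j)).
move=> j x xj; have r0 := rho0 j; have rS := rhoS j.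
have h2 : `|q j - x0| <= `|q j - x| + `|x - x0|.
  by rewrite -(subrKA x) ler_normD.
have h3 : `|x - x0| <= `|x - q j| + `|q j - x0|.
  by rewrite -(subrKA (q j)) ler_normD.
rewrite [`|q j - x|]distrC -/(rho j) in h2 h3.
have xf : far j.+1 x by rewrite /far /=; lra.
rewrite (hN _ _ xf) big_ord_recr /= big1 ?add0r// => i _.
apply/eqP/negPn/negP => /(supp_near us)/andP[h4 _].
have := rho_lt (ltn_ord i); lra.
Qed.

End Series.

(** * Smooth functions in charts *)

Section ManifoldCalculus.
Variables (R : realType) (n : nat) (M : manifold R n).
Implicit Types (U V : set M) (c : chart R n M).

Lemma msmooth_chart c U (f : M -> R[i]) : atlas c -> open U -> U `<=` cdom c ->
  smooth_on (cfun c @` U) (fun x => complex.Re (f (cinv c x))) ->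
  smooth_on (cfun c @` U) (fun x => complex.Im (f (cinv c x))) ->
  msmooth U f.
Proof.
move=> ac oU Uc h1 h2 c' ac'.
have oU' := @cimg_openI R n M c' U oU.
have oV : open (cfun c @` U).
  by rewrite -(setIidr Uc); exact: cimg_openI.
pose g := fun x => cfun c (cinv c' x).
have gV x : (cfun c' @` (cdom c' `&` U)) x -> (cfun c @` U) (g x).
  by move=> [p [cp Up] <-]; exists p; rewrite /g ?cfunK.
have gC k i : Ck k (cfun c' @` (cdom c' `&` U)) (fun x => g x 0 i).
  apply: Ck_sub (atlas_compat ac' ac i k) => _ [p [cp Up] <-].
  by exists p => //; split => //; exact: Uc.
have E x : (cfun c' @` (cdom c' `&` U)) x -> cinv c (g x) = cinv c' x.
  by move=> [p [cp Up] <-]; rewrite /g !cfunK//; exact: Uc.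
split=> k.
  apply: Ck_ext (Ck_comp oU' oV gV (gC k) (h1 k)) => //.
  by move=> x Ux /=; rewrite E.
apply: Ck_ext (Ck_comp oU' oV gV (gC k) (h2 k)) => //.
by move=> x Ux /=; rewrite E.
Qed.

Lemma msmooth_pair c U (u v : 'rV[R]_n -> R) : atlas c -> open U -> U `<=` cdom c ->
  smooth_on (cfun c @` U) u -> smooth_on (cfun c @` U) v ->
  msmooth U (fun p => Complex (u (cfun c p)) (v (cfun c p))).
Proof.
move=> ac oU Uc hu hv; have oV : open (cfun c @` U).
  by rewrite -(setIidr Uc); exact: cimg_openI.
have E x : (cfun c @` U) x -> cfun c (cinv c x) = x.
  by move=> [p Up <-]; rewrite cfunK//; exact: Uc.
apply: (msmooth_chart ac oU Uc) => k.
  by apply: Ck_ext (hu k) => // x Ux /=; rewrite E.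
by apply: Ck_ext (hv k) => // x Ux /=; rewrite E.
Qed.

Definition coordf c i : M -> R[i] := fun p => Complex (cfun c p 0 i) 0.

Lemma msmooth_coordf c i : atlas c -> msmooth (cdom c) (coordf c i).
Proof.
move=> ac; apply: (msmooth_pair (u := fun x => x 0 i) (v := cst 0) ac) => // [|k|k].
- exact: cdom_open.
- exact: Ck_coord.
- exact: Ck_cst.
Qed.

Lemma msmooth_pderiv c i U f : atlas c -> open U -> U `<=` cdom c ->
  msmooth U f -> msmooth U (pderiv c i f).
Proof.
move=> ac oU Uc /(_ c ac); rewrite setIidr// => -[h1 h2].
apply: (msmooth_pair (u := 'D_(delta_mx 0 i) (fun x => complex.Re (f (cinv c x))))
  (v := 'D_(delta_mx 0 i) (fun x => complex.Im (f (cinv c x)))) ac oU Uc) => k.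
  by have [_ /(_ i)[_ ]] := h1 k.+1.
by have [_ /(_ i)[_ ]] := h2 k.+1.
Qed.

Lemma derive_add (f g : 'rV[R]_n -> R) x v : derivable f x v -> derivable g x v ->
  'D_v (fun y => f y + g y) x = 'D_v f x + 'D_v g x.
Proof. exact: deriveD. Qed.

Lemma derive_complexM1 (f1 f2 g1 g2 : 'rV[R]_n -> R) x v :
  derivable f1 x v -> derivable f2 x v -> derivable g1 x v -> derivable g2 x v ->
  'D_v (fun y => f1 y * g1 y - f2 y * g2 y) x =
   f1 x * 'D_v g1 x + g1 x * 'D_v f1 x - (f2 x * 'D_v g2 x + g2 x * 'D_v f2 x).
Proof.
move=> h1 h2 h3 h4.
have := is_deriveB (is_deriveM (derivableP h1) (derivableP h3)) (is_deriveM (derivableP h2) (derivableP h4)).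
by move=> [_ <-].
Qed.

Lemma derive_complexM2 (f1 f2 g1 g2 : 'rV[R]_n -> R) x v :
  derivable f1 x v -> derivable f2 x v -> derivable g1 x v -> derivable g2 x v ->
  'D_v (fun y => f1 y * g2 y + f2 y * g1 y) x =
   f1 x * 'D_v g2 x + g2 x * 'D_v f1 x + (f2 x * 'D_v g1 x + g1 x * 'D_v f2 x).
Proof.
move=> h1 h2 h3 h4.
have := is_deriveD (is_deriveM (derivableP h1) (derivableP h4)) (is_deriveM (derivableP h2) (derivableP h3)).
by move=> [_ <-].
Qed.

Lemma derive_coord i j (x : 'rV[R]_n) :
  'D_(delta_mx 0 i) (fun y : 'rV[R]_n => y 0 j) x = (i == j)%:R :> R.
Proof.
apply: derive_val; apply: is_derive_cvg; apply/cvgrPdist_le => e e0.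
have := nbhs_dnbhs_neq (0:R); apply: filterS => h1 h0.
rewrite /= !mxE eqxx /= addrK scalerA mulVf// eq_sym.
by case: eqP => _; rewrite ?scale1r ?subrr ?normr0 ?ltW//=.
Qed.

Section AtPoint.
Variables (c : chart R n M) (ac : atlas c) (p : M) (cp : cdom c p) (i : 'I_n).

Lemma smooth_near_derivable f : smooth_near p f ->
  derivable (fun x => complex.Re (f (cinv c x))) (cfun c p) (delta_mx 0 i) /\
  derivable (fun x => complex.Im (f (cinv c x))) (cfun c p) (delta_mx 0 i).
Proof.
move=> [U Up /(_ c ac)[/(_ 1%N)[_ /(_ i)[h1 _]] /(_ 1%N)[_ /(_ i)[h2 _]]]].
by split; [apply: h1 | apply: h2]; exists p.
Qed.

Lemma pderivD f g : smooth_near p f -> smooth_near p g ->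
  pderiv c i (fun q => f q + g q) p = pderiv c i f p + pderiv c i g p.
Proof.
move=> /smooth_near_derivable[f1 f2] /smooth_near_derivable[g1 g2].
have E1 : (fun x => complex.Re (f (cinv c x) + g (cinv c x))) =
    (fun x => complex.Re (f (cinv c x)) + complex.Re (g (cinv c x))).
  by apply/funext => x; case: (f _) (g _) => [? ?] [].
have E2 : (fun x => complex.Im (f (cinv c x) + g (cinv c x))) =
    (fun x => complex.Im (f (cinv c x)) + complex.Im (g (cinv c x))).
  by apply/funext => x; case: (f _) (g _) => [? ?] [].
by rewrite /pderiv E1 E2 (derive_add f1 g1) (derive_add f2 g2).
Qed.

Lemma pderivM f g : smooth_near p f -> smooth_near p g ->
  pderiv c i (fun q => f q * g q) p = pderiv c i f p * g p + f p * pderiv c i g p.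
Proof.
move=> hf hg.
have [f1 f2] := smooth_near_derivable hf; have [g1 g2] := smooth_near_derivable hg.
have E1 : (fun x => complex.Re (f (cinv c x) * g (cinv c x))) =
    (fun x => complex.Re (f (cinv c x)) * complex.Re (g (cinv c x)) -
       complex.Im (f (cinv c x)) * complex.Im (g (cinv c x))).
  by apply/funext => x; case: (f _) (g _) => [? ?] [].
have E2 : (fun x => complex.Im (f (cinv c x) * g (cinv c x))) =
    (fun x => complex.Re (f (cinv c x)) * complex.Im (g (cinv c x)) +
       complex.Im (f (cinv c x)) * complex.Re (g (cinv c x))).
  by apply/funext => x; case: (f _) (g _) => [? ?] [].
rewrite /pderiv E1 E2 (derive_complexM1 f1 f2 g1 g2) (derive_complexM2 f1 f2 g1 g2) !cfunK//.
case: (f p) (g p) => [a b] [a' b'] /=.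
by apply/eqP; rewrite eq_complex /=; apply/andP; split; apply/eqP; ring.
Qed.

Lemma pderiv_germ (U : opens M) f g : U p -> (forall q, U q -> f q = g q) ->
  pderiv c i f p = pderiv c i g p.
Proof.
move=> Up fg.
have oU := @cimg_openI R n M c U (oset_open U).
have Ux : (cfun c @` (cdom c `&` U)) (cfun c p) by exists p.
rewrite /pderiv; congr Complex; apply: (derive_open_eq _ oU Ux) => _ [q [cq Uq] <-];
  by rewrite cfunK// fg.
Qed.

Lemma pderiv_cst (a : R[i]) : pderiv c i (cst a) p = 0.
Proof. by rewrite /pderiv !derive_cst. Qed.

Lemma pderivZ (a : R[i]) f : smooth_near p f ->
  pderiv c i (fun q => a * f q) p = a * pderiv c i f p.
Proof.
move=> hf; have ha : smooth_near p (cst a).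
  by have [U Up _] := hf; exists U => //; exact: msmooth_cst.
by rewrite (pderivM ha hf) pderiv_cst mul0r add0r.
Qed.

Lemma pderiv_coordf j : pderiv c i (coordf c j) p = (i == j)%:R.
Proof.
have h : smooth_near p (coordf c j).
  by exists (Opens (cdom_open c)) => //; exact: msmooth_coordf.
have oU := @cimg_openI R n M c (cdom c) (cdom_open c).
have Ux : (cfun c @` (cdom c `&` cdom c)) (cfun c p) by exists p.
rewrite /pderiv (@derive_open_eq R n _ _ (fun x => x 0 j) _ _ oU Ux); last first.
  by move=> _ [q [cq _] <-]; rewrite /= cfunK.
by rewrite derive_coord /= derive_cst; case: (i == j).
Qed.

Lemma tangent_coord : tangent p (coord_tvec c i p).
Proof.
have snD f g : smooth_near p f -> smooth_near p g -> smooth_near p (fun q => f q + g q).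
  move=> [U Up fU] [V Vp gV]; exists (Opens (opensI_proof U V)) => //=.
  apply: msmoothD => /=; first by apply: openI; exact: oset_open.
    by apply: msmooth_sub fU => q [].
  by apply: msmooth_sub gV => q [].
have snM f g : smooth_near p f -> smooth_near p g -> smooth_near p (fun q => f q * g q).
  move=> [U Up fU] [V Vp gV]; exists (Opens (opensI_proof U V)) => //=.
  apply: msmoothM => /=; first by apply: openI; exact: oset_open.
    by apply: msmooth_sub fU => q [].
  by apply: msmooth_sub gV => q [].
have snZ (a : R[i]) f : smooth_near p f -> smooth_near p (fun q => a * f q).
  move=> hf; apply: snM => //.
  by have [U Up _] := hf; exists U => //; exact: msmooth_cst.
split.
- move=> a f g hf hg; rewrite /coord_tvec !asboolT//; last by apply: snD => //; exact: snZ.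
  by rewrite pderivD ?pderivZ//; exact: snZ.
- move=> f g hf hg; rewrite /coord_tvec !asboolT//; last exact: snM.
  exact: pderivM.
- move=> U f g Up fg; rewrite /coord_tvec; have -> : `[< smooth_near p f >] = `[< smooth_near p g >].
    apply/asboolP/asboolP => -[V Vp hV]; exists (Opens (opensI_proof U V)) => //=;
      (apply: msmooth_ext (msmooth_sub (@subIsetr _ U V) hV) => [|q [Uq _]];
        [by apply: openI; exact: oset_open | by rewrite fg]).
  by case: ifP => // _; exact: pderiv_germ fg.
- by move=> f hf; rewrite /coord_tvec asboolF.
Qed.

End AtPoint.

(** A closed ball in the chart is compact, so its image [F] is closed by the Hausdorff axiom. This
    is what makes the extension of the bump by 0 smooth outside the chart. *)
Lemma bump_manifold (U : opens M) p : U p -> exists (chi : M -> R[i]) (F : set M),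
  [/\ msmooth setT chi, closed F, F `<=` U, (forall q, ~ F q -> chi q = 0) &
      \forall q \near p, chi q = 1].
Proof.
move=> Up; have [c ac cp] := atlas_cover p.
have oV := @cimg_openI R n M c U (oset_open U).
have Vx : (cfun c @` (cdom c `&` U)) (cfun c p) by exists p.
have /nbhs_ballP[d /= d0 Hd] : nbhs (cfun c p) (cfun c @` (cdom c `&` U)).
  exact: open_nbhs_nbhs.
set x0 := cfun c p in Vx Hd.
pose K := [set x : 'rV[R]_n | `|x - x0| <= d / 2].
have KV x : K x -> (cfun c @` (cdom c `&` U)) x.
  by move=> hx; apply: Hd; rewrite -ball_normE /= distrC (le_lt_trans hx)//; lra.
have cK : compact K.
  apply: bounded_closed_compact.
    exists (`|x0| + d / 2); split; first exact: num_real.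
    move=> m hm x /= hx; rewrite -[x](subrK x0) (le_trans (ler_normD _ _))//.
    by rewrite addrC (le_trans _ (ltW hm))// lerD2l.
  rewrite /K (_ : mkset _ = ~` [set x | d / 2 < `|x - x0|]).
    exact/open_closedC/open_normgt.
  by apply/seteqP; split=> x /=; rewrite ltNge; [move=> ->|move=> /negP; rewrite negbK].
pose F := cinv c @` K.
have cF : closed F.
  apply: compact_closed; first exact: m_hausdorff.
  apply: continuous_compact => //.
  apply: continuous_in_subspaceT => x /set_mem /KV [q [cq _] <-].
  exact: cinv_continuous.
have FcU : F `<=` cdom c `&` U.
  by move=> _ [x /KV [q hq <-] <-]; rewrite cfunK//; case: hq.
pose b x := @box_bump R n (d^-1 *: (x - x0)).
pose chi q : R[i] := if `[< cdom c q >] then Complex (b (cfun c q)) 0 else 0.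
have chi0 q : ~ F q -> chi q = 0.
  move=> Fq; rewrite /chi; case: asboolP => // cq.
  rewrite /b bump_eq0// normrZ gtr0_norm ?invr_gt0// ler_pdivlMl//.
  rewrite leNgt; apply/negP => h; apply: Fq; exists (cfun c q); last exact: cfunK.
  by rewrite /K /=; apply/ltW.
exists chi, F; split=> //.
- apply: msmooth_local => q _; have [Fq|Fq] := pselect (F q); last first.
    exists (~` F) => //; apply: msmooth_ext (msmooth_cst _ 0) => [|r /chi0->//].
    exact: closed_openC.
  exists (cdom c); first by have [] := FcU _ Fq.
  apply: (@msmooth_ext _ _ _ _ (fun q => Complex (b (cfun c q)) ((cst 0 : 'rV[R]_n -> R) (cfun c q)))).
  + exact: cdom_open.
  + by move=> r cr; rewrite /chi asboolT.
  + apply: (msmooth_pair ac) => // [|k|k]; first exact: cdom_open; last exact: Ck_cst.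
    apply: (@Ck_sub _ _ _ setT) => //; apply: Ck_affine; exact: smooth_bump.
- by move=> q /FcU [].
- have h1 : \forall q \near p, cdom c q by apply: open_nbhs_nbhs; split => //; exact: cdom_open.
  have h2 : \forall q \near p, `|cfun c q - x0| <= d / 4.
    have d4 : 0 < d / 4 by lra.
    by have /cvgrPdistC_le/(_ _ d4) := cfun_continuous cp.
  apply: filterS2 h1 h2 => q cq hq; rewrite /chi asboolT//.
  by rewrite /b bump_eq1// normrZ gtr0_norm ?invr_gt0// ler_pdivrMl.
Qed.

Lemma lindelof (P : opens M -> Prop) : (exists p : M, True) ->
  (forall p, exists2 W : opens M, W p & P W) ->
  exists W : nat -> opens M, (forall k, P (W k)) /\ forall p, exists k, W k p.
Proof.
move=> [p0 _] HP; have [B cB [oB bB]] := @m_second_countable R n M.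
have /countable_injP[cod codI] := cB.
have /choice[W hW] p : exists W : opens M, W p /\ P W by have [W] := HP p; exists W.
(* [k] is the code of a basis set contained in [W q]; [s] picks one such [q] for each code and falls
   back on [p0] for codes that have none. *)
pose good k (q : M) := exists b, [/\ B b, cod b = k & b `<=` W q].
pose s k := if pselect (exists q, good k q) is left h then projT1 (cid h) else p0.
exists (fun k => W (s k)); split=> [k|p]; first by have [] := hW (s k).
have [Wp _] := hW p.
have [b [Bb bp] bW] := bB p _ (open_nbhs_nbhs (conj (oset_open (W p)) Wp)).
exists (cod b); rewrite /s; case: pselect => [h|[]]; last by exists p, b.
case: (cid h) => /= q [b' [Bb' cb' b'W]]; apply: b'W.
by have -> : b' = b by apply: codI; rewrite ?inE.
Qed.

End ManifoldCalculus.

(** * Local operators and jets *)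

Section LocalOperators.
Variables (R : realType) (n : nat) (M : manifold R n).
Implicit Types U V W : opens M.

Section CinfRing.
Variable U : opens M.
Let mulA : associative (@cinf_mul R n M U). Proof. exact: cinf_mulA. Qed.
Let mulC : commutative (@cinf_mul R n M U). Proof. exact: cinf_mulC. Qed.
Let mul1 : left_id (cinf_cst U 1) (@cinf_mul R n M U). Proof. exact: cinf_mul1l. Qed.
Let mulD : left_distributive (@cinf_mul R n M U) +%R.
Proof.
move=> f g h; apply: cinf_inj => p Up.
by rewrite cinfD// !cinf_mulE// cinfD// mulrDl.
Qed.
Let mulDr : right_distributive (@cinf_mul R n M U) +%R.
Proof. by move=> f g h; rewrite !(mulC f) mulD. Qed.
Let mul1r : right_id (cinf_cst U 1) (@cinf_mul R n M U).
Proof. by move=> f; rewrite mulC mul1. Qed.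
Let mul0 : left_zero 0 (@cinf_mul R n M U).
Proof. by move=> f; apply: (addrI (cinf_mul 0 f)); rewrite -mulD !addr0. Qed.
Let mulr0 : right_zero 0 (@cinf_mul R n M U).
Proof. by move=> f; rewrite mulC mul0. Qed.

HB.instance Definition _ := GRing.Zmodule_isComPzRing.Build (cinf U) mulA mulC mul1 mulD.
End CinfRing.

Lemma cinfM U (f g : cinf U) p : U p -> (f * g) p = f p * g p.
Proof. exact: cinf_mulE. Qed.
Lemma cinf1 U p : U p -> (1 : cinf U) p = 1.
Proof. exact: cinf_cstE. Qed.
Lemma cinf0 U p : U p -> (0 : cinf U) p = 0.
Proof. exact: cinf_cstE. Qed.
Lemma cinfN U (f : cinf U) p : U p -> (- f) p = - f p.
Proof. by move=> Up; apply: (addrI (f p)); rewrite -cinfD// !subrr cinf0. Qed.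
Lemma cinfB U (f g : cinf U) p : U p -> (f - g) p = f p - g p.
Proof. by move=> Up; rewrite cinfD// cinfN. Qed.
Lemma cinf_resM U V (VU : V `<=` U) (f g : cinf U) :
  cinf_res VU (f * g) = cinf_res VU f * cinf_res VU g.
Proof. exact: cinf_res_mul. Qed.
Lemma cinf_res1 U V (VU : V `<=` U) : cinf_res VU 1 = 1 :> cinf V.
Proof. exact: cinf_res_cst. Qed.
Lemma cinf_scaleM U (a : R[i]) (f g : cinf U) : a *: (f * g) = (a *: f) * g.
Proof. exact: cinf_mulA. Qed.
Lemma cinf_scaleMr U (a : R[i]) (f g : cinf U) : f * (a *: g) = a *: (f * g).
Proof. by rewrite mulrC -cinf_scaleM mulrC. Qed.
Lemma cinf_cst_mul U (a : R[i]) (f : cinf U) : cinf_cst U a * f = a *: f.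
Proof. by []. Qed.

(** An endomorphism of the sheaf of smooth functions over [U]. The value 0 imposed on opens not
    contained in [U] makes two operators that agree inside [U] equal, so that [lop U] can be given
    ring and module structures. *)
Record lop (U : opens M) := Lop {
  lop_fun :> forall V : opens M, cinf V -> cinf V;
  lop_lin : forall V, V `<=` U -> forall (a : R[i]) (f g : cinf V),
    lop_fun (a *: f + g) = a *: lop_fun f + lop_fun g;
  lop_res : forall V W (WV : W `<=` V), V `<=` U -> forall f : cinf V,
    cinf_res WV (lop_fun f) = lop_fun (cinf_res WV f);
  lop_junk : forall V, ~ (V `<=` U) -> forall f : cinf V, lop_fun f = 0 }.
Arguments lop_fun {U} _ V f : rename.

HB.instance Definition _ U := gen_eqMixin (lop U).
HB.instance Definition _ U := gen_choiceMixin (lop U).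

Lemma lopP U (N N' : lop U) : (forall V, V `<=` U -> forall f : cinf V, N V f = N' V f) ->
  N = N'.
Proof.
move=> H; have e : lop_fun N = lop_fun N'.
  apply: functional_extensionality_dep => V; apply/funext => f.
  by case: (pselect (V `<=` U)) => [/H//|h]; rewrite !lop_junk.
case: N N' e {H} => [N h1 h2 h3] [N' h1' h2' h3'] /= e.
by case: _ / e in h1' h2' h3' *; congr Lop; exact: Prop_irrelevance.
Qed.

Section Build.
Variables (U : opens M) (F : forall V, V `<=` U -> cinf V -> cinf V).
Hypothesis F_lin : forall V (VU : V `<=` U) (a : R[i]) (f g : cinf V),
  F VU (a *: f + g) = a *: F VU f + F VU g.
Hypothesis F_res : forall V W (WV : W `<=` V) (VU : V `<=` U) (WU : W `<=` U) (f : cinf V),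
  cinf_res WV (F VU f) = F WU (cinf_res WV f).

Definition build_fun V (f : cinf V) : cinf V :=
  if pselect (V `<=` U) is left VU then F VU f else 0.

Lemma build_funE V (VU : V `<=` U) f : build_fun f = F VU f.
Proof.
rewrite /build_fun; case: pselect => // VU'; by rewrite (Prop_irrelevance VU' VU).
Qed.

Let b_lin V : V `<=` U -> forall (a : R[i]) (f g : cinf V),
  build_fun (a *: f + g) = a *: build_fun f + build_fun g.
Proof. by move=> VU a f g; rewrite !(build_funE VU). Qed.
Let b_res V W (WV : W `<=` V) : V `<=` U -> forall f : cinf V,
  cinf_res WV (build_fun f) = build_fun (cinf_res WV f).
Proof.
by move=> VU f; rewrite (build_funE VU) (build_funE (subset_trans WV VU)); exact: F_res.
Qed.
Let b_junk V : ~ (V `<=` U) -> forall f : cinf V, build_fun f = 0.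
Proof. by move=> h f; rewrite /build_fun; case: pselect. Qed.

Definition build_lop : lop U := @Lop U build_fun b_lin b_res b_junk.
Lemma build_lopE V (VU : V `<=` U) f : build_lop V f = F VU f.
Proof. exact: build_funE. Qed.
End Build.

Section LopTheory.
Variable U : opens M.
Implicit Types (N : lop U).

Lemma lopD N V (f g : cinf V) : N V (f + g) = N V f + N V g.
Proof.
case: (pselect (V `<=` U)) => h; last by rewrite !lop_junk ?addr0.
by have := lop_lin N h 1 f g; rewrite !scale1r.
Qed.
Lemma lop0 N V : N V 0 = 0.
Proof. by apply: (addrI (N V 0)); rewrite -lopD !addr0. Qed.
Lemma lopZ N V a (f : cinf V) : N V (a *: f) = a *: N V f.
Proof.
case: (pselect (V `<=` U)) => h; last by rewrite !lop_junk ?scaler0.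
by have := lop_lin N h a f 0; rewrite !addr0 lop0 addr0.
Qed.
Lemma lopN N V (f : cinf V) : N V (- f) = - N V f.
Proof. by rewrite -scaleN1r lopZ scaleN1r. Qed.
Lemma lopB N V (f g : cinf V) : N V (f - g) = N V f - N V g.
Proof. by rewrite lopD lopN. Qed.
Lemma lop_sum N V I (r : seq I) (P : pred I) (F : I -> cinf V) :
  N V (\sum_(i <- r | P i) F i) = \sum_(i <- r | P i) N V (F i).
Proof. exact: (big_morph (N V) (@lopD N V) (@lop0 N V)). Qed.

Definition lop_zero : lop U.
Proof.
by exists (fun V _ => 0) => // [V VU a f g|V W WV VU f]; rewrite ?scaler0 ?addr0 ?raddf0.
Defined.
Definition lop_add N N' : lop U.
Proof.
exists (fun V f => N V f + N' V f) => [V VU a f g|V W WV VU f|V VU f].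
- by rewrite !lop_lin// scalerDr addrACA.
- by rewrite raddfD /= !lop_res.
- by rewrite !lop_junk ?addr0.
Defined.
Definition lop_opp N : lop U.
Proof.
exists (fun V f => - N V f) => [V VU a f g|V W WV VU f|V VU f].
- by rewrite !lop_lin// opprD scalerN.
- by rewrite raddfN /= !lop_res.
- by rewrite !lop_junk ?oppr0.
Defined.
Definition lop_mul N N' : lop U.
Proof.
exists (fun V f => N V (N' V f)) => [V VU a f g|V W WV VU f|V VU f].
- by rewrite !lop_lin.
- by rewrite !lop_res.
- by rewrite !lop_junk.
Defined.
Definition lop_scale (a : R[i]) N : lop U.
Proof.
exists (fun V f => a *: N V f) => [V VU b f g|V W WV VU f|V VU f].
- by rewrite !lop_lin// scalerDr !scalerA mulrC.
- by rewrite linearZ /= !lop_res.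
- by rewrite !lop_junk ?scaler0.
Defined.
Definition lop_one : lop U.
Proof.
by apply: (@build_lop U (fun V _ f => f)).
Defined.
Lemma lop_oneE V (VU : V `<=` U) (f : cinf V) : lop_one V f = f.
Proof. exact: (build_lopE _ _ VU). Qed.

Let addA : associative lop_add. Proof. by move=> a b c; apply: lopP => V _ f /=; rewrite addrA. Qed.
Let addC : commutative lop_add. Proof. by move=> a b; apply: lopP => V _ f /=; rewrite addrC. Qed.
Let add0 : left_id lop_zero lop_add. Proof. by move=> a; apply: lopP => V _ f /=; rewrite add0r. Qed.
Let addN : left_inverse lop_zero lop_opp lop_add.
Proof. by move=> a; apply: lopP => V _ f /=; rewrite addNr. Qed.
HB.instance Definition _ := GRing.isZmodule.Build (lop U) addA addC add0 addN.

Let mulA : associative lop_mul. Proof. by move=> a b c; apply: lopP. Qed.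
Let mul1l : left_id lop_one lop_mul.
Proof. by move=> a; apply: lopP => V VU f; exact: (lop_oneE VU). Qed.
Let mul1r : right_id lop_one lop_mul.
Proof. by move=> a; apply: lopP => V VU f; rewrite /= build_funE. Qed.
Let mulDl : left_distributive lop_mul +%R. Proof. by move=> a b c; apply: lopP. Qed.
Let mulDr : right_distributive lop_mul +%R.
Proof. by move=> a b c; apply: lopP => V _ f; exact: lopD. Qed.
HB.instance Definition _ := GRing.Zmodule_isPzRing.Build (lop U) mulA mul1l mul1r mulDl mulDr.

Let scaleA a b N : lop_scale a (lop_scale b N) = lop_scale (a * b) N.
Proof. by apply: lopP => V _ f /=; rewrite scalerA. Qed.
Let scale1 : left_id 1 lop_scale. Proof. by move=> a; apply: lopP => V _ f /=; rewrite scale1r. Qed.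
Let scaleDr : right_distributive lop_scale +%R.
Proof. by move=> a f g; apply: lopP => V _ h /=; rewrite scalerDr. Qed.
Let scaleDl N : {morph lop_scale^~ N : a b / a + b}.
Proof. by move=> a b; apply: lopP => V _ h /=; rewrite scalerDl. Qed.
HB.instance Definition _ := GRing.Zmodule_isLmodule.Build R[i] (lop U) scaleA scale1 scaleDr scaleDl.

Lemma lopDE N N' V (f : cinf V) : (N + N') V f = N V f + N' V f. Proof. by []. Qed.
Lemma lopNE N V (f : cinf V) : (- N) V f = - N V f. Proof. by []. Qed.
Lemma lopBE N N' V (f : cinf V) : (N - N') V f = N V f - N' V f. Proof. by []. Qed.
Lemma lop0E V (f : cinf V) : (0 : lop U) V f = 0. Proof. by []. Qed.
Lemma lopZE a N V (f : cinf V) : (a *: N) V f = a *: N V f. Proof. by []. Qed.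
Lemma lopME N N' V (f : cinf V) : (N * N') V f = N V (N' V f). Proof. by []. Qed.
Lemma lop1E V (VU : V `<=` U) (f : cinf V) : (1 : lop U) V f = f.
Proof. exact: lop_oneE. Qed.
Lemma lop_sumE V I (r : seq I) (P : pred I) (F : I -> lop U) (f : cinf V) :
  (\sum_(i <- r | P i) F i) V f = \sum_(i <- r | P i) F i V f.
Proof. by apply: (big_morph (fun N : lop U => N V f)). Qed.
Lemma lopZl a N N' : (a *: N) * N' = a *: (N * N'). Proof. by apply: lopP. Qed.
Lemma lopZr a N N' : N * (a *: N') = a *: (N * N').
Proof. by apply: lopP => V _ f; exact: lopZ. Qed.

Definition mop (h : cinf U) : lop U.
Proof.
apply: (@build_lop U (fun V VU f => cinf_res VU h * f)) => [V VU a f g|V W WV VU WU f].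
- by rewrite mulrDr cinf_scaleMr.
- by rewrite cinf_resM (cinf_res_comp VU WV WU).
Defined.
Lemma mopE h V (VU : V `<=` U) (f : cinf V) : mop h V f = cinf_res VU h * f.
Proof. exact: (build_lopE _ _ VU). Qed.
Lemma mopD h h' : mop (h + h') = mop h + mop h'.
Proof. by apply: lopP => V VU f; rewrite lopDE !(mopE _ VU) raddfD /= mulrDl. Qed.
Lemma mopM h h' : mop (h * h') = mop h * mop h'.
Proof. by apply: lopP => V VU f; rewrite lopME !(mopE _ VU) cinf_resM mulrA. Qed.
Lemma mop1 : mop 1 = 1.
Proof. by apply: lopP => V VU f; rewrite (mopE _ VU) (lop1E VU) cinf_res1 GRing.mul1r. Qed.
Lemma mop0 : mop 0 = 0.
Proof. by apply: (addrI (mop 0)); rewrite -mopD !addr0. Qed.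
Lemma mopN h : mop (- h) = - mop h.
Proof. by apply: (addrI (mop h)); rewrite -mopD !subrr mop0. Qed.
Lemma mopB h h' : mop (h - h') = mop h - mop h'.
Proof. by rewrite mopD mopN. Qed.
Lemma mopZ a h : mop (a *: h) = a *: mop h.
Proof. by apply: lopP => V VU f; rewrite lopZE !(mopE _ VU) linearZ /= cinf_scaleM. Qed.
Lemma mopC h h' : mop h * mop h' = mop h' * mop h.
Proof. by rewrite -!mopM mulrC. Qed.

End LopTheory.

Definition restr U U' (UU : U' `<=` U) (N : lop U) : lop U'.
Proof.
apply: (@build_lop U' (fun V _ f => N V f)) => [V VU a f g|V W WV VU WU f].
- by rewrite lop_lin//; exact: subset_trans UU.
- by rewrite lop_res//; exact: subset_trans UU.
Defined.

Section Restr.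
Variables (U U' : opens M) (UU : U' `<=` U).
Implicit Types N : lop U.
Lemma restrE N V (VU : V `<=` U') (f : cinf V) : restr UU N V f = N V f.
Proof. exact: (build_lopE _ _ VU). Qed.
Lemma restrD N N' : restr UU (N + N') = restr UU N + restr UU N'.
Proof. by apply: lopP => V VU f; rewrite lopDE !restrE. Qed.
Lemma restr0 : restr UU 0 = 0.
Proof. by apply: lopP => V VU f; rewrite !restrE. Qed.
Lemma restrN N : restr UU (- N) = - restr UU N.
Proof. by apply: lopP => V VU f; rewrite lopNE !restrE. Qed.
Lemma restrB N N' : restr UU (N - N') = restr UU N - restr UU N'.
Proof. by rewrite restrD restrN. Qed.
Lemma restrM N N' : restr UU (N * N') = restr UU N * restr UU N'.
Proof. by apply: lopP => V VU f; rewrite lopME !restrE. Qed.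
Lemma restr1 : restr UU 1 = 1.
Proof. by apply: lopP => V VU f; rewrite restrE// !lop1E//; exact: subset_trans UU. Qed.
Lemma restrZ a N : restr UU (a *: N) = a *: restr UU N.
Proof. by apply: lopP => V VU f; rewrite lopZE !restrE. Qed.
Lemma restr_mop h : restr UU (mop h) = mop (cinf_res UU h).
Proof.
apply: lopP => V VU f; rewrite restrE// (mopE _ VU) (mopE _ (subset_trans VU UU)).
by rewrite (cinf_res_comp UU VU (subset_trans VU UU)).
Qed.
Lemma restr_sum I (r : seq I) (P : pred I) (F : I -> lop U) :
  restr UU (\sum_(i <- r | P i) F i) = \sum_(i <- r | P i) restr UU (F i).
Proof. exact: (big_morph _ restrD restr0). Qed.
End Restr.

Lemma restr_comp U U' U'' (h1 : U' `<=` U) (h2 : U'' `<=` U') (h3 : U'' `<=` U) (N : lop U) :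
  restr h2 (restr h1 N) = restr h3 N.
Proof.
by apply: lopP => V VU f; rewrite !restrE//; exact: subset_trans h2.
Qed.

Lemma restr_id U (h : U `<=` U) (N : lop U) : restr h N = N.
Proof. by apply: lopP => V VU f; rewrite restrE. Qed.

Definition capo U V : opens M := Opens (opensI_proof U V).
Lemma capol U V : capo U V `<=` U. Proof. by move=> p []. Qed.
Lemma capor U V : capo U V `<=` V. Proof. by move=> p []. Qed.

Lemma lop_germ U (N : lop U) V V' W (f : cinf V) (g : cinf V') p :
  V `<=` U -> V' `<=` U -> V p -> V' p -> W p ->
  (forall q, V q -> V' q -> W q -> f q = g q) -> N V f p = N V' g p.
Proof.
move=> VU VU' Vp Vp' Wp fg; pose Z := capo (capo V V') W.
have ZV : Z `<=` V by move=> q [[]].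
have ZV' : Z `<=` V' by move=> q [[]].
have Zp : Z p by [].
have := lop_res N ZV VU f; have := lop_res N ZV' VU' g.
have -> : cinf_res ZV f = cinf_res ZV' g.
  by apply: cinf_inj => q Zq; rewrite !cinf_resE//; case: Zq => [[Vq Vq'] Wq]; exact: fg.
by move=> <- /(congr1 (fun h : cinf Z => h p)); rewrite !cinf_resE.
Qed.

End LocalOperators.

Section Jets.
Variables (R : realType) (n : nat) (M : manifold R n).
Variables (c : chart R n M) (ac : atlas c).
Implicit Types (U V W : opens M) (q : M).

Definition cdomo : opens M := Opens (cdom_open c).

Definition dop (i : 'I_n) : lop cdomo.
Proof.
apply: (@build_lop R n M cdomo (fun V (VU : V `<=` cdomo) f =>
  mk_cinf (msmooth_pderiv i ac (oset_open V) VU (cinf_smooth f)))).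
- move=> V VU a f g; apply: cinf_inj => p Vp; have cp : cdom c p := VU p Vp.
  have sf : smooth_near p f by exists V => //; exact: cinf_smooth.
  have sg : smooth_near p g by exists V => //; exact: cinf_smooth.
  have saf : smooth_near p (fun q => a * f q).
    exists V => //; apply: msmoothM; [exact: oset_open|exact: msmooth_cst|exact: cinf_smooth].
  rewrite cinfD// cinfZ// !mk_cinfE// -(pderivZ ac cp i a sf) -(pderivD ac cp i saf sg).
  by apply: (pderiv_germ cp i Vp) => q Vq; rewrite cinfD// cinfZ.
- move=> V W WV VU WU f; apply: cinf_inj => p Wp.
  rewrite cinf_resE// !mk_cinfE//; last exact: WV.
  by apply: (pderiv_germ (WU p Wp) i Wp) => q Wq; rewrite cinf_resE.
Defined.

Lemma dopE i V (VU : V `<=` cdomo) (f : cinf V) p : V p -> dop i V f p = pderiv c i f p.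
Proof. by move=> Vp; rewrite (build_lopE _ _ VU) mk_cinfE. Qed.

(* [f] vanishes to order [s] at [q], with respect to the coordinates of the chart. *)
Fixpoint J s (f : M -> R[i]) q : Prop :=
  if s is s'.+1 then f q = 0 /\ forall i, J s' (pderiv c i f) q else True.

Lemma J_germ s V (f g : M -> R[i]) q : V `<=` cdomo -> V q ->
  (forall p, V p -> f p = g p) -> J s f q -> J s g q.
Proof.
move=> Vc Vq; elim: s f g => [//|s IH] f g fg [h1 h2]; split; first by rewrite -fg.
move=> i; apply: IH (h2 i) => p Vp; exact: (pderiv_germ (Vc p Vp) i Vp).
Qed.

Lemma J_dop s V (VU : V `<=` cdomo) (f : cinf V) q i : V q -> J s.+1 f q -> J s (dop i V f) q.
Proof.
move=> Vq [_ /(_ i)]; apply: (J_germ VU Vq) => p Vp; by rewrite (dopE _ VU).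
Qed.

Lemma J_S s V (VU : V `<=` cdomo) (f : cinf V) q : V q ->
  f q = 0 -> (forall i, J s (dop i V f) q) -> J s.+1 f q.
Proof.
move=> Vq fq h; split=> // i; apply: (J_germ VU Vq) (h i) => p Vp; by rewrite (dopE _ VU).
Qed.

Lemma J0 s V (f : cinf V) q : J s.+1 f q -> f q = 0.
Proof. by case. Qed.

Lemma J_zero s V (VU : V `<=` cdomo) q : V q -> J s (0 : cinf V) q.
Proof.
move=> Vq; elim: s => [//|s IH]; apply: (J_S VU Vq); first by rewrite cinf0.
by move=> i; rewrite lop0.
Qed.

Lemma J_W s V (VU : V `<=` cdomo) (f : cinf V) q : V q -> J s.+1 f q -> J s f q.
Proof.
move=> Vq; elim: s f => [//|s IH] f Jf; apply: (J_S VU Vq); first exact: J0 Jf.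
by move=> i; apply: IH; exact: J_dop.
Qed.

Lemma J_mono s s' V (VU : V `<=` cdomo) (f : cinf V) q : V q -> (s' <= s)%N -> J s f q -> J s' f q.
Proof.
move=> Vq /subnKC <-; elim: (s - s')%N => [|k IH]; first by rewrite addn0.
by rewrite addnS => /(J_W VU Vq).
Qed.

Lemma J_D s V (VU : V `<=` cdomo) (f g : cinf V) q : V q -> J s f q -> J s g q -> J s (f + g) q.
Proof.
move=> Vq; elim: s f g => [//|s IH] f g hf hg; apply: (J_S VU Vq).
  by rewrite cinfD// (J0 hf) (J0 hg) addr0.
by move=> i; rewrite lopD; apply: IH; exact: J_dop.
Qed.

Lemma dopM i V (VU : V `<=` cdomo) (f g : cinf V) :
  dop i V (f * g) = dop i V f * g + f * dop i V g.
Proof.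
apply: cinf_inj => p Vp; have cp : cdom c p := VU p Vp.
have sf : smooth_near p f by exists V => //; exact: cinf_smooth.
have sg : smooth_near p g by exists V => //; exact: cinf_smooth.
rewrite cinfD// !cinfM// !dopE// -(pderivM ac cp i sf sg).
by apply: (pderiv_germ cp i Vp) => q Vq; rewrite cinfM.
Qed.

Lemma J_M s V (VU : V `<=` cdomo) (f g : cinf V) q : V q -> J s f q -> J s (f * g) q.
Proof.
move=> Vq; elim: s f g => [//|s IH] f g hf; apply: (J_S VU Vq).
  by rewrite cinfM// (J0 hf) mul0r.
move=> i; rewrite (dopM _ VU); apply: (J_D VU Vq); apply: IH.
  exact: J_dop.
exact: J_W hf.
Qed.

Lemma J_Mr s V (VU : V `<=` cdomo) (f g : cinf V) q : V q -> J s g q -> J s (f * g) q.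
Proof. by move=> Vq hg; rewrite mulrC; exact: J_M. Qed.

Lemma J_Z s V (VU : V `<=` cdomo) a (f : cinf V) q : V q -> J s f q -> J s (a *: f) q.
Proof. by move=> Vq hf; rewrite -cinf_cst_mul; exact: J_Mr. Qed.

Lemma J_M1 s V (VU : V `<=` cdomo) (x f : cinf V) q : V q -> x q = 0 -> J s f q -> J s.+1 (x * f) q.
Proof.
move=> Vq xq; elim: s f => [|s IH] f hf; apply: (J_S VU Vq); rewrite ?cinfM// ?xq ?mul0r//.
move=> i; rewrite (dopM _ VU); apply: (J_D VU Vq); first exact: J_Mr.
by apply: IH; exact: J_dop.
Qed.

Lemma J_sum s V (VU : V `<=` cdomo) I (r : seq I) (F : I -> cinf V) q : V q ->
  (forall i, J s (F i) q) -> J s (\sum_(i <- r) F i) q.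
Proof.
move=> Vq hF; elim: r => [|i r IH]; first by rewrite big_nil; exact: J_zero.
by rewrite big_cons; exact: J_D.
Qed.

Lemma J_exp s V (VU : V `<=` cdomo) (x : cinf V) q : V q -> x q = 0 -> J s (x ^+ s) q.
Proof.
move=> Vq xq; elim: s => [//|s IH]; rewrite exprS; exact: J_M1.
Qed.

Lemma J_RJ s V (VU : V `<=` cdomo) (f : cinf V) q : V q -> J s f q ->
  RJ s (fun x => complex.Re (f (cinv c x))) (cfun c q) /\
  RJ s (fun x => complex.Im (f (cinv c x))) (cfun c q).
Proof.
move=> Vq; elim: s f => [//|s IH] f hf.
have E := @cfunK _ _ _ c.
have cq := VU q Vq.
have oV : open (cfun c @` V).
  by have := @cimg_openI R n M c V (oset_open V); rewrite setIidr.
have Vx : (cfun c @` V) (cfun c q) by exists q.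
have RJ_ext s' (u v : 'rV[R]_n -> R) x : (cfun c @` V) x ->
    (forall y, (cfun c @` V) y -> u y = v y) -> RJ s' u x -> RJ s' v x.
  elim: s' u v => [//|s' IH'] u v Vx' uv [h1 h2]; split; first by rewrite -uv.
  move=> i; apply: IH' (h2 i) => // y Vy; exact: (derive_open_eq _ oV Vy uv).
split; split; rewrite ?E// ?(J0 hf)// => i.
  have [h _] := IH _ (J_dop VU i Vq hf); apply: RJ_ext h => // _ [p Vp <-].
  by rewrite E ?(dopE _ VU)//; exact: VU.
have [_ h] := IH _ (J_dop VU i Vq hf); apply: RJ_ext h => // _ [p Vp <-].
by rewrite E ?(dopE _ VU)//; exact: VU.
Qed.

End Jets.

Lemma near_open (T : topologicalType) (x : T) (P : T -> Prop) :
  (\forall y \near x, P y) -> exists S : set T, [/\ open S, S x & forall y, S y -> P y].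
Proof.
move=> h; have : nbhs x P by [].
by rewrite nbhsE => -[S [oS Sx] SP]; exists S.
Qed.

(** * Peetre's theorem *)

Section Peetre.
Variables (R : realType) (n : nat) (M : manifold R n).
Implicit Types (U V W : opens M) (q p : M).

Record bop (U : opens M) := Bop {
  bop_fun :> forall V : opens M, cinf V -> cinf V -> cinf V;
  bop_linl : forall V, V `<=` U -> forall (a : R[i]) (f f' g : cinf V),
    bop_fun (a *: f + f') g = a *: bop_fun f g + bop_fun f' g;
  bop_linr : forall V, V `<=` U -> forall (a : R[i]) (f g g' : cinf V),
    bop_fun f (a *: g + g') = a *: bop_fun f g + bop_fun f g';
  bop_res : forall V W (WV : W `<=` V), V `<=` U -> forall f g : cinf V,
    cinf_res WV (bop_fun f g) = bop_fun (cinf_res WV f) (cinf_res WV g) }.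
Arguments bop_fun {U} _ V f g : rename.

Definition bop_swap U (B : bop U) : bop U.
Proof.
exists (fun V f g => B V g f).
- by move=> V VU a f f' g; rewrite bop_linr.
- by move=> V VU a f f' g; rewrite bop_linl.
- by move=> V W WV VU f g; rewrite bop_res.
Defined.

(** Peetre's theorem is proved for bilinear operators only; through this operator, with [g = 1], it
    also serves for linear ones. *)
Definition bop_lop U (N : lop U) : bop U.
Proof.
exists (fun V f g => N V f * g).
- by move=> V VU a f f' g; rewrite lop_lin// mulrDl cinf_scaleM.
- by move=> V VU a f g g'; rewrite mulrDr cinf_scaleMr.
- by move=> V W WV VU f g; rewrite cinf_resM lop_res.
Defined.

Lemma bopZ0 U (B : bop U) V (VU : V `<=` U) a b (f g : cinf V) :
  B V (a *: f) (b *: g) = (a * b) *: B V f g.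
Proof.
have zl (h : cinf V) : B V 0 h = 0.
  by apply: (addrI (B V 0 h)); have := bop_linl B VU 1 0 0 h; rewrite !scale1r addr0 => <-; rewrite addr0.
have zr (h : cinf V) : B V h 0 = 0.
  by apply: (addrI (B V h 0)); have := bop_linr B VU 1 h 0 0; rewrite !scale1r addr0 => <-; rewrite addr0.
have := bop_linl B VU a f 0 (b *: g); rewrite addr0 zl addr0 => ->.
by have := bop_linr B VU b f g 0; rewrite addr0 zr addr0 => ->; rewrite scalerA.
Qed.

Lemma bop0l U (B : bop U) V (VU : V `<=` U) (g : cinf V) : B V 0 g = 0.
Proof. by have := bopZ0 B VU 0 1 0 g; rewrite scale0r scale1r mul0r scale0r. Qed.

Lemma bop_germ U (B : bop U) V V' W (f g : cinf V) (f' g' : cinf V') p :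
  V `<=` U -> V' `<=` U -> V p -> V' p -> W p ->
  (forall q, V q -> V' q -> W q -> f q = f' q /\ g q = g' q) -> B V f g p = B V' f' g' p.
Proof.
move=> VU VU' Vp Vp' Wp fg; pose Z := capo (capo V V') W.
have ZV : Z `<=` V by move=> q [[]].
have ZV' : Z `<=` V' by move=> q [[]].
have Zp : Z p by [].
have := bop_res B ZV VU f g; have := bop_res B ZV' VU' f' g'.
have -> : cinf_res ZV f = cinf_res ZV' f'.
  by apply: cinf_inj => q Zq; rewrite !cinf_resE//; case: Zq => [[Vq Vq'] Wq]; have [] := fg q Vq Vq' Wq.
have -> : cinf_res ZV g = cinf_res ZV' g'.
  by apply: cinf_inj => q Zq; rewrite !cinf_resE//; case: Zq => [[Vq Vq'] Wq]; have [] := fg q Vq Vq' Wq.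
by move=> <- /(congr1 (fun h : cinf Z => h p)); rewrite !cinf_resE.
Qed.

Variables (c : chart R n M) (ac : atlas c).

Lemma open_chart_ball U p (r : R) : U `<=` cdom c -> open [set q | U q /\ `|cfun c q - cfun c p| < r].
Proof.
move=> Uc; rewrite openE => q [Uq hq].
have h1 : \forall z \near q, U z by apply: open_nbhs_nbhs; split => //; exact: oset_open.
have d0 : 0 < r - `|cfun c q - cfun c p| by rewrite subr_gt0.
have h2 : \forall z \near q, `|cfun c z - cfun c q| < r - `|cfun c q - cfun c p|.
  by have /cvgrPdistC_lt/(_ _ d0) := cfun_continuous (Uc q Uq).
apply: filterS2 h1 h2 => z Uz hz; split=> //.
have := ler_normD (cfun c z - cfun c q) (cfun c q - cfun c p).
by rewrite subrKA; lra.
Qed.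

(** Otherwise there are points q_j tending to [p], distinct from [p], with f_j vanishing to order
    j+1 at q_j and B(f_j, g_j)(q_j) = 1. Suitable multiples of f_j and g_j, cut off around q_j, add
    up to two smooth functions on which [B] takes the value j+1 at q_j, against continuity at [p].
    The supports must avoid [p], hence [q <> p]. *)
Lemma peetre_left U (B : bop U) p : U p -> cdom c p -> exists (V : opens M) (K : nat),
  [/\ V p, V `<=` U, V `<=` cdom c & forall W (f g : cinf W) q, V q -> W q -> W `<=` V -> q <> p ->
    J c K f q -> B W f g q = 0].
Proof.
move=> Up cp; apply: contrapT => H.
pose U0 := capo U (cdomo c).
have U0p : U0 p by [].
have U0c : U0 `<=` cdom c by move=> q [].
have U0U : U0 `<=` U by move=> q [].
set x0 := cfun c p.
have inj q : U0 q -> cfun c q = x0 -> q = p.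
  by move=> [_ cq] e; rewrite -(cfunK cq) e cfunK.
(* A counterexample consists of an open set, two sections on it and a point at distance less than
   [r] from [p] in the chart. The value 1 is reached by rescaling [f]. *)
pose spec (r : R) (K : nat) (d : {W : opens M & (cinf W * cinf W * M)%type}) :=
  let q := (projT2 d).2 in let f := (projT2 d).1.1 in let g := (projT2 d).1.2 in
  [/\ projT1 d `<=` U0, projT1 d q, 0 < `|cfun c q - x0| < r, J c K f q & B _ f g q = 1].
have bad (rK : R * nat) : exists d, 0 < rK.1 -> spec rK.1 rK.2 d.
  case: rK => r K /=; have [r0|r0] := ltP 0 r; last first.
    by exists (existT _ U0 (0, 0, p)).
  apply: contrapT => H1; apply: H.
  pose V := Opens (open_chart_ball p r U0c).
  exists V, K; split.
  - by split=> //; rewrite subrr normr0.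
  - by move=> q [[]].
  - by move=> q [[]].
  move=> W f g q Vq Wq WV qp Jf; apply: contrapT => /eqP Bn0; apply: H1.
  exists (existT _ W ((B W f g q)^-1 *: f, g, q)) => _.
  have WU0 : W `<=` U0 by move=> z /WV [].
  split=> //=.
  - case: Vq => [U0q ->]; rewrite andbT normr_gt0 subr_eq0.
    by apply/eqP => /(inj _ U0q).
  - by apply: (J_Z ac) => //; move=> z /WU0 [].
  - have -> : g = 1 *: g by rewrite scale1r.
    rewrite bopZ0; last by move=> z /WU0/U0U.
    by rewrite mulr1 cinfZ// scale1r mulVf.
have [D HD] := choice bad.
(* Each new point lies within a quarter of the previous distance, as [glue_series] requires, and the
   order of vanishing grows by one. *)
pose dd := fix dd j := if j is j'.+1 then D (`|cfun c (projT2 (dd j')).2 - x0| / 4, j.+1) else D (1, 1%N).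
have dS j : spec (if j is j'.+1 then `|cfun c (projT2 (dd j')).2 - x0| / 4 else 1) j.+1 (dd j).
  elim: j => [|j IH]; first exact: HD.
  by apply: HD => /=; case: IH => _ _ /andP[h _] _ _; rewrite divr_gt0.
pose Wj j := projT1 (dd j).
pose qj j : M := (projT2 (dd j)).2.
pose fj j : cinf (Wj j) := (projT2 (dd j)).1.1.
pose gj j : cinf (Wj j) := (projT2 (dd j)).1.2.
pose xj j := cfun c (qj j).
have WU0 j : Wj j `<=` U0 by case: (dS j).
have Wq j : Wj j (qj j) by case: (dS j).
have Jf j : J c j.+1 (fj j) (qj j) by case: (dS j).
have B1 j : B _ (fj j) (gj j) (qj j) = 1 by case: (dS j).
have rho0 j : 0 < `|xj j - x0| by case: (dS j) => _ _ /andP[].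
have rhoS j : `|xj j.+1 - x0| <= `|xj j - x0| / 4.
  by case: (dS j.+1) => _ _ /andP[_ /ltW].
have oW j : open (cfun c @` Wj j).
  have := @cimg_openI R n M c (Wj j) (oset_open (Wj j)); rewrite setIidr//.
  by move=> z /(WU0 j)/U0c.
have Wc j : Wj j `<=` cdom c by move=> z /WU0/U0c.
have Wx j : (cfun c @` Wj j) (xj j) by exists (qj j).
have sm j (h : cinf (Wj j)) : smooth_on (cfun c @` Wj j) (fun x => complex.Re (h (cinv c x))) /\
    smooth_on (cfun c @` Wj j) (fun x => complex.Im (h (cinv c x))).
  by have := cinf_smooth h ac; rewrite setIidr.
have sb0' j := series_bound_gt0 rho0 j.
pose bd j := series_bound x0 xj j.
have rho40 j : 0 < `|xj j - x0| / 4 by rewrite divr_gt0.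
have /choice[G HG] j : exists G : R * (('rV[R]_n -> R) * ('rV[R]_n -> R)),
   [/\ 0 < G.1, smooth_on setT G.2.1 /\ smooth_on setT G.2.2,
     (forall x, `|xj j - x0| / 4 < `|x - xj j| -> G.2.1 x = 0 /\ G.2.2 x = 0),
     (\forall x \near xj j, G.2.1 x = G.1 * complex.Re (gj j (cinv c x)) /\
         G.2.2 x = G.1 * complex.Im (gj j (cinv c x))) &
     sb j 1 (bd j) setT G.2.1 /\ sb j 1 (bd j) setT G.2.2].
  have [s1 s2] := sm j (gj j).
  have [u1 [u1s u10 u1e u1b]] := cutoff (oW j) (Wx j) s1 (rho40 j).
  have [u2 [u2s u20 u2e u2b]] := cutoff (oW j) (Wx j) s2 (rho40 j).
  have [K1 K10 hK1] := u1b j; have [K2 K20 hK2] := u2b j.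
  (* Nothing is known about the vanishing of the second argument at the point, so shrinking its
     support does not make it small; it is multiplied by a small constant instead. *)
  pose a := bd j / (K1 + K2 + 1).
  have a0 : 0 < a by rewrite divr_gt0// ltr_wpDl// addr_ge0.
  have aK : a * (K1 + K2) <= bd j.
    rewrite /a mulrAC ler_pdivrMr ?ltr_wpDl ?addr_ge0// ler_wpM2l ?ltW// ?sb0'//.
    by rewrite ltrDl.
  exists (a, (fun x => a * u1 x, fun x => a * u2 x)); split=> //=.
  - by split=> k; apply: CkM; [exact: openT|exact: Ck_cst|exact: u1s|exact: openT|exact: Ck_cst|exact: u2s].
  - by move=> x /ltW hx; rewrite u10// u20// mulr0.
  - by apply: filterS2 u1e u2e => x -> ->.
  - have aK1 : a * K1 <= bd j by apply: le_trans aK; rewrite ler_wpM2l ?(ltW a0)// lerDl.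
    have aK2 : a * K2 <= bd j by apply: le_trans aK; rewrite ler_wpM2l ?(ltW a0)// lerDr.
    by split; [exact: (sb_le ltr01 aK1 (sb_scale_l openT ltr01 (ltW a0) (u1s j) hK1)) |
      exact: (sb_le ltr01 aK2 (sb_scale_l openT ltr01 (ltW a0) (u2s j) hK2))].
(* The factor undoes the scaling of the second argument and creates the value j+1. However large it
   is, the first argument vanishes to order j+1, so [cutoff_flat] still makes its cutoff small. *)
have /choice[F HF] j : exists F : ('rV[R]_n -> R) * ('rV[R]_n -> R),
   [/\ smooth_on setT F.1 /\ smooth_on setT F.2,
     (forall x, `|xj j - x0| / 4 < `|x - xj j| -> F.1 x = 0 /\ F.2 x = 0),
     (\forall x \near xj j, F.1 x = complex.Re (((j.+1%:R / (G j).1)%:C%C *: fj j : cinf (Wj j)) (cinv c x)) /\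
         F.2 x = complex.Im (((j.+1%:R / (G j).1)%:C%C *: fj j : cinf (Wj j)) (cinv c x))) &
     sb j 1 (bd j) setT F.1 /\ sb j 1 (bd j) setT F.2].
  set h := (_ *: fj j).
  have Jh : J c j.+1 h (qj j) by apply: (J_Z ac).
  have [RJ1 RJ2] := J_RJ ac (Wc j) (Wq j) Jh.
  have [s1 s2] := sm j h.
  have [u1 [u1s u10 u1e u1b]] := cutoff_flat (oW j) (Wx j) s1 RJ1 (sb0' j) (rho40 j).
  have [u2 [u2s u20 u2e u2b]] := cutoff_flat (oW j) (Wx j) s2 RJ2 (sb0' j) (rho40 j).
  exists (u1, u2); split=> //=.
  - by move=> x /ltW hx; rewrite u10// u20.
  - by apply: filterS2 u1e u2e => x -> ->.
have [hf1 [hf1s hf1e]] : exists h, smooth_on setT h /\ forall j x, `|x - xj j| < `|xj j - x0| / 4 -> h x = (F j).1 x.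
  by apply: (glue_series rho0 rhoS) => [j|j x /=|j]; case: (HF j) => -[? ?] h ? [? ?] // /h[].
have [hf2 [hf2s hf2e]] : exists h, smooth_on setT h /\ forall j x, `|x - xj j| < `|xj j - x0| / 4 -> h x = (F j).2 x.
  by apply: (glue_series rho0 rhoS) => [j|j x /=|j]; case: (HF j) => -[? ?] h ? [? ?] // /h[].
have [hg1 [hg1s hg1e]] : exists h, smooth_on setT h /\ forall j x, `|x - xj j| < `|xj j - x0| / 4 -> h x = (G j).2.1 x.
  by apply: (glue_series rho0 rhoS) => [j|j x /=|j]; case: (HG j) => ? -[? ?] h ? [? ?] // /h[].
have [hg2 [hg2s hg2e]] : exists h, smooth_on setT h /\ forall j x, `|x - xj j| < `|xj j - x0| / 4 -> h x = (G j).2.2 x.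
  by apply: (glue_series rho0 rhoS) => [j|j x /=|j]; case: (HG j) => ? -[? ?] h ? [? ?] // /h[].
have smT (h : 'rV[R]_n -> R) (S : set 'rV[R]_n) : smooth_on setT h -> smooth_on S h.
  by move=> hs k; apply: Ck_sub (hs k).
pose FF : cinf U0 := mk_cinf (msmooth_pair ac (oset_open U0) U0c (smT _ _ hf1s) (smT _ _ hf2s)).
pose GG : cinf U0 := mk_cinf (msmooth_pair ac (oset_open U0) U0c (smT _ _ hg1s) (smT _ _ hg2s)).
have val j : B U0 FF GG (qj j) = j.+1%:R.
  have [a0 _ _ ge _] := HG j; have [_ _ fe _] := HF j.
  have near_q : \forall q \near qj j, Wj j q /\
      (FF q = ((j.+1%:R / (G j).1)%:C%C *: fj j : cinf (Wj j)) q /\ GG q = (((G j).1)%:C%C *: gj j : cinf (Wj j)) q).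
    have n1 : \forall q \near qj j, Wj j q.
      by apply: open_nbhs_nbhs; split => //; exact: oset_open.
    have n2 : \forall x \near xj j, `|x - xj j| < `|xj j - x0| / 4.
      apply/nbhs_ballP; exists (`|xj j - x0| / 4) => //= x.
      by rewrite -ball_normE /= distrC.
    have n3 : \forall q \near qj j, hf1 (cfun c q) = (F j).1 (cfun c q) /\ hf2 (cfun c q) = (F j).2 (cfun c q) /\
       hg1 (cfun c q) = (G j).2.1 (cfun c q) /\ hg2 (cfun c q) = (G j).2.2 (cfun c q).
      have n2' : \forall q \near qj j, `|cfun c q - xj j| < `|xj j - x0| / 4.
        exact: (cfun_continuous (Wc j _ (Wq j)) n2).
      by apply: filterS n2' => q hq; rewrite (hf1e j _ hq) (hf2e j _ hq) (hg1e j _ hq) (hg2e j _ hq).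
    have n4 : \forall q \near qj j, (F j).1 (cfun c q) = complex.Re (((j.+1%:R / (G j).1)%:C%C *: fj j : cinf (Wj j)) (cinv c (cfun c q))) /\
         (F j).2 (cfun c q) = complex.Im (((j.+1%:R / (G j).1)%:C%C *: fj j : cinf (Wj j)) (cinv c (cfun c q))).
      exact: (cfun_continuous (Wc j _ (Wq j)) fe).
    have n5 : \forall q \near qj j, (G j).2.1 (cfun c q) = (G j).1 * complex.Re (gj j (cinv c (cfun c q))) /\
         (G j).2.2 (cfun c q) = (G j).1 * complex.Im (gj j (cinv c (cfun c q))).
      exact: (cfun_continuous (Wc j _ (Wq j)) ge).
    have n45 := filterI n4 n5.
    apply: filterS3 n1 n3 (n45 (nbhs_filter _)) => q Wjq [e1 [e2 [e3 e4]]] [[e5 e6] [e7 e8]].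
    have U0q := WU0 j q Wjq; have cq := Wc j q Wjq.
    have FFE : FF q = Complex (hf1 (cfun c q)) (hf2 (cfun c q)) by exact: mk_cinfE.
    have GGE : GG q = Complex (hg1 (cfun c q)) (hg2 (cfun c q)) by exact: mk_cinfE.
    split=> //; rewrite FFE GGE e1 e2 e3 e4 e5 e6 e7 e8 cfunK//; split.
      by case: (cinf_val _ q).
    rewrite cinfZ//; case: (gj j q) => a b.
    by apply/eqP; rewrite eq_complex /= !mul0r subr0 addr0 !eqxx.
  have [S [oS Sq HS]] := near_open near_q.
  rewrite (bop_germ (W := Opens oS) (V' := Wj j) B (f' := (j.+1%:R / (G j).1)%:C%C *: fj j) (g' := ((G j).1)%:C%C *: gj j) U0U _ _ (Wq j)) //.
  - rewrite bopZ0; last by move=> z /WU0/U0U.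
    rewrite cinfZ// B1 mulr1 -rmorphM /= divfK ?gt_eqF// rmorph_nat.
    by [].
  - by move=> z /WU0/U0U.
  - exact: WU0.
  - by move=> q _ _ /HS [_ []].
pose phi x := complex.Re (B U0 FF GG (cinv c x)).
have phi_c : {for x0, continuous phi}.
  have [/(_ 0%N) h _] := cinf_smooth (B U0 FF GG) ac.
  by apply: (Ck_continuous h); exists p.
(* A rate of convergence: the distance to [x0] is of size 1/(j+1), so one index [j] can be chosen
   both larger than [C] and with [xj j] within [d] of [x0]. *)
have geo j : `|xj j - x0| * j.+1%:R <= `|xj 0%N - x0|.
  elim: j => [|j IH]; first by rewrite mulr1.
  apply: le_trans IH; apply: (@le_trans _ _ (`|xj j - x0| / 4 * j.+2%:R)).
    by rewrite ler_wpM2r// rhoS.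
  rewrite -mulrA ler_wpM2l// ler_pdivrMl// -natrM ler_nat mulnC; lia.
have /cvgrPdist_le/(_ _ ltr01)/nbhs_ballP[d /= d0 hd] : phi x @[x --> x0] --> phi x0 by exact: phi_c.
pose C := `|phi x0| + 1 + `|xj 0%N - x0| / d.
have C0 : 0 <= C by rewrite addr_ge0 ?divr_ge0 ?ltW// ltW.
have := archi_boundP C0; set j := Num.bound C => hj.
have C1 : C < j.+1%:R by rewrite (lt_le_trans hj)// ler_nat.
have xjd : `|xj j - x0| < d.
  have := geo j; rewrite -ler_pdivlMr// => /le_lt_trans; apply.
  rewrite ltr_pdivrMr// mulrC -ltr_pdivrMr//; apply: le_lt_trans C1.
  by rewrite /C lerDr addr_ge0.
have := hd (xj j); rewrite -ball_normE /= distrC => /(_ xjd).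
have phij : phi (xj j) = j.+1%:R.
  by rewrite /phi /xj (cfunK (Wc j _ (Wq j))) val -(rmorph_nat (@real_complex R)).
have : 0 <= `|xj 0%N - x0| / d by rewrite divr_ge0// ltW.
rewrite phij; move: C1; rewrite /C; set b := `|xj 0%N - x0| / d; set a := phi x0.
by have := ler_norm (- (a - j.+1%:R)); rewrite normrN; have := ler_norm a; lra.
Qed.

(** In dimension 0 no other point exists in the chart, but there a function vanishing at [q] is
    zero; this is the alternative [n = 0]. In positive dimension the left version is applied to [B]
    and to [bop_swap B]. *)
Lemma peetre U (B : bop U) p : U p -> cdom c p -> exists (V : opens M) (K : nat),
  [/\ V p, V `<=` U, V `<=` cdom c & forall W (f g : cinf W) q, V q -> W q -> W `<=` V ->
    q <> p \/ n = 0%N -> J c K f q \/ J c K g q -> B W f g q = 0].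
Proof.
move=> Up cp.
have [n0|n0] := eqVneq n 0%N.
  exists (capo U (cdomo c)), 1%N; split=> //; try by move=> q [].
  move=> W f g q [Uq cq] Wq WV _ hJ.
  have WU : W `<=` U by move=> z /WV [].
  have key (h : cinf W) : J c 1 h q -> h = 0.
    move=> [hq _]; apply: cinf_inj => z Wz; rewrite cinf0//.
    have cz : cdom c z by have [] := WV _ Wz.
    suff -> : z = q by [].
    rewrite -(cfunK cz) -(cfunK cq); congr (cinv c _).
    by apply/rowP => i; have := ltn_ord i; rewrite {2}n0.
  case: hJ => /key ->; first by rewrite bop0l// cinf0.
  by rewrite -[B W f 0]/(bop_swap B W 0 f) bop0l// cinf0.
have [V1 [K1 [V1p V1U V1c H1]]] := peetre_left B Up cp.
have [V2 [K2 [V2p V2U V2c H2]]] := peetre_left (bop_swap B) Up cp.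
exists (capo V1 V2), (maxn K1 K2); split=> //; try by move=> q [/V1U].
  by move=> q [/V1c].
move=> W f g q [V1q V2q] Wq WV [qp|nn]; last by rewrite nn in n0.
have W1 : W `<=` V1 by move=> z /WV [].
have W2 : W `<=` V2 by move=> z /WV [].
have Wc : W `<=` cdom c by move=> z /W1/V1c.
case=> hJ.
  by apply: H1 => //; apply: (J_mono ac Wc Wq _ hJ); rewrite leq_maxl.
by apply: (H2 W g f) => //; apply: (J_mono ac Wc Wq _ hJ); rewrite leq_maxr.
Qed.

(** Recovers the point excluded in [peetre]: in positive dimension [p] is not isolated in the chart,
    and continuity applies. *)
Lemma cinf_eq0_dense V (f : cinf V) p : V `<=` cdom c ->
  (forall q, V q -> q <> p \/ n = 0%N -> f q = 0) -> f = 0.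
Proof.
move=> Vc H; apply: cinf_inj => q Vq; rewrite cinf0//.
have [n0|n0] := eqVneq n 0%N; first by apply: H => //; right.
have [qp|qp] := pselect (q = p); last exact: H Vq (or_introl qp).
have oV : open (cfun c @` V).
  by have := @cimg_openI R n M c V (oset_open V); rewrite setIidr.
set x0 := cfun c q.
have Vx0 : (cfun c @` V) x0 by exists q.
have key (u : 'rV[R]_n -> R) : {for x0, continuous u} ->
    (forall x, (cfun c @` V) x -> x <> x0 -> u x = 0) -> u x0 = 0.
  move=> uc u0; apply/eqP/negPn/negP => un0.
  have e0 : 0 < `|u x0| / 2 by rewrite divr_gt0// normr_gt0.
  have h1 : \forall x \near x0, `|u x0 - u x| <= `|u x0| / 2.
    by have /cvgrPdist_le/(_ _ e0) := uc.
  have h2 : \forall x \near x0, (cfun c @` V) x by exact: open_nbhs_nbhs.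
  have : \forall x \near x0, `|u x0 - u x| <= `|u x0| / 2 /\ (cfun c @` V) x.
    exact: filterI.
  move=> /nbhs_ballP[d /= d0 hd].
  have i : 'I_n by move: n0; case: (n) => // m _; exact: ord0.
  pose x := x0 + (d / 2) *: delta_mx 0 i.
  have xx0 : x - x0 = (d / 2) *: delta_mx 0 i by rewrite /x [x0 + _]addrC addrK.
  have [|hx1 hx2] := hd x.
    rewrite -ball_normE /= distrC xx0; apply: normrV_lt => // j; rewrite !mxE eqxx /=.
    case: (j == i); rewrite ?mulr0 ?normr0// mulr1 gtr0_norm ?divr_gt0//; lra.
  move: hx1; rewrite (u0 x) ?subr0//.
    by apply/negP; rewrite -ltNge ltr_pdivrMr// ltr_pMr ?normr_gt0// ltr1n.
  move=> /eqP; rewrite -subr_eq0 xx0 => /eqP/rowP/(_ i)/eqP; rewrite !mxE !eqxx mulr1.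
  by apply/negP; rewrite gt_eqF// divr_gt0.
have [/(_ 0%N) s1 /(_ 0%N) s2] := cinf_smooth f ac.
have Vx0' : (cfun c @` (cdom c `&` V)) x0 by exists q => //; split=> //; exact: Vc.
have z x : (cfun c @` V) x -> x <> x0 -> f (cinv c x) = 0.
  move=> [r Vr <-] rx; have cr := Vc _ Vr; rewrite cfunK//; apply: H => //; left => rp.
  by apply: rx; rewrite rp -qp.
have r1 := key _ (Ck_continuous s1 Vx0').
have r2 := key _ (Ck_continuous s2 Vx0').
have e1 : complex.Re (f q) = 0.
  by rewrite -[in f q](cfunK (Vc q Vq)); apply: r1 => x hx hxx; rewrite z.
have e2 : complex.Im (f q) = 0.
  by rewrite -[in f q](cfunK (Vc q Vq)); apply: r2 => x hx hxx; rewrite z.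
by apply/eqP; rewrite eq_complex e1 e2 !eqxx.
Qed.

End Peetre.

(** * Darboux coordinates at a point *)

Section TangentSpace.
Variables (R : realType) (n : nat) (M : manifold R n).
Variables (w : two_form M) (P : M -> set (tvec M)).
Hypothesis hw : symplectic w.
Implicit Types (u v : tvec M) (p : M) (U V W : opens M).

Lemma tangent_comb p (a : R[i]) u v : tangent p u -> tangent p v ->
  tangent p (fun f => a * u f + v f).
Proof.
move=> hu hv; split.
- move=> b f g hf hg; rewrite (tangent_linear hu)// (tangent_linear hv)//; ring.
- move=> f g hf hg; rewrite (tangent_leibniz hu)// (tangent_leibniz hv)//; ring.
- by move=> U f g Up fg; rewrite (tangent_germ hu Up fg) (tangent_germ hv Up fg).
- by move=> f hf; rewrite (tangent_junk hu)// (tangent_junk hv)// mulr0 addr0.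
Qed.

Lemma tangent0 p : tangent p (fun=> 0).
Proof. by split=> // *; rewrite ?mulr0 ?mul0r ?addr0. Qed.

Lemma tangent_sum p I (r : seq I) (a : I -> R[i]) (X : I -> tvec M) :
  (forall i, tangent p (X i)) -> tangent p (fun f => \sum_(i <- r) a i * X i f).
Proof.
move=> hX; elim: r => [|i r IH].
  have -> : (fun f => \sum_(i <- [::]) a i * X i f) = (fun=> 0); last exact: tangent0.
  by apply/funext => f; rewrite big_nil.
have -> : (fun f => \sum_(j <- i :: r) a j * X j f) = (fun f => a i * X i f + \sum_(j <- r) a j * X j f).
  by apply/funext => f; rewrite big_cons.
exact: tangent_comb.
Qed.

Section AtPoint.
Variables (U : opens M) (x y : 'I_n./2 -> M -> R[i]) (hD : darboux_chart w P U x y).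
Variables (p : M) (Up : U p).

Lemma darboux_inj u : tangent p u -> (forall i, u (x i) = 0) -> (forall i, u (y i) = 0) ->
  forall f, u f = 0.
Proof.
move=> hu ux uy; apply: (sympl_nondegenerate hw hu) => v hv.
have [_ _ /(_ p Up) E _] := hD; rewrite E// big1// => i _.
by rewrite ux uy mul0r mulr0 subrr.
Qed.

Lemma darboux_eq u v : tangent p u -> tangent p v -> (forall i, u (x i) = v (x i)) ->
  (forall i, u (y i) = v (y i)) -> u = v.
Proof.
move=> hu hv ux uy; apply/funext => f.
have h := darboux_inj (tangent_comb (-1) hv hu).
apply/eqP; rewrite -subr_eq0 -mulN1r addrC h// => i; rewrite ?ux ?uy mulN1r addNr//.
Qed.

Variables (c : chart R n M) (ac : atlas c) (cp : cdom c p).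
Let E i := coord_tvec c i p.
Let hE i : tangent p (E i). Proof. exact: tangent_coord. Qed.
Let Ecoord i j : E i (coordf c j) = (i == j)%:R.
Proof.
rewrite /E /coord_tvec asboolT; first exact: pderiv_coordf.
by exists (cdomo c) => //; exact: msmooth_coordf.
Qed.

Let Jm : 'M[R[i]]_(n, n./2 + n./2) :=
  \matrix_(i, j) match fintype.split j with inl k => E i (x k) | inr k => E i (y k) end.

Let JmE (a : 'rV[R[i]]_n) : (forall j, (a *m Jm) 0 (lshift _ j) = \sum_i a 0 i * E i (x j)) /\
  (forall j, (a *m Jm) 0 (rshift _ j) = \sum_i a 0 i * E i (y j)).
Proof.
split=> j; rewrite mxE; apply: eq_bigr => i _; rewrite mxE; congr (_ * _).
  by rewrite (unsplitK (inl j)).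
by rewrite (unsplitK (inr j)).
Qed.

(** The Jacobian matrix of the Darboux functions has [n] rows, independent by nondegeneracy, and at
    most [n] columns. It is therefore square and invertible, and [n] is even. *)
Lemma darboux_half : (n./2 + n./2 = n)%N /\ row_full Jm.
Proof.
have rf : row_free Jm.
  apply: inj_row_free => a aJ; apply/rowP => j; rewrite [RHS]mxE.
  have [h1 h2] := JmE a.
  have hu := tangent_sum (index_enum 'I_n) (a 0) hE.
  have := darboux_inj hu _ _ (coordf c j).
  rewrite (bigD1 j)//= Ecoord eqxx mulr1 big1 ?addr0; last first.
    by move=> i /negbTE ij; rewrite Ecoord ij mulr0.
  by apply => i; rewrite -?h1 -?h2 aJ mxE.
have le1 : (n./2 + n./2 <= n)%N by rewrite addnn -{2}(odd_double_half n) leq_addl.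
have le2 : (n <= n./2 + n./2)%N by rewrite -{1}(eqP rf); exact: rank_leq_col.
have e : (n./2 + n./2 = n)%N by apply/eqP; rewrite eqn_leq le1.
by split=> //; rewrite /row_full (eqP rf) eq_sym; apply/eqP.
Qed.

Lemma darboux_span (a b : 'I_n./2 -> R[i]) : exists d : 'I_n -> R[i],
  (forall j, \sum_i d i * E i (x j) = a j) /\ (forall j, \sum_i d i * E i (y j) = b j).
Proof.
have [_ rf] := darboux_half.
pose r : 'rV[R[i]]_(n./2 + n./2) := row_mx (\row_j a j) (\row_j b j).
have /submxP[D rD] : (r <= Jm)%MS by exact: submx_full.
have [h1 h2] := JmE D.
exists (D 0); split=> j; first by rewrite -h1 -rD row_mxEl mxE.
by rewrite -h2 -rD row_mxEr mxE.
Qed.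

Lemma darboux_dual (a b : 'I_n./2 -> R[i]) : exists2 X, tangent p X &
  (forall j, X (x j) = a j) /\ (forall j, X (y j) = b j).
Proof.
have [d h] := darboux_span a b.
by exists (fun f => \sum_i d i * E i f) => //; exact: tangent_sum.
Qed.

(** A tangent vector is determined by its values on the Darboux functions, and combinations of the
    coordinate vectors attain all such values. Counting dimensions in this way replaces the Taylor
    expansion of [f]. *)
Lemma tangent_coordE v f : tangent p v -> v f = \sum_i v (coordf c i) * E i f.
Proof.
move=> hv; have [d [h1 h2]] := darboux_span (fun j => v (x j)) (fun j => v (y j)).
have e : v = fun f => \sum_i d i * E i f.
  by apply: darboux_eq => //; exact: tangent_sum.
have -> : v f = \sum_i d i * E i f by rewrite {1}e.
apply: eq_bigr => i _; congr (_ * _).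
rewrite e (bigD1 i)//= Ecoord eqxx mulr1 big1 ?addr0// => j /negbTE ji.
by rewrite Ecoord ji mulr0.
Qed.

(** The set in the definition of [hamiltonian] is inhabited: expanding [v f] in the vectors [ex i],
    [ey i] dual to the Darboux functions leads to the values [ey i f] on [x i] and [- ex i f] on
    [y i]. *)
Lemma hamiltonianP f : tangent p (hamiltonian w p f) /\
  forall v, tangent p v -> w p v (hamiltonian w p f) = v f.
Proof.
have [_ _ /(_ p Up) wE _] := hD.
suff [X HX] : exists X, [set X | tangent p X /\ forall v, tangent p v -> w p v X = v f] X.
  exact: (@xgetPex _ (fun=> 0) [set X | tangent p X /\ forall v, tangent p v -> w p v X = v f] (ex_intro _ X HX)).
have /choice[ex hex] i : exists X, tangent p X /\ ((forall j, X (x j) = (i == j)%:R) /\ forall j, X (y j) = 0).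
  by have [X hX h] := darboux_dual (fun j => (i == j)%:R) (fun=> 0); exists X.
have /choice[ey hey] i : exists X, tangent p X /\ ((forall j, X (x j) = 0) /\ forall j, X (y j) = (i == j)%:R).
  by have [X hX h] := darboux_dual (fun=> 0) (fun j => (i == j)%:R); exists X.
have dec v : tangent p v -> forall f, v f = \sum_i v (x i) * ex i f + \sum_i v (y i) * ey i f.
  move=> hv g.
  have h1 : tangent p (fun f => \sum_i v (x i) * ex i f) by apply: tangent_sum => i; case: (hex i).
  have h2 : tangent p (fun f => \sum_i v (y i) * ey i f) by apply: tangent_sum => i; case: (hey i).
  have h3 := tangent_comb 1 h1 h2.
  rewrite [LHS](congr1 (fun u => u g) (darboux_eq hv h3 _ _)) ?mul1r// => j.
    rewrite mul1r [X in _ = _ + X]big1 ?addr0; last by move=> i _; have [_ [-> _]] := hey i; rewrite mulr0.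
    rewrite (bigD1 j)//= big1 ?addr0; first by have [_ [-> _]] := hex j; rewrite eqxx mulr1.
    by move=> i /negbTE ij; have [_ [-> _]] := hex i; rewrite ij mulr0.
  rewrite mul1r [X in _ = X + _]big1 ?add0r; last by move=> i _; have [_ [_ ->]] := hex i; rewrite mulr0.
  rewrite (bigD1 j)//= big1 ?addr0; first by have [_ [_ ->]] := hey j; rewrite eqxx mulr1.
  by move=> i /negbTE ij; have [_ [_ ->]] := hey i; rewrite ij mulr0.
have [X hX [X1 X2]] := darboux_dual (fun i => ey i f) (fun i => - ex i f).
exists X; split=> // v hv; rewrite wE// (dec v hv f) -big_split /=.
by apply: eq_bigr => i _; rewrite X1 X2; ring.
Qed.

Lemma hamiltonian_x i : (forall j, hamiltonian w p (x i) (x j) = 0) /\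
  (forall j, hamiltonian w p (x i) (y j) = - (i == j)%:R).
Proof.
have [_ _ /(_ p Up) wE _] := hD.
have [hX HX] := hamiltonianP (x i).
split=> j.
  have [v hv [v1 v2]] := darboux_dual (fun=> 0) (fun k => (k == j)%:R).
  have := HX v hv; rewrite wE// v1 (bigD1 j)//= v2 v1 eqxx mul1r mulr0 subr0 big1 ?addr0//.
  by move=> k /negbTE kj; rewrite v1 v2 kj mul0r mulr0 subrr.
have [v hv [v1 v2]] := darboux_dual (fun k => (k == j)%:R) (fun=> 0).
have := HX v hv; rewrite wE// v1 (bigD1 j)//= v2 v1 eqxx mul0r mulr1 sub0r big1 ?addr0 => [<-|]; first by rewrite opprK.
by move=> k /negbTE kj; rewrite v1 v2 kj mul0r mulr0 subrr.
Qed.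

Lemma hamiltonian_y i : (forall j, hamiltonian w p (y i) (x j) = (i == j)%:R) /\
  (forall j, hamiltonian w p (y i) (y j) = 0).
Proof.
have [_ _ /(_ p Up) wE _] := hD.
have [hX HX] := hamiltonianP (y i).
split=> j.
  have [v hv [v1 v2]] := darboux_dual (fun=> 0) (fun k => (k == j)%:R).
  have := HX v hv; rewrite wE// v2 (bigD1 j)//= v2 v1 eqxx mul1r mulr0 subr0 big1 ?addr0//.
  by move=> k /negbTE kj; rewrite v1 v2 kj mul0r mulr0 subrr.
have [v hv [v1 v2]] := darboux_dual (fun k => (k == j)%:R) (fun=> 0).
have := HX v hv; rewrite wE// v2 (bigD1 j)//= v2 v1 eqxx mul0r mulr1 sub0r big1 ?addr0 => [/(canRL opprK)|]; first by rewrite oppr0.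
by move=> k /negbTE kj; rewrite v1 v2 kj mul0r mulr0 subrr.
Qed.

End AtPoint.

Definition is_der U (D : lop U) := forall V, V `<=` U -> forall f g : cinf V,
  D V (f * g) = D V f * g + f * D V g.

Lemma is_derD U (D D' : lop U) : is_der D -> is_der D' -> is_der (D + D').
Proof. by move=> h h' V VU f g; rewrite !lopDE h// h'//; ring. Qed.
Lemma is_derN U (D : lop U) : is_der D -> is_der (- D).
Proof. by move=> h V VU f g; rewrite !lopNE h//; ring. Qed.
Lemma is_derB U (D D' : lop U) : is_der D -> is_der D' -> is_der (D - D').
Proof. by move=> h h'; apply: is_derD => //; exact: is_derN. Qed.
Lemma is_der0 U : is_der (0 : lop U).
Proof. by move=> V VU f g; rewrite !lop0E; ring. Qed.
Lemma is_der_sum U I (r : seq I) (D : I -> lop U) : (forall i, is_der (D i)) ->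
  is_der (\sum_(i <- r) D i).
Proof.
move=> h; elim: r => [|i r IH]; first by rewrite big_nil; exact: is_der0.
by rewrite big_cons; exact: is_derD.
Qed.
Lemma is_der_mop U (h : cinf U) (D : lop U) : is_der D -> is_der (mop h * D).
Proof. by move=> hD V VU f g; rewrite !lopME !(mopE _ VU) hD//; ring. Qed.
Lemma is_der_comm U (D D' : lop U) : is_der D -> is_der D' -> is_der (D * D' - D' * D).
Proof.
by move=> h h' V VU f g; rewrite !lopBE !lopME !h// !h'// !lopD !h// !h'//; ring.
Qed.
Lemma is_der_restr U U' (UU : U' `<=` U) (D : lop U) : is_der D -> is_der (restr UU D).
Proof. by move=> h V VU f g; rewrite !restrE// h//; exact: subset_trans UU. Qed.
Lemma is_der1 U (D : lop U) V (VU : V `<=` U) : is_der D -> D V 1 = 0.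
Proof.
move=> h; have := h V VU 1 1; rewrite !mulr1 mul1r => e.
by apply: (addrI (D V 1)); rewrite -e addr0.
Qed.

(** Passage from sheaf derivations to the pointwise vectors of [tangent], with the same value 0 on
    functions that are not smooth near [p]. By locality the chosen neighbourhood does not affect the
    value. *)
Definition lop_at U (N : lop U) p : tvec M := fun f =>
  if pselect (exists V, [/\ V p, V `<=` U & msmooth V f]) is left h then
    N _ (mk_cinf (let: And3 _ _ hf := projT2 (cid h) in hf)) p else 0.

Lemma lop_atE U (N : lop U) p V f (hf : msmooth V f) (g : cinf V) : V `<=` U -> V p ->
  (forall q, V q -> g q = f q) -> lop_at N p f = N V g p.
Proof.
move=> VU Vp gf; rewrite /lop_at; case: pselect => [h|[]]; last by exists V.
case: (cid h) => V' [Vp' VU' hf'] /=; apply: (@lop_germ R n M U N _ _ V) => //.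
by move=> q Vq' Vq _; rewrite mk_cinfE// gf.
Qed.

Lemma lop_atcE U (N : lop U) p V (f : cinf V) : V `<=` U -> V p -> lop_at N p f = N V f p.
Proof. by move=> VU Vp; exact: (lop_atE N (cinf_smooth f)). Qed.

Lemma tangent_lop U (N : lop U) p : U p -> is_der N -> tangent p (lop_at N p).
Proof.
move=> Up hN.
have sn f : smooth_near p f -> exists V, [/\ V p, V `<=` U & msmooth V f].
  move=> [V Vp hf]; exists (capo U V); split=> //; first exact: capol.
  by apply: msmooth_sub hf; exact: capor.
split.
- move=> a f g /sn[V [Vp VU hf]] /sn[W [Wp WU hg]].
  pose Z := capo V W; have ZV : Z `<=` V by exact: capol.
  have ZU : Z `<=` U by exact: subset_trans VU.
  have hf' := msmooth_sub ZV hf; have hg' := msmooth_sub (@capor _ _ _ V W) hg.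
  have Zp : Z p by [].
  have hfg := cinf_smooth (a *: mk_cinf hf' + mk_cinf hg').
  have e q : Z q -> (a *: mk_cinf hf' + mk_cinf hg') q = a * f q + g q.
    by move=> Zq; rewrite cinfD// cinfZ// !mk_cinfE.
  rewrite (lop_atE N (msmooth_ext (oset_open Z) e hfg) ZU Zp e) (lop_atE N hf' (g := mk_cinf hf') ZU Zp); last by move=> q Zq; rewrite mk_cinfE.
  rewrite (lop_atE N hg' (g := mk_cinf hg') ZU Zp); last by move=> q Zq; rewrite mk_cinfE.
  by rewrite lop_lin// cinfD// cinfZ.
- move=> f g /sn[V [Vp VU hf]] /sn[W [Wp WU hg]].
  pose Z := capo V W; have ZV : Z `<=` V by exact: capol.
  have ZU : Z `<=` U by exact: subset_trans VU.
  have hf' := msmooth_sub ZV hf; have hg' := msmooth_sub (@capor _ _ _ V W) hg.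
  have Zp : Z p by [].
  have hfg := cinf_smooth (mk_cinf hf' * mk_cinf hg').
  have e q : Z q -> (mk_cinf hf' * mk_cinf hg') q = f q * g q.
    by move=> Zq; rewrite cinfM// !mk_cinfE.
  rewrite (lop_atE N (msmooth_ext (oset_open Z) e hfg) ZU Zp e) (lop_atE N hf' (g := mk_cinf hf') ZU Zp); last by move=> q Zq; rewrite mk_cinfE.
  rewrite (lop_atE N hg' (g := mk_cinf hg') ZU Zp); last by move=> q Zq; rewrite mk_cinfE.
  by rewrite hN// cinfD// !cinfM// !mk_cinfE.
- move=> V f g Vp fg.
  have key f' g' : (forall q, V q -> f' q = g' q) -> smooth_near p f' -> lop_at N p f' = lop_at N p g'.
    move=> fg' /sn[W [Wp WU hf]]; pose Z := capo V W.
    have ZU : Z `<=` U by move=> q [_ /WU].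
    have hf' := msmooth_sub (@capor _ _ _ V W) hf.
    have Zp : Z p by [].
    rewrite (lop_atE N hf' (g := mk_cinf hf') ZU Zp); last by move=> q Zq; rewrite mk_cinfE.
    have hg' : msmooth Z g' by apply: msmooth_ext hf' => [|q [Vq _]]; [exact: oset_open | exact: fg'].
    rewrite (lop_atE N hg' (g := mk_cinf hf') ZU Zp)// => q Zq; rewrite mk_cinfE//; case: Zq => Vq _; exact: fg'.
  have [hf|hf] := pselect (smooth_near p f); first exact: key.
  have [hg|hg] := pselect (smooth_near p g); first by apply/esym/key => // q /fg.
  rewrite /lop_at; case: pselect => [[W [Wp WU h]]|_]; first by exfalso; apply: hf; exists W.
  by case: pselect => // -[W [Wp WU h]]; exfalso; apply: hg; exists W.
- move=> f hf; rewrite /lop_at; case: pselect => // -[W [Wp WU h]].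
  by exfalso; apply: hf; exists W.
Qed.

Lemma is_der_dop (c : chart R n M) (ac : atlas c) i : is_der (dop ac i).
Proof. by move=> V VU f g; exact: dopM. Qed.

Lemma is_der_eq0 U V0 (VU0 : V0 `<=` U) (x y : 'I_n./2 -> M -> R[i])
  (hD : darboux_chart w P U x y) (N : lop V0) : is_der N ->
  (forall V i, V `<=` V0 -> forall f : cinf V, (forall q, V q -> f q = x i q) -> N V f = 0) ->
  (forall V i, V `<=` V0 -> forall f : cinf V, (forall q, V q -> f q = y i q) -> N V f = 0) -> N = 0.
Proof.
move=> hN Nx Ny; apply: lopP => V VV0 f; rewrite lop0E; apply: cinf_inj => p Vp; rewrite cinf0//.
have V0p := VV0 p Vp; have hT := tangent_lop V0p hN.
have [/(_ _) hxy _ _ _] := hD.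
rewrite -(lop_atcE N f VV0 Vp); apply: (darboux_inj hD (VU0 p V0p) hT) => i.
  have [hx _] := hxy i; have hx' := msmooth_sub VU0 hx.
  rewrite (lop_atE N hx' (g := mk_cinf hx') (@subset_refl _ _) V0p); last by move=> q Vq; rewrite mk_cinfE.
  by rewrite (Nx V0 i) ?cinf0// => q Vq; rewrite mk_cinfE.
have [_ hy] := hxy i; have hy' := msmooth_sub VU0 hy.
rewrite (lop_atE N hy' (g := mk_cinf hy') (@subset_refl _ _) V0p); last by move=> q Vq; rewrite mk_cinfE.
by rewrite (Ny V0 i) ?cinf0// => q Vq; rewrite mk_cinfE.
Qed.

End TangentSpace.

(** * Operators commuting with coordinates *)

Section LocallyFinite.
Variables (R : realType) (n : nat) (M : manifold R n).
Implicit Types (U V W : opens M).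

Definition vanishes_on U (N : lop U) V := forall W, W `<=` V -> forall f : cinf W, N W f = 0.

Lemma vanishes_val U (N : lop U) V W (f : cinf W) q : vanishes_on N V -> V `<=` U -> W `<=` U ->
  V q -> W q -> N W f q = 0.
Proof.
move=> hN VU WU Vq Wq; have := lop_res N (@capor _ _ _ V W) WU f.
rewrite (hN _ (@capol _ _ _ V W)) => /(congr1 (fun h : cinf (capo V W) => h q)).
by rewrite cinf_resE// cinf0.
Qed.

Definition locally_finite U (F : nat -> lop U) := forall p, U p ->
  exists (V : opens M) (K : nat), [/\ V p, V `<=` U & forall k, (K <= k)%N -> vanishes_on (F k) V].

(** The value at [p] is a sum truncated at an index valid near [p]. Any two valid truncations agree,
    so near each point the result is a finite sum of smooth sections. *)
Lemma lfs U (F : nat -> lop U) : locally_finite F -> exists S : lop U,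
  forall V K, V `<=` U -> (forall k, (K <= k)%N -> vanishes_on (F k) V) ->
  forall W, W `<=` V -> forall f : cinf W, S W f = \sum_(k < K) F k W f.
Proof.
move=> hF.
have /choice[VK hVK] (p : M) : exists VK : opens M * nat, U p ->
    [/\ VK.1 p, VK.1 `<=` U & forall k, (VK.2 <= k)%N -> vanishes_on (F k) VK.1].
  case: (pselect (U p)) => [/hF[V [K h]]|h]; first by exists (V, K).
  by exists (U, 0%N).
pose K p := (VK p).2.
have sum_eq V (K1 K2 : nat) (f : cinf V) q : V q -> (K1 <= K2)%N ->
    (forall k, (K1 <= k)%N -> F k V f q = 0) ->
    (\sum_(k < K2) F k V f) q = (\sum_(k < K1) F k V f) q.
  move=> Vq /subnKC <-; elim: (K2 - K1)%N => [|j IH] h; first by rewrite addn0.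
  by rewrite addnS big_ord_recr cinfD// IH// h ?addr0// leq_addr.
have sum_eq' V (K1 K2 : nat) (f : cinf V) q : V q ->
    (forall k, (K1 <= k)%N -> F k V f q = 0) -> (forall k, (K2 <= k)%N -> F k V f q = 0) ->
    (\sum_(k < K2) F k V f) q = (\sum_(k < K1) F k V f) q.
  by move=> Vq h1 h2; case/orP: (leq_total K1 K2) => h; [exact: sum_eq | apply/esym/sum_eq].
pose s V (f : cinf V) (p : M) : R[i] := (\sum_(k < K p) F k V f) p.
have van V (f : cinf V) p q : V `<=` U -> V q -> U p -> (VK p).1 q -> forall k, (K p <= k)%N -> F k V f q = 0.
  move=> VU Vq Up Vpq k kK; have [_ h2 h3] := hVK p Up.
  exact: (vanishes_val _ (h3 k kK) h2 VU).
have sE V (f : cinf V) p q : V `<=` U -> V q -> U p -> (VK p).1 q -> s V f q = (\sum_(k < K p) F k V f) q.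
  move=> VU Vq Up Vpq; have Uq := VU q Vq; have [h1 _ _] := hVK q Uq.
  by apply: sum_eq' => //; [exact: van Vpq | exact: van h1].
have sS V (f : cinf V) : V `<=` U -> msmooth V (s V f).
  move=> VU; apply: msmooth_local => p Vp; have Up := VU p Vp; have [h1 h2 _] := hVK p Up.
  exists (capo V (VK p).1) => //.
  apply: msmooth_ext (cinf_smooth (cinf_res (@capol _ _ _ V (VK p).1) (\sum_(k < K p) F k V f))).
    exact: oset_open.
  by move=> q [Vq Vpq]; rewrite cinf_resE// (sE _ f p).
have [S0 HS0] : exists S0 : lop U, forall V (VU : V `<=` U) (f : cinf V), S0 V f = mk_cinf (sS V f VU).
  have h1 V (VU : V `<=` U) (a : R[i]) (f g : cinf V) : mk_cinf (sS V (a *: f + g) VU) = a *: mk_cinf (sS V f VU) + mk_cinf (sS V g VU).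
    apply: cinf_inj => p Vp; rewrite cinfD// cinfZ// !mk_cinfE// /s -cinfZ// -cinfD//.
    congr (cinf_val _ p); rewrite scaler_sumr -big_split /=.
    by apply: eq_bigr => k _; rewrite lop_lin.
  have h2 V W (WV : W `<=` V) (VU : V `<=` U) (WU : W `<=` U) (f : cinf V) :
      cinf_res WV (mk_cinf (sS V f VU)) = mk_cinf (sS W (cinf_res WV f) WU).
    apply: cinf_inj => p Wp; have Vp := WV p Wp.
    rewrite cinf_resE// !mk_cinfE// /s -(cinf_resE WV _ Wp); congr (cinf_val _ p).
    by rewrite raddf_sum; apply: eq_bigr => k _; exact: lop_res.
  by exists (build_lop h1 h2) => V VU f; rewrite (build_lopE _ _ VU).
exists S0 => V K0 VU hK W WV f; have WU := subset_trans WV VU.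
rewrite (HS0 _ WU); apply: cinf_inj => p Wp; rewrite mk_cinfE// /s.
have [h1 h2 h3] := hVK p (WU p Wp).
apply: (sum_eq' _ _ _ _ _ Wp); last exact: (van W f p p WU Wp (WU p Wp) h1).
by move=> k /hK h; rewrite (h W WV) cinf0.
Qed.

End LocallyFinite.

Section Commutators.
Variables (R : realType) (n : nat) (M : manifold R n) (U : opens M).
Implicit Types (V W : opens M) (N D S : lop U) (x : cinf U).

Definition ad x N : lop U := N * mop x - mop x * N.

Lemma adE x N V (VU : V `<=` U) (f : cinf V) :
  ad x N V f = N V (cinf_res VU x * f) - cinf_res VU x * N V f.
Proof. by rewrite /ad lopBE !lopME !(mopE _ VU). Qed.
Lemma adD x N N' : ad x (N + N') = ad x N + ad x N'.
Proof. by rewrite /ad mulrDl mulrDr opprD addrACA. Qed.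
Lemma adN x N : ad x (- N) = - ad x N.
Proof. by rewrite /ad mulNr mulrN opprB opprK addrC. Qed.
Lemma adB x N N' : ad x (N - N') = ad x N - ad x N'.
Proof. by rewrite adD adN. Qed.
Lemma ad0 x : ad x 0 = 0.
Proof. by rewrite /ad mul0r mulr0 subrr. Qed.
Lemma adZ x a N : ad x (a *: N) = a *: ad x N.
Proof. by rewrite /ad lopZl lopZr scalerBr. Qed.
Lemma adM x N N' : ad x (N * N') = ad x N * N' + N * ad x N'.
Proof. by rewrite /ad mulrBl mulrBr !mulrA [RHS]addrC subrKA. Qed.
Lemma adC x y N : ad x (ad y N) = ad y (ad x N).
Proof.
rewrite /ad !mulrBl !mulrBr -!mulrA (mopC x y) !mulrA (mopC x y).
by rewrite !opprB [LHS]addrACA [RHS]addrACA; congr (_ + _); exact: addrC.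
Qed.
Lemma ad_mop x h : ad x (mop h) = 0.
Proof. by rewrite /ad mopC subrr. Qed.
Lemma ad_sum x I (r : seq I) (F : I -> lop U) : ad x (\sum_(i <- r) F i) = \sum_(i <- r) ad x (F i).
Proof. exact: (big_morph _ (adD x) (ad0 x)). Qed.

Lemma iter_adC x y k N : ad y (iter k (ad x) N) = iter k (ad x) (ad y N).
Proof. by elim: k => //= k <-; rewrite adC. Qed.
Lemma iter_ad0 x k : iter k (ad x) 0 = 0.
Proof. by elim: k => //= k ->; rewrite ad0. Qed.

Lemma ad_der x D : is_der D -> ad x D = mop (D U x).
Proof.
move=> hD; apply: lopP => V VU f; rewrite (adE _ _ VU) (mopE _ VU) hD// addrK.
by rewrite -lop_res.
Qed.

(** Evaluated at [q], a commutator with [x] is composition with [x - x q], because the constant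
    [x q] passes through the operator. *)
Lemma iter_ad_val x D k V (VU : V `<=` U) (f : cinf V) q : V q ->
  iter k (ad x) D V f q = D V ((cinf_res VU x - cinf_cst V (x q)) ^+ k * f) q.
Proof.
move=> Vq; elim: k f => [|k IH] f; first by rewrite expr0 mul1r.
rewrite iterS (adE _ _ VU) cinfB// cinfM// cinf_resE//.
have -> : x q * iter k (ad x) D V f q = iter k (ad x) D V (cinf_cst V (x q) * f) q.
  by rewrite cinf_cst_mul lopZ cinfZ.
rewrite -cinfB// -lopB -mulrBl IH; congr (cinf_val (D V _) q).
by rewrite exprSr mulrA.
Qed.

(** The power in [iter_ad_val] vanishes to order [k] at [q], so Peetre's theorem kills it for large
    [k]. The exponent depends on the neighbourhood, hence nilpotency is only local. *)
Lemma nilpotent_ad x D p : U p -> (exists2 c : chart R n M, atlas c & cdom c p) ->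
  exists (V : opens M) (K : nat), [/\ V p, V `<=` U &
    forall k, (K <= k)%N -> vanishes_on (iter k (ad x) D) V].
Proof.
move=> Up [c ac cp]; have [V [K [Vp VU Vc H]]] := peetre ac (bop_lop D) Up cp.
exists V, K; split=> // k Kk W WV f.
have WU := subset_trans WV VU; have Wc := subset_trans WV Vc.
apply: (cinf_eq0_dense (p := p) ac Wc) => q Wq hq; rewrite (iter_ad_val _ _ _ WU)//.
set g := _ * f; have := H W g 1 q (WV q Wq) Wq WV hq.
rewrite [bop_lop D W g 1]mulr1; apply; left; apply: (J_mono ac Wc Wq Kk).
apply: (J_M ac Wc f Wq); apply: (@J_exp _ _ _ c ac k W Wc _ q Wq).
by rewrite cinfB// cinf_resE// cinf_cstE// subrr.
Qed.

Section Primitive.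
Variables (x : cinf U) (Z D : lop U).
Hypothesis hZ : is_der Z.
Hypothesis Zx : Z U x = 1.
Let a := ad x.

Let coefk (k : nat) : R[i] := (-1) ^+ k / (k.+1)`!%:R.

(** Repeated integration by parts: since the commutator of [Z] with [x] is 1, the series D Z - (ad x
    D) Z^2/2! + (ad x)^2 D Z^3/3! - ... telescopes to a primitive of [D]. With the powers of [Z] on
    the right, every term kills constants. *)
Definition primitive_term k : lop U := coefk k *: (iter k a D * Z ^+ k.+1).

Let aZ : a Z = 1. Proof. by rewrite /a ad_der// Zx mop1. Qed.

Let aZX k : a (Z ^+ k.+1) = k.+1%:R *: Z ^+ k.
Proof.
elim: k => [|k IH]; first by rewrite expr1 expr0 scale1r.
rewrite exprS /a adM -/a aZ mul1r IH lopZr -exprS -{1}[Z ^+ k.+1]scale1r -scalerDl.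
by rewrite -[1]/(1%:R) -natrD add1n.
Qed.

Lemma ad_primitive_term k : a (primitive_term k) =
  coefk k *: (iter k.+1 a D * Z ^+ k.+1) + (if k is k'.+1 then - coefk k' else 1) *: (iter k a D * Z ^+ k).
Proof.
rewrite /primitive_term /a adZ adM -/a aZX lopZr scalerDr iterS scalerA; congr (_ + _ *: _).
case: k => [|k]; first by rewrite /coefk expr0 divr1 mulr1.
rewrite /coefk factS natrM exprS invfM mulN1r !mulNr; congr (- _).
by rewrite -!mulrA; congr (_ * _); rewrite mulrCA mulVf ?mulr1 ?pnatr_eq0.
Qed.

Lemma ad_primitive_sum K : a (\sum_(k < K.+1) primitive_term k) = D + coefk K *: (iter K.+1 a D * Z ^+ K.+1).
Proof.
elim: K => [|K IH].
  by rewrite big_ord1 ad_primitive_term /= scale1r expr0 mulr1 addrC.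
rewrite big_ord_recr /a adD -/a IH ad_primitive_term -addrA; congr (_ + _).
by rewrite scaleNr addrCA subrr addr0.
Qed.

(** The last clause allows iteration over several coordinates: the primitive for [x] acquires no
    commutator with a [y] that commutes with [D] and is killed by [Z]. *)
Lemma primitive : (forall p : M, exists2 c : chart R n M, atlas c & cdom c p) ->
  exists S, [/\ a S = D, forall V, V `<=` U -> S V 1 = 0 &
  forall y, ad y D = 0 -> Z U y = 0 -> ad y S = 0].
Proof.
move=> hc.
have lf : locally_finite primitive_term.
  move=> p Up; have [V [K [Vp VU hV]]] := nilpotent_ad x D Up (hc p).
  exists V, K; split=> // k Kk W WV f.
  by rewrite /primitive_term lopZE lopME hV// scaler0.
have [S HS] := lfs lf.
have red (V : opens M) (VU : V `<=` U) p : V p -> exists (W : opens M) (K : nat),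
    [/\ W p, W `<=` V, forall k, (K <= k)%N -> vanishes_on (iter k a D) W & forall W' (f : cinf W'), W' `<=` W -> S W' f = (\sum_(k < K.+1) primitive_term k) W' f].
  move=> Vp; have [V' [K [V'p V'U hV']]] := nilpotent_ad x D (VU p Vp) (hc p).
  exists (capo V V'), K; split=> //; first exact: capol.
    by move=> k Kk W WV f; apply: hV' => // q /WV[].
  move=> W' f WV; rewrite lop_sumE; apply: (HS V') => //.
    move=> k Kk W WV' g; rewrite /primitive_term lopZE lopME hV' ?scaler0//; exact: ltnW.
  by move=> q /WV[].
exists S; split.
- apply: lopP => V VU f; apply: cinf_inj => p Vp.
  have [W [K [Wp WV hW HW]]] := red V VU p Vp; have WU := subset_trans WV VU.
  rewrite -(cinf_resE WV _ Wp) -[RHS](cinf_resE WV _ Wp) !lop_res//; congr (cinf_val _ p).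
  rewrite /a (adE _ _ WU) !HW// -(adE _ _ WU) -/a ad_primitive_sum lopDE lopZE lopME.
  by rewrite (hW K.+1) ?leqnSn// scaler0 addr0.
- move=> V VU; apply: cinf_inj => p Vp; rewrite cinf0//.
  have [W [K [Wp WV hW HW]]] := red V VU p Vp; have WU := subset_trans WV VU.
  rewrite -(cinf_resE WV _ Wp) lop_res// HW// lop_sumE big1 ?cinf0// => k _.
  by rewrite /primitive_term lopZE lopME exprSr lopME cinf_res1 (is_der1 WU hZ) lop0 lop0 scaler0.
- move=> y Dy Zy; apply: lopP => V VU f; apply: cinf_inj => p Vp.
  have [W [K [Wp WV hW HW]]] := red V VU p Vp; have WU := subset_trans WV VU.
  rewrite -(cinf_resE WV _ Wp) -[RHS](cinf_resE WV _ Wp) !lop_res//; congr (cinf_val _ p).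
  rewrite (adE _ _ WU) !HW// -(adE _ _ WU) ad_sum lop_sumE big1 ?lop0E// => k _.
  have yZ : ad y Z = 0 by rewrite ad_der// Zy mop0.
  have yZX j : ad y (Z ^+ j) = 0.
    elim: j => [|j IH]; first by rewrite expr0 -mop1 ad_mop.
    by rewrite exprS adM yZ IH mul0r mulr0 addr0.
  by rewrite /primitive_term adZ adM yZX iter_adC Dy iter_ad0 mul0r mulr0 addr0 scaler0.
Qed.

End Primitive.

(** The coordinates are treated one at a time. By compatibility, what is left of [D K] commutes with
    the earlier [x i], so the primitive added for [x K] leaves the equations already solved
    intact. *)
Lemma joint_primitive m (x : 'I_m -> cinf U) (Z D : 'I_m -> lop U) :
  (forall p : M, exists2 c : chart R n M, atlas c & cdom c p) ->
  (forall i, is_der (Z i)) -> (forall i j, Z i U (x j) = (i == j)%:R) ->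
  (forall i j, ad (x i) (D j) = ad (x j) (D i)) ->
  exists S, (forall i, ad (x i) S = D i) /\ forall V, V `<=` U -> S V 1 = 0.
Proof.
move=> hc hZ Zx Dx.
suff H k : (k <= m)%N -> exists S, (forall i : 'I_m, (i < k)%N -> ad (x i) S = D i) /\
    forall V, V `<=` U -> S V 1 = 0.
  by have [S [h1 h2]] := H m (leqnn m); exists S; split=> // i; exact: h1.
elim: k => [|k IH] km; first by exists 0; split.
have [S [h1 h2]] := IH (ltnW km).
pose K := Ordinal km.
have ZK : Z K U (x K) = 1 by rewrite Zx eqxx.
have [S' [h3 h4 h5]] := primitive (D K - ad (x K) S) (hZ K) ZK hc.
exists (S + S'); split; last by move=> V VU; rewrite lopDE h2// h4// addr0.
move=> i; rewrite ltnS leq_eqVlt => /orP[/eqP iK|ik].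
  have -> : i = K by exact: val_inj.
  by rewrite adD h3 addrC subrK.
have iK : i != K by rewrite -(inj_eq val_inj) /= ltn_eqF.
rewrite adD h1// h5 ?addr0//.
- by rewrite adB Dx adC h1// Dx subrr.
- by rewrite Zx eq_sym (negbTE iK).
Qed.

End Commutators.

(** * Operators commuting with given functions *)

Section CentralizerLemma.
Variables (R : realType) (n : nat) (M : manifold R n).
Variables (c : chart R n M) (ac : atlas c).
Variables (U : opens M) (Uc : U `<=` cdom c) (m : nat).
Variables (x : 'I_m -> cinf U) (d : 'I_m -> lop U) (b : 'I_n -> 'I_m -> cinf U).
Variable (O : forall V : opens M, set (cinf V)).
Implicit Types (V W : opens M) (N D S : lop U).

Hypothesis d_der : forall i, is_der (d i).
Hypothesis dx : forall i j, d i U (x j) = (i == j)%:R.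
Hypothesis Od : forall V (f : cinf V) i, V `<=` U -> O f -> O (d i V f).
Hypothesis OD : forall V (f g : cinf V), V `<=` U -> O f -> O g -> O (f + g).
Hypothesis OM : forall V (f g : cinf V), V `<=` U -> O f -> O g -> O (f * g).
Hypothesis Ocst : forall V a, V `<=` U -> O (cinf_cst V a).
Hypothesis Ores : forall V W (WV : W `<=` V) (f : cinf V), V `<=` U -> O f -> O (cinf_res WV f).
Hypothesis Ox : forall i, O (x i).
Hypothesis d_comm : forall V (f : cinf V) i j, V `<=` U -> O f -> d i V (d j V f) = d j V (d i V f).
Hypothesis chain : forall V (f : cinf V) l (VU : V `<=` U), O f ->
  dop ac l V f = \sum_j cinf_res VU (b l j) * d j V f.
Hypothesis d_J : forall V (f : cinf V) i q s, V `<=` U -> V q -> J c s.+1 f q -> J c s (d i V f) q.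

Let OZ V a (f : cinf V) : V `<=` U -> O f -> O (a *: f).
Proof. by move=> VU hf; rewrite -cinf_cst_mul; apply: OM => //; exact: Ocst. Qed.
Let Osum V (I : Type) (r : seq I) (F : I -> cinf V) : V `<=` U -> (forall i, O (F i)) ->
  O (\sum_(i <- r) F i).
Proof.
move=> VU hF; elim: r => [|i r IH]; first by rewrite big_nil; exact: Ocst.
by rewrite big_cons; exact: OD.
Qed.

Section AtPoint.
Variables (V : opens M) (VU : V `<=` U) (q : M) (Vq : V q).
Let Vc : V `<=` cdom c. Proof. exact: subset_trans Uc. Qed.
Let xi i : cinf V := cinf_res VU (x i) - cinf_cst V (x i q).
Let xi0 i : xi i q = 0.
Proof. by rewrite cinfB// cinf_resE// cinf_cstE// subrr. Qed.
Let Oxi i : O (xi i).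
Proof.
by rewrite /xi -scaleN1r; apply: OD => //; [exact: Ores | apply: OZ => //; exact: Ocst].
Qed.
Let dxi i j : d i V (xi j) = (i == j)%:R.
Proof.
have e : cinf_cst V (x j q) = x j q *: (1 : cinf V) by rewrite -cinf_cst_mul mulr1.
rewrite lopB -lop_res// dx e lopZ (is_der1 VU (d_der i)) scaler0 subr0.
by case: (i == j); rewrite ?cinf_res1// raddf0.
Qed.

(** The Euler vector field of the functions [x i], centred at [q]. *)
Definition euler (u : cinf V) : cinf V := \sum_i xi i * d i V u.

Let O_euler u : O u -> O (euler u).
Proof. by move=> hu; apply: Osum => // i; apply: OM => //; exact: Od. Qed.

Let d_euler u j : O u -> d j V (euler u) = d j V u + euler (d j V u).
Proof.
move=> hu; rewrite lop_sum.
under eq_bigr => i _ do rewrite d_der// dxi d_comm//.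
rewrite big_split /=; congr (_ + _).
rewrite (bigD1 j)//= eqxx mul1r big1 ?addr0// => i /negbTE ij.
by rewrite eq_sym ij mul0r.
Qed.

Let J_from_d u s : O u -> u q = 0 -> (forall j, J c s (d j V u) q) -> J c s.+1 u q.
Proof.
move=> hu u0 h; apply: (J_S (ac := ac) Vc) => // l; rewrite (chain _ VU)//.
by apply: (J_sum ac Vc) => // j; exact: J_Mr.
Qed.

(** Euler's identity for homogeneous polynomials: on a leading part of degree s+1 the Euler field is
    multiplication by s+1, so the difference vanishes to one order more. The induction uses that the
    bracket of [d j] with the Euler field is [d j]; by [chain], the derivatives [d j] alone detect
    vanishing for functions in [O]. *)
Lemma euler_J u s : O u -> J c s.+1 u q -> J c s.+2 (u - s.+1%:R^-1 *: euler u) q.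
Proof.
have OB (v v' : cinf V) : O v -> O v' -> O (v - v').
  by move=> h h'; rewrite -scaleN1r; apply: OD => //; exact: OZ.
elim: s u => [|s IH] u hu hJ.
  have E1 : O (u - 1%:R^-1 *: euler u) by apply: OB => //; apply: OZ => //; exact: O_euler.
  apply: J_from_d; [exact: E1 | |].
    rewrite cinfB// cinfZ// (J0 hJ) sub0r; apply/eqP; rewrite oppr_eq0 mulf_eq0; apply/orP; right; apply/eqP.
    apply: (@J0 _ _ _ c 0 V); apply: (J_sum ac Vc) => // i; exact: J_M1.
  move=> j; rewrite lopB lopZ (d_euler _ hu) invr1 scale1r opprD addrA subrr sub0r -scaleN1r.
  by apply: (J_Z ac Vc) => //; apply: (J_sum ac Vc) => // i; exact: J_M1.
have E1 : O (u - s.+2%:R^-1 *: euler u) by apply: OB => //; apply: OZ => //; exact: O_euler.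
apply: J_from_d; [exact: E1 | |].
  rewrite cinfB// cinfZ// (J0 hJ) sub0r; apply/eqP; rewrite oppr_eq0 mulf_eq0; apply/orP; right; apply/eqP.
  apply: (@J0 _ _ _ c 0 V); apply: (J_sum ac Vc) => // i; exact: J_M1.
move=> j; rewrite lopB lopZ (d_euler _ hu).
have -> : d j V u - s.+2%:R^-1 *: (d j V u + euler (d j V u)) =
   (s.+1%:R / s.+2%:R) *: (d j V u - s.+1%:R^-1 *: euler (d j V u)).
  have n0 k : (k.+1%:R : R[i]) != 0 by rewrite pnatr_eq0.
  rewrite scalerBr scalerDr opprD addrA; congr (_ - _); last first.
    by rewrite scalerA; congr (_ *: _); rewrite mulrAC mulfV// mul1r.
  rewrite -{1}[d j V u]scale1r -scalerBl; congr (_ *: _).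
  apply: (mulIf (n0 s.+1)); rewrite mulrBl mul1r mulVf ?n0// divfK ?n0//.
  by rewrite -[s.+2]addn1 natrD addrK.
apply: (J_Z ac Vc _ Vq); apply: IH; [exact: (Od _ VU hu) | exact: (d_J _ VU Vq hJ)].
Qed.

(** Each round subtracts a multiple of [euler b'], which lies in the ideal of the [xi i]. Only the
    remainder is kept in [O]; the coefficients [h i] are arbitrary smooth functions. *)
Lemma jet_modulo (a : cinf V) s : O a -> a q = 0 ->
  exists (b' : cinf V) (h : 'I_m -> cinf V), [/\ O b', J c s.+1 b' q & a = b' + \sum_i xi i * h i].
Proof.
move=> ha a0; elim: s => [|s [b' [h [hb hJ ->]]]].
  exists a, (fun=> 0); split; [exact: ha | by split | by rewrite big1 ?addr0// => i _; rewrite mulr0].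
exists (b' - s.+1%:R^-1 *: euler b'), (fun i => h i + s.+1%:R^-1 *: d i V b'); split.
- by rewrite -scaleN1r; apply: OD => //; apply: OZ => //; apply: OZ => //; exact: O_euler.
- exact: euler_J.
under [in RHS]eq_bigr => i _ do rewrite mulrDr cinf_scaleMr.
by rewrite big_split /= -scaler_sumr [X in _ = _ + X]addrC addrA subrK.
Qed.

End AtPoint.

(** Fix [q] and expand [a - a q] modulo Peetre's order. The terms in the ideal of the [x i - x i q]
    give 0 at [q] because [N] commutes with [x i], and the flat remainder gives 0 by Peetre's
    theorem. [O] is kept abstract since two cases occur: all functions with chart coordinates, and
    polarized functions with Darboux coordinates. *)
Lemma centralizer N : (forall i, ad (x i) N = 0) ->
  forall V (a g : cinf V), V `<=` U -> O a -> N V (a * g) = a * N V g.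
Proof.
move=> hN V a g VU ha; apply: cinf_inj => p Vp.
have [V' [K [V'p V'U V'c H]]] := peetre ac (bop_lop N) (VU p Vp) (Uc (VU p Vp)).
pose W := capo V V'; have WV : W `<=` V := @capol _ _ _ V V'.
have WV' : W `<=` V' := @capor _ _ _ V V'.
have WU : W `<=` U := subset_trans WV VU.
have Wc : W `<=` cdom c := subset_trans WV' V'c.
have Wp : W p by [].
pose a' := cinf_res WV a; pose g' := cinf_res WV g.
suff E : N W (a' * g') - a' * N W g' = 0.
  have : N W (a' * g') = a' * N W g' by apply/eqP; rewrite -subr_eq0; exact/eqP.
  rewrite /a' /g' -cinf_resM -!lop_res// -cinf_resM.
  by move=> /(congr1 (fun h : cinf W => h p)); rewrite !cinf_resE.
apply: (cinf_eq0_dense (p := p) ac Wc) => q Wq hq.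
have Oa' : O (a' - cinf_cst W (a' q)).
  rewrite -scaleN1r; apply: OD => //; first exact: Ores.
  by apply: OZ => //; exact: Ocst.
have a'0 : (a' - cinf_cst W (a' q)) q = 0 by rewrite cinfB// cinf_cstE// subrr.
have [b' [h [_ hJ e]]] := jet_modulo WU Wq K Oa' a'0.
have Ncst f : N W (cinf_cst W (a' q) * f) q = a' q * N W f q.
  by rewrite cinf_cst_mul lopZ cinfZ.
have hx i f : N W (cinf_res WU (x i) * f) = cinf_res WU (x i) * N W f.
  by have := congr1 (fun L : lop U => L W f) (hN i); rewrite (adE _ _ WU) => /eqP; rewrite subr_eq0 => /eqP.
have hxi i f : N W ((cinf_res WU (x i) - cinf_cst W (x i q)) * f) q = 0.
  rewrite mulrBl lopB cinfB// hx cinfM// cinf_resE// cinf_cst_mul lopZ cinfZ// subrr//.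
rewrite cinfB// [X in _ - X]cinfM//.
have -> : a' * g' = (a' - cinf_cst W (a' q)) * g' + cinf_cst W (a' q) * g' by rewrite -mulrDl subrK.
rewrite lopD cinfD// Ncst addrK e mulrDl lopD cinfD//.
rewrite mulr_suml lop_sum.
have sum0 (F : 'I_m -> cinf W) : (forall i, F i q = 0) -> (\sum_i F i) q = 0.
  move=> hF; elim/big_rec: _ => [|i f _ IH]; first exact: cinf0.
  by rewrite cinfD// hF add0r.
rewrite sum0 ?addr0; last by move=> i; rewrite -mulrA hxi.
have := H W (b' * g') 1 q (WV' q Wq) Wq WV' hq; rewrite [bop_lop N W _ 1]mulr1; apply; left.
by apply: (J_M ac Wc) => //; apply: (J_mono ac Wc Wq _ hJ).
Qed.

End CentralizerLemma.

(** A copy of sequences distinct from [fps], so that series with noncommuting coefficients can carry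
    their own product. *)
Record ser (A : Type) := Ser { sc :> nat -> A }.

HB.instance Definition _ (A : Type) := gen_eqMixin (ser A).
HB.instance Definition _ (A : Type) := gen_choiceMixin (ser A).

Lemma serP (A : Type) (a b : ser A) : (forall k, a k = b k) -> a = b.
Proof. by case: a b => [a] [b] /= ab; congr Ser; exact/funext. Qed.

Definition upd (A : Type) (s : ser A) k (a : A) : ser A := Ser (fun j => if j == k then a else s j).

Lemma upd_lt (A : Type) (s : ser A) k a j : (j < k)%N -> upd s k a j = s j.
Proof. by move=> jk; rewrite /= ltn_eqF. Qed.
Lemma upd_eq (A : Type) (s : ser A) k a : upd s k a k = a.
Proof. by rewrite /= eqxx. Qed.

(** Successive approximation: the step at stage [k] changes no coefficient of index below [k], so
    coefficient [j] is final from stage j+1 on. The last hypothesis says that [P k] sees only the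
    first [k] coefficients. *)
Lemma ser_limit (A : Type) (P : nat -> ser A -> Prop) (s0 : ser A) :
  P 0%N s0 ->
  (forall k s, P k s -> exists2 s', P k.+1 s' & forall j, (j < k)%N -> s' j = s j) ->
  (forall k (s s' : ser A), (forall j, (j < k)%N -> s' j = s j) -> P k s -> P k s') ->
  exists s, forall k, P k s.
Proof.
move=> P0 Pstep Pext.
have /choice[nxt hn] (ks : nat * ser A) : exists s', P ks.1 ks.2 ->
    P ks.1.+1 s' /\ forall j, (j < ks.1)%N -> s' j = ks.2 j.
  case: (pselect (P ks.1 ks.2)) => [/Pstep[s' h1 h2]|h]; first by exists s'.
  by exists s0.
pose st := fix st k := if k is k'.+1 then nxt (k', st k') else s0.
have stP k : P k (st k) by elim: k => // k IH; have [] := hn (k, st k) IH.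
have stE j k : (j < k)%N -> st k j = st j.+1 j.
  elim: k => // k IH; rewrite ltnS leq_eqVlt => /orP[/eqP->//|jk].
  by have [_ /(_ j jk) /= ->] := hn (k, st k) (stP k); exact: IH.
by exists (Ser (fun k => st k.+1 k)) => k; apply: Pext (stP k) => j /stE.
Qed.

(** * Formal series of operators *)

Section SeriesRing.
Variable A : pzRingType.
Implicit Types a b c : ser A.

Definition ser_add a b : ser A := Ser (fun k => a k + b k).
Definition ser_opp a : ser A := Ser (fun k => - a k).
Definition ser_zero : ser A := Ser (fun=> 0).
Definition ser_mul a b : ser A := Ser (fun k => \sum_(i < k.+1) a i * b (k - i)%N).
Definition ser_cst (x : A) : ser A := Ser (fun k => if k is 0%N then x else 0).

Let addA : associative ser_add. Proof. by move=> a b c; apply: serP => k /=; rewrite addrA. Qed.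
Let addC : commutative ser_add. Proof. by move=> a b; apply: serP => k /=; rewrite addrC. Qed.
Let add0 : left_id ser_zero ser_add. Proof. by move=> a; apply: serP => k /=; rewrite add0r. Qed.
Let addN : left_inverse ser_zero ser_opp ser_add.
Proof. by move=> a; apply: serP => k /=; rewrite addNr. Qed.
HB.instance Definition _ := GRing.isZmodule.Build (ser A) addA addC add0 addN.

Let mulA : associative ser_mul.
Proof.
move=> a b c; apply: serP => k /=.
under eq_bigr do rewrite mulr_sumr.
under [RHS]eq_bigr do rewrite mulr_suml.
rewrite (conv_assoc k (fun i j k => a i * b j * c k)).
by apply: eq_bigr => i _; apply: eq_bigr => j _; rewrite mulrA.
Qed.
Let mul1l : left_id (ser_cst 1) ser_mul.
Proof.
move=> a; apply: serP => k /=; rewrite big_ord_recl /= mul1r subn0.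
by rewrite big1 ?addr0// => i _; rewrite mul0r.
Qed.
Let mul1r : right_id (ser_cst 1) ser_mul.
Proof.
move=> a; apply: serP => k /=; rewrite big_ord_recr /= subnn mulr1.
rewrite big1 ?add0r// => i _; have := ltn_ord i; rewrite -subn_gt0.
by case: (k - i)%N => // j _; rewrite mulr0.
Qed.
Let mulDl : left_distributive ser_mul +%R.
Proof.
move=> a b c; apply: serP => k /=; rewrite -big_split /=.
by apply: eq_bigr => i _; rewrite -mulrDl.
Qed.
Let mulDr : right_distributive ser_mul +%R.
Proof.
move=> a b c; apply: serP => k /=; rewrite -big_split /=.
by apply: eq_bigr => i _; rewrite -mulrDr.
Qed.
HB.instance Definition _ := GRing.Zmodule_isPzRing.Build (ser A) mulA mul1l mul1r mulDl mulDr.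

Lemma serDE a b k : (a + b) k = a k + b k. Proof. by []. Qed.
Lemma serBE a b k : (a - b) k = a k - b k. Proof. by []. Qed.
Lemma ser0E k : (0 : ser A) k = 0. Proof. by []. Qed.
Lemma serME a b k : (a * b) k = \sum_(i < k.+1) a i * b (k - i)%N. Proof. by []. Qed.
Lemma ser1E k : (1 : ser A) k = if k is 0%N then 1 else 0. Proof. by []. Qed.
Lemma serM0 a b : (a * b) 0%N = a 0%N * b 0%N.
Proof. by rewrite serME big_ord1 subn0. Qed.

Lemma ser_mul_eq k a a' b b' : (forall j, (j < k)%N -> a j = a' j) ->
  (forall j, (j < k)%N -> b j = b' j) -> forall j, (j < k)%N -> (a * b) j = (a' * b') j.
Proof.
move=> ha hb j jk; rewrite !serME; apply: eq_bigr => i _.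
rewrite ha ?hb//; first exact: leq_ltn_trans (leq_subr _ _) jk.
exact: leq_ltn_trans (leq_ord i) jk.
Qed.

Lemma ser_mull_top k a a' b : (forall j, (j < k)%N -> a j = a' j) ->
  (a * b) k = (a' * b) k + (a k - a' k) * b 0%N.
Proof.
move=> ha; rewrite !serME !big_ord_recr /= subnn mulrBl -addrA [X in _ = _ + X]addrC subrK; congr (_ + _).
by apply: eq_bigr => i _; rewrite ha.
Qed.
Lemma ser_mulr_top k a b b' : (forall j, (j < k)%N -> b j = b' j) ->
  (a * b) k = (a * b') k + a 0%N * (b k - b' k).
Proof.
move=> hb; rewrite !serME !big_ord_recl /= !subn0 mulrBr addrC [RHS]addrAC [X in _ = X + _]addrC subrK [RHS]addrC; congr (_ + _).
apply: eq_bigr => i _; rewrite hb// /bump /= add1n ltn_subrL /=; exact: leq_trans (ltn_ord i).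
Qed.

Lemma ser_rinv a : a 0%N = 1 -> exists2 b : ser A, b 0%N = 1 & a * b = 1.
Proof.
move=> a0.
have [b hb] : exists b : ser A, forall k, forall j, (j < k)%N -> (a * b) j = (1 : ser A) j.
  apply: (ser_limit (s0 := 0)) => // [k s hs|k s s' e hs j jk]; last first.
    by rewrite -(hs j jk); apply: (ser_mul_eq _ e).
  exists (upd s k (s k + ((1 : ser A) k - (a * s) k))); last by move=> j; exact: upd_lt.
  move=> j; rewrite ltnS leq_eqVlt => /orP[/eqP->|jk].
    rewrite (ser_mulr_top _ (fun j => @upd_lt _ s k _ j)) upd_eq a0 GRing.mul1r [s k + _]addrC addrK addrC subrK//.
  by rewrite -(hs j jk); apply: (ser_mul_eq (k := k)) => // i; exact: upd_lt.
exists b; last by apply: serP => k; exact: (hb k.+1).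
by have := hb 1%N 0%N isT; rewrite serM0 a0 GRing.mul1r ser1E.
Qed.

Lemma ser_inv a : a 0%N = 1 -> exists b : ser A, [/\ b 0%N = 1, a * b = 1 & b * a = 1].
Proof.
move=> a0; have [b b0 ab] := ser_rinv a0; have [a' _ ba'] := ser_rinv b0.
exists b; split=> //; suff -> : a = a' by [].
by rewrite -[a]mulr1 -ba' GRing.mulrA ab GRing.mul1r.
Qed.

Lemma ser_cst_comm (x : A) a k : (ser_cst x * a) k = x * a k.
Proof.
by rewrite serME big_ord_recl /= subn0 big1 ?addr0// => i _; rewrite mul0r.
Qed.
Lemma ser_mul_cst (x : A) a k : (a * ser_cst x) k = a k * x.
Proof.
rewrite serME big_ord_recr /= subnn big1 ?add0r// => i _; have := ltn_ord i; rewrite -subn_gt0.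
by case: (k - i)%N => // j _; rewrite mulr0.
Qed.

Definition ser_mon k (x : A) : ser A := Ser (fun j => if j == k then x else 0).

Lemma ser_mon_mull k x a j : (ser_mon k x * a) j = if (k <= j)%N then x * a (j - k)%N else 0.
Proof.
rewrite serME; case: ifP => kj; last first.
  by rewrite big1// => i _ /=; rewrite ltn_eqF ?mul0r// (leq_ltn_trans (leq_ord i))// ltnNge kj.
rewrite (bigD1 (Ordinal (kj : (k < j.+1)%N)))//= eqxx big1 ?addr0// => i /negbTE ik.
by rewrite -val_eqE /= in ik; rewrite ik mul0r.
Qed.
Lemma ser_mon_mulr k x a j : (a * ser_mon k x) j = if (k <= j)%N then a (j - k)%N * x else 0.
Proof.
rewrite serME (conv_rev j (fun i l => a i * ser_mon k x l)); case: ifP => kj; last first.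
  by rewrite big1// => i _ /=; rewrite ltn_eqF ?mulr0// (leq_ltn_trans (leq_ord i))// ltnNge kj.
rewrite (bigD1 (Ordinal (kj : (k < j.+1)%N)))//= eqxx big1 ?addr0// => i /negbTE ik.
by rewrite -val_eqE /= in ik; rewrite ik mulr0.
Qed.
End SeriesRing.

Section OperatorSeries.
Variables (R : realType) (n : nat) (M : manifold R n).
Implicit Types U V W : opens M.

Definition mser U (f : fps (cinf U)) : ser (lop U) := Ser (fun k => mop (f k)).
Definition ev U (N : ser (lop U)) : fps (cinf U) := Fps (fun k => N k U 1).
Definition act U (N : ser (lop U)) V (f : fps (cinf V)) : fps (cinf V) :=
  Fps (fun k => \sum_(i < k.+1) N i V (f (k - i)%N)).
Definition srestr U U' (h : U' `<=` U) (N : ser (lop U)) : ser (lop U') :=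
  Ser (fun k => restr h (N k)).
Definition fcst U (f : cinf U) : fps (cinf U) := Fps (fun k => if k is 0%N then f else 0).

Lemma ev_coef U (N : ser (lop U)) k : ev N k = N k U 1. Proof. by []. Qed.
Lemma act_coef U (N : ser (lop U)) V (f : fps (cinf V)) k :
  act N f k = \sum_(i < k.+1) N i V (f (k - i)%N).
Proof. by []. Qed.
Lemma srestr_coef U U' (h : U' `<=` U) (N : ser (lop U)) k : srestr h N k = restr h (N k).
Proof. by []. Qed.
Lemma mser_coef U (f : fps (cinf U)) k : mser f k = mop (f k). Proof. by []. Qed.

Lemma srestrM U U' (h : U' `<=` U) (N N' : ser (lop U)) :
  srestr h (N * N') = srestr h N * srestr h N'.
Proof.
apply: serP => k; rewrite /srestr /= restr_sum; apply: eq_bigr => i _; exact: restrM.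
Qed.
Lemma srestrB U U' (h : U' `<=` U) (N N' : ser (lop U)) :
  srestr h (N - N') = srestr h N - srestr h N'.
Proof. by apply: serP => k; rewrite /srestr /= restrB. Qed.
Lemma srestr_mser U U' (h : U' `<=` U) (f : fps (cinf U)) :
  srestr h (mser f) = mser (Fps (fun k => cinf_res h (f k))).
Proof. by apply: serP => k; rewrite /srestr /= restr_mop. Qed.
Lemma srestr_comp U U' U'' (h1 : U' `<=` U) (h2 : U'' `<=` U') (h3 : U'' `<=` U) (N : ser (lop U)) :
  srestr h2 (srestr h1 N) = srestr h3 N.
Proof. by apply: serP => k; rewrite /srestr /= restr_comp. Qed.
Lemma srestr1 U U' (h : U' `<=` U) : srestr h 1 = 1.
Proof. by apply: serP => -[|k]; rewrite /srestr /= ?restr1 ?restr0. Qed.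
Lemma ev_srestr U U' (h : U' `<=` U) (N : ser (lop U)) k :
  ev (srestr h N) k = cinf_res h (ev N k).
Proof. by rewrite !ev_coef srestr_coef restrE// lop_res// cinf_res1. Qed.

Lemma evE U (N : ser (lop U)) : ev N = act N (fcst (1 : cinf U)).
Proof.
apply: fpsP => k; rewrite /= big_ord_recr /= subnn big1 ?add0r// => i _.
by have := ltn_ord i; rewrite -subn_gt0; case: (k - i)%N => // j _; rewrite lop0.
Qed.
Lemma actM U (N N' : ser (lop U)) V (f : fps (cinf V)) : act (N * N') f = act N (act N' f).
Proof.
apply: fpsP => k /=.
transitivity (\sum_(i < k.+1) \sum_(j < i.+1) N j V (N' (i - j)%N V (f (k - i)%N))).
  by apply: eq_bigr => i _; rewrite lop_sumE.
rewrite (conv_assoc k (fun j i l => N j V (N' i V (f l)))).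
by apply: eq_bigr => i _; rewrite lop_sum.
Qed.
Lemma act1 U V (VU : V `<=` U) (f : fps (cinf V)) : act (1 : ser (lop U)) f = f.
Proof.
apply: fpsP => k; rewrite act_coef big_ord_recl subn0 ser1E (lop1E VU) big1 ?addr0// => i _.
Qed.
Lemma ev_mul U (N N' : ser (lop U)) : ev (N * N') = act N (ev N').
Proof. by rewrite !evE actM. Qed.
Lemma ev1 U : ev (1 : ser (lop U)) = fcst 1.
Proof. by rewrite evE act1. Qed.
Lemma act0E U (N : ser (lop U)) V (f : fps (cinf V)) : act N f 0%N = N 0%N V (f 0%N).
Proof. by rewrite /= big_ord1. Qed.

Lemma act_linear U (N : ser (lop U)) V : linear (@act U N V).
Proof.
move=> c f g; apply: fpsP => k; rewrite fpsD fpsZ /=.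
transitivity (\sum_(i < k.+1) \sum_(j < (k - i).+1) c j *: N i V (f (k - i - j)%N) +
   \sum_(i < k.+1) N i V (g (k - i)%N)).
  rewrite -big_split /=; apply: eq_bigr => i _; rewrite lopD lop_sum; congr (_ + _).
  by apply: eq_bigr => j _; rewrite lopZ.
congr (_ + _); rewrite (triangle_swap k (fun i j => c j *: N i V (f (k - i - j)%N))).
apply: eq_bigr => j _; rewrite scaler_sumr; apply: eq_bigr => i _.
by rewrite subnAC.
Qed.

Lemma act_res U (N : ser (lop U)) V W (WV : W `<=` V) (VU : V `<=` U) (f : fps (cinf V)) :
  Fps (fun k => cinf_res WV (act N f k)) = act N (Fps (fun k => cinf_res WV (f k))).
Proof.
by apply: fpsP => k /=; rewrite raddf_sum; apply: eq_bigr => i _; exact: lop_res.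
Qed.

Lemma act_srestr U U' (h : U' `<=` U) (N : ser (lop U)) V (VU : V `<=` U') (f : fps (cinf V)) :
  act (srestr h N) f = act N f.
Proof. by apply: fpsP => k; rewrite !act_coef; apply: eq_bigr => i _; rewrite srestr_coef restrE. Qed.

Lemma ev_mser U (f : fps (cinf U)) : ev (mser f) = f.
Proof. by apply: fpsP => k; rewrite ev_coef mser_coef (mopE _ (@subset_refl _ _)) mulr1 cinf_res_id. Qed.

Lemma act_mser U (f g : fps (cinf U)) : act (mser f) g = usual_prod (f : cinft M U) (g : cinft M U).
Proof.
by apply: fpsP => k; rewrite act_coef; apply: eq_bigr => i _; rewrite mser_coef (mopE _ (@subset_refl _ _)) cinf_res_id.
Qed.

Lemma mser_comm U (f g : fps (cinf U)) : mser f * mser g = mser g * mser f.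
Proof.
apply: serP => k /=; rewrite (conv_rev k (fun i j => mop (f i) * mop (g j))).
by apply: eq_bigr => i _; exact: mopC.
Qed.

(** A series is its constant term plus t times its shift. Linearity over power series then
    determines each coefficient of the image from finitely many constant series, so t-adic
    continuity is automatic. *)
Lemma fps_linear_coef (V W : lmodType R[i]) (Phi : fps V -> fps W) (hPhi : linear Phi)
    (c : V -> fps V) (hc : forall v k, c v k = if k is 0%N then v else 0) (b : fps V) k :
  Phi b k = \sum_(i < k.+1) Phi (c (b (k - i)%N)) i.
Proof.
have E (a : fps V) : a = fpsX R[i] *: Fps (fun k => a k.+1) + c (a 0%N).
  by apply: fpsP => -[|j]; rewrite fpsD hc ?fpsXZ0 ?fpsXZS ?add0r ?addr0.
elim: k b => [|k IH] b; rewrite {1}(E b) hPhi fpsD.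
  by rewrite fpsXZ0 add0r big_ord1 subn0.
rewrite fpsXZS IH [RHS]big_ord_recr /= subnn; congr (_ + _).
by apply: eq_bigr => i _; rewrite subSn ?leq_ord.
Qed.

Lemma act_fcst U (N : ser (lop U)) V (f : cinf V) k : act N (fcst f) k = N k V f.
Proof.
rewrite act_coef big_ord_recr /= subnn big1 ?add0r// => i _.
by have := ltn_ord i; rewrite -subn_gt0; case: (k - i)%N => // j _; rewrite lop0.
Qed.

Lemma serlopP U (N N' : ser (lop U)) :
  (forall V, V `<=` U -> forall f : fps (cinf V), act N f = act N' f) -> N = N'.
Proof.
move=> h; apply: serP => k; apply: lopP => V VU f.
by rewrite -!act_fcst h.
Qed.

Section FamilySeries.
Variables (U : opens M) (F : forall V, V `<=` U -> fps (cinf V) -> fps (cinf V)).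
Hypothesis F_lin : forall V (VU : V `<=` U), linear (F VU).
Hypothesis F_res : forall V W (WV : W `<=` V) (VU : V `<=` U) (WU : W `<=` U) (f : fps (cinf V)) k,
  cinf_res WV (F VU f k) = F WU (Fps (fun k => cinf_res WV (f k))) k.

Let fcst_res V W (WV : W `<=` V) (f : cinf V) :
  Fps (fun k => cinf_res WV (fcst f k)) = fcst (cinf_res WV f).
Proof. by apply: fpsP => -[|k] //=; rewrite raddf0. Qed.

Definition fser : ser (lop U).
Proof.
exists => k; apply: (@build_lop R n M U (fun V VU f => F VU (fcst f) k)).
- move=> V VU a f g; pose c : fps R[i] := Fps (fun k => if k is 0%N then a else 0).
  have Z (W : lmodType R[i]) (b : fps W) j : (c *: b) j = a *: b j.
    by rewrite fpsZ big_ord_recl subn0 big1 ?addr0// => i _; rewrite scale0r.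
  have -> : fcst (a *: f + g) = c *: fcst f + fcst g.
    by apply: fpsP => j; rewrite fpsD Z; case: j => [|j] //=; rewrite scaler0 addr0.
  by rewrite F_lin fpsD Z.
- by move=> V W WV VU WU f; rewrite (F_res _ _ WU) fcst_res.
Defined.

Lemma fserE V (VU : V `<=` U) (f : fps (cinf V)) : act fser f = F VU f.
Proof.
apply: fpsP => k; rewrite act_coef (fps_linear_coef (F_lin VU) (c := @fcst V))//.
by apply: eq_bigr => i _; exact: (build_lopE _ _ VU).
Qed.
End FamilySeries.
End OperatorSeries.

(** * Trivializations of the algebra *)

Section Trivialization.
Variables (R : realType) (n : nat) (M : manifold R n) (w : two_form M) (A : dq w).
Implicit Types U V W : opens M.

Definition otop : opens M := Opens openT.
Lemma sub_otop U : U `<=` otop. Proof. by []. Qed.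

Definition trivialization (phi : forall U, {linear A U -> cinft M U}) :=
  [/\ natural_map phi, forall U, bijective (phi U) &
      forall U (a : A U), coef (phi U a) 0%N = symb a].

Section Twist.
Variables (phi : forall U, {linear A U -> cinft M U}) (hphi : trivialization phi).
Variables (T : ser (lop otop)) (T0 : T 0%N = 1).

Definition twist_fun U (a : A U) : cinft M U := act T (phi U a).
Lemma twist_linear U : linear (@twist_fun U).
Proof. by move=> c a b; rewrite /twist_fun linearP; exact: act_linear. Qed.
HB.instance Definition _ U :=
  GRing.isLinear.Build (fps R[i]) (A U) (cinft M U) *:%R (@twist_fun U) (@twist_linear U).
Definition twist U : {linear A U -> cinft M U} := @twist_fun U.

Lemma twistE U (a : A U) : twist U a = act T (phi U a). Proof. by []. Qed.

Lemma twist_triv : trivialization twist.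
Proof.
have [h1 h2 h3] := hphi; split.
- move=> U V VU s; rewrite !twistE h1.
  by apply/esym; exact: (act_res T VU (sub_otop (U := U))).
- move=> U; have [T' [T'0 TT' T'T]] := ser_inv T0; have [g gK Kg] := h2 U.
  exists (fun b => g (act T' b)) => a; first by rewrite twistE -actM T'T act1// gK.
  by rewrite twistE Kg -actM TT' act1.
- by move=> U a; rewrite twistE act0E T0 lop1E// h3.
Qed.
End Twist.

(** The image of the unit has constant term 1, so multiplication by it is an invertible series;
    twisting by the inverse sends the unit to 1. This is what later makes the bidifferential
    coefficients vanish on constants. *)
Lemma normalized_triv : exists phi : forall U, {linear A U -> cinft M U},
  trivialization phi /\ forall U, phi U (aone A U) = fcst (1 : cinf U) :> fps (cinf U).
Proof.
have [phi hphi] := dq_triv A; have [h1 h2 h3] := hphi.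
pose u : fps (cinf otop) := phi otop (aone A otop).
have u0 : mser u 0%N = 1 by rewrite mser_coef /u h3 symb_one; exact: mop1.
have [T [T0 _ Tu]] := ser_inv u0.
exists (twist phi T); split; first exact: twist_triv.
move=> U; rewrite twistE -(res_aone A (sub_otop (U := U))) h1.
have -> : act T (res (cinft M) (sub_otop (U := U)) (phi otop (aone A otop))) =
   Fps (fun k => cinf_res (sub_otop (U := U)) (act T u k)).
  by rewrite (act_res T (sub_otop (U := U)) (@subset_refl _ _)).
rewrite -[u in act T u]ev_mser -ev_mul Tu ev1; apply: fpsP => -[|k] /=; last exact: raddf0.
exact: cinf_res1.
Qed.
End Trivialization.

Section Multiplications.
Variables (R : realType) (n : nat) (M : manifold R n) (w : two_form M) (A : dq w).
Variables (phi : forall U, {linear A U -> cinft M U}) (hphi : trivialization phi).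
Hypothesis phi1 : forall U, phi U (aone A U) = fcst (1 : cinf U) :> fps (cinf U).
Implicit Types U V W : opens M.

Let phi_inv U : exists psi : fps (cinf U) -> A U, cancel (phi U) psi /\ cancel psi (phi U).
Proof. by have [_ /(_ U)[g h1 h2] _] := hphi; exists g. Qed.
Definition psi U : fps (cinf U) -> A U := projT1 (cid (phi_inv U)).
Lemma phiK U : cancel (phi U) (@psi U).
Proof. by rewrite /psi; case: cid => g []. Qed.
Lemma psiK U : cancel (@psi U) (phi U).
Proof. by rewrite /psi; case: cid => g []. Qed.
Lemma phi_inj U : injective (phi U). Proof. exact: can_inj (@phiK U). Qed.
Lemma phi_res U V (VU : V `<=` U) (a : A U) k :
  coef (phi V (res A VU a)) k = cinf_res VU (coef (phi U a) k).
Proof. by have [h _ _] := hphi; rewrite h. Qed.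
Lemma psi_linear U : linear (@psi U).
Proof. by move=> c a b; apply: phi_inj; rewrite linearP !psiK. Qed.
Lemma psi_res U V (VU : V `<=` U) (f : fps (cinf U)) :
  psi (Fps (fun k => cinf_res VU (f k))) = res A VU (psi f).
Proof. by apply: phi_inj; rewrite psiK; apply: fpsP => k; rewrite phi_res psiK. Qed.
Lemma symb_psi U (f : fps (cinf U)) : symb (psi f) = f 0%N.
Proof. by have [_ _ h] := hphi; rewrite -h psiK. Qed.
Lemma symb_phi U (a : A U) : coef (phi U a) 0%N = symb a.
Proof. by have [_ _ h] := hphi. Qed.

Section OneSection.
Variables (U : opens M) (a : A U).
Let FL V (VU : V `<=` U) (f : fps (cinf V)) : fps (cinf V) := phi V (amul (res A VU a) (psi f)).
Let FR V (VU : V `<=` U) (f : fps (cinf V)) : fps (cinf V) := phi V (amul (psi f) (res A VU a)).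
Let FL_lin V (VU : V `<=` U) : linear (FL VU).
Proof. by move=> c f g; rewrite /FL psi_linear amul_linr; exact: linearP. Qed.
Let FR_lin V (VU : V `<=` U) : linear (FR VU).
Proof. by move=> c f g; rewrite /FR psi_linear amul_linl; exact: linearP. Qed.
Let FL_res V W (WV : W `<=` V) (VU : V `<=` U) (WU : W `<=` U) (f : fps (cinf V)) k :
  cinf_res WV (FL VU f k) = FL WU (Fps (fun k => cinf_res WV (f k))) k.
Proof. by rewrite /FL psi_res -(res_comp VU WV WU) -res_amul phi_res. Qed.
Let FR_res V W (WV : W `<=` V) (VU : V `<=` U) (WU : W `<=` U) (f : fps (cinf V)) k :
  cinf_res WV (FR VU f k) = FR WU (Fps (fun k => cinf_res WV (f k))) k.
Proof. by rewrite /FR psi_res -(res_comp VU WV WU) -res_amul phi_res. Qed.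

Definition Lmul : ser (lop U) := fser FL_lin FL_res.
Definition Rmul : ser (lop U) := fser FR_lin FR_res.
Lemma LmulE V (VU : V `<=` U) (f : fps (cinf V)) :
  act Lmul f = phi V (amul (res A VU a) (psi f)).
Proof. exact: (fserE FL_lin FL_res VU). Qed.
Lemma RmulE V (VU : V `<=` U) (f : fps (cinf V)) :
  act Rmul f = phi V (amul (psi f) (res A VU a)).
Proof. exact: (fserE FR_lin FR_res VU). Qed.
End OneSection.

Lemma psi1 U : psi (fcst (1 : cinf U)) = aone A U.
Proof. by rewrite -phi1 phiK. Qed.

Lemma ev_Lmul U (a : A U) : ev (Lmul a) = phi U a.
Proof. by rewrite evE (LmulE a (@subset_refl _ _)) psi1 amul1r res_id. Qed.
Lemma ev_Rmul U (a : A U) : ev (Rmul a) = phi U a.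
Proof. by rewrite evE (RmulE a (@subset_refl _ _)) psi1 amul1l res_id. Qed.
Lemma LmulM U (a b : A U) : Lmul (amul a b) = Lmul a * Lmul b.
Proof.
apply: serlopP => V VU f; rewrite actM !(LmulE _ VU) phiK res_amul.
by rewrite amulA.
Qed.
Lemma LRmulC U (a b : A U) : Lmul a * Rmul b = Rmul b * Lmul a.
Proof.
apply: serlopP => V VU f; rewrite !actM (LmulE _ VU) !(RmulE _ VU) (LmulE _ VU) !phiK.
by rewrite amulA.
Qed.
Lemma Lmul_res U V (VU : V `<=` U) (a : A U) : srestr VU (Lmul a) = Lmul (res A VU a).
Proof.
apply: serlopP => W WV f; have WU := subset_trans WV VU.
by rewrite act_srestr// (LmulE _ WU) (LmulE _ WV) (res_comp VU WV WU).
Qed.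
Lemma Rmul_res U V (VU : V `<=` U) (a : A U) : srestr VU (Rmul a) = Rmul (res A VU a).
Proof.
apply: serlopP => W WV f; have WU := subset_trans WV VU.
by rewrite act_srestr// (RmulE _ WU) (RmulE _ WV) (res_comp VU WV WU).
Qed.
Lemma Lmul0 U (a : A U) : Lmul a 0%N = mop (symb a : cinf U).
Proof.
apply: lopP => V VU f; rewrite -act_fcst (LmulE _ VU) symb_phi symb_mul symb_psi symb_res.
by rewrite (mopE _ VU).
Qed.
Lemma Rmul0 U (a : A U) : Rmul a 0%N = mop (symb a : cinf U).
Proof.
apply: lopP => V VU f; rewrite -act_fcst (RmulE _ VU) symb_phi symb_mul symb_psi symb_res.
by rewrite (mopE _ VU); exact: mulrC.
Qed.
(** [dq_bracket] writes the commutator as t times a section whose symbol is the bracket; the order 1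
    coefficient of the commutator is that symbol. *)
Lemma LRmul1 U (a : A U) V (VU : V `<=` U) (f : cinf V) q : V q ->
  (Lmul a 1%N - Rmul a 1%N) V f q = poisson w (symb (res A VU a) : cinf V) f q.
Proof.
move=> Vq; rewrite lopBE -!act_fcst (LmulE _ VU) (RmulE _ VU).
have [c hc hq] := dq_bracket (res A VU a) (psi (fcst f)).
have -> : coef (phi V (amul (res A VU a) (psi (fcst f)))) 1%N -
   coef (phi V (amul (psi (fcst f)) (res A VU a))) 1%N = symb c.
  transitivity (coef (phi V (fpsX R[i] *: c)) 1%N); first by rewrite -hc linearB.
  by rewrite linearZ -symb_phi; exact: fpsXZS.
by rewrite hq// symb_psi.
Qed.
End Multiplications.

Section ChartCentralizer.
#[local] Opaque build_lop restr mop dop cinf_res.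
Variables (R : realType) (n : nat) (M : manifold R n).
Variables (w : two_form M) (P : M -> set (tvec M)) (hP : polarized_symplectic w P).
Implicit Types U V W : opens M.
Let hw := ps_symplectic hP.

Lemma is_der_coord U c (ac : atlas c) (Uc : U `<=` cdom c) (N : lop U) : is_der N ->
  (forall V i (f : cinf V), V `<=` U -> (forall q, V q -> f q = coordf c i q) -> N V f = 0) -> N = 0.
Proof.
move=> hN N0; apply: lopP => V VU f; rewrite lop0E; apply: cinf_inj => q Vq; rewrite cinf0//.
have [U0 [x [y [U0q hD]]]] := ps_darboux hP q.
have Uq := VU q Vq; have hT := tangent_lop Uq hN.
rewrite -(lop_atcE N f VU Vq) (tangent_coordE hw hD U0q ac (Uc q Uq) f hT) big1// => i _.
have hs : msmooth U (coordf c i) := msmooth_sub Uc (msmooth_coordf i ac).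
rewrite (lop_atE N hs (g := mk_cinf hs) (@subset_refl _ _) Uq); last by move=> r Ur; rewrite mk_cinfE.
by rewrite (N0 U i _ (@subset_refl _ U)) ?cinf0 ?mul0r// => r Ur; rewrite mk_cinfE.
Qed.

Section Chart.
Variables (c : chart R n M) (ac : atlas c) (U : opens M) (Uc : U `<=` cdom c).

Definition cx (i : 'I_n) : cinf U := mk_cinf (msmooth_sub Uc (msmooth_coordf i ac)).
Lemma cxE i q : U q -> cx i q = coordf c i q. Proof. by move=> Uq; rewrite mk_cinfE. Qed.
Definition cd (i : 'I_n) : lop U := restr (Uc : U `<=` cdomo c) (dop ac i).
Lemma cdE i V (VU : V `<=` U) (f : cinf V) : cd i V f = dop ac i V f.
Proof. exact: restrE. Qed.
Lemma cd_der i : is_der (cd i).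
Proof. exact/is_der_restr/is_der_dop. Qed.
#[local] Opaque cd cx.
Lemma cd_cx i j : cd i U (cx j) = (i == j)%:R.
Proof.
apply: cinf_inj => q Uq; rewrite cdE// dopE//.
rewrite (@pderiv_germ _ _ _ c q (Uc Uq) i U (cx j) (coordf c j) Uq); last by move=> r Ur; exact: cxE.
rewrite (pderiv_coordf ac (Uc Uq)); case: (i == j); by rewrite ?cinf1// cinf0.
Qed.
Lemma cd_comm i j : cd i * cd j = cd j * cd i.
Proof.
apply/eqP; rewrite -subr_eq0; apply/eqP.
apply: (is_der_coord ac Uc); first by apply: is_der_comm; exact: cd_der.
move=> V l f VU hf.
have -> : f = cinf_res VU (cx l) by apply: cinf_inj => q Vq; rewrite cinf_resE// hf// cxE//; exact: VU.
have E k k' : cd k V (cd k' V (cinf_res VU (cx l))) = 0.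
  rewrite -(lop_res _ VU (@subset_refl _ U)) -(lop_res _ VU (@subset_refl _ U)) cd_cx.
  by case: (k' == l); rewrite ?lop0 ?(is_der1 (@subset_refl _ U) (cd_der k)) raddf0.
transitivity (cd i V (cd j V (cinf_res VU (cx l))) - cd j V (cd i V (cinf_res VU (cx l)))).
  reflexivity.
by rewrite (E i j) (E j i); exact: subrr.
Qed.

(** The case of [centralizer] where the class of functions is everything and [d] consists of the
    partial derivatives themselves. *)
Lemma chart_centralizer N : (forall i, ad (cx i) N = 0) -> forall V (f g : cinf V), V `<=` U ->
  N V (f * g) = f * N V g.
Proof.
have ch V (f : cinf V) l (VU : V `<=` U) : (setT : set (cinf V)) f ->
    dop ac l V f = \sum_j cinf_res VU ((l == j)%:R : cinf U) * cd j V f.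
  move=> _; rewrite (bigD1 l)//= eqxx cinf_res1 mul1r big1 ?addr0 ?(cdE _ VU)// => i /negbTE il.
  by rewrite eq_sym il raddf0 mul0r.
have dJ V (f : cinf V) i q s : V `<=` U -> V q -> J c s.+1 f q -> J c s (cd i V f) q.
  by move=> VU Vq; rewrite (cdE _ VU); move=> h; exact: (@J_dop _ _ _ _ ac s V (subset_trans VU Uc) f q i Vq h).
have dc V (f : cinf V) i j : V `<=` U -> (setT : set (cinf V)) f -> cd i V (cd j V f) = cd j V (cd i V f).
  by move=> VU _; exact: (congr1 (fun L : lop U => L V f) (cd_comm i j)).
move=> hN V f g VU.
exact: (@centralizer R n M c ac U Uc n cx cd _ (fun _ => setT) cd_der cd_cx (fun _ _ _ _ _ => I)
  (fun _ _ _ _ _ _ => I) (fun _ _ _ _ _ _ => I) (fun _ _ _ => I) (fun _ _ _ _ _ _ => I)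
  (fun _ => I) dc ch dJ N hN V f g VU I).
Qed.
End Chart.
End ChartCentralizer.

(** * Polarized frames *)

Section Frames.
#[local] Opaque build_lop restr mop dop cinf_res.
Variables (R : realType) (n : nat) (M : manifold R n).
Variables (w : two_form M) (P : M -> set (tvec M)) (hP : polarized_symplectic w P).
Variables (A : dq w) (phi : forall U, {linear A U -> cinft M U}) (hphi : trivialization phi).
Implicit Types U V W : opens M.
Let hw := ps_symplectic hP.

Lemma hamiltonian_germ U p (f g : M -> R[i]) : U p -> (forall q, U q -> f q = g q) ->
  hamiltonian w p f = hamiltonian w p g.
Proof.
move=> Up fg; rewrite /hamiltonian; congr (xget _ _); apply/funext => X; apply/propext.
by split=> -[h1 h2]; split=> // v hv; rewrite h2//; [|apply/esym]; exact: (tangent_germ hv Up fg).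
Qed.

(** The derivation given by the bracket with the symbol of [a]. Read off from the product of [A], it
    is at once a local operator, and the smooth dependence of Hamiltonian vectors on the point comes
    with it. *)
Definition hop U (a : A U) : lop U := Lmul hphi a 1%N - Rmul hphi a 1%N.

Lemma hopE U (a : A U) V (VU : V `<=` U) (f : cinf V) q : V q ->
  hop a V f q = hamiltonian w q (symb a : cinf U) f.
Proof.
move=> Vq; rewrite (LRmul1 hphi a VU f Vq) /poisson.
rewrite (@hamiltonian_germ V q _ (symb a : cinf U) Vq)// => r Vr.
by rewrite symb_res cinf_resE.
Qed.

Let tham q f : tangent q (hamiltonian w q f).
Proof.
have [U0 [x [y [U0q hD]]]] := ps_darboux hP q; have [c ac cq] := atlas_cover q.
by have [] := hamiltonianP hw hD U0q ac cq f.
Qed.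

Lemma is_der_hop U (a : A U) : is_der (hop a).
Proof.
move=> V VU f g; apply: cinf_inj => q Vq.
rewrite (hopE a VU (f * g) Vq) (cinfD _ _ Vq) !(cinfM _ _ Vq) (hopE a VU f Vq) (hopE a VU g Vq).
have hT := tham q (symb a : cinf U).
rewrite (tangent_germ hT (U := V) (g := fun r => f r * g r) Vq); last by move=> r Vr; rewrite cinfM.
by apply: (tangent_leibniz hT); exists V => //; exact: cinf_smooth.
Qed.

Section Local.
Variables (U0 : opens M) (x0 y0 : 'I_n./2 -> M -> R[i]) (hD : darboux_chart w P U0 x0 y0).
Variables (U : opens M) (UU0 : U `<=` U0) (c : chart R n M) (ac : atlas c) (Uc : U `<=` cdom c).
Variables (xt yt : 'I_n./2 -> A U).
Let x i : cinf U := symb (xt i).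
Let y i : cinf U := symb (yt i).
Hypothesis xE : forall i q, U q -> x i q = x0 i q.
Hypothesis yE : forall i q, U q -> y i q = y0 i q.

(** The bracket with [y i] is the derivative in [x i], and the bracket with [x i] is minus the
    derivative in [y i]; hence the sign in [dy]. *)
Let dx i : lop U := hop (yt i).
Let dy i : lop U := - hop (xt i).
Let dx_der i : is_der (dx i). Proof. exact: is_der_hop. Qed.
Let dy_der i : is_der (dy i). Proof. apply: is_derN; exact: is_der_hop. Qed.

Let hval (a : A U) (f0 g0 : M -> R[i]) V (VU : V `<=` U) (f : cinf V) q : V q ->
  (forall r, U r -> (symb a : cinf U) r = f0 r) -> (forall r, V r -> f r = g0 r) ->
  hop a V f q = hamiltonian w q f0 g0.
Proof.
move=> Vq af fg; rewrite (hopE a VU f Vq) (hamiltonian_germ (VU q Vq) af).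
exact: (tangent_germ (tham q f0) Vq fg).
Qed.

Let hx i q : U q -> (forall j, hamiltonian w q (x0 i) (x0 j) = 0) /\
  (forall j, hamiltonian w q (x0 i) (y0 j) = - (i == j)%:R).
Proof. by move=> Uq; exact: (hamiltonian_x hw hD (UU0 Uq) ac (Uc Uq)). Qed.
Let hy i q : U q -> (forall j, hamiltonian w q (y0 i) (x0 j) = (i == j)%:R) /\
  (forall j, hamiltonian w q (y0 i) (y0 j) = 0).
Proof. by move=> Uq; exact: (hamiltonian_y hw hD (UU0 Uq) ac (Uc Uq)). Qed.

Let delta_val V (b : bool) q : V q -> (b%:R : cinf V) q = b%:R.
Proof. by case: b => Vq; [exact: cinf1 | exact: cinf0]. Qed.

Let dxx i j V (VU : V `<=` U) (f : cinf V) : (forall q, V q -> f q = x0 j q) -> dx i V f = (i == j)%:R.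
Proof.
move=> hf; apply: cinf_inj => q Vq.
by rewrite (hval VU Vq (yE i) hf) delta_val//; have [h _] := hy i (VU q Vq); exact: h.
Qed.
Let dxy i j V (VU : V `<=` U) (f : cinf V) : (forall q, V q -> f q = y0 j q) -> dx i V f = 0.
Proof.
move=> hf; apply: cinf_inj => q Vq.
by rewrite (hval VU Vq (yE i) hf) cinf0//; have [_ h] := hy i (VU q Vq); exact: h.
Qed.
Let dyx i j V (VU : V `<=` U) (f : cinf V) : (forall q, V q -> f q = x0 j q) -> dy i V f = 0.
Proof.
move=> hf; apply: cinf_inj => q Vq.
rewrite /dy lopNE (cinfN _ Vq) (hval VU Vq (xE i) hf) cinf0//; have [h _] := hx i (VU q Vq).
by rewrite h oppr0.
Qed.
Let dyy i j V (VU : V `<=` U) (f : cinf V) : (forall q, V q -> f q = y0 j q) -> dy i V f = (i == j)%:R.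
Proof.
move=> hf; apply: cinf_inj => q Vq.
rewrite /dy lopNE (cinfN _ Vq) (hval VU Vq (xE i) hf) delta_val//; have [_ h] := hx i (VU q Vq).
by rewrite h opprK.
Qed.

#[local] Opaque hop.

Let bool_der (D : lop U) V (VU : V `<=` U) (b : bool) : is_der D -> D V b%:R = 0.
Proof. by move=> hD'; case: b; [exact: (is_der1 VU hD') | exact: lop0]. Qed.

(** The commutator is again a derivation and kills every Darboux function, because both derivations
    take the constant values 0 or 1 there; [is_der_eq0] concludes. *)
Let comm0 (D D' : lop U) : is_der D -> is_der D' ->
  (forall j V (VU : V `<=` U) (f : cinf V), (forall q, V q -> f q = x0 j q) -> exists b : bool, D V f = b%:R) ->
  (forall j V (VU : V `<=` U) (f : cinf V), (forall q, V q -> f q = y0 j q) -> exists b : bool, D V f = b%:R) ->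
  (forall j V (VU : V `<=` U) (f : cinf V), (forall q, V q -> f q = x0 j q) -> exists b : bool, D' V f = b%:R) ->
  (forall j V (VU : V `<=` U) (f : cinf V), (forall q, V q -> f q = y0 j q) -> exists b : bool, D' V f = b%:R) ->
  forall V (f : cinf V), D V (D' V f) = D' V (D V f).
Proof.
move=> h h' Dx Dy D'x D'y V f.
suff E : D * D' - D' * D = 0.
  apply/eqP; rewrite -subr_eq0; apply/eqP.
  exact: (congr1 (fun L : lop U => L V f) E).
apply: (is_der_eq0 hw UU0 hD); first exact: is_der_comm.
  move=> W i WU g hg; have [b1 e1] := Dx i W WU g hg; have [b2 e2] := D'x i W WU g hg.
  transitivity (D W (D' W g) - D' W (D W g)); first by [].
  by rewrite e1 e2 !(bool_der WU) ?subr0.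
move=> W i WU g hg; have [b1 e1] := Dy i W WU g hg; have [b2 e2] := D'y i W WU g hg.
transitivity (D W (D' W g) - D' W (D W g)); first by [].
by rewrite e1 e2 !(bool_der WU) ?subr0.
Qed.

Let dx_dx i j V (f : cinf V) : dx i V (dx j V f) = dx j V (dx i V f).
Proof.
apply: comm0; [exact: dx_der | exact: dx_der | | | |] => k W WU g hg.
- by exists (i == k); exact: dxx.
- by exists false; exact: (dxy _ WU hg).
- by exists (j == k); exact: dxx.
- by exists false; exact: (dxy _ WU hg).
Qed.
Let dx_dy i j V (f : cinf V) : dx i V (dy j V f) = dy j V (dx i V f).
Proof.
apply: comm0; [exact: dx_der | exact: dy_der | | | |] => k W WU g hg.
- by exists (i == k); exact: dxx.
- by exists false; exact: (dxy _ WU hg).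
- by exists false; exact: (dyx _ WU hg).
- by exists (j == k); exact: dyy.
Qed.

Let at_val (D : lop U) (f0 : M -> R[i]) (g : cinf U) q : U q -> (forall r, U r -> g r = f0 r) ->
  lop_at D q f0 = D U g q.
Proof.
move=> Uq gf; apply: (lop_atE D (V := U)) => //.
by apply: (msmooth_ext (oset_open U)) (cinf_smooth g).
Qed.

(** At each point the vectors [dy j] span [P]: a vector killing all [x j] is their combination with
    coefficients its values on the [y j]. *)
Lemma frame_polarized V (VU : V `<=` U) (f : cinf V) :
  polarized_fun P (f : cinf_sheaf M V) <-> forall i, dy i V f = 0.
Proof.
have [_ _ _ PE] := hD; split=> [hf i|hf q Vq X].
  apply: cinf_inj => q Vq; rewrite cinf0//; have Uq := VU q Vq.
  rewrite -(lop_atcE (dy i) f VU Vq); apply: (hf q Vq); rewrite PE; last exact: UU0.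
  split; first exact: tangent_lop.
  by move=> j; rewrite (at_val (dy i) Uq (xE j)) (dyx i (@subset_refl _ U) (xE j)) cinf0.
have Uq := VU q Vq.
rewrite PE; last exact: UU0.
move=> [hX Xx].
have E : X = fun h => \sum_j X (y0 j) * lop_at (dy j) q h.
  apply: (darboux_eq hw hD (UU0 Uq) hX).
    by apply: tangent_sum => j; exact: tangent_lop.
  - move=> i; rewrite Xx big1// => j _.
    by rewrite (at_val (dy j) Uq (xE i)) (dyx j (@subset_refl _ U) (xE i)) cinf0// mulr0.
  - move=> i; rewrite (bigD1 i)//= (at_val (dy i) Uq (yE i)) (dyy i (@subset_refl _ U) (yE i)).
    rewrite eqxx delta_val// mulr1 big1 ?addr0// => j /negbTE ji.
    by rewrite (at_val (dy j) Uq (yE i)) (dyy j (@subset_refl _ U) (yE i)) ji delta_val// mulr0.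
by rewrite E big1// => j _; rewrite (lop_atcE (dy j) f VU Vq) hf cinf0// mulr0.
Qed.

Let Odx V (f : cinf V) i : V `<=` U -> polarized_fun P (f : cinf_sheaf M V) ->
  polarized_fun P (dx i V f : cinf_sheaf M V).
Proof.
move=> VU /(frame_polarized VU) h; apply/(frame_polarized VU) => j.
by rewrite -dx_dy h lop0.
Qed.

(** The difference of a partial derivative and its expansion in [dx j] and [dy j] is a derivation
    killing the Darboux functions, hence 0; on a polarized function the [dy j] terms drop out. *)
Let chain V (f : cinf V) l (VU : V `<=` U) : polarized_fun P (f : cinf_sheaf M V) ->
  dop ac l V f = \sum_j cinf_res VU (cd ac Uc l U (x j)) * dx j V f.
Proof.
move=> /(frame_polarized VU) hf.
pose bx j : cinf U := cd ac Uc l U (x j); pose b' j : cinf U := cd ac Uc l U (y j).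
pose N : lop U := cd ac Uc l - (\sum_j mop (bx j) * dx j + \sum_j mop (b' j) * dy j).
have NE W (WU : W `<=` U) (g : cinf W) : N W g = cd ac Uc l W g -
    (\sum_j cinf_res WU (bx j) * dx j W g + \sum_j cinf_res WU (b' j) * dy j W g).
  rewrite /N lopBE lopDE !lop_sumE; congr (_ - (_ + _)); apply: eq_bigr => j _.
    by rewrite lopME (mopE _ WU).
  by rewrite lopME (mopE _ WU).
have N0 : N = 0.
  apply: (is_der_eq0 hw UU0 hD).
  - apply: is_derB; first exact: cd_der.
    by apply: is_derD; apply: is_der_sum => j; apply: is_der_mop.
  - move=> W i WU g hg; rewrite NE; set z := (\sum_j _ * dy j W g).
    have -> : z = 0 by rewrite /z big1// => j _; rewrite (dyx j WU hg) mulr0.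
    rewrite addr0 (bigD1 i)//= (dxx i WU hg) eqxx mulr1 big1 ?addr0; last first.
      by move=> j /negbTE ji; rewrite (dxx j WU hg) ji mulr0.
    have -> : g = cinf_res WU (x i).
      by apply: cinf_inj => q Wq; rewrite cinf_resE// hg// xE//; exact (WU q Wq).
    by rewrite -lop_res// subrr.
  - move=> W i WU g hg; rewrite NE; set z := (\sum_j _ * dx j W g).
    have -> : z = 0 by rewrite /z big1// => j _; rewrite (dxy j WU hg) mulr0.
    rewrite add0r (bigD1 i) // (dyy i WU hg) eqxx mulr1 big1 ?addr0; last first.
      by move=> j /andP[_ /negbTE ji]; rewrite (dyy j WU hg) ji mulr0.
    have -> : g = cinf_res WU (y i).
      by apply: cinf_inj => q Wq; rewrite cinf_resE// hg// yE//; exact (WU q Wq).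
    by rewrite -lop_res// [X in _ - X]addr0 subrr.
have := NE V VU f; rewrite N0 lop0E => /esym/eqP.
rewrite subr_eq0 => /eqP; rewrite (cdE _ _ _ VU) => ->.
by rewrite [X in _ + X]big1 ?addr0// => j _; rewrite hf mulr0.
Qed.

(** In the chart [dx i] is a combination of partial derivatives with smooth coefficients, so it
    lowers the order of vanishing by at most one. *)
Let dx_J V (f : cinf V) i q s : V `<=` U -> V q -> J c s.+1 f q -> J c s (dx i V f) q.
Proof.
move=> VU Vq hJ.
pose N : lop U := dx i - \sum_l mop (dx i U (cx ac Uc l)) * cd ac Uc l.
have NE W (WU : W `<=` U) (g : cinf W) : N W g = dx i W g -
    \sum_l cinf_res WU (dx i U (cx ac Uc l)) * cd ac Uc l W g.
  rewrite /N lopBE !lop_sumE; congr (_ - _); apply: eq_bigr => j _.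
  by rewrite lopME (mopE _ WU).
have N0 : N = 0.
  apply: (is_der_coord hP ac Uc).
    by apply: is_derB => //; apply: is_der_sum => j; apply: is_der_mop; exact: cd_der.
  move=> W l g WU hg.
  have -> : g = cinf_res WU (cx ac Uc l).
    by apply: cinf_inj => r Wr; rewrite cinf_resE// hg// cxE//; exact: WU.
  rewrite NE (bigD1 l)//= -(lop_res (dx i) WU (@subset_refl _ U)) -(lop_res (cd ac Uc l) WU (@subset_refl _ U)) cd_cx eqxx cinf_res1 mulr1.
  rewrite big1 ?addr0 ?subrr// => j /negbTE jl.
  by rewrite -[cd _ _ _ _ _]lop_res// cd_cx jl raddf0 mulr0.
have := NE V VU f; rewrite N0 lop0E => /esym/eqP; rewrite subr_eq0 => /eqP ->.
have Vc := subset_trans VU Uc.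
apply: (@J_sum _ _ _ _ ac s V Vc _ _ _ q Vq) => l; apply: (@J_Mr _ _ _ _ ac s V Vc _ _ q Vq).
by rewrite (cdE _ _ _ VU); exact: (@J_dop _ _ _ _ ac s V Vc f q l Vq hJ).
Qed.

Lemma frame_centralizer N : (forall i, ad (x i) N = 0) -> forall V (a g : cinf V), V `<=` U ->
  polarized_fun P (a : cinf_sheaf M V) -> N V (a * g) = a * N V g.
Proof.
move=> hN V a g VU ha.
have dcst i W (WU : W `<=` U) z : dy i W (cinf_cst W z) = 0.
  have -> : cinf_cst W z = z *: (1 : cinf W) by rewrite -cinf_cst_mul mulr1.
  by rewrite lopZ (is_der1 WU (dy_der i)) scaler0.
have OD W (f h : cinf W) : W `<=` U -> polarized_fun P (f : cinf_sheaf M W) ->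
    polarized_fun P (h : cinf_sheaf M W) -> polarized_fun P (f + h : cinf_sheaf M W).
  move=> WU /(frame_polarized WU) h1 /(frame_polarized WU) h2; apply/(frame_polarized WU) => i.
  by rewrite lopD h1 h2 addr0.
have OM W (f h : cinf W) : W `<=` U -> polarized_fun P (f : cinf_sheaf M W) ->
    polarized_fun P (h : cinf_sheaf M W) -> polarized_fun P (f * h : cinf_sheaf M W).
  move=> WU /(frame_polarized WU) h1 /(frame_polarized WU) h2; apply/(frame_polarized WU) => i.
  by rewrite (dy_der i WU) h1 h2 mul0r mulr0 addr0.
have Ocst W z : W `<=` U -> polarized_fun P (cinf_cst W z : cinf_sheaf M W).
  by move=> WU; apply/(frame_polarized WU) => i; exact: dcst.
have Ores W W' (h : W' `<=` W) (f : cinf W) : W `<=` U -> polarized_fun P (f : cinf_sheaf M W) ->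
    polarized_fun P (cinf_res h f : cinf_sheaf M W').
  by move=> WU hf q Wq X PX; rewrite -(hf q (h q Wq) X PX); have [_ _ _ PE] := hD;
    move: PX; rewrite PE; [move=> [hX _]; apply: (tangent_germ hX Wq) => r Wr; rewrite cinf_resE |
    apply: UU0; apply: WU; exact: h].
have Ox i : polarized_fun P (x i : cinf_sheaf M U).
  by apply/(frame_polarized (@subset_refl _ U)) => j; exact: (dyx j (@subset_refl _ U) (xE i)).
have dxd i j : dx i U (x j) = (i == j)%:R by exact: (dxx i (@subset_refl _ U) (xE j)).
exact: (@centralizer R n M c ac U Uc _ x dx _ (fun W => @polarized_fun R n M P W) dx_der dxd
  Odx OD OM Ocst Ores Ox (fun W f i j _ _ => dx_dx i j f) chain dx_J N hN V a g VU ha).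
Qed.

Lemma frame_dual i j : dx i U (x j) = (i == j)%:R.
Proof. exact: (dxx i (@subset_refl _ U) (xE j)). Qed.

End Local.

Variable O : forall U : opens M, set (A U).

(** What the straightening retains of Darboux coordinates. The lifts [xt] lie in [O], while the [yt]
    act only through their derivations. [fr_central] is stated over every smaller open set because
    an operator there need not come from one over [U]. *)
Record frame (U : opens M) (xt yt : 'I_n./2 -> A U) : Prop := Frame {
  fr_O : forall i, O (xt i);
  fr_dual : forall i j, hop (yt i) U (symb (xt j)) = (i == j)%:R;
  fr_pol : forall V (VU : V `<=` U) (f : cinf V),
    polarized_fun P (f : cinf_sheaf M V) <-> forall i, hop (xt i) V f = 0;
  fr_central : forall U' (UU : U' `<=` U) (N : lop U'),
    (forall i, ad (cinf_res UU (symb (xt i))) N = 0) ->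
    forall V (a g : cinf V), V `<=` U' -> polarized_fun P (a : cinf_sheaf M V) ->
    N V (a * g) = a * N V g }.

Lemma frame_exists (hO : is_pdq P O) p : exists (U : opens M) (xt yt : 'I_n./2 -> A U), U p /\ frame xt yt.
Proof.
have [U0 [x0 [y0 [U0p hD]]]] := ps_darboux hP p; have [c ac cp] := atlas_cover p.
have [xs _ _ PE] := hD.
have x0P i : polarized_fun P (mk_cinf (xs i).1 : cinf_sheaf M U0).
  move=> q U0q X; rewrite PE// => -[hX Xx]; rewrite -(Xx i).
  by apply: (tangent_germ hX U0q) => r U0r; rewrite mk_cinfE.
(* The symbol map is onto polarized functions only in the sense of sheaves, so each [x i] lifts near
   [p] only; the finitely many neighbourhoods are then intersected. *)
have /choice[V hV] i : exists V : opens M, exists VU : V `<=` U0, V p /\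
    (@symb _ _ _ _ A V @` @O V) (cinf_res VU (mk_cinf (xs i).1)).
  have /(pdq_symbol hO)/(_ p U0p)[V [VU [Vp h]]] := x0P i.
  by exists V, VU.
have : \forall q \near p, forall i, V i q.
  apply: (@filter_forall _ _ (fun i q => V i q) (nbhs p) (nbhs_filter p)) => i.
  apply: open_nbhs_nbhs; split; first exact: oset_open.
  by have [? []] := hV i.
case/near_open => S [oS Sp hS].
pose U := capo (capo (Opens oS) U0) (cdomo c).
have UV i : U `<=` V i by move=> q [[Sq _] _]; exact: hS.
have UU0 : U `<=` U0 by move=> q [[]].
have Uc : U `<=` cdom c by move=> q [].
have /choice[xt hxt] i : exists a : A U, O a /\ (forall q, U q -> (symb a : cinf U) q = x0 i q).
  have [VU [Vp [a Oa e]]] := hV i; exists (res A (UV i) a); split; first exact: (sub_res (pdq_sub hO)).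
  move=> q Uq; rewrite symb_res e; have Vq := UV i q Uq.
  transitivity ((cinf_res VU (mk_cinf (xs i).1)) q); first exact: cinf_resE.
  by rewrite cinf_resE// mk_cinfE//; exact: UU0.
pose ys i : cinf U := cinf_res UU0 (mk_cinf (xs i).2).
pose yt i : A U := psi hphi (fcst (ys i)).
have yE i q : U q -> (symb (yt i) : cinf U) q = y0 i q.
  by move=> Uq; rewrite symb_psi [LHS]cinf_resE// mk_cinfE//; exact (UU0 q Uq).
have xE i := (hxt i).2.
exists U, xt, yt; split=> //; split.
- by move=> i; have [] := hxt i.
- exact: (frame_dual hD UU0 ac Uc xE yE).
- move=> W WU f; rewrite (frame_polarized hD UU0 ac Uc xE yE WU); split=> h i; last first.
    by rewrite lopNE h oppr0.
  by have := h i; rewrite lopNE => /eqP; rewrite oppr_eq0 => /eqP.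
- move=> U' UU N hN; have U'U0 := subset_trans UU UU0; have U'c := subset_trans UU Uc.
  apply: (@frame_centralizer U0 x0 y0 hD U' U'U0 c ac U'c (fun i => res A UU (xt i)) (fun i => res A UU (yt i))).
  + by move=> i q U'q; rewrite symb_res [LHS]cinf_resE// xE//; exact (UU q U'q).
  + by move=> i q U'q; rewrite symb_res [LHS]cinf_resE// yE//; exact (UU q U'q).
  + by move=> i; rewrite symb_res; exact: hN.
Qed.

End Frames.

Section Unital.
Variables (R : realType) (n : nat) (M : manifold R n).
Implicit Types U V W : opens M.

(** Coefficientwise form of [N 1 = 1], with [N] equal to the identity modulo t. A multiplication
    composed with such an [N] is recovered from its value on 1. *)
Definition unital U (N : ser (lop U)) :=
  N 0%N = 1 /\ forall k V, V `<=` U -> N k.+1 V 1 = 0.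

Lemma unital_act U (N : ser (lop U)) V (VU : V `<=` U) : unital N ->
  act N (fcst (1 : cinf V)) = fcst 1.
Proof.
move=> [N0 N1]; apply: fpsP => -[|k]; rewrite act_fcst; last exact: N1.
by rewrite N0; exact: lop1E.
Qed.
Lemma unitalP U (N : ser (lop U)) : N 0%N = 1 ->
  (forall V, V `<=` U -> act N (fcst (1 : cinf V)) = fcst 1) -> unital N.
Proof.
move=> N0 N1; split=> // k V VU; have := congr1 (fun f : fps (cinf V) => f k.+1) (N1 V VU).
by rewrite act_fcst.
Qed.
Lemma unital_ev U (N : ser (lop U)) : unital N -> ev N = fcst 1.
Proof. by move=> hN; rewrite evE unital_act. Qed.
Lemma unitalM U (N N' : ser (lop U)) : unital N -> unital N' -> unital (N * N').
Proof.
move=> hN hN'; apply: unitalP; first by rewrite serM0 hN.1 hN'.1 mulr1.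
by move=> V VU; rewrite actM !unital_act.
Qed.
Lemma unital1 U : unital (1 : ser (lop U)).
Proof. by split. Qed.
Lemma unital_inv U (N N' : ser (lop U)) : N' 0%N = 1 -> N' * N = 1 -> unital N -> unital N'.
Proof.
move=> N'0 NN hN; apply: unitalP => // V VU.
by rewrite -{1}(unital_act VU hN) -actM NN act1.
Qed.
Lemma unital_srestr U V (VU : V `<=` U) (N : ser (lop U)) : unital N -> unital (srestr VU N).
Proof.
move=> hN; apply: unitalP; first by rewrite srestr_coef hN.1 restr1.
by move=> W WV; rewrite act_srestr// unital_act//; exact: subset_trans VU.
Qed.

Lemma ev_mserM U (h : fps (cinf U)) (N : ser (lop U)) : unital N -> ev (mser h * N) = h.
Proof. by move=> hN; rewrite ev_mul (unital_ev hN) -evE ev_mser. Qed.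
End Unital.

Lemma mser_fcst (R : realType) (n : nat) (M : manifold R n) (U : opens M) (g : cinf U) :
  mser (fcst g) = ser_cst (mop g).
Proof. by apply: serP => -[|k] //; rewrite mser_coef /= mop0. Qed.

Lemma ser_low_mul (B : pzRingType) (a b : ser B) k : (forall j, (j < k)%N -> a j = 0) ->
  (a * b) k = a k * b 0%N.
Proof.
by move=> h; rewrite (ser_mull_top (a' := 0)) ?mul0r ?add0r ?ser0E ?subr0.
Qed.

(** For two commuting pairs, this identity at the first order where the errors [s * l - x * s] are
    nonzero is the compatibility required by [joint_primitive]. *)
Lemma intertwiner_square (B : pzRingType) (s l l' x x' : B) : l * l' = l' * l -> x * x' = x' * x ->
  (s * l - x * s) * l' - x' * (s * l - x * s) = (s * l' - x' * s) * l - x * (s * l' - x' * s).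
Proof.
move=> ll xx; rewrite !mulrBl !mulrBr -!(mulrA s) ll !mulrA xx !opprB [LHS]addrACA [RHS]addrACA.
by congr (_ + _); exact: addrC.
Qed.

(** * Formal exponentials of derivations *)

Section Exponential.
Variables (R : realType) (n : nat) (M : manifold R n).
Implicit Types U V W : opens M.

(** The derivation t d/dt of series, which turns exponentials into solutions of a linear
    differential equation. *)
Definition theta U (N : ser (lop U)) : ser (lop U) := Ser (fun k => k%:R *: N k).

Lemma thetaE U (N : ser (lop U)) k : theta N k = k%:R *: N k. Proof. by []. Qed.

Lemma thetaM U (N N' : ser (lop U)) : theta (N * N') = theta N * N' + N * theta N'.
Proof.
apply: serP => k; rewrite serDE !serME /theta /= scaler_sumr -big_split /=.
apply: eq_bigr => i _; rewrite lopZl lopZr -scalerDl -natrD subnKC//; exact: leq_ord.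
Qed.

(* The formal exponential [E] of [t ^ j v], characterized by [t dE/dt = j t ^ j v E]. *)
Definition is_exp U (j : nat) (v : lop U) (E : ser (lop U)) :=
  E 0%N = 1 /\ theta E = ser_mon j (j%:R *: v) * E.

(** As [j] is positive, the equation expresses k+1 times coefficient k+1 through lower coefficients,
    and k+1 is invertible in [R[i]]. *)
Lemma theta_uniq U j (v : lop U) (F G : ser (lop U)) : (0 < j)%N -> F 0%N = G 0%N ->
  theta F = ser_mon j v * F -> theta G = ser_mon j v * G -> F = G.
Proof.
move=> j0 FG hF hG; apply: serP => k; have [m] := ubnP k; elim: m k => // m IH [|k] // km.
have eF := congr1 (fun s : ser (lop U) => s k.+1) hF.
have eG := congr1 (fun s : ser (lop U) => s k.+1) hG.
have e : (k.+1%:R : R[i]) *: F k.+1 = k.+1%:R *: G k.+1.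
  move: eF eG; rewrite !thetaE !ser_mon_mull => -> ->; case: ifP => // jk.
  by rewrite IH//; lia.
have := congr1 (fun N : lop U => (k.+1%:R : R[i])^-1 *: N) e.
by rewrite !scalerA mulVf ?pnatr_eq0// !scale1r.
Qed.

Lemma is_exp_exists U j (v : lop U) : (0 < j)%N -> exists E, is_exp j v E.
Proof.
move=> j0; pose Q (E : ser (lop U)) i := E 0%N = 1 /\ theta E i = (ser_mon j (j%:R *: v) * E) i.
have Qext k (E E' : ser (lop U)) i : (forall i, (i < k)%N -> E' i = E i) -> (i < k)%N -> Q E i -> Q E' i.
  move=> e ik [E0 Ei]; split; first by rewrite e//; exact: leq_ltn_trans ik.
  rewrite thetaE e// -thetaE Ei !ser_mon_mull; case: ifP => // ji; congr (_ * _).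
  by rewrite e//; exact: leq_ltn_trans (leq_subr _ _) ik.
have [E hE] : exists E : ser (lop U), forall k i, (i < k)%N -> Q E i.
  apply: (ser_limit (P := fun k E => forall i, (i < k)%N -> Q E i) (s0 := 1)) => // [k E hE|k E E' e hE i ik]; last first.
    exact: (Qext k E E' i e ik (hE i ik)).
  case: k hE => [|k] hE.
    exists (1 : ser (lop U)) => // -[|i] // _; split=> //.
    by rewrite thetaE scale0r ser_mon_mull leqNgt j0.
  pose a := (k.+1%:R : R[i])^-1 *: (ser_mon j (j%:R *: v) * E) k.+1.
  have e i : (i < k.+1)%N -> upd E k.+1 a i = E i by exact: upd_lt.
  exists (upd E k.+1 a); last exact: e.
  move=> i; rewrite ltnS leq_eqVlt => /orP[/eqP->|ik]; last exact: (Qext k.+1 E _ i e ik (hE i ik)).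
  split; first by rewrite e//; exact: (hE 0%N isT).1.
  rewrite thetaE upd_eq /a scalerA mulfV ?pnatr_eq0// scale1r !ser_mon_mull; case: ifP => // jk; congr (_ * _).
  by rewrite upd_lt//; lia.
by exists E; split; [exact: (hE 1%N 0%N isT).1 | apply: serP => k; exact: (hE k.+1 k (ltnSn k)).2].
Qed.

Section ExpTheory.
Variables (U : opens M) (j : nat) (j0 : (0 < j)%N) (v : lop U) (hv : is_der v).

Lemma is_exp_lt (E : ser (lop U)) i : is_exp j v E -> (0 < i < j)%N -> E i = 0.
Proof.
move=> [E0 hE] /andP[i0 ij]; have := congr1 (fun s : ser (lop U) => s i) hE.
rewrite thetaE ser_mon_mull leqNgt ij /=.
move=> /(congr1 (fun N : lop U => (i%:R : R[i])^-1 *: N)).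
by rewrite scalerA mulVf ?pnatr_eq0 -?lt0n// scale1r scaler0.
Qed.
Lemma is_exp_eq (E : ser (lop U)) : is_exp j v E -> E j = v.
Proof.
move=> [E0 hE]; have := congr1 (fun s : ser (lop U) => s j) hE.
rewrite thetaE ser_mon_mull leqnn subnn E0 mulr1.
move=> /(congr1 (fun N : lop U => (j%:R : R[i])^-1 *: N)).
by rewrite !scalerA mulVf ?pnatr_eq0 -?lt0n// !scale1r.
Qed.
Lemma is_exp_unital (E : ser (lop U)) : is_exp j v E -> unital E.
Proof.
move=> [E0 hE]; split=> // k V VU; have [m] := ubnP k; elim: m k => // m IH k km.
have := congr1 (fun s : ser (lop U) => s k.+1 V 1) hE.
rewrite thetaE ser_mon_mull lopZE.
have -> : (if (j <= k.+1)%N then j%:R *: v * E (k.+1 - j)%N else 0) V 1 = 0.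
  case: ifP => jk; last by rewrite lop0E.
  rewrite lopME lopZE; have [e|e] := posnP (k.+1 - j)%N.
    by rewrite e E0 (lop1E VU) (is_der1 VU hv) scaler0.
  rewrite -(prednK e) IH ?lop0 ?scaler0//; rewrite -ltnS (prednK e).
  by lia.
move=> /(congr1 (fun N : cinf V => (k.+1%:R : R[i])^-1 *: N)).
by rewrite scalerA mulVf ?pnatr_eq0// scale1r scaler0.
Qed.

(** Both sides solve the equation of [E] with initial value [mop f]. For the right-hand side, the
    commutator of [v] with a multiplication is the multiplication by the image under [v]. *)
Lemma is_exp_cst (E : ser (lop U)) (f : cinf U) : is_exp j v E ->
  E * mser (fcst f) = mser (act E (fcst f)) * E.
Proof.
move=> [E0 hE]; set h := act E (fcst f).
have tf : theta (mser (fcst f)) = 0.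
  by apply: serP => -[|k]; rewrite thetaE mser_coef ?scale0r//= mop0 scaler0.
have th : theta (mser h) = ser_mon j (j%:R *: v) * mser h - mser h * ser_mon j (j%:R *: v).
  apply: serP => k; rewrite serBE thetaE !mser_coef /h act_fcst.
  rewrite ser_mon_mull ser_mon_mulr; case: ifP => jk; last first.
    have := congr1 (fun s : ser (lop U) => s k U f) hE; rewrite thetaE ser_mon_mull jk lopZE lop0E.
    by rewrite -mopZ => ->; rewrite mop0 subrr.
  rewrite -mopZ mser_coef act_fcst.
  have -> : j%:R *: v * mop (E (k - j)%N U f) - mop (E (k - j)%N U f) * (j%:R *: v) =
     j%:R *: ad (E (k - j)%N U f) v by rewrite /ad scalerBr lopZl lopZr.
  rewrite ad_der// -mopZ; congr mop.
  by have := congr1 (fun s : ser (lop U) => s k U f) hE; rewrite thetaE ser_mon_mull jk !lopZE.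
apply: (@theta_uniq U j (j%:R *: v) _ _ j0).
- by rewrite !serM0 E0 mul1r mulr1 !mser_coef /h act_fcst E0 lop1E.
- by rewrite thetaM tf mulr0 addr0 hE mulrA.
- by rewrite thetaM th hE mulrBl !mulrA subrK.
Qed.

(** The exponential of a derivation is an automorphism of the functions; the case of constants
    spreads to series by reordering convolutions. *)
Lemma is_exp_aut (E : ser (lop U)) (f : fps (cinf U)) : is_exp j v E ->
  E * mser f = mser (act E f) * E.
Proof.
move=> hE; apply: serP => k; rewrite !serME.
have cst i (g : cinf U) : E i * mop g = \sum_(r < i.+1) mop (E r U g) * E (i - r)%N.
  have := congr1 (fun s : ser (lop U) => s i) (is_exp_cst g hE).
  rewrite mser_fcst ser_mul_cst serME => ->.
  by apply: eq_bigr => r _; rewrite mser_coef act_fcst.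
transitivity (\sum_(i < k.+1) \sum_(r < i.+1) mop (E r U (f (k - i)%N)) * E (i - r)%N).
  by apply: eq_bigr => i _; rewrite mser_coef cst.
rewrite (conv_assoc k (fun r l s => mop (E r U (f s)) * E l)).
transitivity (\sum_(i < k.+1) \sum_(r < i.+1) mop (E r U (f (i - r)%N)) * E (k - i)%N); last first.
  apply: eq_bigr => i _; rewrite mser_coef act_coef -mulr_suml; congr (_ * _).
  exact/esym/(big_morph _ (@mopD _ _ _ U) (@mop0 _ _ _ U)).
rewrite (conv_assoc k (fun r s l => mop (E r U (f s)) * E l)).
apply: eq_bigr => r _.
by rewrite (conv_rev (k - r) (fun l s => mop (E r U (f s)) * E l)).
Qed.
End ExpTheory.

Lemma is_exp_srestr U V (VU : V `<=` U) j (v : lop U) (E : ser (lop U)) :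
  is_exp j v E -> is_exp j (restr VU v) (srestr VU E).
Proof.
move=> [E0 hE]; split; first by rewrite srestr_coef E0 restr1.
have -> : theta (srestr VU E) = srestr VU (theta E) by apply: serP => k; rewrite /= -restrZ.
rewrite hE srestrM; congr (_ * _); apply: serP => k /=.
by case: ifP => _; rewrite ?restr0// restrZ.
Qed.
End Exponential.

Lemma actB (R : realType) (n : nat) (M : manifold R n) (U V : opens M) (N N' : ser (lop U))
  (f : fps (cinf V)) : act (N - N') f = act N f - act N' f.
Proof.
apply: fpsP => k; rewrite fpsD fpsN !act_coef -sumrN -big_split /=.
by apply: eq_bigr => i _; rewrite -lopBE.
Qed.

Lemma hop_def (R : realType) (n : nat) (M : manifold R n) (w : two_form M) (A : dq w)
  (phi : forall U, {linear A U -> cinft M U}) (hphi : trivialization phi) (U : opens M) (a : A U) :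
  hop hphi a = Lmul hphi a 1%N - Rmul hphi a 1%N.
Proof. by []. Qed.

(** * Local straightening *)

Section Straightening.
#[local] Opaque build_lop restr mop Lmul Rmul hop.
Variables (R : realType) (n : nat) (M : manifold R n).
Variables (w : two_form M) (P : M -> set (tvec M)) (hP : polarized_symplectic w P).
Variables (A : dq w) (phi : forall U, {linear A U -> cinft M U}) (hphi : trivialization phi).
Hypothesis phi1 : forall U, phi U (aone A U) = fcst (1 : cinf U) :> fps (cinf U).
Variable O : forall U : opens M, set (A U).
Hypothesis hO : is_pdq P O.
Implicit Types U V W : opens M.
Local Notation L := (Lmul hphi).
Local Notation Rm := (Rmul hphi).

(** When [T] is unital and intertwines [L a] with some multiplication, the multiplier must be
    [ev (T * L a)]; hence this particular difference measures the failure. *)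
Definition defect V (T : ser (lop V)) (a : A V) : ser (lop V) :=
  T * L a - mser (ev (T * L a)) * T.

Definition straight U (T : ser (lop U)) := unital T /\
  forall V (VU : V `<=` U) (a : A V), O a -> defect (srestr VU T) a = 0.

Definition straight_mod K U (T : ser (lop U)) := unital T /\
  forall V (VU : V `<=` U) (a : A V), O a -> forall j, (j < K)%N ->
    defect (srestr VU T) a j = 0.

Lemma defect0 V (T : ser (lop V)) (a : A V) (h : fps (cinf V)) : unital T ->
  T * L a = mser h * T -> defect T a = 0.
Proof. by move=> hT e; rewrite /defect e ev_mserM// subrr. Qed.

Lemma straight_ev U (T : ser (lop U)) V (VU : V `<=` U) (a : A V) : straight T -> O a ->
  srestr VU T * L a = mser (ev (srestr VU T * L a)) * srestr VU T.
Proof. by move=> [_ h] Oa; apply/eqP; rewrite -subr_eq0; apply/eqP; exact: h. Qed.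

Lemma defect_res V W (WV : W `<=` V) (T : ser (lop V)) (a : A V) :
  srestr WV (defect T a) = defect (srestr WV T) (res A WV a).
Proof.
rewrite /defect srestrB !srestrM srestr_mser Lmul_res.
suff -> : Fps (fun k => cinf_res WV (ev (T * L a) k)) = ev (srestr WV T * L (res A WV a)) by [].
apply: fpsP => k; transitivity (cinf_res WV (ev (T * L a) k)); first by [].
by rewrite -ev_srestr srestrM Lmul_res.
Qed.

Lemma defect_ext K V (T T' : ser (lop V)) (a : A V) : (forall i, (i < K)%N -> T i = T' i) ->
  forall i, (i < K)%N -> defect T a i = defect T' a i.
Proof.
move=> e; have eL := ser_mul_eq e (fun i _ => erefl (L a i)).
move=> i iK; rewrite !serBE eL//; congr (_ - _); apply: (ser_mul_eq _ e iK) => l lK.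
by rewrite !mser_coef !ev_coef eL.
Qed.

(** Altering the coefficient of order [K] by [D] changes the defect there by the failure of Leibniz'
    rule for [D] with first factor the symbol of [a]. This is linear in [D], the source of both the
    local corrections and the gluing. *)
Lemma defect_top K V (T T' : ser (lop V)) (a : A V) : (0 < K)%N -> T 0%N = 1 ->
  (forall i, (i < K)%N -> T i = T' i) ->
  defect T a K = defect T' a K + ((T K - T' K) * mop (symb a : cinf V) -
    mop ((T K - T' K) V (symb a : cinf V)) - mop (symb a : cinf V) * (T K - T' K)).
Proof.
move=> K0 T0 TT'; set D := T K - T' K; set a0 : cinf V := symb a; have T'0 : T' 0%N = 1 by rewrite -TT'.
have tl : (T * L a) K = (T' * L a) K + D * mop a0 by rewrite (ser_mull_top _ TT') Lmul0.
rewrite /defect !serBE tl; set h := ev (T * L a); set h' := ev (T' * L a).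
have hlt i : (i < K)%N -> mser h i = mser h' i.
  by move=> iK; rewrite !mser_coef /h /h' !ev_coef (ser_mul_eq TT' (fun _ _ => erefl) iK).
have hK : mser h K - mser h' K = mop (D V a0).
  rewrite !mser_coef -mopB /h /h' !ev_coef tl lopDE addrAC subrr add0r lopME.
  by rewrite (mopE _ (@subset_refl _ V)) mulr1 cinf_res_id.
have h'0 : mser h' 0%N = mop a0.
  rewrite mser_coef /h' ev_coef serM0 Lmul0 T'0 mul1r.
  by rewrite (mopE _ (@subset_refl _ V)) mulr1 cinf_res_id.
rewrite (ser_mull_top _ hlt) (ser_mulr_top _ TT') hK h'0 -/D T0 mulr1 !opprD !addrA.
rewrite [LHS]addrAC; congr (_ - _ - _); exact: addrAC.
Qed.

Definition polarized_ser V (f : fps (cinf V)) := forall k, polarized_fun P (f k : cinf_sheaf M V).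

Section Frame.
Variables (U : opens M) (xt yt : 'I_n./2 -> A U) (hfr : frame P hphi O xt yt).
Let x i : cinf U := symb (xt i).
Let X i : ser (lop U) := ser_cst (mop (x i)).
Let xtC i j : L (xt i) * L (xt j) = L (xt j) * L (xt i).
Proof. by rewrite -!LmulM (pdq_comm hO (fr_O hfr i) (fr_O hfr j)). Qed.
Let cC i j : X i * X j = X j * X i.
Proof. by apply: serP => -[|k]; rewrite ser_cst_comm ser_mul_cst /= ?mulr0 ?mul0r// mopC. Qed.

(** At order k+1 the unknown coefficient must have the commutators [- E i k.+1] with the [x i].
    Their compatibility comes from the lifts commuting in [A], which they do because they lie in the
    commutative [O]. *)
Lemma local_intertwiner : exists S, unital S /\ forall i, S * L (xt i) = X i * S.
Proof.
pose Q k (S : ser (lop U)) := (forall j, (j < k)%N -> if j is 0%N then S j = 1 else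
    forall V, V `<=` U -> S j V 1 = 0) /\ forall i j, (j < k)%N -> (S * L (xt i)) j = (X i * S) j.
have Qext k (S S' : ser (lop U)) : (forall j, (j < k)%N -> S' j = S j) -> Q k S -> Q k S'.
  move=> e [h1 h2]; split=> [j jk|i j jk].
    by have := h1 j jk; rewrite -(e j jk).
  by rewrite (ser_mul_eq e (fun _ _ => erefl) jk) h2// (ser_mul_eq (fun _ _ => erefl) e jk).
have [S hS] : exists S, forall k, Q k S.
  apply: (ser_limit (P := Q) (s0 := 1)); [by split | | exact: Qext].
  move=> [|k] S hQ.
    exists 1 => //; split=> [[|j]|i [|j]] // _.
    by rewrite mul1r mulr1 Lmul0 /X.
  have e0 : forall j, (j < k.+1)%N -> upd S k.+1 0 j = S j by move=> j; exact: upd_lt.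
  (* The coefficient to be found is first reset to 0, so that the correction [D] is the whole new
     coefficient. *)
  have {e0} [S' [hQ' S'0 S'S]] : exists S', [/\ Q k.+1 S', S' k.+1 = 0 & forall j, (j < k.+1)%N -> S' j = S j].
    by exists (upd S k.+1 0); split; [exact: Qext e0 hQ | exact: upd_eq |].
  suff [S'' h1 h2] : exists2 S'', Q k.+2 S'' & forall j, (j < k.+1)%N -> S'' j = S' j.
    by exists S'' => // j jk; rewrite h2// S'S.
  move: S' hQ' S'0 {S'S S hQ} => S hQ S0; have [_ hS] := hQ.
  pose E i : ser (lop U) := S * L (xt i) - X i * S.
  have sq i j : E j * L (xt i) - X i * E j = E i * L (xt j) - X j * E i.
    exact: (intertwiner_square S (xtC j i) (cC j i)).
  have EE i : E i = S * L (xt i) - X i * S by [].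
  have E0 i j : (j < k.+1)%N -> E i j = 0 by move=> jk; rewrite /E serBE hS// subrr.
  clearbody E; have top_r i j : (E i * L (xt j)) k.+1 = E i k.+1 * mop (x j).
    by rewrite ser_low_mul; [rewrite Lmul0 | exact: E0].
  have top_l i j : (X i * E j) k.+1 = mop (x i) * E j k.+1 by rewrite ser_cst_comm.
  have [D [hD D1]] : exists D : lop U, (forall i, ad (x i) D = - E i k.+1) /\
      forall V, V `<=` U -> D V 1 = 0.
    apply: (joint_primitive (Z := fun i => hop hphi (yt i))).
    - by move=> p; exact: atlas_cover.
    - by move=> i; exact: (is_der_hop hP).
    - exact: (fr_dual hfr).
    move=> i j; rewrite !adN; congr (- _).
    have := congr1 (fun s : ser (lop U) => s k.+1) (sq i j).
    by rewrite !serBE (top_r j i) (top_l i j) (top_r i j) (top_l j i).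
  exists (upd S k.+1 D); last by move=> j; exact: upd_lt.
  have e j : (j < k.+1)%N -> upd S k.+1 D j = S j by exact: upd_lt.
  have [h1 h2] := Qext k.+1 S _ e hQ.
  split=> [j|i j]; rewrite ltnS leq_eqVlt => /orP[/eqP->|jk]; try by [exact: h1 | exact: h2].
    move=> V VU; rewrite upd_eq; exact: D1.
  rewrite (ser_mull_top _ e) (ser_mulr_top _ e) upd_eq Lmul0.
  rewrite S0 subr0; apply/eqP; rewrite -subr_eq0 opprD addrACA -serBE -EE.
  by rewrite -[D * _ - _]/(ad (x i) D) hD subrr.
exists S; split.
  split; first exact: ((hS 1%N).1 0%N isT).
  by move=> k V VU; exact: ((hS k.+2).1 k.+1 (ltnSn _) V VU).
by move=> i; apply: serP => k; exact: ((hS k.+1).2 i k (ltnSn _)).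
Qed.

Lemma srestr_cst V (VU : V `<=` U) (N : lop U) : srestr VU (ser_cst N) = ser_cst (restr VU N).
Proof. by apply: serP => -[|k] //; rewrite srestr_coef /= restr0. Qed.

Lemma frame_comm V (VU : V `<=` U) (N : ser (lop V)) :
  (forall i, N * srestr VU (X i) = srestr VU (X i) * N) ->
  forall f : fps (cinf V), polarized_ser f -> N * mser f = mser f * N.
Proof.
move=> hN f hf; apply: serP => k; rewrite !serME (conv_rev k (fun i j => mser f i * N j)).
apply: eq_bigr => l _; rewrite mser_coef; apply: lopP => W WV g.
rewrite !lopME !(mopE _ WV).
have hN' i : ad (cinf_res VU (x i)) (N l) = 0.
  rewrite /ad -restr_mop; have := congr1 (fun s : ser (lop V) => s l) (hN i).
  by rewrite srestr_cst ser_mul_cst ser_cst_comm => ->; rewrite subrr.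
have hp : polarized_fun P (cinf_res WV (f (k - l)%N) : cinf_sheaf M W).
  apply/(fr_pol hfr (subset_trans WV VU)) => i.
  by rewrite -lop_res// (fr_pol hfr VU (f (k - l)%N)).1 ?raddf0//; exact: hf.
exact: (@fr_central _ _ _ _ _ _ _ hphi O U xt yt hfr V VU (N l) hN' W _ g WV hp).
Qed.

Section Conjugation.
Variables (S S' : ser (lop U)) (hS : unital S) (SX : forall i, S * L (xt i) = X i * S).
Hypotheses (S'0 : S' 0%N = 1) (SS' : S * S' = 1) (S'S : S' * S = 1).

Section OnOpen.
Variables (V : opens M) (VU : V `<=` U).
Let SV := srestr VU S.
Let S'V := srestr VU S'.
Let XV i := srestr VU (X i).
Let xV i := res A VU (xt i).
Let SSV : SV * S'V = 1. Proof. by rewrite -srestrM SS' srestr1. Qed.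
Let SSV' : S'V * SV = 1. Proof. by rewrite -srestrM S'S srestr1. Qed.
Let hSV : unital SV. Proof. exact: unital_srestr. Qed.
Let hSV' : unital S'V. Proof. exact/unital_srestr/(unital_inv S'0 S'S hS). Qed.
Let SXV i : SV * L (xV i) = XV i * SV.
Proof. by rewrite -Lmul_res -!srestrM SX. Qed.
Let S'XV i : S'V * XV i = L (xV i) * S'V.
Proof. by rewrite -[XV i]mulr1 -SSV (mulrA (XV i)) -SXV !mulrA SSV' mul1r. Qed.

Definition conjR (b : A V) := SV * Rm b * S'V.

(** Conjugation by [S] turns [L (xt i)] into multiplication by [x i], and right multiplications
    commute with left ones. *)
Lemma conjR_X b i : conjR b * XV i = XV i * conjR b.
Proof.
by rewrite /conjR -mulrA S'XV mulrA -(mulrA SV) -(LRmulC hphi) mulrA SXV -!mulrA.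
Qed.

Lemma conjR_comm b f : polarized_ser f -> conjR b * mser f = mser f * conjR b.
Proof. by move=> hf; exact: (@frame_comm V VU (conjR b) (conjR_X b) f hf). Qed.

Lemma ev_conjR b : ev (conjR b) = act SV (phi V b).
Proof. by rewrite /conjR ev_mul (unital_ev hSV') -evE ev_mul (ev_Rmul hphi phi1). Qed.


Lemma conjR_act b (f : fps (cinf V)) : polarized_ser f ->
  act (conjR b) f = act (mser f) (act SV (phi V b)).
Proof.
by move=> hf; rewrite -{1}[f]ev_mser -ev_mul conjR_comm// ev_mul ev_conjR.
Qed.

(** [Z i] is the commutator with [xt i] seen through [S], up to sign, so it kills [h] because [a]
    commutes with [xt i]. It also kills polarized functions, and its leading term is, up to sign,
    the bracket with [x i]; polarization of the coefficients of [h] follows one at a time. *)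
Lemma straight_polarized (a : A V) : O a -> polarized_ser (ev (SV * L a)).
Proof.
move=> Oa; set h := ev (SV * L a) => k.
pose Z i : ser (lop V) := SV * (Rm (xV i) - L (xV i)) * S'V.
have ZE i : Z i = conjR (xV i) - XV i.
  by rewrite /Z mulrBr mulrBl SXV -[XV i * SV * S'V]mulrA SSV mulr1.
have OxV i : O (xV i) by exact: (sub_res (pdq_sub hO) VU (fr_O hfr i)).
have Xh i : act (conjR (xV i)) h = act (XV i) h.
  rewrite /h -!ev_mul /conjR -!mulrA (mulrA S'V) SSV' mul1r -(LRmulC hphi).
  rewrite ev_mul (ev_mul (L a)) (ev_Rmul hphi phi1) -(ev_Lmul hphi phi1 (xV i)) -ev_mul -LmulM.
  by rewrite (pdq_comm hO Oa (OxV i)) LmulM -ev_mul mulrA SXV mulrA.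
have Zh i : act (Z i) h = 0.
  by rewrite ZE actB Xh subrr.
have Z0 i : Z i 0%N = 0.
  by rewrite /Z !serM0 serBE Lmul0 Rmul0 subrr mulr0 mul0r.
have Z1 i : Z i 1%N = - restr VU (hop hphi (xt i)).
  rewrite /Z; set B := Rm _ - L _.
  have B0 : B 0%N = 0 by rewrite /B serBE Lmul0 Rmul0 subrr.
  rewrite ser_low_mul; last by case=> [|j] // _; rewrite serM0 B0 mulr0.
  rewrite hSV'.1 mulr1 serME !big_ord_recl big_ord0 addr0 hSV.1 mul1r subn0 B0 mulr0 addr0.
  by rewrite /B serBE hop_def restrB -!srestr_coef Lmul_res Rmul_res opprB.
have pol0 : polarized_fun P ((0 : cinf V) : cinf_sheaf M V).
  by apply/(fr_pol hfr VU) => i; rewrite lop0.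
have Zp i l (f : cinf V) : polarized_fun P (f : cinf_sheaf M V) -> Z i l V f = 0.
  move=> hf; have hf' : polarized_ser (fcst f) by case.
  have XC : mser (fcst f) * XV i = XV i * mser (fcst f).
    by rewrite mser_fcst /XV srestr_cst restr_mop -!mser_fcst mser_comm.
  have : act (Z i) (fcst f) = 0.
    rewrite ZE actB (conjR_act _ hf') -(ev_Lmul hphi phi1) -ev_mul SXV -ev_mul mulrA XC -mulrA ev_mul.
    by rewrite ev_mserM// subrr.
  by move=> /(congr1 (fun f : fps (cinf V) => f l)); rewrite act_fcst.
(* Order k+1 of [Z i] applied to [h]: as [Z i] starts at order 1, [h k] meets only the leading term,
   and the other coefficients have index below [k], where the induction hypothesis applies. *)
have [m] := ubnP k; elim: m k => // m IH k km.
apply/(fr_pol hfr VU) => i.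
have := congr1 (fun f : fps (cinf V) => f k.+1) (Zh i).
rewrite act_coef big_ord_recl Z0 lop0E add0r big_ord_recl big1 ?addr0; last first.
  by move=> l _; apply: Zp; apply: IH; rewrite !lift0; have := ltn_ord l; lia.
rewrite !lift0 subSS subn0 Z1 lopNE restrE// => /eqP; rewrite oppr_eq0 => /eqP; exact.
Qed.
End OnOpen.

(** The product a b is also right multiplication by b applied to a, so its image under [S] is
    [conjR b] applied to S a. The latter is polarized, hence passes through [conjR b], leaving the
    usual product of S a and S b. *)
Lemma intertwiner_straight : straight S.
Proof.
split=> // V VU a Oa; set h := ev (srestr VU S * L a).
apply/eqP; rewrite subr_eq0; apply/eqP; apply: serlopP => W WV g; have WU := subset_trans WV VU.
pose b : A W := psi hphi g; have bE : g = phi W b by rewrite psiK.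
pose hW : fps (cinf W) := ev (srestr WU S * L (res A WV a)).
have hWp : polarized_ser hW by apply: straight_polarized; exact: (sub_res (pdq_sub hO) WV Oa).
have e1 : act (srestr VU S) g = act (srestr WU S) g by rewrite !act_srestr.
transitivity (act (conjR WU b) hW).
  rewrite actM (LmulE hphi a WV) /hW ev_mul (ev_Lmul hphi phi1) /conjR !actM.
  rewrite -[act (srestr WU S') _]actM -srestrM S'S srestr1 act1//.
  rewrite (RmulE hphi b (@subset_refl _ W)) phiK res_id -/b !act_srestr//.
rewrite (conjR_act WU b hWp) -bE -e1 actM -(act_srestr WV (mser h) (@subset_refl _ W)) srestr_mser.
suff -> : hW = Fps (fun k => cinf_res WV (h k)) by [].
apply: fpsP => k; transitivity (cinf_res WV (ev (srestr VU S * L a) k)); last by [].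
by rewrite -ev_srestr srestrM (srestr_comp VU WV WU) Lmul_res.
Qed.
End Conjugation.

Lemma local_straightening : exists S, straight S /\
  forall V (VU : V `<=` U) (a : A V), O a -> polarized_ser (ev (srestr VU S * L a)).
Proof.
have [S [hS SX]] := local_intertwiner; have [S' [S'0 SS' S'S]] := ser_inv hS.1.
exists S; split; first exact: (intertwiner_straight hS SX S'0 SS' S'S).
exact: (straight_polarized hS SX S'0 SS' S'S).
Qed.

(* The derivation [v] corrects a discrepancy [D] along the frame: [D - v] commutes
   with the [x_i]. *)
Lemma straight_step K j (S T T' : ser (lop U)) : straight S ->
  (forall V (VU : V `<=` U) (a : A V), O a -> polarized_ser (ev (srestr VU S * L a))) ->
  straight_mod K T -> straight T' -> (0 < j < K)%N -> (forall i, (i < j)%N -> T' i = T i) ->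
  exists2 T'', straight T'' & forall i, (i < j.+1)%N -> T'' i = T i.
Proof.
move=> hS Spol [hT hTK] hT' /andP[j0 jK] TT'.
pose D : lop U := T j - T' j.
have D1 V : V `<=` U -> D V 1 = 0.
  by move=> VU; rewrite /D lopBE -(prednK j0) hT.2// hT'.1.2// subrr.
have TD : forall i, (i < j)%N -> T i = T' i by move=> i /TT'.
have Dder V (VU : V `<=` U) (a : A V) : O a ->
    restr VU D * mop (symb a : cinf V) = mop (D V (symb a : cinf V)) + mop (symb a : cinf V) * restr VU D.
  move=> Oa; have e i : (i < j)%N -> srestr VU T i = srestr VU T' i.
    by move=> ij; rewrite !srestr_coef TD.
  have T0 : srestr VU T 0%N = 1 by rewrite srestr_coef hT.1 restr1.
  have := defect_top a j0 T0 e; rewrite hTK// hT'.2// ser0E add0r !srestr_coef -restrB restrE//.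
  by move=> /esym/eqP; rewrite subr_eq0 subr_eq => /eqP ->; exact: addrC.
pose v : lop U := \sum_i mop (D U (x i)) * hop hphi (yt i).
have hv : is_der v by apply: is_der_sum => i; apply: is_der_mop; exact: (is_der_hop hP).
have vx i : v U (x i) = D U (x i).
  rewrite /v lop_sumE (bigD1 i)// lopME (mopE _ (@subset_refl _ U)) cinf_res_id (fr_dual hfr) eqxx mulr1.
  rewrite big1; first exact: addr0.
  move=> l /andP[_ /negbTE li].
  by rewrite lopME (fr_dual hfr) li lop0.
pose G := D - v.
have Gx i : G * mop (x i) = mop (x i) * G.
  apply/eqP; rewrite -subr_eq0 -[X in X == 0]/(ad (x i) G) /G adB (ad_der _ hv) vx.
  have := Dder U (@subset_refl _ U) (xt i) (fr_O hfr i); rewrite restr_id /ad => ->.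
  by rewrite addrK subrr.
have G1 V : V `<=` U -> G V 1 = 0 by move=> VU; rewrite /G lopBE D1// (is_der1 VU hv) subrr.
have [E hE] := is_exp_exists v j0.
have [S' [S'0 SS' S'S]] := ser_inv hS.1.1.
have hS' := unital_inv S'0 S'S hS.1.
pose N : ser (lop U) := 1 + ser_mon j G.
have Nlt i : (i < j)%N -> N i = (1 : ser (lop U)) i by move=> ij; rewrite /N serDE /= ltn_eqF// addr0.
have hN : unital N.
  apply: unitalP; first by rewrite Nlt.
  move=> V VU; apply: fpsP => k; rewrite act_fcst /N serDE lopDE /=.
  have -> : (if k == j then G else 0) V 1 = 0 by case: ifP => _; [exact: G1 | exact: lop0E].
  by rewrite addr0; case: k => [|k]; [exact: lop1E | exact: lop0E].
have NX i : N * X i = X i * N.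
  apply: serP => k; rewrite ser_cst_comm ser_mul_cst /N serDE mulrDl mulrDr; congr (_ + _).
    by case: k => [|k]; rewrite ser1E ?mul1r ?mulr1 ?mul0r ?mulr0.
  by rewrite /=; case: ifP => _; rewrite ?Gx// mul0r mulr0.
(* Inserting [N] between [S'] and [S] keeps [T'] straight, since [N] commutes with multiplication by
   the polarized series that [S] attaches to [a]. It adds [G] at order [j]; the factor [E] then adds
   [v], and [T' j + G + v = T j]. *)
pose Y := T' * S' * N * S.
have mS : T' * S' * (ser_mon j G * S) = Y - T'.
  by rewrite /Y /N mulrDr mulr1 mulrDl -[T' * S' * S]mulrA S'S mulr1 addrAC subrr add0r !mulrA.
have mSlt i : (i < j)%N -> (ser_mon j G * S) i = (0 : ser (lop U)) i.
  by move=> ij; rewrite ser_mon_mull leqNgt ij.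
have Ylt i : (i < j)%N -> Y i = T' i.
  move=> ij; apply/eqP; rewrite -subr_eq0 -serBE -mS.
  by rewrite (ser_mul_eq (fun _ _ => erefl) mSlt ij) mulr0 ser0E.
have Yj : Y j = T' j + G.
  have := congr1 (fun s : ser (lop U) => s j) mS; rewrite (ser_mulr_top _ mSlt) mulr0 ser0E add0r subr0.
  rewrite ser_mon_mull leqnn subnn hS.1.1 mulr1 serM0 hT'.1.1 S'0 !mul1r serBE => /eqP.
  by rewrite eq_sym subr_eq addrC => /eqP.
have Elt i : (i < j)%N -> E i = (1 : ser (lop U)) i.
  by case: i => [|i] ij; [rewrite hE.1 | rewrite (is_exp_lt hE)].
exists (E * Y); last first.
  move=> i; rewrite ltnS leq_eqVlt => /orP[/eqP->|ij].
    rewrite (ser_mull_top _ Elt) mul1r Yj (is_exp_eq j0 hE) Ylt// hT'.1.1 mulr1.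
    by rewrite -(prednK j0) ser1E subr0 (prednK j0) -addrA /G subrK /D addrC subrK.
  by rewrite (ser_mul_eq Elt (fun _ _ => erefl) ij) mul1r Ylt// TT'.
have hEY : unital (E * Y).
  apply: unitalM; first exact: is_exp_unital hE.
  by apply: unitalM => //; [apply: unitalM => //; apply: unitalM => //; exact: hT'.1 | exact: hS.1].
split=> //.
move=> V VU a Oa.
have eS := straight_ev VU hS Oa; have eT := straight_ev VU hT' Oa.
set m := ev (srestr VU S * L a) in eS; set m' := ev (srestr VU T' * L a) in eT.
have eN : srestr VU N * mser m = mser m * srestr VU N.
  by apply: frame_comm; [move=> i; rewrite -!srestrM NX | exact: Spol].
have eE := is_exp_aut j0 (is_der_restr VU hv) m' (is_exp_srestr VU hE).
apply: (@defect0 _ _ _ (act (srestr VU E) m')); first exact: unital_srestr.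
have eS' : srestr VU S' * mser m = L a * srestr VU S'.
  have sS : srestr VU S' * srestr VU S = 1 by rewrite -srestrM S'S srestr1.
  have Ss : srestr VU S * srestr VU S' = 1 by rewrite -srestrM SS' srestr1.
  by rewrite -[mser m]mulr1 -Ss (mulrA (mser m)) -eS !mulrA sS mul1r.
rewrite /Y !srestrM -!mulrA eS (mulrA (srestr VU N)) eN !mulrA.
rewrite -(mulrA _ (srestr VU S')) eS' !mulrA -(mulrA _ (srestr VU T')) eT !mulrA.
by rewrite eE.
Qed.

(** Starting from a local solution, [straight_step] adjusts one coefficient at a time. Order 0 costs
    nothing because both series begin with 1. *)
Lemma straight_extension K (T : ser (lop U)) : straight_mod K T ->
  exists2 T', straight T' & forall i, (i < K)%N -> T' i = T i.
Proof.
move=> hT; have [S [hS Spol]] := local_straightening.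
suff H j : (j <= K)%N -> exists2 T', straight T' & forall i, (i < j)%N -> T' i = T i by exact: (H K).
elim: j => [|j IH] jK; first by exists S.
have [T' hT' TT'] := IH (ltnW jK).
case: j jK TT' {IH} => [|j] jK TT'; last exact: (straight_step hS Spol hT hT' _ TT').
by exists S => // -[|i] // _; rewrite hS.1.1 hT.1.1.
Qed.
End Frame.
End Straightening.

(** * Extending cut-off operators by zero *)

Section Cutoff.
#[local] Opaque build_lop restr mop Lmul Rmul hop lop_at.
Variables (R : realType) (n : nat) (M : manifold R n).
Implicit Types U V W : opens M.
Local Notation otop := (@otop R n M).

Lemma lop_at_res W (N : lop W) V (f : cinf V) q : V q -> W q ->
  lop_at N q f = N (capo V W) (cinf_res (@capol _ _ _ V W) f) q.
Proof.
move=> Vq Wq; apply: (lop_atE N (msmooth_sub (@capol _ _ _ V W) (cinf_smooth f))).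
- exact: capor.
- by [].
- by move=> r rVW; rewrite cinf_resE.
Qed.

(** The section is smooth near points of [F] because [F] lies in [W], and zero on the complement of
    [F], which is open. *)
Lemma lop_cutoff (chi : M -> R[i]) (F : set M) W (N : lop W) : msmooth setT chi -> closed F ->
  F `<=` W -> (forall q, ~ F q -> chi q = 0) ->
  exists N' : lop otop, forall V (f : cinf V) q, V q -> N' V f q = chi q * lop_at N q f.
Proof.
move=> chiS cF FW chi0.
have sm V (f : cinf V) : msmooth V (fun q => chi q * lop_at N q f).
  apply: msmooth_local => p Vp; case: (pselect (F p)) => Fp.
    have Wp := FW p Fp; exists (capo V W) => //.
    have h := msmoothM (oset_open (capo V W)) (msmooth_sub (fun _ _ => I) chiS)
      (cinf_smooth (N (capo V W) (cinf_res (@capol _ _ _ V W) f))).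
    apply: msmooth_ext h; first exact: oset_open.
    by move=> q [Vq Wq]; rewrite (lop_at_res N f Vq Wq).
  pose G : opens M := Opens (closed_openC cF).
  exists (capo V G) => //; apply: msmooth_ext (msmooth_cst (capo V G) 0); first exact: oset_open.
  by move=> q [_ Gq]; rewrite chi0// mul0r.
have h1 V (VU : V `<=` otop) (a : R[i]) (f g : cinf V) : mk_cinf (sm V (a *: f + g)) = a *: mk_cinf (sm V f) + mk_cinf (sm V g).
  apply: cinf_inj => q Vq; rewrite cinfD// cinfZ// !mk_cinfE//.
  case: (pselect (W q)) => Wq; last first.
    by rewrite chi0 ?mul0r ?mulr0 ?addr0// => /FW.
  by rewrite !(lop_at_res N _ Vq Wq) linearP lopD lopZ cinfD// cinfZ// mulrDr mulrCA.
have h2 V V' (VV : V' `<=` V) (VU : V `<=` otop) (WU : V' `<=` otop) (f : cinf V) :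
    cinf_res VV (mk_cinf (sm V f)) = mk_cinf (sm V' (cinf_res VV f)).
  apply: cinf_inj => q V'q; have Vq := VV q V'q; rewrite cinf_resE// !mk_cinfE//.
  case: (pselect (W q)) => Wq; last by rewrite chi0 ?mul0r// => /FW.
  congr (_ * _); rewrite (lop_at_res N _ Vq Wq) (lop_at_res N _ V'q Wq).
  apply: (lop_germ N (W := capo V' W)) => //; try exact: capor.
  by move=> r rVW rV'W _; have rV' := capol rV'W; rewrite !cinf_resE.
exists (build_lop h1 h2) => V f q Vq.
by rewrite (build_lopE _ _ (sub_otop (U := V))) mk_cinfE.
Qed.
End Cutoff.

(** * Gluing by a partition of unity *)

Section Partition.
Variables (R : realType) (n : nat) (M : manifold R n) (chi : nat -> M -> R[i]).

(** Where [chi l = 1], all [pou k] with [k > l] vanish and the remaining ones sum to 1. A countable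
    cover thus gives a locally finite partition of unity directly, with no local finiteness assumed
    of the [chi k]. *)
Definition pou k : M -> R[i] := fun q => chi k q * \prod_(l < k) (1 - chi l q).

Lemma pou_smooth k : (forall l, msmooth setT (chi l)) -> msmooth setT (pou k).
Proof.
move=> hchi; apply: msmoothM; [exact: openT | exact: hchi |].
elim: k => [|k IH].
  apply: (msmooth_ext openT (f := fun=> 1)); last exact: msmooth_cst.
  by move=> q _; rewrite big_ord0.
apply: (msmooth_ext openT (f := fun q => \prod_(l < k) (1 - chi l q) * (1 + (-1) * chi k q))).
  by move=> q _; rewrite big_ord_recr /= mulN1r.
apply: msmoothM; [exact: openT | exact: IH |].
apply: msmoothD; [exact: openT | exact: msmooth_cst |].
by apply: msmoothM; [exact: openT | exact: msmooth_cst | exact: hchi].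
Qed.

Lemma pou_sum m q : \sum_(k < m) pou k q = 1 - \prod_(l < m) (1 - chi l q).
Proof.
elim: m => [|m IH]; first by rewrite !big_ord0 subrr.
by rewrite !big_ord_recr /= IH /pou; ring.
Qed.

Lemma pou_eq0 k l q : chi l q = 1 -> (l < k)%N -> pou k q = 0.
Proof.
move=> e lk; rewrite /pou (bigD1 (Ordinal lk))//= e subrr mul0r mulr0//.
Qed.
End Partition.

Section Gluing.
#[local] Opaque build_lop restr mop Lmul Rmul hop lop_at.
Variables (R : realType) (n : nat) (M : manifold R n).
Variables (w : two_form M) (P : M -> set (tvec M)) (hP : polarized_symplectic w P).
Variables (A : dq w) (phi : forall U, {linear A U -> cinft M U}) (hphi : trivialization phi).
Hypothesis phi1 : forall U, phi U (aone A U) = fcst (1 : cinf U) :> fps (cinf U).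
Variable O : forall U : opens M, set (A U).
Hypothesis hO : is_pdq P O.
Hypothesis M0 : exists p : M, True.
Implicit Types U V W : opens M.
Local Notation L := (Lmul hphi).
Local Notation otop := (@otop R n M).
Local Notation straight := (@straight _ _ _ _ _ _ hphi O).
Local Notation straight_mod := (@straight_mod _ _ _ _ _ _ hphi O).
Let ut U : U `<=` otop := sub_otop (U := U).

(** The local solutions share the coefficients of [T] below order [K], so only their coefficients of
    order [K] are averaged. By [defect_top] the defect at that order is affine in this coefficient,
    and weights summing to 1 preserve its zeros. *)
Lemma glue_step K (T : ser (lop otop)) : (0 < K)%N -> straight_mod K T ->
  exists2 T', straight_mod K.+1 T' & forall j, (j < K)%N -> T' j = T j.
Proof.
move=> K0 [hT hTK].
pose good W := exists (U : opens M) (TU : ser (lop U)) (chi : M -> R[i]) (F : set M),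
  [/\ straight TU, (forall i, (i < K)%N -> TU i = srestr (@ut U) T i), msmooth setT chi, closed F &
   [/\ F `<=` U, (forall q, ~ F q -> chi q = 0) & forall q, W q -> chi q = 1]].
have [W [gW covW]] : exists W : nat -> opens M, (forall k, good (W k)) /\ forall p, exists k, W k p.
  apply: (lindelof M0) => p.
  have [U [xt [yt [Up hfr]]]] := frame_exists hP hphi hO p.
  have hTU : straight_mod K (srestr (@ut U) T).
    split; first exact: unital_srestr.
    by move=> V VU a Oa j jK; rewrite (srestr_comp (@ut U) VU (@ut V)) hTK.
  have [TU hTU' e] := straight_extension hP phi1 hO hfr hTU.
  have [chi [F [h1 h2 h3 h4 /near_open[S [oS Sp hS]]]]] := bump_manifold Up.
  by exists (Opens oS) => //; exists U, TU, chi, F.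
have {gW}/choice[U gW] k : exists U : opens M, exists (TU : ser (lop U)) (chi : M -> R[i]) (F : set M),
  [/\ straight TU, (forall i, (i < K)%N -> TU i = srestr (@ut U) T i), msmooth setT chi, closed F &
   [/\ F `<=` U, (forall q, ~ F q -> chi q = 0) & forall q, W k q -> chi q = 1]] := gW k.
pose TU k := projT1 (cid (gW k)).
have /choice[chi gW'] k : exists (chi : M -> R[i]), exists F : set M,
  [/\ straight (TU k), (forall i, (i < K)%N -> TU k i = srestr (@ut (U k)) T i), msmooth setT chi, closed F &
   [/\ F `<=` U k, (forall q, ~ F q -> chi q = 0) & forall q, W k q -> chi q = 1]].
  exact: (projT2 (cid (gW k))).
have chiS l : msmooth setT (chi l) by have [F []] := gW' l.
have hTU k : straight (TU k) by have [F []] := gW' k.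
have eTU k i : (i < K)%N -> TU k i = srestr (@ut (U k)) T i by have [F [_ h _ _ _]] := gW' k; exact: h.
have chi1 k q : W k q -> chi k q = 1 by have [F [_ _ _ _ [_ _ h]]] := gW' k; exact: h.
have chi0 k q : ~ U k q -> chi k q = 0.
  by have [F [_ _ _ _ [h1 h _]]] := gW' k; move=> h2; apply: h => /h1.
have /choice[Phi hPhi] k : exists N' : lop otop, forall V (f : cinf V) q, V q ->
    N' V f q = pou chi k q * lop_at (TU k K) q f.
  have [F [_ _ _ cF [FU h _]]] := gW' k.
  apply: (lop_cutoff (TU k K) (pou_smooth k chiS) cF FU) => q Fq.
  by rewrite /pou h// mul0r.
have lf : locally_finite Phi.
  move=> p _; have [l Wp] := covW p; exists (W l), l.+1; split=> // k lk V VW f.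
  apply: cinf_inj => q Vq; rewrite hPhi// cinf0// (pou_eq0 (l := l))// ?mul0r//; exact/chi1/VW.
have [D hD] := lfs lf.
have DE l V (f : cinf V) q : W l q -> V q -> D V f q = \sum_(k < l.+1) pou chi k q * lop_at (TU k K) q f.
  move=> Wq Vq; pose Z := capo V (W l).
  have ZV : Z `<=` V := @capol _ _ _ V (W l).
  rewrite -(cinf_resE ZV _ (conj Vq Wq)) lop_res//.
  rewrite (hD (W l) l.+1)//; last exact: capor.
    have sE (F : 'I_l.+1 -> cinf Z) r : Z r -> (\sum_k F k) r = \sum_k F k r.
      move=> Zr; elim/big_rec2: _ => [|k x y _ <-]; first exact: cinf0.
      exact: cinfD.
    rewrite sE//; apply: eq_bigr => k _; rewrite hPhi//.
    case: (pselect (U k q)) => Uq; last by rewrite /pou chi0// !mul0r.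
    congr (_ * _); rewrite (lop_at_res _ _ Vq Uq) (lop_at_res _ _ (conj Vq Wq : Z q) Uq).
    apply: (lop_germ _ (W := Z)) => //; try exact: capor.
    by move=> r rZU rVU rZ; rewrite (cinf_resE _ _ rZU) (cinf_resE _ _ rZ) (cinf_resE _ _ rVU).
  move=> k lk V' V'W f'.
  apply: cinf_inj => r V'r; rewrite hPhi// cinf0// (pou_eq0 (l := l))// ?mul0r//; exact/chi1/V'W.
exists (upd T K D); last by move=> j; exact: upd_lt.
have D1 V : V `<=` otop -> D V 1 = 0.
  move=> VU; apply: cinf_inj => q Vq; rewrite cinf0//; have [l Wq] := covW q.
  rewrite (DE l)// big1// => k _; case: (pselect (U k q)) => Uq; last by rewrite /pou chi0// !mul0r.
  rewrite (lop_at_res _ _ Vq Uq) cinf_res1 -(prednK K0) (hTU k).1.2 ?cinf0 ?mulr0//; exact: capor.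
have hT' : unital (upd T K D).
  split=> [|k V VU]; first by rewrite upd_lt// hT.1.
  rewrite /=; case: eqP => _; [exact: D1 | exact: hT.2].
split=> // V VU a Oa j; rewrite ltnS leq_eqVlt => /orP[/eqP->|jK]; last first.
  rewrite -(hTK V VU a Oa j jK); apply: (@defect_ext _ _ _ _ _ _ _ K) => // i iK.
  by rewrite !srestr_coef upd_lt.
(* The comparison series has 0 at order [K], so that the increments in [defect_top] are the
   coefficients of order [K] themselves. *)
pose T1 := srestr VU (upd T K D); pose T2 := srestr VU (upd T K 0).
have T2K : T2 K = 0 by rewrite srestr_coef upd_eq restr0.
have T1K : T1 K = restr VU D by rewrite srestr_coef upd_eq.
have T10 : T1 0%N = 1 by rewrite srestr_coef upd_lt// hT.1 restr1.
have T12 i : (i < K)%N -> T1 i = T2 i by move=> iK; rewrite !srestr_coef !upd_lt.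
rewrite -[srestr VU _]/T1 (defect_top hphi a K0 T10 T12) T1K T2K subr0.
apply: lopP => V' V'V g; rewrite lop0E; apply: cinf_inj => q V'q; rewrite cinf0//.
have [l Wq] := covW q.
pose a0 : cinf V' := cinf_res V'V (symb a : cinf V).
pose Aq := defect hphi T2 a K V' g q.
pose lam k := lop_at (TU k K) q.
pose e k := lam k (a0 * g) - lam k a0 * g q - a0 q * lam k g.
have DV (f : cinf V') : D V' f q = \sum_(k < l.+1) pou chi k q * lam k f by exact: DE.
(* [Aq] is the part of the defect common to all local solutions and [e k] the part linear in the
   k-th one; their sum is the defect of [TU k], which is zero. *)
have key k : pou chi k q * (Aq + e k) = 0.
  case: (pselect (U k q)) => Uq; last by rewrite /pou chi0// !mul0r.
  pose Z := capo V' (U k); have ZV' : Z `<=` V' := @capol _ _ _ V' (U k).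
  have ZU : Z `<=` U k := @capor _ _ _ V' (U k); have ZV := subset_trans ZV' V'V.
  have Zq : Z q by [].
  pose aZ := res A ZV a; pose gZ := cinf_res ZV' g; pose TZ := srestr ZU (TU k).
  have TZ0 : TZ 0%N = 1 by rewrite srestr_coef (hTU k).1.1 restr1.
  have TZ2 i : (i < K)%N -> TZ i = srestr ZV T2 i.
    by move=> iK; rewrite !srestr_coef eTU// srestr_coef upd_lt// !(restr_comp _ _ (@ut Z)).
  have TZK : TZ K - srestr ZV T2 K = restr ZU (TU k K).
    transitivity (restr ZU (TU k K) - restr ZV (T2 K)); first by [].
    by rewrite T2K restr0 subr0.
  have OaZ : O aZ by exact: (sub_res (pdq_sub hO) ZV Oa).
  have := defect_top hphi aZ K0 TZ0 TZ2; rewrite TZK (hTU k).2// ser0E -defect_res srestr_coef.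
  move=> /(congr1 (fun N : lop Z => N Z gZ q)); rewrite lop0E cinf0// => E.
  have aZE : cinf_res ZV' a0 = symb aZ :> cinf Z.
    by rewrite /a0 (cinf_res_comp V'V ZV' ZV) /aZ symb_res.
  have lamE (f : cinf V') : lam k f = TU k K Z (cinf_res ZV' f) q by rewrite (Prop_irrelevance ZV' (@capol _ _ _ V' (U k))); exact: (lop_at_res (TU k K) f V'q Uq).
  rewrite [X in _ * X](_ : _ = 0) ?mulr0// E lopDE cinfD//; congr (_ + _).
    by rewrite restrE// /Aq /gZ -lop_res// cinf_resE.
  rewrite !lopBE !cinfB// !lopME !(mopE _ (@subset_refl _ Z)) !cinf_res_id !restrE// !cinfM//.
  rewrite /e !lamE cinf_resM aZE -/gZ; congr (_ - _ * _ - _ * _); rewrite ?cinf_resE//.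
  by rewrite /aZ symb_res [RHS]cinf_resE.
have sum1 : \sum_(k < l.+1) pou chi k q = 1.
  by rewrite pou_sum (bigD1 (Ordinal (ltnSn l)))//= chi1// subrr mul0r subr0.
rewrite lopDE cinfD// -[X in X + _]/Aq; clearbody Aq.
rewrite !lopBE !cinfB// !lopME !(mopE _ V'V) (restrE VU D (@subset_refl _ V)) !(restrE VU D V'V).
rewrite cinfM// cinfM// (lop_res D V'V VU) !DV.
rewrite -[Aq]mul1r -sum1 mulr_suml mulr_suml mulr_sumr -!sumrB -big_split.
rewrite big1// => k _; rewrite -[RHS](key k) /e -/a0.
transitivity (pou chi k q * Aq + (pou chi k q * lam k (a0 * g) - pou chi k q * lam k a0 * g q -
  a0 q * (pou chi k q * lam k g))); first by [].
by move: (lam k (a0 * g)) (lam k a0) (lam k g) (a0 q) (g q) => ? ? ? ? ?; ring.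
Qed.

Lemma straight_mod1 : straight_mod 1 (1 : ser (lop otop)).
Proof.
split=> [|V VU a Oa [|j] // _]; first exact: unital1.
rewrite srestr1 /defect mul1r mulr1 serBE mser_coef ev_coef Lmul0.
by rewrite (mopE _ (@subset_refl _ V)) mulr1 cinf_res_id subrr.
Qed.

Lemma global_straightening : exists T : ser (lop otop), straight T.
Proof.
(* Being unital constrains all coefficients, whereas [ser_limit] wants a property of the first [k]
   ones; hence agreement below order [k] with some solution modulo t^k. *)
pose Q k (T : ser (lop otop)) := exists2 T', straight_mod k T' & forall j, (j < k)%N -> T' j = T j.
have [T hT] : exists T : ser (lop otop), forall k, Q k T.
  apply: (ser_limit (P := Q) (s0 := 1)).
  - by exists 1 => //; split=> //.
  - move=> [|k] T [T' hT' e].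
      by exists 1 => //; exists 1 => //; exact: straight_mod1.
    have [T'' h1 h2] := glue_step (ltn0Sn k) hT'; exists T''; first by exists T''.
    by move=> j jk; rewrite h2// e.
  - by move=> k T T' e [T0 h1 h2]; exists T0 => // j jk; rewrite h2// e.
have T0 : T 0%N = 1 by have [T' hT' <-//] := hT 1%N; exact: hT'.1.1.
exists T; split; first by split=> // k V VU; have [T' hT' <-//] := hT k.+2; exact: hT'.1.2.
move=> V VU a Oa; apply: serP => k; have [T' hT' e] := hT k.+1.
rewrite ser0E -(hT'.2 V VU a Oa k (ltnSn k)); apply/esym/(@defect_ext _ _ _ _ _ _ _ k.+1) => // i ik.
by rewrite !srestr_coef e.
Qed.
End Gluing.

(** * Bidifferential coefficients *)

Section Weyl.
Variables (K : numFieldType) (E : lmodType K) (I : eqType) (a z : I -> E -> E).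
Hypotheses (a_lin : forall i, linear (a i)) (z_lin : forall i, linear (z i)).
Hypothesis a_comm : forall i j N, a i (a j N) = a j (a i N).
Variable G : E -> Prop.
Hypotheses (Ga : forall i N, G N -> G (a i N)) (Gz : forall i N, G N -> G (z i N)).
Hypothesis az : forall i j N, G N -> a i (z j N) = z j (a i N) + (i == j)%:R *: N.

Let Gzi i k N : G N -> G (iter k (z i) N). Proof. by move=> GN; elim: k => //= k; exact: Gz. Qed.
Let Gai i k N : G N -> G (iter k (a i) N). Proof. by move=> GN; elim: k => //= k; exact: Ga. Qed.

Let lin0 (f : E -> E) : linear f -> f 0 = 0.
Proof. by move=> h; have := h 1 0 0; rewrite !scale1r addr0 => e; apply: (addrI (f 0)); rewrite addr0 -e. Qed.
Let linD (f : E -> E) N N' : linear f -> f (N + N') = f N + f N'.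
Proof. by move=> h; have := h 1 N N'; rewrite !scale1r. Qed.
Let linZ (f : E -> E) c N : linear f -> f (c *: N) = c *: f N.
Proof. by move=> h; have := h c N 0; rewrite (lin0 h) !addr0. Qed.
Let iter_lin (f : E -> E) k : linear f -> linear (iter k f).
Proof. by move=> h; elim: k => [|k IH] c N N' //=; rewrite IH h. Qed.

Let az_iter i k N : G N -> a i N = 0 -> a i (iter k.+1 (z i) N) = k.+1%:R *: iter k (z i) N.
Proof.
move=> GN aN; elim: k => [|k IH].
  by rewrite /= az// aN lin0// eqxx add0r.
rewrite iterS az; last exact: Gzi.
rewrite IH eqxx (linZ _ _ (z_lin i)) -[z i (iter k _ _)]/(iter k.+1 (z i) N).
by rewrite -scalerDl natr1.
Qed.
Let az_top i k N : G N -> a i N = 0 -> iter k (a i) (iter k (z i) N) = k`!%:R *: N.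
Proof.
move=> GN aN; elim: k => [|k IH]; first by rewrite scale1r.
rewrite iterSr az_iter// linZ; last exact: iter_lin.
by rewrite IH scalerA -natrM factS.
Qed.

(** With [a i] acting as differentiation in [z i], this is Taylor's formula: the top coefficient
    [Q0], the k-th derivative over k!, is split off and the rest is killed by one derivative less.
    The relation between [a] and [z] is available on [G] only, hence the invariance hypotheses on
    [S]. *)
Lemma weyl_split (S : E -> Prop) i k N :
  (forall N, S N -> G N) -> (forall c N N', S N -> S N' -> S (c *: N + N')) -> S 0 ->
  (forall N, S N -> S (a i N)) -> (forall N, S N -> S (z i N)) ->
  S N -> iter k (a i) N = 0 ->
  exists Q : nat -> E, [/\ (forall l, S (Q l)), (forall l, a i (Q l) = 0),
    (forall j m, j != i -> iter m (a j) N = 0 -> forall l, iter m (a j) (Q l) = 0) &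
    N = \sum_(l < k) iter l (z i) (Q l)].
Proof.
move=> SG Slin S0 Sa Sz; elim: k N => [|k IH] N SN aN.
  exists (fun=> 0); split; [by [] | by move=> _; exact: lin0 (a_lin i) | | by rewrite big_ord0].
  by move=> j m _ _ _; exact: lin0 (iter_lin m (a_lin j)).
have Sai l X : S X -> S (iter l (a i) X) by move=> SX; elim: l => //= l; exact: Sa.
have Szi l X : S X -> S (iter l (z i) X) by move=> SX; elim: l => //= l; exact: Sz.
pose Q0 := (k`!%:R : K)^-1 *: iter k (a i) N.
have SQ0 : S Q0 by rewrite /Q0 -[_ *: _]addr0; apply: Slin => //; exact: Sai.
have aQ0 : a i Q0 = 0 by rewrite /Q0 linZ// -iterS aN scaler0.
pose N' := (-1) *: iter k (z i) Q0 + N.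
have SN' : S N' by apply: Slin => //; exact: Szi.
have aN' : iter k (a i) N' = 0.
  have e : k`!%:R *: Q0 = iter k (a i) N.
    by rewrite /Q0 scalerA mulfV ?scale1r// pnatr_eq0 -lt0n fact_gt0.
  by rewrite /N' iter_lin// az_top ?e ?scaleN1r ?addNr//; exact: SG.
have iaj m j X : iter m (a j) (a i X) = a i (iter m (a j) X).
  by elim: m => //= m ->; rewrite a_comm.
have iaji m j l X : iter m (a j) (iter l (a i) X) = iter l (a i) (iter m (a j) X).
  by elim: l => //= l IHl; rewrite iaj IHl.
have iazi m j l X : G X -> j != i -> iter m (a j) (iter l (z i) X) = iter l (z i) (iter m (a j) X).
  move=> GX ji; elim: m => //= m ->; move: (iter m _ X) (Gai j m GX) => {GX}X GX.
  by elim: l => //= l IHl; rewrite az ?(negbTE ji) ?scale0r ?addr0 ?IHl//; exact: Gzi.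
have [Q [h1 h2 h3 h4]] := IH N' SN' aN'.
exists (fun l => if l == k then Q0 else Q l); split.
- by move=> l; case: ifP.
- by move=> l; case: ifP.
- move=> j m ji jN l; have jQ0 : iter m (a j) Q0 = 0.
    by rewrite /Q0 (linZ _ _ (iter_lin m (a_lin j))) iaji jN (lin0 (iter_lin k (a_lin i))) scaler0.
  case: ifP => // _; apply: h3 => //.
  by rewrite /N' (iter_lin m (a_lin j)) (iazi m j k Q0 (SG _ SQ0) ji) jQ0 jN addr0 (lin0 (iter_lin k (z_lin i))) scaler0.
- rewrite big_ord_recr /= eqxx; have -> : N = N' + iter k (z i) Q0.
    by rewrite /N' scaleN1r addrC addNKr.
  rewrite h4; congr (_ + _); apply: eq_bigr => l _; by rewrite ltn_eqF.
Qed.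

Definition zpow (s : seq I) (b : I -> nat) (N : E) : E :=
  foldr (fun i X => iter (b i) (z i) X) N s.

Lemma weyl_span (s : seq I) : uniq s -> forall (S T : E -> Prop) k N,
  (forall N, S N -> G N) -> (forall c N N', S N -> S N' -> S (c *: N + N')) -> S 0 ->
  (forall i N, i \in s -> S N -> S (a i N)) -> (forall i N, i \in s -> S N -> S (z i N)) ->
  T 0 -> (forall N N', T N -> T N' -> T (N + N')) ->
  (forall b Q, (forall i, i \in s -> b i < k)%N -> S Q -> (forall i, i \in s -> a i Q = 0) -> T (zpow s b Q)) ->
  S N -> (forall i, i \in s -> iter k (a i) N = 0) -> T N.
Proof.
elim: s => [|i s IH] /=.
  by move=> _ S T k N _ _ _ _ _ _ _ hT SN _; apply: (hT (fun=> 0%N) N).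
move=> /andP[is_ us] S T k N SG Slin S0 Sa Sz T0 TD hT SN aN.
have [Q [h1 h2 h3 ->]] := weyl_split SG Slin S0 (fun N => @Sa i N (mem_head _ _))
  (fun N => @Sz i N (mem_head _ _)) SN (aN i (mem_head _ _)).
have ji j : j \in s -> j != i by move=> js; apply: contraNneq is_ => <-.
have sin j : j \in s -> j \in i :: s by move=> js; rewrite in_cons js orbT.
suff H (l : 'I_k) : T (iter l (z i) (Q l)) by elim/big_rec: _ => [//|l X _ TX]; exact: TD.
have zl : linear (iter l (z i)) by exact: iter_lin.
apply: (IH us (fun X => S X /\ a i X = 0) (fun X => T (iter l (z i) X)) k (Q l)).
- by move=> X [SX _]; exact: SG.
- by move=> c X X' [SX aX] [SX' aX']; split; [exact: Slin | rewrite a_lin aX aX' scaler0 addr0].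
- by split=> //; exact: lin0.
- by move=> j X js [SX aX]; split; [apply: Sa => //; exact: sin | rewrite a_comm aX lin0].
- move=> j X js [SX aX]; split; first by apply: Sz => //; exact: sin.
  by rewrite az ?aX ?lin0 ?add0r; [|exact: z_lin|exact: SG]; rewrite eq_sym (negbTE (ji j js)) scale0r.
- by rewrite lin0.
- by move=> X X' TX TX'; rewrite linD//; exact: TD.
- move=> b X bk [SX aiX] aX.
  have := hT (fun j => if j == i then l : nat else b j) X; rewrite /= eqxx.
  have -> : zpow s (fun j => if j == i then l : nat else b j) X = zpow s b X.
    elim: s {IH us Sa Sz hT aN h3 bk aX sin} is_ ji => //= j s IH.
    rewrite in_cons negb_or => /andP[ij js] ji; rewrite IH//; last first.
      by move=> j' h; apply: ji; rewrite in_cons h orbT.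
    by rewrite eq_sym (negbTE ij).
  apply=> //.
    by move=> j; rewrite in_cons; case: eqP => [_ _|_ /=]; [exact: ltn_ord | exact: bk].
  by move=> j; rewrite in_cons => /orP[/eqP->//|]; exact: aX.
- by [].
- by move=> j js; apply: (h3 j k (ji j js)); exact/aN/sin.
Qed.
End Weyl.

Section Extension.
Variables (R : realType) (n : nat) (M : manifold R n).
Implicit Types U V W : opens M.

(** The Weyl calculus below acts on sections over the whole of [U]; by locality this lemma carries
    its results to smaller opens. *)
Lemma cinf_extend U V (VU : V `<=` U) (f : cinf V) q : V q ->
  exists (f' : cinf U) (W : opens M), W q /\ forall p, W p -> f' p = f p.
Proof.
move=> Vq; have [chi [F [h1 h2 h3 h4 /near_open[S [oS Sq hS]]]]] := bump_manifold Vq.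
have sm : msmooth U (fun p => chi p * f p).
  apply: msmooth_local => p Up; case: (pselect (F p)) => Fp.
    exists V; first exact: h3.
    by apply: msmoothM; [exact: oset_open | exact: (msmooth_sub (fun _ _ => I) h1) | exact: cinf_smooth].
  exists (~` F) => //; apply: (msmooth_ext (closed_openC h2) (f := fun=> 0)); last exact: msmooth_cst.
  by move=> r Fr; rewrite h4// mul0r.
exists (mk_cinf sm), (capo (Opens oS) V); split=> // p [Sp Vp].
by rewrite mk_cinfE ?hS ?mul1r//; exact: VU.
Qed.
End Extension.

(** * Bilinear local operators in coordinates *)

Section BopAlgebra.
Variables (R : realType) (n : nat) (M : manifold R n) (U : opens M).
Implicit Types (V W : opens M) (B : bop U) (N : lop U).

Definition bop_comb (a : R[i]) B B' : bop U.
Proof.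
exists (fun V f g => a *: B V f g + B' V f g).
- move=> V VU b f f' g; rewrite !bop_linl// !scalerDr addrACA; congr (_ + _ + _).
  by rewrite !scalerA mulrC.
- move=> V VU b f g g'; rewrite !bop_linr// !scalerDr addrACA; congr (_ + _ + _).
  by rewrite !scalerA mulrC.
- by move=> V W WV VU f g; rewrite linearP /= !bop_res.
Defined.

Definition bop_zero : bop U.
Proof.
by exists (fun V _ _ => 0) => [V VU a f f' g|V VU a f g g'|V W WV VU f g];
  rewrite ?scaler0 ?addr0 ?raddf0.
Defined.

Definition bop_pre N B : bop U.
Proof.
exists (fun V f g => B V (N V f) g).
- by move=> V VU b f f' g; rewrite lop_lin// bop_linl.
- by move=> V VU b f g g'; rewrite bop_linr.
- by move=> V W WV VU f g; rewrite bop_res// lop_res.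
Defined.

Definition bop_post N B : bop U.
Proof.
exists (fun V f g => N V (B V f g)).
- by move=> V VU b f f' g; rewrite bop_linl// lop_lin.
- by move=> V VU b f g g'; rewrite bop_linr// lop_lin.
- by move=> V W WV VU f g; rewrite lop_res// bop_res.
Defined.

Definition bop_fix B (g : cinf U) : lop U.
Proof.
apply: (@build_lop R n M U (fun V VU f => B V f (cinf_res VU g))).
- by move=> V VU a f f'; rewrite bop_linl.
- by move=> V W WV VU WU f; rewrite bop_res// (cinf_res_comp VU WV WU).
Defined.
Lemma bop_fixE B (g : cinf U) V (VU : V `<=` U) (f : cinf V) :
  bop_fix B g V f = B V f (cinf_res VU g).
Proof. exact: (build_lopE _ _ VU). Qed.
End BopAlgebra.

Section Coordinates.
#[local] Opaque build_lop restr mop cd cx cinf_res.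
Variables (R : realType) (n : nat) (M : manifold R n).
Variables (w : two_form M) (P : M -> set (tvec M)) (hP : polarized_symplectic w P).
Variables (c : chart R n M) (ac : atlas c).
Implicit Types U V W : opens M.

Section OnOpen.
Variables (U : opens M) (Uc : U `<=` cdom c).
Local Notation x := (cx ac Uc).
Local Notation d := (cd ac Uc).

Definition dpow_seq (s : seq 'I_n) (b : 'I_n -> nat) V (f : cinf V) : cinf V :=
  foldr (fun i => iter (b i) (d i V)) f s.

Lemma dpow_lin s b V (VU : V `<=` U) : linear (@dpow_seq s b V).
Proof.
move=> a f g; elim: s => //= i s ->; elim: (b i) => //= k ->; exact: lop_lin.
Qed.
Lemma dpow_res s b V W (WV : W `<=` V) (VU : V `<=` U) (f : cinf V) :
  cinf_res WV (dpow_seq s b f) = dpow_seq s b (cinf_res WV f).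
Proof.
elim: s => //= i s <-; elim: (b i) => //= k <-; exact: lop_res.
Qed.

Definition dpow (b : 'I_n -> nat) : lop U.
Proof.
apply: (@build_lop R n M U (fun V _ f => dpow_seq (enum 'I_n) b f)).
- by move=> V VU; exact: dpow_lin.
- by move=> V W WV VU WU f; exact: dpow_res.
Defined.
Lemma dpowE b V (VU : V `<=` U) (f : cinf V) : dpow b V f = dpow_seq (enum 'I_n) b f.
Proof. exact: (build_lopE _ _ VU). Qed.

Lemma dpow_mpderiv k (al : {ffun 'I_n -> 'I_k.+1}) V (VU : V `<=` U) (f : cinf V) q : V q ->
  dpow (fun i => al i) V f q = mpderiv c al f q.
Proof.
move=> Vq; rewrite dpowE// /dpow_seq /mpderiv.
elim: (enum 'I_n) q Vq => [//|i s IH] /= q Vq.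
elim: (nat_of_ord (al i)) q Vq => [|m IHm] q Vq /=; first exact: IH.
rewrite cdE// dopE//; last exact: subset_trans Uc.
exact: (@pderiv_germ _ _ _ c q (Uc (VU q Vq)) i V _ _ Vq IHm).
Qed.

(** Plain functions come with a module structure, as the Weyl lemmas require; [nat_op] selects those
    given by bilinear local operators, on which the commutation relations hold. *)
Let E := cinf U -> cinf U -> cinf U.
Let aop (i : 'I_n + 'I_n) (B : E) : E := match i with
  | inl i => fun f g => B (x i * f) g - x i * B f g
  | inr i => fun f g => B f (x i * g) - x i * B f g end.
Let zop (i : 'I_n + 'I_n) (B : E) : E := match i with
  | inl i => fun f g => B (d i U f) g
  | inr i => fun f g => B f (d i U g) end.
Let nat_op (B : E) := exists Bh : bop U, forall f g, B f g = Bh U f g.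

Let aopl i (B : E) f g : aop (inl i) B f g = B (x i * f) g - x i * B f g. Proof. by []. Qed.
Let aopr i (B : E) f g : aop (inr i) B f g = B f (x i * g) - x i * B f g. Proof. by []. Qed.

Let a_lin i : linear (aop i).
Proof.
have H (a : R[i]) (h u u' v v' : cinf U) : (a *: u + u') - h * (a *: v + v') = a *: (u - h * v) + (u' - h * v').
  by rewrite mulrDr cinf_scaleMr scalerBr opprD addrACA.
by case: i => i a B B'; apply/funext => f; apply/funext => g; exact: H.
Qed.
Let z_lin i : linear (zop i). Proof. by case: i => i a B B'. Qed.
Let a_comm i j B : aop i (aop j B) = aop j (aop i B).
Proof.
case: i j => [i|i] [j|j]; apply/funext => f; apply/funext => g;
  rewrite !(aopl, aopr) ?(mulrCA (x j)) //; ring.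
Qed.
Let nat_swap B : nat_op B -> nat_op (fun f g => B g f).
Proof. by move=> [Bh hB]; exists (bop_swap Bh) => f g; exact: hB. Qed.
Let nat_aopl i B : nat_op B -> nat_op (aop (inl i) B).
Proof.
move=> [Bh hB]; exists (bop_comb (-1) (bop_post (mop (x i)) Bh) (bop_pre (mop (x i)) Bh)) => f g /=.
by rewrite !(mopE _ (@subset_refl _ U)) cinf_res_id !hB scaleN1r addrC.
Qed.
Let nat_aop i B : nat_op B -> nat_op (aop i B).
Proof.
case: i => i hB; first exact: nat_aopl.
exact: (nat_swap (nat_aopl i (nat_swap hB))).
Qed.
Let nat_zop i B : nat_op B -> nat_op (zop i B).
Proof.
have zl (B' : E) j : nat_op B' -> nat_op (zop (inl j) B').
  by move=> [Bh hB]; exists (bop_pre (d j) Bh) => f g; exact: hB.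
case: i => i hB; first exact: zl.
exact: (nat_swap (zl _ i (nat_swap hB))).
Qed.
Let nat_bil B : nat_op B -> (forall f f' g, B (f + f') g = B f g + B f' g) /\
  (forall f g g', B f (g + g') = B f g + B f g').
Proof.
move=> [Bh hB]; split=> f f' g; rewrite !hB.
  by have := bop_linl Bh (@subset_refl _ U) 1 f f' g; rewrite !scale1r.
by have := bop_linr Bh (@subset_refl _ U) 1 f f' g; rewrite !scale1r.
Qed.
Let nat_bil0 B g : nat_op B -> B 0 g = 0 /\ B g 0 = 0.
Proof.
move=> /nat_bil[h1 h2]; split.
  by apply: (addrI (B 0 g)); rewrite -h1 !addr0.
by apply: (addrI (B g 0)); rewrite -h2 !addr0.
Qed.
Let dx i j f : d j U (x i * f) = (i == j)%:R * f + x i * d j U f.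
Proof. by rewrite (cd_der ac Uc j (@subset_refl _ U)) cd_cx eq_sym. Qed.
Let az i j B : nat_op B -> aop i (zop j B) = zop j (aop i B) + (i == j)%:R *: B.
Proof.
move=> nB; have [hl hr] := nat_bil nB.
have zb (b : bool) f g : (b%:R *: B) f g = B (b%:R * f) g.
  rewrite -[LHS]/(b%:R *: B f g); case: b; first by rewrite scale1r mul1r.
  by rewrite scale0r mul0r (nat_bil0 g nB).1.
have zb' (b : bool) f g : (b%:R *: B) f g = B f (b%:R * g).
  rewrite -[LHS]/(b%:R *: B f g); case: b; first by rewrite scale1r mul1r.
  by rewrite scale0r mul0r (nat_bil0 f nB).2.
case: i j => [i|i] [j|j]; apply/funext => f; apply/funext => g.
- transitivity (aop (inl i) B (d j U f) g + ((i == j)%:R *: B) f g); last by [].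
  transitivity (B (d j U (x i * f)) g - x i * B (d j U f) g); first by [].
  by rewrite dx hl zb aopl; ring.
- by transitivity (aop (inl i) B f (d j U g) + (0 *: B) f g); rewrite ?scale0r ?addr0 -?[RHS]/(_ + 0) ?addr0.
- by transitivity (aop (inr i) B (d j U f) g + (0 *: B) f g); rewrite ?scale0r ?addr0 -?[RHS]/(_ + 0) ?addr0.
- transitivity (aop (inr i) B f (d j U g) + ((i == j)%:R *: B) f g); last by [].
  transitivity (B f (d j U (x i * g)) - x i * B f (d j U g)); first by [].
  by rewrite dx hr zb' aopr; ring.
Qed.

(** For fixed [g] the operator commutes with all coordinates, so [chart_centralizer] makes it
    multiplication by its value on 1. *)
Let kill_left (B : E) : nat_op B -> (forall i, aop (inl i) B = 0) -> forall f g, B f g = f * B 1 g.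
Proof.
move=> [Bh hB] aB f g; have U1 := @subset_refl _ U.
pose N := bop_fix Bh g.
have NE h : N U h = B h g by rewrite bop_fixE cinf_res_id hB.
have hN i : ad (x i) N = 0.
  apply: lopP => V VU h; rewrite lop0E (adE _ _ VU); apply: cinf_inj => q Vq; rewrite cinf0//.
  have [h' [W [Wq hW]]] := cinf_extend VU h Vq.
  rewrite cinfB// cinfM// cinf_resE// !(bop_fixE _ _ VU).
  have e1 : Bh V h (cinf_res VU g) q = B h' g q.
    rewrite hB; apply: (bop_germ Bh (W := W)) => //; first exact (VU q Vq).
    by move=> r Vr Ur Wr; rewrite hW// cinf_resE.
  have e2 : Bh V (cinf_res VU (x i) * h) (cinf_res VU g) q = B (x i * h') g q.
    rewrite hB; apply: (bop_germ Bh (W := W)) => //; first exact (VU q Vq).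
    by move=> r Vr Ur Wr; rewrite !cinfM// !cinf_resE// hW.
  have Uq := VU q Vq.
  rewrite e1 e2 -(cinfM _ _ Uq) -(cinfB _ _ Uq) -[B _ _ - _]aopl aB.
  exact: (cinf0 Uq).
by have := chart_centralizer hP hN f 1 U1; rewrite mulr1 !NE.
Qed.
Let kill_all (B : E) : nat_op B -> (forall i, aop i B = 0) -> forall f g, B f g = B 1 1 * f * g.
Proof.
move=> nB aB f g; rewrite (kill_left nB (fun i => aB (inl i))).
have aB' i : aop (inl i) (fun u v => B v u) = 0.
  apply/funext => u; apply/funext => v.
  exact: (congr1 (fun X : E => X v u) (aB (inr i))).
by rewrite [B 1 g](kill_left (nat_swap nB) aB'); ring.
Qed.

Let zpow_l (b : 'I_n + 'I_n -> nat) (s : seq 'I_n) (B : E) f g :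
  foldr (fun i X => iter (b i) (zop i) X) B [seq inl i | i <- s] f g =
  B (foldl (fun h i => iter (b (inl i)) (d i U) h) f s) g.
Proof.
elim: s f => //= i s IH f; rewrite -IH; set X := foldr _ _ _.
elim: (b (inl i)) f => //= k IHk f; rewrite -[LHS]/(iter k (zop (inl i)) X (d i U f) g) IHk.
by rewrite -iterSr.
Qed.
Let zpow_r (b : 'I_n + 'I_n -> nat) (s : seq 'I_n) (B : E) f g :
  foldr (fun i X => iter (b i) (zop i) X) B [seq inr i | i <- s] f g =
  B f (foldl (fun h i => iter (b (inr i)) (d i U) h) g s).
Proof.
elim: s g => //= i s IH g; rewrite -IH; set X := foldr _ _ _.
elim: (b (inr i)) g => //= k IHk g; rewrite -[LHS]/(iter k (zop (inr i)) X f (d i U g)) IHk.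
by rewrite -iterSr.
Qed.

(** Here [aop] takes commutators with coordinates in either argument and [zop] precomposes with
    partial derivatives. Elements killed by every [aop i] are multiplications by [B 1 1], so
    [weyl_span] reads as an expansion in partial derivatives. *)
Lemma bop_expand (Bh : bop U) K : (forall i, iter K (aop i) (Bh U : E) = 0) ->
  exists e : {ffun 'I_n -> 'I_K.+1} -> {ffun 'I_n -> 'I_K.+1} -> cinf U, forall f g,
    Bh U f g = \sum_al \sum_be e al be * dpow (fun i => al i) U f * dpow (fun i => be i) U g.
Proof.
move=> aB; pose Rep (B : E) := exists e : {ffun 'I_n -> 'I_K.+1} -> {ffun 'I_n -> 'I_K.+1} -> cinf U,
    forall f g, B f g = \sum_al \sum_be e al be * dpow (fun i => al i) U f * dpow (fun i => be i) U g.
(* Precomposition reverses the order of the factors; the reversed lists make the derivatives come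
   out in the order of [mpderiv]. *)
pose s : seq ('I_n + 'I_n)%type := [seq inl i | i <- rev (enum 'I_n)] ++ [seq inr i | i <- rev (enum 'I_n)].
have us : uniq s.
  rewrite cat_uniq !map_inj_uniq ?rev_uniq ?enum_uniq ?andbT //=; try by move=> ? ? [].
  by apply/hasPn => _ /mapP[i _ ->]; apply/negP => /mapP[].
have Slin (a : R[i]) B B' : nat_op B -> nat_op B' -> nat_op (a *: B + B').
  by move=> [Bh1 h1] [Bh2 h2]; exists (bop_comb a Bh1 Bh2) => f g /=; rewrite -h1 -h2.
have S0 : nat_op 0 by exists (bop_zero U).
have T0 : Rep 0.
  exists (fun _ _ => 0) => f g; rewrite big1// => al _; rewrite big1// => be _.
  by rewrite !mul0r.
have TD B B' : Rep B -> Rep B' -> Rep (B + B').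
  move=> [e h] [e' h']; exists (fun al be => e al be + e' al be) => f g.
  transitivity (B f g + B' f g); first by [].
  rewrite h h' -big_split; apply: eq_bigr => al _; rewrite -big_split; apply: eq_bigr => be _.
  by rewrite !mulrDl.
have hT b (Q : E) : (forall i, i \in s -> b i < K)%N -> nat_op Q -> (forall i, i \in s -> aop i Q = 0) ->
    Rep (zpow zop s b Q).
  move=> bK nQ aQ; have ins i : i \in s.
    by rewrite mem_cat; case: i => i; apply/orP; [left | right]; apply: map_f; rewrite mem_rev mem_enum.
  have QE := kill_all nQ (fun i => aQ i (ins i)).
  pose al0 : {ffun 'I_n -> 'I_K.+1} := [ffun i => inord (b (inl i))].
  pose be0 : {ffun 'I_n -> 'I_K.+1} := [ffun i => inord (b (inr i))].
  have alE : (fun i => al0 i : nat) = fun i => b (inl i).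
    by apply/funext => i; rewrite ffunE inordK// ltnS ltnW// bK.
  have beE : (fun i => be0 i : nat) = fun i => b (inr i).
    by apply/funext => i; rewrite ffunE inordK// ltnS ltnW// bK.
  exists (fun al be => if (al == al0) && (be == be0) then Q 1 1 else 0) => f g.
  rewrite /zpow foldr_cat zpow_l zpow_r QE !foldl_rev (bigD1 al0)//= [X in _ = _ + X]big1 ?addr0; last first.
    by move=> al /negbTE h; rewrite big1// => be _; rewrite h !mul0r.
  rewrite (bigD1 be0)//= [X in _ = _ + X]big1 ?addr0; last first.
    by move=> be /negbTE h; rewrite h andbF !mul0r.
  by rewrite !eqxx /= alE beE !dpowE.
apply: (@weyl_span _ E _ aop zop a_lin z_lin a_comm nat_op nat_aop nat_zop az s us nat_op Rep K) => //.
- by move=> i N _; exact: nat_aop.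
- by move=> i N _; exact: nat_zop.
- by exists Bh.
Qed.

Lemma iter_aop (Bh : bop U) k (f g : cinf U) q : U q ->
  (forall i, iter k (aop (inl i)) (Bh U : E) f g q = Bh U ((x i - cinf_cst U (x i q)) ^+ k * f) g q) /\
  (forall i, iter k (aop (inr i)) (Bh U : E) f g q = Bh U f ((x i - cinf_cst U (x i q)) ^+ k * g) q).
Proof.
move=> Uq; have nB k' i : nat_op (iter k' (aop i) (Bh U : E)).
  by elim: k' => [|k' IH]; [exists Bh | exact: nat_aop].
have BZ B' a (u v : cinf U) : nat_op B' -> B' (a *: u) v = a *: B' u v /\ B' u (a *: v) = a *: B' u v.
  move=> [B1 h1]; rewrite !h1; split; first by have := bopZ0 B1 (@subset_refl _ U) a 1 u v; rewrite scale1r mulr1.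
  by have := bopZ0 B1 (@subset_refl _ U) 1 a u v; rewrite scale1r mul1r.
split=> i.
  elim: k f => [|k IH] h; first by rewrite expr0 mul1r.
  rewrite exprSr -mulrA -IH -[iter k.+1 _ _]/(aop (inl i) (iter k (aop (inl i)) (Bh U : E))) aopl mulrBl cinf_cst_mul.
  have nk := nB k (inl i); have [hl _] := nat_bil nk.
  by rewrite -scaleNr hl (BZ _ _ _ _ nk).1 cinfB// cinfM// cinfD// cinfZ// mulNr.
elim: k g => [|k IH] h; first by rewrite expr0 mul1r.
rewrite exprSr -mulrA -IH -[iter k.+1 _ _]/(aop (inr i) (iter k (aop (inr i)) (Bh U : E))) aopr mulrBl cinf_cst_mul.
have nk := nB k (inr i); have [_ hr] := nat_bil nk.
by rewrite -scaleNr hr (BZ _ _ _ _ nk).2 cinfB// cinfM// cinfD// cinfZ// mulNr.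
Qed.

(** By [iter_aop], the K-fold commutator inserts at [q] a factor vanishing to order [K] in one of
    the two arguments, where the hypothesis, supplied by Peetre's theorem, gives 0. *)
Lemma nilpotent_expand (Bh : bop U) K p : (forall (f g : cinf U) q, U q -> q <> p \/ n = 0%N ->
    J c K f q \/ J c K g q -> Bh U f g q = 0) ->
  exists e : {ffun 'I_n -> 'I_K.+1} -> {ffun 'I_n -> 'I_K.+1} -> cinf U, forall f g,
    Bh U f g = \sum_al \sum_be e al be * dpow (fun i => al i) U f * dpow (fun i => be i) U g.
Proof.
move=> H; apply: bop_expand => i; apply/funext => f; apply/funext => g.
have hJ j h q : U q -> J c K ((x j - cinf_cst U (x j q)) ^+ K * h) q.
  move=> Uq; apply: (@J_M _ _ _ _ ac K U Uc _ _ q Uq); apply: (@J_exp _ _ _ _ ac K U Uc _ q Uq).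
  by rewrite cinfB// cinf_cstE// subrr.
transitivity (0 : cinf U); last by [].
apply: (cinf_eq0_dense (p := p) ac Uc) => q Uq hq; have [h1 h2] := iter_aop Bh K f g Uq.
by case: i => i; rewrite ?h1 ?h2; apply: H => //; [left | right]; exact: hJ.
Qed.
End OnOpen.
End Coordinates.

Definition bop_restr (R : realType) (n : nat) (M : manifold R n) (U U' : opens M) (UU : U' `<=` U)
  (B : bop U) : bop U'.
Proof.
exists (fun V f g => B V f g).
- by move=> V VU a f f' g; rewrite bop_linl//; exact: subset_trans UU.
- by move=> V VU a f g g'; rewrite bop_linr//; exact: subset_trans UU.
- by move=> V W WV VU f g; rewrite bop_res//; exact: subset_trans UU.
Defined.

Lemma bop_bidiff (R : realType) (n : nat) (M : manifold R n) (w : two_form M) (P : M -> set (tvec M))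
    (hP : polarized_symplectic w P) (U0 : opens M) (B : bop U0) (p : M) : U0 p ->
  exists (U : opens M) (c : chart R n M) (k : nat)
    (e : {ffun 'I_n -> 'I_k.+1} -> {ffun 'I_n -> 'I_k.+1} -> M -> R[i]),
    [/\ U p, atlas c /\ U `<=` cdom c, (forall alpha beta, msmooth U (e alpha beta)) &
      forall (V : opens M) (f g : cinf V), V `<=` U -> forall q, V q ->
        B V f g q = \sum_alpha \sum_beta e alpha beta q * mpderiv c alpha f q * mpderiv c beta g q].
Proof.
move=> U0p; have [c ac cp] := atlas_cover p.
have [U [K [Up UU0 Uc H]]] := peetre ac B U0p cp.
have [f g q Uq hq hJ|e he] := nilpotent_expand hP (Bh := bop_restr UU0 B) (K := K) (p := p) ac Uc.
  exact: (H U f g q Uq Uq (@subset_refl _ U) hq hJ).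
exists U, c, K, (fun al be => e al be); split=> //; first by move=> al be; exact: cinf_smooth.
move=> V f g VU q Vq; have Uq := VU q Vq.
have [f' [W1 [W1q h1]]] := cinf_extend VU f Vq; have [g' [W2 [W2q h2]]] := cinf_extend VU g Vq.
pose W := capo W1 W2.
have -> : B V f g q = B U f' g' q.
  have VU0 := subset_trans VU UU0; apply: (bop_germ B (W := W)) => //.
  by move=> r Vr Ur [/h1 -> /h2 ->].
have -> : B U f' g' = _ := he f' g'.
have sE (I : finType) (F : I -> cinf U) : (\sum_i F i) q = \sum_i F i q.
  elim/big_rec2: _ => [|i u v _ <-]; first exact: cinf0.
  exact: cinfD.
rewrite sE; apply: eq_bigr => al _; rewrite sE; apply: eq_bigr => be _.
rewrite !cinfM// -(dpow_mpderiv ac Uc al VU f Vq) -(dpow_mpderiv ac Uc be VU g Vq).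
congr (_ * _ * _); apply: (lop_germ _ (W := W)) => //; first by move=> r Ur Vr [/h1].
by move=> r Ur Vr [_ /h2].
Qed.

(** * The star-product *)

Section Transport.
Variables (R : realType) (n : nat) (M : manifold R n).
Variables (w : two_form M) (P : M -> set (tvec M)) (hP : polarized_symplectic w P).
Variable A : dq w.
Variable O : forall U : opens M, set (A U).
Hypothesis hO : is_pdq P O.
Implicit Types U V W : opens M.
Local Notation otop := (@otop R n M).

Lemma straightened_triv : exists phi : forall U, {linear A U -> cinft M U},
  [/\ trivialization phi, forall U, phi U (aone A U) = fcst (1 : cinf U) :> fps (cinf U) &
      forall U (a b : A U), O a -> phi U (amul a b) = usual_prod (phi U a) (phi U b)].
Proof.
have [phi [hphi phi1]] := normalized_triv A.
have [T hT] : exists T : ser (lop otop), straight hphi O T.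
  (* The countable cover used in the gluing needs a starting point; over the empty manifold any two
     operators coincide. *)
  have [M0|M0] := pselect (exists p : M, True); first exact: (global_straightening hP hphi phi1 hO M0).
  exists 1; split=> [|V VU a _]; first exact: unital1.
  by apply: serP => k; apply: lopP => W WV f; apply: cinf_inj => p; case: M0; exists p.
have sT U : U `<=` otop by exact: sub_otop.
exists (twist phi T); split; first exact: (twist_triv hphi hT.1.1).
  by move=> U; rewrite twistE phi1 (unital_act (sT U) hT.1).
move=> U a b Oa; rewrite !twistE.
have actT (f : fps (cinf U)) : act T f = act (srestr (sT U) T) f by rewrite act_srestr.
have LE : phi U (amul a b) = act (Lmul hphi a) (phi U b).
  by rewrite (LmulE hphi a (@subset_refl _ U)) phiK res_id.
rewrite LE actT -actM (straight_ev (sT U) hT Oa) actM -actT act_mser.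
by rewrite ev_mul (ev_Lmul hphi phi1) -actT.
Qed.

Variables (phi : forall U, {linear A U -> cinft M U}) (hphi : trivialization phi).
Hypothesis phi1 : forall U, phi U (aone A U) = fcst (1 : cinf U) :> fps (cinf U).
Hypothesis phiO : forall U (a b : A U), O a ->
  phi U (amul a b) = usual_prod (phi U a) (phi U b).
Local Notation psi := (psi hphi).

Definition smul U (a b : fps (cinf U)) : fps (cinf U) := phi U (amul (psi a) (psi b)).

Lemma smul_linl U (b : fps (cinf U)) : linear (fun a => smul a b).
Proof. by move=> c a a'; rewrite /smul psi_linear amul_linl; exact: linearP. Qed.
Lemma smul_linr U (a : fps (cinf U)) : linear (smul a).
Proof. by move=> c b b'; rewrite /smul psi_linear amul_linr; exact: linearP. Qed.

Definition cser (a : R[i]) : fps R[i] := Fps (fun k => if k is 0%N then a else 0).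
Lemma cserZ (E : lmodType R[i]) a (b : fps E) k : (cser a *: b) k = a *: b k.
Proof. by rewrite fpsZ big_ord_recl subn0 big1 ?addr0// => i _; rewrite scale0r. Qed.
Lemma fcst_lin U a (f g : cinf U) : fcst (a *: f + g) = cser a *: fcst f + fcst g.
Proof. by apply: fpsP => k; rewrite fpsD cserZ; case: k => [|k] //=; rewrite scaler0 addr0. Qed.

Definition mu_op (i : nat) U (f g : cinf_sheaf M U) : cinf_sheaf M U := smul (fcst (f : cinf U)) (fcst (g : cinf U)) i.

Lemma mu_linl i U c (f f' g : cinf_sheaf M U) :
  mu_op i (c *: f + f') g = c *: mu_op i f g + mu_op i f' g.
Proof. by rewrite /mu_op fcst_lin smul_linl fpsD cserZ. Qed.
Lemma mu_linr i U c (f g g' : cinf_sheaf M U) :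
  mu_op i f (c *: g + g') = c *: mu_op i f g + mu_op i f g'.
Proof. by rewrite /mu_op fcst_lin smul_linr fpsD cserZ. Qed.
Lemma smul_res U V (VU : V `<=` U) (a b : fps (cinf U)) k :
  cinf_res VU (smul a b k) = smul (Fps (fun k => cinf_res VU (a k))) (Fps (fun k => cinf_res VU (b k))) k.
Proof. by rewrite /smul !psi_res -res_amul (phi_res hphi). Qed.
Lemma mu_res i U V (VU : V `<=` U) (f g : cinf_sheaf M U) :
  res (cinf_sheaf M) VU (mu_op i f g) =
  mu_op i (res (cinf_sheaf M) VU f) (res (cinf_sheaf M) VU g).
Proof.
have E (h : cinf U) : Fps (fun k => cinf_res VU (fcst h k)) = fcst (cinf_res VU h).
  by apply: fpsP => -[|k] //=; rewrite raddf0.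
by rewrite /mu_op -!E; exact: smul_res.
Qed.

Definition mu_bop (i : nat) : bop otop.
Proof.
exists (fun V f g => mu_op i (f : cinf_sheaf M V) (g : cinf_sheaf M V)).
- by move=> V _ a f f' g; exact: mu_linl.
- by move=> V _ a f g g'; exact: mu_linr.
- by move=> V W WV _ f g; exact: mu_res.
Defined.

Definition mu_bidiff (i : nat) : bidiff M :=
  Bidiff (@mu_linl i) (@mu_linr i) (@mu_res i) (fun p => bop_bidiff hP (mu_bop i) (I : otop p)).

(** The transported product is bilinear over power series, so [fps_linear_coef] recovers it, in each
    argument, from the values on constants that define [mu_op]. *)
Lemma star_smul U (a b : cinft M U) : star mu_bidiff a b = smul a b.
Proof.
apply: fpsP => k; rewrite (fps_linear_coef (smul_linr a) (c := @fcst _ _ _ U))//.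
transitivity (\sum_(l < k.+1) \sum_(i < l.+1) mu_op i (coef a (l - i)%N : cinf_sheaf M U) (coef b (k - l)%N)).
  by rewrite (conv_assoc k (fun i j m => mu_op i (coef a j : cinf_sheaf M U) (coef b m))).
apply: eq_bigr => l _.
by rewrite (fps_linear_coef (smul_linl (fcst (b (k - l)%N))) (c := @fcst _ _ _ U)).
Qed.

Lemma smulA U : associative (@smul U).
Proof. by move=> a b c; rewrite /smul !phiK amulA. Qed.
Lemma smul1l U (a : fps (cinf U)) : smul (fcst 1) a = a.
Proof. by rewrite /smul (psi1 hphi phi1) amul1l psiK. Qed.
Lemma smul1r U (a : fps (cinf U)) : smul a (fcst 1) = a.
Proof. by rewrite /smul (psi1 hphi phi1) amul1r psiK. Qed.

Let mu_assoc U : associative (@star _ _ _ mu_bidiff U).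
Proof. by move=> a b c; rewrite !star_smul smulA. Qed.
Let mu0 U (f g : cinf_sheaf M U) : mu_bidiff 0%N U f g = amul f g.
Proof. by rewrite /= /mu_op /smul (symb_phi hphi) symb_mul !symb_psi. Qed.
Let mu_const i U (z : R[i]) (f : cinf_sheaf M U) : (0 < i)%N ->
  mu_bidiff i U (z *: aone (cinf_sheaf M) U) f = 0 /\
  mu_bidiff i U f (z *: aone (cinf_sheaf M) U) = 0.
Proof.
move=> i0; rewrite /= /mu_op.
have -> : fcst (z *: aone (cinf_sheaf M) U : cinf U) = cser z *: fcst (1 : cinf U).
  by apply: fpsP => k; rewrite cserZ; case: k => [|k] //=; rewrite scaler0.
have Z (F : fps (cinf U) -> fps (cinf U)) (u : fps (cinf U)) : linear F -> F (cser z *: u) = cser z *: F u.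
  move=> hF; have F0 : F 0 = 0.
    by have := hF 1 0 0; rewrite !scale1r addr0 => e; apply: (addrI (F 0)); rewrite addr0 -e.
  by have := hF (cser z) u 0; rewrite F0 !addr0.
have := Z _ (fcst 1) (smul_linl (fcst (f : cinf U))); rewrite /= => ->.
rewrite (Z _ (fcst 1) (smul_linr (fcst (f : cinf U)))) smul1l smul1r cserZ.
by case: i i0 => // i _ /=; rewrite scaler0.
Qed.
Let mu_bracket U (f g : cinf_sheaf M U) p : U p ->
  (mu_bidiff 1%N U f g - mu_bidiff 1%N U g f : cinf U) p = poisson w (f : cinf U) (g : cinf U) p.
Proof.
move=> Up; have := LRmul1 hphi (psi (fcst (f : cinf U))) (@subset_refl _ U) (g : cinf U) Up.
rewrite res_id symb_psi lopBE -!act_fcst (LmulE hphi _ (@subset_refl _ U)) (RmulE hphi _ (@subset_refl _ U)).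
by rewrite !res_id.
Qed.

Definition smul_star : star_product w := StarProduct mu_assoc mu0 mu_const mu_bracket.

Definition Oimg U : set (cinft M U) := [set b | O (psi b)].

Lemma OimgE U : phi U @` @O U = @Oimg U.
Proof.
apply/seteqP; split=> [_ [a Oa <-]|b Ob]; first by rewrite /Oimg /= phiK.
by exists (psi b) => //; rewrite psiK.
Qed.

Let psiL U (c : fps R[i]) (a b : cinft M U) : psi (c *: a + b) = c *: psi a + psi b.
Proof. exact: psi_linear. Qed.
Let psi0 U : psi (0 : fps (cinf U)) = 0.
Proof. by apply: (phi_inj hphi); rewrite psiK linear0. Qed.
Let psi_resE U V (VU : V `<=` U) (b : cinft M U) : psi (res (cinft M) VU b) = res A VU (psi b).
Proof. exact: psi_res. Qed.

Let psiZ U (c : fps R[i]) (a : cinft M U) : psi (c *: a) = c *: psi a.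
Proof. by have := psiL c a 0; rewrite psi0 !addr0. Qed.
Let psiB U (a b : cinft M U) : psi (a - b) = psi a - psi b.
Proof. by rewrite addrC -scaleN1r psiL scaleN1r addrC. Qed.

Let tpow_psi k U (b : cinft M U) : tpow_sub Oimg k b <-> tpow_sub O k (psi b).
Proof.
split=> h p Up; have [V [VU [Vp [c Oc e]]]] := h p Up; exists V, VU; split=> //.
  by exists (psi c) => //; rewrite -psi_resE e psiZ.
exists (phi V c); first by rewrite /Oimg /= phiK.
by apply: (can_inj (@psiK _ _ _ _ _ _ hphi V)); rewrite psi_resE e psiZ phiK.
Qed.

Lemma smul_psp : is_psp P smul_star Oimg.
Proof.
split.
- split=> [U|U c a b|U V VU a|U a h]; rewrite /Oimg /=.
  + by rewrite psi0; exact: (sub_zero (pdq_sub hO)).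
  + by rewrite psiL; exact: (sub_lin (pdq_sub hO)).
  + by rewrite psi_resE; exact: (sub_res (pdq_sub hO)).
  + apply: (sub_local (pdq_sub hO)) => p Up; have [V [VU [Vp Ob]]] := h p Up.
    by exists V, VU; split=> //; rewrite -psi_resE.
- move=> U a b Oa Ob; rewrite /Oimg /=; have := phiO (psi b) Oa; rewrite !psiK => <-.
  by rewrite phiK; exact: (pdq_mul hO).
- move=> U I W WU s cov Os comp.
  have [||s0 [[Os0 hs0] uniq0]] := pdq_complete hO WU (s := fun k i => psi (s k i)) cov.
  + by move=> k i; exact: Os.
  + by move=> k l i j kl V Vi Vj; rewrite -!psi_resE -psiB; apply/tpow_psi; exact: comp.
  exists (phi U s0); split.
    split; first by rewrite /Oimg /= phiK.
    by move=> k i; apply/tpow_psi; rewrite psiB psi_resE phiK; exact: hs0.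
  move=> s1 [Os1 hs1]; rewrite (uniq0 (psi s1)) ?psiK//; split=> // k i.
  by rewrite -psi_resE -psiB; apply/tpow_psi; exact: hs1.
- move=> U f; rewrite (pdq_symbol hO f); split=> h p Up;
    have [V [VU [Vp [a Oa e]]]] := h p Up; exists V, VU; split=> //.
    by exists (phi V a); [rewrite /Oimg /= phiK | rewrite (symb_phi hphi)].
  by exists (psi a) => //; rewrite symb_psi.
- by move=> U a b Oa; rewrite [LHS]star_smul; have := phiO (psi b) Oa; rewrite !psiK.
Qed.

Lemma smul_equiv : pdq_equiv O (B := star_dq smul_star) Oimg.
Proof.
have [h1 _ h3] := hphi.
exists phi; last exact: OimgE.
split.
- exact: h1.
- by move=> U a b; rewrite [RHS]star_smul /smul !phiK.
- move=> U; rewrite phi1; apply: fpsP => -[|k] /=; first by rewrite scale1r.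
  by rewrite scale0r.
- exact: h3.
Qed.
End Transport.

Theorem corollary7p13 (R : realType) (n : nat) (M : manifold R n)
    (omega : two_form M) (P : M -> set (tvec M))
    (hP : polarized_symplectic omega P)
    (A : dq omega) (O : forall U : opens M, set (A U)) (hO : is_pdq P O) :
  exists (mu : star_product omega) (Ot : forall U : opens M, set (cinft M U)),
    is_psp P mu Ot /\ pdq_equiv O (B := star_dq mu) Ot.
Proof.
have [phi [hphi phi1 phiO]] := straightened_triv hP hO.
exists (smul_star hP hphi phi1), (Oimg O hphi).
by split; [exact: (smul_psp hP hO hphi phi1 phiO) | exact: smul_equiv].
Qed.
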